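(* For every local field $K$ of characteristic zero (i.e. every finite extension $K$ of some $\mathbb{Q}_p$), there exists a Bost-Connes type system for $K$.
   Context: Let $K$ be a finite extension of $\mathbb{Q}_p$, let $q_K$ be its module (the cardinality of the residue field, $q_K=p^f$ with $f$ the inertia degree of $K/\mathbb{Q}_p$), let $K^{\mathrm{ab}}$ be its maximal abelian extension and $G_K^{\mathrm{ab}}=G(K^{\mathrm{ab}}/K)$ its Galois group. Fix an embedding $K\subset\mathbb{C}$ and regard $K^{\mathrm{ab}}$ as a subfield of $\mathbb{C}$. A $C^*$-dynamical system is a pair $(A,\sigma_t)$ of a $C^*$-algebra $A$ with a strongly continuous one-parameter group $(\sigma_t)_{t\in\mathbb{R}}$ of $*$-automorphisms. For $0<\beta<\infty$ a KMS$_\beta$-state is a $\sigma$-invariant state $\varphi$ with $\varphi(ab)=\varphi(b\,\sigma_{i\beta}(a))$ for $a,b$ in a dense $*$-subalgebra of $\sigma$-analytic elements. A KMS$_\infty$-state is a state that is a weak-$*$ limit of KMS$_\beta$-states as $\beta\to\infty$. Partition function: we say that the partition function of $(A,\sigma_t)$ is $Z(\beta)$ if for every $0<\beta<\infty$ and every extremal KMS$_\beta$-state $\varphi$ there are an irreducible representation $\pi:A\to B(\mathcal{H})$ and a self-adjoint operator $H\ge 0$ on $\mathcal{H}$, normalized to have smallest eigenvalue $0$, with $e^{itH}\pi(a)e^{-itH}=\pi(\sigma_t(a))$ for all $a\in A$, $t\in\mathbb{R}$, with $\varphi(a)=\mathrm{Tr}(e^{-\beta H}\pi(a))/\mathrm{Tr}(e^{-\beta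 H})$ for all $a\in A$, and with $\mathrm{Tr}(e^{-\beta H})=Z(\beta)$. A $C^*$-dynamical system $(A,\sigma_t)$ equipped with an action of $G_K^{\mathrm{ab}}$ (by $*$-automorphisms of $A$ commuting with $\sigma_t$, hence acting on KMS-states) is called a Bost-Connes type system for $K$ if: (1) For $0<\beta\le+\infty$, the action of $G_K^{\mathrm{ab}}$ on the set of extremal KMS$_\beta$-states of $(A,\sigma_t)$ is free and transitive. (2) The partition function of $(A,\sigma_t)$ is $(1-q_K^{-\beta})^{-1}$. (3) There exists a $K$-subalgebra $A_0\subset A$ (called an arithmetic subalgebra) such that: (a) the subalgebra $A_0\otimes_K\mathbb{C}$ is dense in $A$ (i.e. the natural map $A_0\otimes_K\mathbb{C}\to A$ is injective with dense image); (b) for every extremal KMS$_\infty$-state $\varphi$, $\varphi(A_0)=K^{\mathrm{ab}}$; (c) for every extremal KMS$_\infty$-state $\varphi$, every $\alpha\in G_K^{\mathrm{ab}}$ and every $a\in A_0$, $\varphi(\alpha(a))=\alpha(\varphi(a))$. *)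

(* Defs.v *)
From HB Require Import structures.
From mathcomp Require Import all_boot all_order all_algebra all_fingroup all_field.
From mathcomp Require Import finmap.
From mathcomp Require Import all_classical all_reals all_analysis.
From mathcomp Require Import complex.

Set Implicit Arguments.
Unset Strict Implicit.
Unset Printing Implicit Defensive.

Import Order.TTheory GRing.Theory Num.Theory numFieldNormedType.Exports.

Local Open Scope classical_set_scope.
Local Open Scope ring_scope.

(* Z_p is the inverse limit of the rings Z/p^n, the n-th coordinate being the  *)
(* representative in {0, ..., p^n - 1}: the coherence equation also forces     *)
(* x n < p^n. Q_p is its field of fractions.                                   *)

Definition padic_coherent (p : nat) (x : nat -> nat) : bool :=
  `[< forall n, (x n = x n.+1 %% p ^ n)%N >].

Record padic_int (p : nat) (p_pr : prime p) := PadicInt {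
  padic_seq :> nat -> nat;
  padic_seqP : padic_coherent p padic_seq
}.

HB.instance Definition _ (p : nat) (p_pr : prime p) :=
  [isSub for @padic_seq p p_pr].
HB.instance Definition _ (p : nat) (p_pr : prime p) :=
  [Choice of padic_int p_pr by <:].

Section PadicInt.
Variables (p : nat) (p_pr : prime p).
Local Notation Zp := (padic_int p_pr).

Lemma padic_int_ext (x y : Zp) : (forall n, x n = y n) -> x = y.
Proof. by move=> xy; apply/val_inj/funext. Qed.

Lemma padic_intS (x : Zp) n : (x n = x n.+1 %% p ^ n)%N.
Proof. by have /asboolP := padic_seqP x. Qed.

Lemma padic_int_mod (x : Zp) n : (x n %% p ^ n = x n)%N.
Proof. by rewrite padic_intS modn_mod. Qed.

Lemma padic_int_modD (x : Zp) n k : (x n = x (n + k) %% p ^ n)%N.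
Proof.
elim: k => [|k IHk]; first by rewrite addn0 padic_int_mod.
by rewrite addnS {1}IHk padic_intS modn_dvdm // dvdn_exp2l ?leq_addr.
Qed.

Lemma padic_of_subproof (f : nat -> nat) :
  (forall n, f n.+1 = f n %[mod p ^ n])%N ->
  padic_coherent p (fun n => f n %% p ^ n)%N.
Proof.
move=> fE; apply/asboolP => n.
by rewrite modn_dvdm ?fE // dvdn_exp2l.
Qed.

Definition padic_of f fE : Zp := PadicInt p_pr (@padic_of_subproof f fE).

Lemma padic_intE (x : Zp) n : (x n.+1 = x n %[mod p ^ n])%N.
Proof. by rewrite padic_int_mod -padic_intS. Qed.

Lemma padic_const_subproof (k : nat) n : (k = k %[mod p ^ n])%N.
Proof. by []. Qed.

Lemma padic_add_subproof (x y : Zp) n :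
  (x n.+1 + y n.+1 = x n + y n %[mod p ^ n])%N.
Proof. by rewrite -modnDm !padic_intE modnDm. Qed.

Lemma padic_mul_subproof (x y : Zp) n :
  (x n.+1 * y n.+1 = x n * y n %[mod p ^ n])%N.
Proof. by rewrite -modnMm !padic_intE modnMm. Qed.

Lemma padic_opp_subproof (x : Zp) n :
  ((p ^ n.+1).-1 * x n.+1 = (p ^ n).-1 * x n %[mod p ^ n])%N.
Proof.
rewrite -modnMm !padic_intE modnMm.
apply/eqP; rewrite -(eqn_modDr (x n)) -!mulSnr !prednK ?expn_gt0 ?prime_gt0 //.
by rewrite expnS -mulnA mulnCA !modnMr.
Qed.

(* - x is computed as (p^n - 1) x mod p^n, which avoids a subtraction in nat.  *)
Definition padic_zero : Zp := padic_of (padic_const_subproof 0).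
Definition padic_one : Zp := padic_of (padic_const_subproof 1).
Definition padic_add x y : Zp := padic_of (padic_add_subproof x y).
Definition padic_mul x y : Zp := padic_of (padic_mul_subproof x y).
Definition padic_opp x : Zp := padic_of (padic_opp_subproof x).

Lemma padic_addA : associative padic_add.
Proof. by move=> x y z; apply: padic_int_ext => n /=; rewrite modnDmr modnDml addnA. Qed.
Lemma padic_addC : commutative padic_add.
Proof. by move=> x y; apply: padic_int_ext => n /=; rewrite addnC. Qed.
Lemma padic_add0 : left_id padic_zero padic_add.
Proof. by move=> x; apply: padic_int_ext => n /=; rewrite mod0n padic_int_mod. Qed.
Lemma padic_addN : left_inverse padic_zero padic_opp padic_add.
Proof.
move=> x; apply: padic_int_ext => n /=.
by rewrite modnDml -mulSnr prednK ?expn_gt0 ?prime_gt0 // modnMr mod0n.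
Qed.

HB.instance Definition _ := GRing.isZmodule.Build Zp
  padic_addA padic_addC padic_add0 padic_addN.

Lemma padic_mulA : associative padic_mul.
Proof. by move=> x y z; apply: padic_int_ext => n /=; rewrite modnMmr modnMml mulnA. Qed.
Lemma padic_mulC : commutative padic_mul.
Proof. by move=> x y; apply: padic_int_ext => n /=; rewrite mulnC. Qed.
Lemma padic_mul1 : left_id padic_one padic_mul.
Proof. by move=> x; apply: padic_int_ext => n /=; rewrite modnMml mul1n padic_int_mod. Qed.
Lemma padic_mulDl : left_distributive padic_mul padic_add.
Proof.
move=> x y z; apply: padic_int_ext => n /=.
by rewrite modnMml modnDm mulnDl.
Qed.
Lemma padic_oneN0 : padic_one != 0 :> Zp.
Proof.
apply/eqP => /(congr1 (fun x : Zp => x 1%N)) /=.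
by rewrite expn1 mod0n modn_small ?prime_gt1.
Qed.

HB.instance Definition _ := GRing.Zmodule_isComNzRing.Build Zp
  padic_mulA padic_mulC padic_mul1 padic_mulDl padic_oneN0.

Definition padic_unit : {pred Zp} := fun x => `[< exists y : Zp, y * x = 1 >].
Definition padic_inv (x : Zp) : Zp := xget x [set y | y * x = 1].

Lemma padic_mulVx : {in padic_unit, left_inverse 1 padic_inv *%R}.
Proof.
by move=> x /asboolP [y yx]; rewrite /padic_inv; case: xgetP => [//|/(_ y)].
Qed.
Lemma padic_unitPl (x y : Zp) : y * x = 1 -> padic_unit x.
Proof. by move=> yx; apply/asboolP; exists y. Qed.
Lemma padic_inv_out : {in [predC padic_unit], padic_inv =1 id}.
Proof.
move=> x /negP xu; rewrite /padic_inv; case: xgetP => [y -> yx|//].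
by case: xu; exact: padic_unitPl yx.
Qed.

HB.instance Definition _ := GRing.ComNzRing_hasMulInverse.Build Zp
  padic_mulVx padic_unitPl padic_inv_out.

Lemma padic_neq0 (x : Zp) : x != 0 -> exists n, ~~ (p ^ n %| x n)%N.
Proof.
move=> x0; apply: contrapT => /forallNP xn; move/eqP: x0; apply.
apply: padic_int_ext => n /=; rewrite mod0n -padic_int_mod.
by apply/eqP; have /negP := xn n; rewrite negbK.
Qed.

Lemma padic_integral : GRing.integral_domain_axiom Zp.
Proof.
move=> x y xy0; apply/norP => -[/padic_neq0[n xn] /padic_neq0[m ym]].
have x0 : (0 < x (n + m))%N.
  by rewrite lt0n; apply: contra xn => /eqP E; rewrite (padic_int_modD x n m) E mod0n dvdn0.
have y0 : (0 < y (n + m))%N.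
  rewrite lt0n; apply: contra ym => /eqP E.
  by rewrite (padic_int_modD y m n) addnC E mod0n dvdn0.
have : (p ^ (n + m) %| x (n + m) * y (n + m))%N.
  have /(congr1 (fun z : Zp => z (n + m)%N)) /= := xy0.
  by rewrite mod0n => /eqP.
rewrite pfactor_dvdn ?muln_gt0 ?x0 ?y0 // lognM // leqNgt => /negP; apply.
have xl : (logn p (x (n + m)) < n)%N.
  rewrite ltnNge -pfactor_dvdn //; apply: contra xn.
  by rewrite (padic_int_modD x n m) /dvdn modn_mod.
have yl : (logn p (y (n + m)) < m)%N.
  rewrite ltnNge -pfactor_dvdn //; apply: contra ym.
  by rewrite (padic_int_modD y m n) (addnC m) /dvdn modn_mod.
by rewrite (leq_trans (n := (logn p (x (n + m))).+1 + logn p (y (n + m)))%N) ?addSn // -addSn leq_add // ltnW.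
Qed.

HB.instance Definition _ :=
  GRing.ComUnitRing_isIntegral.Build Zp padic_integral.

End PadicInt.

Notation padic_num p_pr := {fraction (padic_int p_pr)}.

Section LocalField.
Variables (p : nat) (p_pr : prime p) (K : fieldExtType (padic_num p_pr)).

Definition integer_ring : set K :=
  [set x | integralOver (fun z : padic_int p_pr => (tofrac z)%:A : K) x].

(* O_K is local, so that its maximal ideal consists of its non-units.          *)
Definition maximal_ideal : set K :=
  [set x | integer_ring x /\ ~ exists2 y, integer_ring y & x * y = 1].

Definition residue_field : set (set K) :=
  [set [set y | integer_ring y /\ maximal_ideal (x - y)] | x in integer_ring].

(* fset_set is the whole set as the residue field is finite.                   *)
Definition module_of : nat := #|` fset_set residue_field|.

End LocalField.

Section AbelianClosure.
Variables (k F : fieldType) (iota : {rmorphism k -> F}).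

(* For F algebraically closed: the union in F of all finite abelian extensions *)
(* of iota(k).                                                                 *)
Definition maximal_abelian : set F :=
  [set z | exists (L : splittingFieldType k) (j : {rmorphism L -> F}),
    [/\ forall c : k, j c%:A = iota c, galois 1 {:L}, abelian 'Gal({:L} / 1)
      & range j z]].

(* Automorphisms of k^ab over k, as maps F -> F which are the identity outside *)
(* k^ab, so that two of them are equal iff they agree on k^ab.                 *)
Definition abelian_galois : set (F -> F) :=
  [set g | [/\ set_bij maximal_abelian maximal_abelian g,
      {in maximal_abelian &, {morph g : x y / x + y}},
      {in maximal_abelian &, {morph g : x y / x * y}},
      forall c, g (iota c) = iota c
    & forall z, ~ maximal_abelian z -> g z = z]].

End AbelianClosure.

(* No unit is required, and the product is part of the data since a ring of    *)
(* the library has a unit.                                                     *)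
Record cstar_algebra (R : realType) := CStarAlgebra {
  cs_carrier :> completeNormedModType R[i];
  cs_mul : cs_carrier -> cs_carrier -> cs_carrier;
  cs_star : cs_carrier -> cs_carrier;
  cs_mulA : associative cs_mul;
  cs_mul_linearl : forall b, linear (cs_mul^~ b);
  cs_mul_linearr : forall a, linear (cs_mul a);
  cs_starD : forall a b, cs_star (a + b) = cs_star a + cs_star b;
  cs_starZ : forall (z : R[i]) a, cs_star (z *: a) = Num.conj z *: cs_star a;
  cs_starM : forall a b, cs_star (cs_mul a b) = cs_mul (cs_star b) (cs_star a);
  cs_starK : involutive cs_star;
  cs_normM : forall a b, `|cs_mul a b| <= `|a| * `|b|;
  cs_normC : forall a, `|cs_mul (cs_star a) a| = `|a| ^+ 2
}.

Definition star_automorphism (R : realType) (A : cstar_algebra R)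
    (f : A -> A) : Prop :=
  [/\ linear f, bijective f, {morph f : a b / cs_mul a b}
    & {morph f : a / cs_star a}].

Record cstar_system (R : realType) := CStarSystem {
  sys_alg :> cstar_algebra R;
  sys_flow : R -> sys_alg -> sys_alg;
  sys_flow_aut : forall t, star_automorphism (sys_flow t);
  sys_flow0 : forall a, sys_flow 0 a = a;
  sys_flowD : forall s t a, sys_flow (s + t) a = sys_flow s (sys_flow t a);
  sys_flow_cont : forall a, continuous (sys_flow^~ a)
}.

(* Functionals take values in R[i]^o, which carries the topology of R[i].      *)

Section States.
Variables (R : realType) (A : cstar_system R).
Local Notation C := R[i].

(* The last two conditions say that phi has norm 1.                            *)
Definition is_state (phi : A -> C^o) : Prop :=
  [/\ linear phi,
      forall a, 0 <= phi (cs_mul (cs_star a) a),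
      forall a, `|phi a| <= `|a|
    & forall c : C, (forall a, `|phi a| <= c * `|a|) -> 1 <= c].

Definition star_subalgebra (D : set A) : Prop :=
  [/\ D 0, forall a b, D a -> D b -> D (a + b),
      forall (z : C) a, D a -> D (z *: a),
      forall a b, D a -> D b -> D (cs_mul a b)
    & forall a, D a -> D (cs_star a)].

(* f : z |-> sigma_z(a) is an entire extension of t |-> sigma_t(a).            *)
Definition analytic_extension (a : A) (f : C^o -> A) : Prop :=
  (forall t : R, f t%:C%C = sys_flow t a) /\
  (forall z : C^o, derivable f z 1).

Definition KMS_finite (beta : R) : set (A -> C^o) :=
  [set phi | [/\ is_state phi, forall t a, phi (sys_flow t a) = phi a
    & exists D : set A,
        [/\ star_subalgebra D, dense D,
            forall a, D a -> exists f, analytic_extension a f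
          & forall a b f, D a -> D b -> analytic_extension a f ->
              phi (cs_mul a b) = phi (cs_mul b (f (0 +i* beta)%C))]]].

(* A net of KMS states is a family indexed by I, convergence being along a     *)
(* proper filter F on I.                                                       *)
Definition KMS_infinite : set (A -> C^o) :=
  [set phi | is_state phi /\
    exists (I : Type) (F : set_system I) (beta : I -> R) (psi : I -> A -> C^o),
      [/\ ProperFilter F, beta i @[i --> F] --> +oo,
          forall i, 0 < beta i /\ KMS_finite (beta i) (psi i)
        & forall a, psi i a @[i --> F] --> phi a]].

Definition KMS (beta : \bar R) : set (A -> C^o) :=
  match beta with
  | b%:E => KMS_finite b
  | +oo%E => KMS_infinite
  | -oo%E => set0
  end.

Definition extreme_points (S : set (A -> C^o)) : set (A -> C^o) :=
  [set phi | S phi /\ forall (psi1 psi2 : A -> C^o) (t : R),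
     S psi1 -> S psi2 -> 0 < t < 1 ->
     (forall a, phi a = t%:C%C * psi1 a + (1 - t)%:C%C * psi2 a) ->
     psi1 = phi /\ psi2 = phi].

Definition extremal_KMS (beta : \bar R) := extreme_points (KMS beta).

End States.

Arguments KMS {R} A beta.
Arguments extremal_KMS {R} A beta.

(* The inner product is linear in its first argument.                          *)
Record hilbert_space (R : realType) := HilbertSpace {
  hs_carrier :> completeNormedModType R[i];
  hs_dot : {dot hs_carrier for @Num.conj R[i]};
  hs_norm : forall x, `|x| ^+ 2 = hs_dot x x
}.

(* A partially defined operator: the values outside the domain do not matter.  *)
Record unbounded_operator (R : realType) (V : hilbert_space R) := UnboundedOp {
  uop_dom : set V;
  uop_fun :> V -> V
}.

Section Operators.
Variables (R : realType) (V : hilbert_space R).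
Local Notation C := R[i].

Definition linear_subspace (W : set V) : Prop :=
  W 0 /\ forall (z : C) x y, W x -> W y -> W (z *: x + y).

Definition bounded_operator (T : V -> V) : Prop := linear T /\ continuous T.

Definition orthonormal_basis (E : set V) : Prop :=
  [/\ forall e, E e -> hs_dot V e e = 1,
      forall e f, E e -> E f -> e <> f -> hs_dot V e f = 0
    & forall x, (forall e, E e -> hs_dot V x e = 0) -> x = 0].

Definition sums_to (E : set V) (u : V -> C) (z : C) : Prop :=
  forall eps : R, 0 < eps -> exists A : {fset V}, [set` A] `<=` E /\
    forall B : {fset V}, (A `<=` B)%fset -> [set` B] `<=` E ->
      `|\sum_(e <- B) u e - z| < eps%:C%C.

(* A bounded T is of trace class iff its diagonal in every orthonormal basis   *)
(* is summable, and the sum is then Tr T for every basis.                      *)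
Definition has_trace (T : V -> V) (z : C) : Prop :=
  bounded_operator T /\
  forall E, orthonormal_basis E -> sums_to E (fun e => hs_dot V (T e) e) z.

(* H is densely defined, and its graph is that of its adjoint.                 *)
Definition self_adjoint (H : unbounded_operator V) : Prop :=
  [/\ linear_subspace (uop_dom H), dense (uop_dom H),
      forall (z : C) x y, uop_dom H x -> uop_dom H y -> H (z *: x + y) = z *: H x + H y
    & forall y w, (forall x, uop_dom H x -> hs_dot V (H x) y = hs_dot V x w) <->
                  (uop_dom H y /\ H y = w)].

Definition positive_operator (H : unbounded_operator V) : Prop :=
  forall x, uop_dom H x -> 0 <= hs_dot V (H x) x.

Definition is_eigenvalue (H : unbounded_operator V) (l : C) : Prop :=
  exists x, [/\ x != 0, uop_dom H x & H x = l *: x].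

Definition smallest_eigenvalue (H : unbounded_operator V) (l : C) : Prop :=
  is_eigenvalue H l /\ forall m, is_eigenvalue H m -> l <= m.

(* U t = e^{itH}: the strongly continuous group with generator iH.             *)
Definition exp_group (H : unbounded_operator V) (U : R -> V -> V) : Prop :=
  [/\ forall t, bounded_operator (U t),
      forall x, U 0 x = x,
      forall s t x, U (s + t) x = U s (U t x),
      forall x, continuous (U^~ x)
    & forall x y, (uop_dom H x /\ (0 +i* 1)%C *: H x = y) <->
        (t%:C%C^-1 *: (U t x - x) @[t --> (0 : R)^'] --> y)].

(* T t = e^{-tH} for t >= 0: the strongly continuous semigroup with generator  *)
(* -H; the values of T at t < 0 are irrelevant.                                *)
Definition exp_semigroup (H : unbounded_operator V) (T : R -> V -> V) : Prop :=
  [/\ forall t : R, 0 <= t -> bounded_operator (T t),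
      forall x, T 0 x = x,
      forall (s t : R) x, 0 <= s -> 0 <= t -> T (s + t) x = T s (T t x),
      forall x, T t x @[t --> (0 : R)^'+] --> x
    & forall x y, (uop_dom H x /\ - H x = y) <->
        (t%:C%C^-1 *: (T t x - x) @[t --> (0 : R)^'+] --> y)].

Definition irreducible_representation (A : cstar_algebra R)
    (pi : A -> V -> V) : Prop :=
  [/\ forall a, bounded_operator (pi a),
      forall (z : C) a b x, pi (z *: a + b) x = z *: pi a x + pi b x,
      forall a b x, pi (cs_mul a b) x = pi a (pi b x),
      forall a x y, hs_dot V (pi a x) y = hs_dot V x (pi (cs_star a) y)
    & (exists a x, pi a x != 0) /\
      forall W : set V, linear_subspace W -> closed W ->
        (forall a x, W x -> W (pi a x)) -> W = [set 0] \/ W = setT].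

End Operators.

Definition partition_function_is (R : realType) (A : cstar_system R)
    (Z : R -> R) : Prop :=
  forall beta : R, 0 < beta -> forall phi : A -> R[i]^o,
    extremal_KMS A beta%:E phi ->
    exists (V : hilbert_space R) (pi : A -> V -> V)
           (H : unbounded_operator V) (U T : R -> V -> V),
      [/\ irreducible_representation pi,
          [/\ self_adjoint H, positive_operator H & smallest_eigenvalue H 0],
          exp_group H U /\ exp_semigroup H T,
          forall a t x, U t (pi a (U (- t) x)) = pi (sys_flow t a) x
        & has_trace (T beta) (Z beta)%:C%C /\
          forall a, exists2 z : R[i], has_trace (T beta \o pi a) z &
                                  phi a = z / (Z beta)%:C%C].

(* The group G_k^ab is the set abelian_galois under composition.               *)
Record galois_cstar_system (R : realType) (k : fieldType)
    (iota : {rmorphism k -> R[i]}) := GaloisCStarSystem {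
  gsys :> cstar_system R;
  gal_act : (R[i] -> R[i]) -> gsys -> gsys;
  gal_act_aut : forall g, abelian_galois iota g -> star_automorphism (gal_act g);
  gal_act1 : forall a, gal_act id a = a;
  gal_actM : forall g h a, abelian_galois iota g -> abelian_galois iota h ->
    gal_act (g \o h) a = gal_act g (gal_act h a);
  gal_act_flow : forall g t a, abelian_galois iota g ->
    gal_act g (sys_flow t a) = sys_flow t (gal_act g a)
}.

Section BostConnes.
Variables (R : realType) (k : fieldType) (iota : {rmorphism k -> R[i]}).
Variable A : galois_cstar_system iota.
Local Notation C := R[i].

(* g acts on functionals by phi |-> phi o g; since G_k^ab is abelian, the      *)
(* left action phi |-> phi o g^-1 has the same orbits and stabilizers.         *)
Definition free_transitive_on (S : set (A -> C^o)) : Prop :=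
  [/\ S !=set0,
      forall g phi, abelian_galois iota g -> S phi -> S (phi \o gal_act g),
      forall g phi, abelian_galois iota g -> S phi ->
        phi \o gal_act g = phi -> g = id
    & forall phi psi, S phi -> S psi ->
        exists2 g, abelian_galois iota g & psi = phi \o gal_act g].

Definition k_subalgebra (A0 : set A) : Prop :=
  [/\ A0 0, forall a b, A0 a -> A0 b -> A0 (a + b),
      forall (c : k) a, A0 a -> A0 (iota c *: a),
      forall a b, A0 a -> A0 b -> A0 (cs_mul a b)
    & forall e, left_id e (@cs_mul R A) -> right_id e (@cs_mul R A) -> A0 e].

(* The element \sum_i a_i (x) z_i of A0 (x)_k C is zero, i.e. every k-bilinear *)
(* map on A0 x C kills it.                                                     *)
Definition tensor_eq0 (A0 : set A) (n : nat) (a : 'I_n -> A) (z : 'I_n -> C) :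
    Prop :=
  forall (W : lmodType k) (B : A -> C -> W),
    (forall (c : k) x y w, A0 x -> A0 y ->
       B (iota c *: x + y) w = c *: B x w + B y w) ->
    (forall (c : k) x v w, A0 x ->
       B x (iota c * v + w) = c *: B x v + B x w) ->
    \sum_(i < n) B (a i) (z i) = 0.

Definition arithmetic_subalgebra (A0 : set A) : Prop :=
  [/\ k_subalgebra A0,
      forall n (a : 'I_n -> A) (z : 'I_n -> C), (forall i, A0 (a i)) ->
        \sum_(i < n) z i *: a i = 0 -> tensor_eq0 A0 a z,
      dense [set b : A | exists n (a : 'I_n -> A) (z : 'I_n -> C),
        (forall i, A0 (a i)) /\ b = \sum_(i < n) z i *: a i],
      forall phi, extremal_KMS A +oo%E phi -> phi @` A0 = maximal_abelian iota
    & forall phi g a, extremal_KMS A +oo%E phi -> abelian_galois iota g ->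
        A0 a -> phi (gal_act g a) = g (phi a)].

End BostConnes.

Definition bost_connes_type (R : realType) (p : nat) (p_pr : prime p)
    (K : fieldExtType (padic_num p_pr)) (iota : {rmorphism K -> R[i]})
    (A : galois_cstar_system iota) : Prop :=
  [/\ forall beta : \bar R, (0 < beta)%E ->
        free_transitive_on (extremal_KMS A beta),
      partition_function_is A
        (fun beta => (1 - (module_of K)%:R `^ (- beta))^-1)
    & exists A0 : set A, arithmetic_subalgebra A0].

(* Main.v *)
(* Let G = Gal(K^ab/K) and A = C(G) (x) Compacts(l2), the closure for the
   supremum norm of the finite matrices E_mn(u) with u : G -> C locally constant,
   with the flow sigma_t = Ad diag(q^(itn)), q = q_K.  As E_mn(u) is an
   eigenvector of the flow, a KMS_beta state satisfies
     phi(E_mn(u)) = delta_mn lambda^m mu(u),    lambda = q^(-beta),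
   so it is determined by the measure mu on G; the limits beta -> oo obey the
   same relation with lambda = 0.  Conditioning phi on a clopen set that splits
   mu splits phi, so for an extremal phi every z in K^ab, as the function
   g |-> g(z), is mu-almost constant; hence mu is multiplicative, a K-embedding
   of K^ab, and mu is a multiple of the Dirac mass at some g.  Thus the extremal
   states form one free orbit, each being the Gibbs state of the evaluation at g
   on l2 for H = diag(n log q), whose partition function is geometric.  The
   finite matrices whose entries are the functions g |-> g(z), z in K^ab, form the
   arithmetic subalgebra: the ground state at g sends such a matrix to g(z),
   z being its corner entry.  Of the ring O of integers of K only 1 < #|residue
   field| < oo is used. *)

From HB Require Import structures.
Require Import Defs.
From mathcomp Require Import all_boot all_order all_algebra all_fingroup all_solvable all_field.
From mathcomp Require Import finmap all_classical all_reals all_analysis.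
From mathcomp Require Import complex ring lra.

Set Implicit Arguments.
Unset Strict Implicit.
Unset Printing Implicit Defensive.

Import Order.TTheory GRing.Theory Num.Theory numFieldNormedType.Exports.

Local Open Scope ring_scope.

(** * The maximal abelian extension and its automorphisms *)

(** The dense subalgebra that witnesses the KMS condition comes with the state and need not contain
    any E_mn(u). For [a] in it with entire extension f, one compares z |-> phi(E f(z)) with an
    explicit exponential: invariance under the flow makes them agree on the real line, the identity
    theorem carries this to i beta, and density frees [a]. The identity theorem, for entire
    functions vanishing on R, is obtained from Goursat's lemma on squares with Riemann sums only, no
    integral being formed. The algebra has no unit, so norm one is tested on the approximate unit
    sum_(i < n) E_ii(1), whose value is a partial geometric series; this fixes the total mass of mu
    at 1 - lambda. The measure mu is just a positive functional on locally constant functions, which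
    suffices because every orbit in K^ab is finite. *)

Section FiniteSubextensions.
Variables (k F : fieldType) (iota : {rmorphism k -> F}).
Hypothesis pchar0 : [pchar k] =i pred0.
Local Notation "p ^i" := (map_poly iota p) (at level 2, format "p ^i").

Lemma exists_irreducible_root (z : F) : algebraicOver iota z ->
  exists p : {poly k}, [/\ irreducible_poly p, p != 0 & root p^i z].
Proof.
move=> [p0 nz_p0 p0z].
pose P n := `[< exists p : {poly k}, [/\ p != 0, root p^i z & size p = n] >].
have exP : exists n, P n by exists (size p0); apply/asboolP; exists p0.
case: (ex_minnP exP) => n /asboolP[p [nz_p pz <-]] min_p.
exists p; split=> //; apply/(subfx_irreducibleP pz nz_p) => q qz nz_q.
by apply: min_p; apply/asboolP; exists q.
Qed.

(** Induction on the list, each step being the primitive element theorem for two elements. The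
    generator is kept as a sum of integer multiples of the members of [s], so that it visibly lies
    in any field containing them. *)
Lemma algebraic_primitive_element (s : seq F) :
  (forall z, z \in s -> algebraicOver iota z) ->
  exists z, [/\ algebraicOver iota z,
    exists a : nat ^ size s, z = \sum_(i < size s) s`_i *+ a i
     & exists ps, s = [seq p^i.[z] | p <- ps]].
Proof.
elim: s => [_|x s IHs alg_s].
  exists 0; split; first exact: algebraic0.
    by exists [ffun _ => 2%N]; rewrite big_ord0.
  by exists nil.
have [|z [alg_z [a Dz] [ps Ds]]] := IHs.
  by move=> y sy; apply: alg_s; rewrite inE sy orbT.
have alg_x : algebraicOver iota x by apply: alg_s; rewrite mem_head.
have [rx [_ nz_rx rx0]] := exists_irreducible_root alg_x.
(* [pchar0_PET] yields a generator that is a difference; applied to [- z] it gives a sum. *)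
have [rz [_ nz_rz rz0]] := exists_irreducible_root (algebraic_opp alg_z).
have [n [[pz Dpz] [px Dpx]]] := pchar0_PET nz_rz rz0 nz_rx rx0 pchar0.
rewrite opprK in Dpz Dpx.
exists (x *+ n + z); split.
- apply: algebraic_add => //; elim: n {Dpz Dpx} => [|n IHn]; first exact: algebraic0.
  by rewrite mulrS; apply: algebraic_add.
- exists [ffun i => oapp a n (unlift ord0 i)].
  rewrite /= big_ord_recl ffunE unlift_none Dz; congr (_ + _).
  by apply: eq_bigr => i _; rewrite ffunE liftK.
- exists (px :: [seq p \Po (- pz) | p <- ps]); rewrite /= Dpx; congr (_ :: _).
  rewrite -map_comp {1}Ds; apply: eq_map => p /=.
  by rewrite map_comp_poly horner_comp rmorphN /= hornerN Dpz opprK.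
Qed.

(** The field is the quotient of the polynomial ring by an irreducible polynomial of a primitive
    element; that element being a sum of multiples of members of [s], their preimages generate. *)
Lemma generated_subextension (s : seq F) :
  (forall z, z \in s -> algebraicOver iota z) ->
  exists (Q : fieldExtType k) (j : {rmorphism Q -> F}) (s1 : seq Q),
    [/\ forall c, j c%:A = iota c, map j s1 = s & <<1 & s1>>%VS = fullv].
Proof.
move=> alg_s; have [z [alg_z [a Dz] [ps Ds]]] := algebraic_primitive_element alg_s.
have [r [irr_r nz_r rz0]] := exists_irreducible_root alg_z.
pose Q : fieldExtType k := SubFieldExtType rz0 irr_r.
pose j : {rmorphism Q -> F} := @subfx_inj _ _ iota z r.
pose z1 : Q := subfx_root iota z r.
have jz1 : j z1 = z by exact: subfx_inj_root.
have jA c : j c%:A = iota c.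
  rewrite /j /= -[c%:A]/(@GRing.scale k Q c 1).
  have -> : (c *: (1 : Q)) = @subfx_eval _ _ iota z r c%:P.
    by rewrite -alg_polyC linearZ /= rmorph1.
  by rewrite subfx_inj_eval // map_polyC hornerC.
have z1gen (xx : Q) : exists p, fieldExt_horner z1 p = xx.
  by have [p ->] := subfxEroot rz0 nz_r xx; exists p.
pose inQs := fieldExt_horner z1; pose s1 := map inQs ps.
have inQsK p : j (inQs p) = p^i.[z].
  rewrite /= -horner_map jz1 -map_poly_comp; congr _.[z].
  by apply: eq_map_poly => b /=; exact: jA.
exists Q, j, s1; split=> //.
  by rewrite -map_comp Ds (eq_map inQsK).
have sz_ps : size ps = size s by rewrite Ds size_map.
apply/vspaceP=> x; rewrite memvf; have [p {x}<-] := z1gen x.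
elim/poly_ind: p => [|p b ApQs]; first by rewrite rmorph0 mem0v.
rewrite rmorphD rmorphM /= fieldExt_hornerX fieldExt_hornerC /=.
suffices Ez1 : z1 = \sum_(i < size s) s1`_i *+ a i.
  apply: memvD; last by rewrite memvZ ?mem1v.
apply: memvM => //; rewrite Ez1 memv_suml // => i _.
  by rewrite rpredMn ?seqv_sub_adjoin ?mem_nth // size_map sz_ps.
apply: (fmorph_inj j); rewrite jz1 Dz rmorph_sum; apply: eq_bigr => i _.
by rewrite rmorphMn {1}Ds !(nth_map 0) ?sz_ps //= -inQsK.
Qed.

End FiniteSubextensions.


(** Bundles a map obtained by choice, whose multiplicativity is known afterwards. *)
Lemma rmorphism_of (A B : nzRingType) (f : A -> B) :
  {morph f : x y / x + y} -> {morph f : x y / x * y} -> f 1 = 1 ->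
  exists h : {rmorphism A -> B}, h =1 f.
Proof.
move=> fD fM f1.
have f0 : f 0 = 0 by apply: (addIr (f 0)); rewrite -fD !add0r.
have fB : zmod_morphism f.
  move=> x y; apply: (addIr (f y)); rewrite -fD !subrK //.
pose a := GRing.isZmodMorphism.Build A B f fB.
have fMM : monoid_morphism f by split.
pose m := GRing.isMonoidMorphism.Build A B f fMM.
pose h : {rmorphism A -> B} := HB.pack f a m.
by exists h.
Qed.

(** * Embeddings and composita of finite abelian extensions *)

Section AbelianExtensions.
Variables (k F : fieldType) (iota : {rmorphism k -> F}).
Hypothesis pchar0 : [pchar k] =i pred0.

Definition abelian_ext (L : splittingFieldType k) (j : {rmorphism L -> F}) :=
  [/\ forall c, j c%:A = iota c, galois 1 {:L} & abelian 'Gal({:L} / 1)%g].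

Lemma maximal_abelianP z : maximal_abelian iota z <->
  exists L j x, @abelian_ext L j /\ j x = z.
Proof.
split=> [[L [j [jA gL aL [x _ jx]]]]|[L [j [x [[jA gL aL] jx]]]]].
  by exists L, j, x.
by exists L, j; split=> //; exists x.
Qed.

Lemma map_poly_alg (L1 L2 : fieldExtType k) (j1 : {rmorphism L1 -> F})
    (j2 : {rmorphism L2 -> F}) (p : {poly k}) :
  (forall c, j1 c%:A = iota c) -> (forall c, j2 c%:A = iota c) ->
  map_poly j1 (map_poly (in_alg L1) p) = map_poly j2 (map_poly (in_alg L2) p).
Proof.
move=> j1A j2A; rewrite -!map_poly_comp; apply: eq_map_poly => c /=.
by rewrite j1A j2A.
Qed.

(** [j2 x] is a root of the minimal polynomial of [x]; this polynomial splits in the normal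
    extension [L], so all its roots in [F] are images under [j1]. *)
Lemma embedding_conjugate (L : splittingFieldType k) (j1 j2 : {rmorphism L -> F}) x :
  (forall c, j1 c%:A = iota c) -> (forall c, j2 c%:A = iota c) ->
  exists y, j2 x = j1 y.
Proof.
move=> j1A j2A; have [r /eqP Dr] := splitting_field_normal 1%AS x.
have /polyOver1P[p Dp] := minPolyOver 1 x.
have : root (map_poly j2 (minPoly 1 x)) (j2 x) by rewrite fmorph_root root_minPoly.
rewrite Dp (map_poly_alg p j2A j1A) -Dp Dr rmorph_prod /= /root horner_prod.
move=> /eqP/eqP; rewrite prodf_seq_eq0 => /hasP[y _ /=].
rewrite rmorphB /= map_polyX map_polyC /= hornerXsubC subr_eq0 => /eqP ->.
by exists y.
Qed.

Lemma embedding_gal (L : splittingFieldType k) (j1 j2 : {rmorphism L -> F}) :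
  (forall c, j1 c%:A = iota c) -> (forall c, j2 c%:A = iota c) ->
  exists2 s, s \in 'Gal({:L} / 1)%g & forall x, j2 x = j1 (s x).
Proof.
move=> j1A j2A.
have /choice[f jf] x := embedding_conjugate x j1A j2A.
have j1I := fmorph_inj j1.
have fD : {morph f : x y / x + y}.
  by move=> x y; apply: j1I; rewrite rmorphD -!jf rmorphD.
have fM : {morph f : x y / x * y}.
  by move=> x y; apply: j1I; rewrite rmorphM -!jf rmorphM.
have f1 : f 1 = 1 by apply: j1I; rewrite -jf !rmorph1.
have fZ : scalable f.
  move=> c x; rewrite -mulr_algl fM; apply: j1I.
  by rewrite -[in RHS]mulr_algl !rmorphM -jf j1A j2A.
have [h hE] := rmorphism_of fD fM f1.
have fL : linear f by move=> c x y; rewrite fD fZ.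
pose fl : {linear L -> L} := HB.pack f (GRing.isLinear.Build k L L _ f fL).
have homf : kHom 1 {:L} (linfun fl).
  apply/kHom_monoid_morphism; split; first by rewrite lfunE.
  by move=> x y; rewrite !lfunE /= fM.
have autf : kAut 1 {:L} (linfun fl) by rewrite kAutfE.
have [s sG fs] := kAut_to_gal autf.
by exists s => // x; rewrite jf -fs ?memvf // lfunE.
Qed.

Lemma embedding_factor (L M : fieldExtType k) (j1 : {rmorphism L -> F})
    (j2 : {rmorphism M -> F}) :
  (forall c, j1 c%:A = iota c) -> (forall c, j2 c%:A = iota c) ->
  (forall x, exists y, j2 y = j1 x) ->
  exists i : {rmorphism L -> M},
    (forall c, i c%:A = c%:A) /\ forall x, j2 (i x) = j1 x.
Proof.
move=> j1A j2A /choice[f jf]; have j2I := fmorph_inj j2.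
have [|||h hE] := @rmorphism_of L M f.
- by move=> x y; apply: j2I; rewrite rmorphD !jf rmorphD.
- by move=> x y; apply: j2I; rewrite rmorphM !jf rmorphM.
- by apply: j2I; rewrite jf !rmorph1.
exists h; split=> [c|x]; last by rewrite hE jf.
by apply: j2I; rewrite hE jf j1A j2A.
Qed.

(** Transported to the image of [L], the automorphism [s] is a homomorphism from an intermediate
    field of the normal extension [M], and such a homomorphism extends to [M]. *)
Lemma gal_lift (L M : splittingFieldType k) (i : {rmorphism L -> M}) s :
  (forall c, i c%:A = c%:A) -> s \in 'Gal({:L} / 1)%g ->
  exists2 t, t \in 'Gal({:M} / 1)%g & forall x, t (i x) = i (s x).
Proof.
move=> iA sG.
have iZ : scalable i.
  by move=> c x; rewrite -mulr_algl rmorphM iA mulr_algl.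
pose f0 : L -> M := i.
have f0L : linear f0 by move=> c x y; rewrite /f0 rmorphD iZ.
have f0M : monoid_morphism f0 by split; [exact: rmorph1 | exact: rmorphM].
pose il : {lrmorphism L -> M} := HB.pack f0
  (GRing.isLinear.Build k L M _ f0 f0L) (GRing.isMonoidMorphism.Build L M f0 f0M).
pose iL : 'AHom(L, M) := linfun_ahom il.
have iLE x : iL x = i x by exact: (lfunE (il : {linear L -> M}) x).
have kiL : lker iL == 0%VS.
  by apply/lker0P => x y; rewrite !iLE; exact: fmorph_inj.
pose E : {subfield M} := (iL @: {:L})%AS.
pose f : 'End(M) := ((iL \o s) \o iL^-1)%VF.
have fE x : f (i x) = i (s x).
  by rewrite /f !comp_lfunE /= -(iLE x) lker0_lfunK // iLE.
have homf : kHom 1 E f.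
  apply/kHomP_tmp; split.
    move=> _ /vlineP[c ->]; rewrite -iA fE.
    by rewrite (fixed_gal (sub1v _) sG) // memvZ ?mem1v.
  move=> _ _ /memv_imgP[x _ ->] /memv_imgP[y _ ->].
  rewrite !iLE -(rmorphM i) !fE -(rmorphM i); congr (i _); exact: rmorphM.
have [|t tG ft] := kHom_to_gal _ (normalFieldf 1%AS) homf.
  by rewrite sub1v subvf.
exists t => // x; rewrite -fE ft //.
by rewrite -iLE memv_img // memvf.
Qed.

(** The field generated by the roots that generate [L1] and [L2] splits the product of their two
    polynomials. Its automorphisms restrict to both factors, where they commute, so every commutator
    fixes a set of generators. *)
Lemma abelian_compositum (L1 L2 : splittingFieldType k)
    (j1 : {rmorphism L1 -> F}) (j2 : {rmorphism L2 -> F}) :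
  abelian_ext j1 -> abelian_ext j2 ->
  exists (M : splittingFieldType k) (j : {rmorphism M -> F}),
    [/\ abelian_ext j, forall x, exists y, j y = j1 x & forall x, exists y, j y = j2 x].
Proof.
move=> [j1A gL1 aL1] [j2A gL2 aL2].
have [p1' /polyOver1P[p1 Dp1] [r1 Er1 gen1]] := splittingFieldP L1.
have [p2' /polyOver1P[p2 Dp2] [r2 Er2 gen2]] := splittingFieldP L2.
have algL (L : fieldExtType k) (j : {rmorphism L -> F}) :
    (forall c, j c%:A = iota c) -> forall x, algebraicOver iota (j x).
  move=> jA x; have /polyOver1P[p Dp] := minPolyOver 1 x.
  exists p; first by rewrite -(map_poly_eq0 (in_alg L)) -Dp monic_neq0 ?monic_minPoly.
  have -> : map_poly iota p = map_poly j (minPoly 1 x).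
    by rewrite Dp -map_poly_comp; apply: eq_map_poly => c /=; rewrite jA.
  by rewrite fmorph_root root_minPoly.
have [|Q [j [s1 [jA js1 genQ]]]] :=
  @generated_subextension _ _ iota pchar0 (map j1 r1 ++ map j2 r2).
  by move=> z; rewrite mem_cat => /orP[] /mapP[x _ ->]; exact: algL.
have splitQ : SplittingField.axiom Q.
  exists (map_poly (in_alg Q) (p1 * p2)); first by apply/polyOver1P; exists (p1 * p2).
  exists s1 => //; rewrite -(eqp_map j) rmorph_prod /=.
  rewrite (eq_bigr (fun x => 'X - (j x)%:P)); last first.
    by move=> x _; rewrite rmorphB /= map_polyX map_polyC.
  rewrite -(big_map j xpredT (fun z => 'X - z%:P)) js1 big_cat /= !rmorphM /=.
  rewrite (map_poly_alg p1 jA j1A) (map_poly_alg p2 jA j2A) -Dp1 -Dp2 !big_map.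
  apply: (@eqp_trans _ (\prod_(i <- r1) ('X - (j1 i)%:P) * map_poly j2 p2')).
    apply: eqp_mulr; move: Er1; rewrite -(eqp_map j1) rmorph_prod /= => /eqp_trans; apply.
    by apply/eqpP; exists (1, 1); rewrite ?oner_eq0 // !scale1r; apply: eq_bigr => x _;
      rewrite rmorphB /= map_polyX map_polyC.
  apply: eqp_mull; move: Er2; rewrite -(eqp_map j2) rmorph_prod /= => /eqp_trans; apply.
  by apply/eqpP; exists (1, 1); rewrite ?oner_eq0 // !scale1r; apply: eq_bigr => x _;
    rewrite rmorphB /= map_polyX map_polyC.
(* From here on the compositum is an abstract splitting field, known through its generators and its
   embedding. *)
have [M [jM [sM [jMA jsM genM]]]] : exists (M : splittingFieldType k)
    (jM : {rmorphism M -> F}) (sM : seq M), [/\ forall c, jM c%:A = iota c,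
    map jM sM = map j1 r1 ++ map j2 r2 & <<1 & sM>>%VS = fullv].
  pose M : splittingFieldType k := HB.pack Q (FieldExt_isSplittingField.Build k Q splitQ).
  by exists M, j, s1.
move: {Q j s1 jA js1 genQ splitQ} M jM sM jMA jsM genM => Q j s1 jA js1 genQ.
have sub (L : splittingFieldType k) (jL : {rmorphism L -> F}) (r : seq L) :
    (forall c, jL c%:A = iota c) -> <<1 & r>>%VS = fullv -> {subset map jL r <= map j s1} ->
    forall x, exists y, j y = jL x.
  move=> jLA genL rs x; have : x \in <<1 & r>>%VS by rewrite genL memvf.
  pose P := fun x => exists y, j y = jL x.
  have Psub : forall x, x \in r -> P x.
    move=> a ra; have /mapP[y _ Ey] : jL a \in map j s1 by apply/rs/map_f.
    by exists y.
  elim/last_ind: r {genL rs} x Psub => [|r a IHr] x Psub.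
    rewrite Fadjoin_nil => /vlineP[c ->]; exists c%:A; by rewrite jA jLA.
  rewrite adjoin_rcons => /Fadjoin_polyP[q /polyOverP qr ->].
  have [ya Ea] : P a by apply: Psub; rewrite mem_rcons mem_head.
  have {}IHr b : b \in <<1 & r>>%VS -> P b.
    by apply: IHr => c rc; apply: Psub; rewrite mem_rcons inE rc orbT.
  have /choice[h hE] i := IHr _ (qr i).
  exists (\sum_(i < size q) h i * ya ^+ i).
  rewrite horner_coef !rmorph_sum; apply: eq_bigr => i _.
  by rewrite !rmorphM !rmorphXn /= hE Ea.
have sub1 : forall x, exists y, j y = j1 x.
  by apply: (sub _ _ _ j1A gen1) => z; rewrite js1 mem_cat => ->.
have sub2 : forall x, exists y, j y = j2 x.
  by apply: (sub _ _ _ j2A gen2) => z; rewrite js1 mem_cat => ->; rewrite orbT.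
exists Q, j; split=> //; split=> //.
  rewrite /galois sub1v normalFieldf andbT; apply/allP => x _.
  apply: pcharf0_separable => q; rewrite -pchar0; exact: (fmorph_pchar (in_alg Q)).
have comm (L : splittingFieldType k) (jL : {rmorphism L -> F}) x :
    (forall c, jL c%:A = iota c) -> abelian 'Gal({:L} / 1)%g ->
    (forall x, exists y, j y = jL x) ->
    forall s t, s \in 'Gal({:Q} / 1)%g -> t \in 'Gal({:Q} / 1)%g -> forall y, j y = jL x ->
    s (t y) = t (s y).
  move=> jLA aL subL s t sG tG y Ey.
  have [i [iA ji]] := embedding_factor jLA jA subL.
  have restr u : u \in 'Gal({:Q} / 1)%g ->
      exists2 v, v \in 'Gal({:L} / 1)%g & forall x, u (i x) = i (v x).
    move=> uG; have [h hE] : exists h : {rmorphism L -> F}, h =1 (fun x => j (u (i x))).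
      by apply: rmorphism_of => [a b|a b|]; rewrite ?rmorphD ?rmorphM ?rmorph1.
    have [|v vG hv] := embedding_gal (j2 := h) jLA.
      move=> c; rewrite hE iA.
      by rewrite (fixed_gal (sub1v _) uG) ?memvZ ?mem1v.
    exists v => // a; apply: (fmorph_inj j); rewrite -[LHS]hE hv -ji.
    by [].
  have -> : y = i x by apply: (fmorph_inj j); rewrite Ey ji.
  have [s' s'G Es] := restr s sG; have [t' t'G Et] := restr t tG.
  rewrite Et Es Es Et; congr (i _).
  by rewrite -!galM ?memvf //; congr ((_ : gal_of _) _); apply: (centsP aL).
apply/centsP => s sG t tG; rewrite /commute; apply/eqP/gal_eqP => y _.
(* The commutator is trivial because its fixed field contains the generators [s1]. *)
pose w := (s * t * (t * s)^-1)%g.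
have wE b : (s * t)%g b = (t * s)%g b -> w b = b.
  by move=> stb; rewrite /w galM ?memvf // stb -galM ?memvf // mulgV gal_id.
have sfix : (<<1 & s1>> <= fixedField [set w])%VS.
  apply/Fadjoin_seqP; split=> [|b s1b]; first exact: sub1v.
  apply/fixedFieldP; rewrite ?memvf // => _ /set1P ->; apply: wE.
  rewrite !galM ?memvf //.
  have : j b \in map j s1 by apply: map_f.
  rewrite js1 mem_cat => /orP[] /mapP[x _ jx].
    by apply/esym/(comm _ _ x j1A aL1 sub1 _ _ sG tG).
  by apply/esym/(comm _ _ x j2A aL2 sub2 _ _ sG tG).
have : y \in fixedField [set w] by apply: (subvP sfix); rewrite genQ memvf.
move=> /mem_fixedFieldP[_ /(_ w)]; rewrite set11 => /(_ isT) wy.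
by rewrite -[in RHS]wy -galM ?memvf // /w mulgKV.
Qed.

Local Open Scope classical_set_scope.

Lemma maximal_abelian_finite (s : seq F) : (forall z, z \in s -> maximal_abelian iota z) ->
  exists (L : splittingFieldType k) (j : {rmorphism L -> F}),
    abelian_ext j /\ forall z, z \in s -> exists x, j x = z.
Proof.
elim: s => [_|z s IHs sK].
  pose L : splittingFieldType k := k^o.
  pose j : {rmorphism L -> F} := iota.
  exists L, j; split=> //; split=> [c||].
  - by congr (iota _); rewrite /GRing.scale /= mulr1.
  - rewrite /galois sub1v normalFieldf andbT; apply/allP => x _.
    by apply: pcharf0_separable => q; rewrite -pchar0.
  - apply/centsP => s sG t tG; rewrite /commute; apply/eqP/gal_eqP => x _.
    have idL u : u \in 'Gal({:L} / 1)%g -> forall y, u y = y.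
      move=> uG y; apply: (fixed_gal (sub1v _) uG).
      by rewrite (_ : y = y *: 1) ?memvZ ?mem1v // /GRing.scale /= mulr1.
    by rewrite !galM ?memvf // !idL.
have [L1 [j1 [ab1 sj1]]] := IHs (fun y sy => sK y (mem_behead (s := z :: s) sy)).
have [L2 [j2 [x2 [ab2 <-]]]] := (maximal_abelianP z).1 (sK z (mem_head _ _)).
have [M [j [ab r1 r2]]] := abelian_compositum ab1 ab2.
exists M, j; split=> // w; rewrite inE => /orP[/eqP -> //|/sj1[x <-]]; exact: r1.
Qed.

Lemma abelian_ext_sub (L : splittingFieldType k) (j : {rmorphism L -> F}) x :
  abelian_ext j -> maximal_abelian iota (j x).
Proof. by move=> ab; apply/maximal_abelianP; exists L, j, x. Qed.

Lemma maximal_abelian_iota c : maximal_abelian iota (iota c).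
Proof.
have [L [j [[jA gL aL] _]]] := @maximal_abelian_finite [::] (fun=> ltac:(by [])).
by rewrite -jA; exact: abelian_ext_sub.
Qed.

Lemma maximal_abelianD z w : maximal_abelian iota z -> maximal_abelian iota w ->
  maximal_abelian iota (z + w).
Proof.
move=> Kz Kw; have [|L [j [ab js]]] := @maximal_abelian_finite [:: z; w].
  by move=> u; rewrite !inE => /orP[] /eqP ->.
have [x <-] := js z (mem_head _ _); have [y <-] := js w ltac:(by rewrite !inE eqxx orbT).
by rewrite -rmorphD; exact: abelian_ext_sub.
Qed.

Lemma maximal_abelianM z w : maximal_abelian iota z -> maximal_abelian iota w ->
  maximal_abelian iota (z * w).
Proof.
move=> Kz Kw; have [|L [j [ab js]]] := @maximal_abelian_finite [:: z; w].
  by move=> u; rewrite !inE => /orP[] /eqP ->.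
have [x <-] := js z (mem_head _ _); have [y <-] := js w ltac:(by rewrite !inE eqxx orbT).
by rewrite -rmorphM; exact: abelian_ext_sub.
Qed.

Lemma abelian_ext_root (L : splittingFieldType k) (j : {rmorphism L -> F}) s (p : {poly k}) x :
  (forall c, j c%:A = iota c) -> s \in 'Gal({:L} / 1)%g ->
  root (map_poly iota p) (j x) -> root (map_poly iota p) (j (s x)).
Proof.
move=> jA sG; have -> : map_poly iota p = map_poly j (map_poly (in_alg L) p).
  by rewrite -map_poly_comp; apply: eq_map_poly => c /=; rewrite jA.
rewrite !fmorph_root => px; have := px; rewrite -(fmorph_root s).
suff -> : map_poly s (map_poly (in_alg L) p) = map_poly (in_alg L) p by [].
rewrite -map_poly_comp; apply: eq_map_poly => c /=.
by rewrite (fixed_gal (sub1v _) sG) // memvZ ?mem1v.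
Qed.

(** The finite list of candidate conjugates of [z]: it bounds the Galois orbits and also makes
    limits along an ultrafilter exist. *)
Lemma maximal_abelian_roots z : maximal_abelian iota z ->
  exists (p : {poly k}) (s : seq F),
    root (map_poly iota p) z /\ forall w, root (map_poly iota p) w -> w \in s.
Proof.
move=> /maximal_abelianP[L [j [x [[jA gL aL] <-]]]].
have [r /eqP Dr] := splitting_field_normal 1%AS x.
have /polyOver1P[p Dp] := minPolyOver 1 x.
have Ep : map_poly iota p = map_poly j (minPoly 1 x).
  by rewrite Dp -map_poly_comp; apply: eq_map_poly => c /=; rewrite jA.
exists p, (map j r); rewrite Ep; split; first by rewrite fmorph_root root_minPoly.
move=> w; rewrite Dr rmorph_prod /= /root horner_prod prodf_seq_eq0 => /hasP[y ry /=].
rewrite rmorphB /= map_polyX map_polyC /= hornerXsubC subr_eq0 => /eqP ->.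
exact: map_f.
Qed.

(** A k-homomorphism from K^ab to F; that it permutes K^ab is derived in [abelian_hom_galois]. *)
Definition abelian_hom (t : F -> F) :=
  [/\ {in maximal_abelian iota &, {morph t : x y / x + y}},
      {in maximal_abelian iota &, {morph t : x y / x * y}}
    & forall c, t (iota c) = iota c].

Lemma abelian_hom_gal t (L : splittingFieldType k) (j : {rmorphism L -> F}) :
  abelian_hom t -> abelian_ext j ->
  exists2 s, s \in 'Gal({:L} / 1)%g & forall x, t (j x) = j (s x).
Proof.
move=> [tD tM tk] ab; have [jA gL aL] := ab.
have jK x : j x \in maximal_abelian iota by rewrite inE; exact: abelian_ext_sub.
have [|||h hE] := @rmorphism_of L F (t \o j).
- by move=> x y /=; rewrite rmorphD tD.
- by move=> x y /=; rewrite rmorphM tM.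
- by rewrite /= rmorph1 -(rmorph1 iota) tk.
have [|s sG hs] := embedding_gal (j2 := h) jA.
  by move=> c; rewrite hE /= jA tk.
by exists s => // x; rewrite -hs hE.
Qed.

Lemma abelian_galois_hom g : abelian_galois iota g -> abelian_hom g.
Proof. by case=> _ gD gM gk _; split. Qed.

(** On each finite abelian extension the map is a Galois automorphism by [abelian_hom_gal], which
    gives stability, injectivity and surjectivity at once. *)
Lemma abelian_hom_galois t : abelian_hom t ->
  abelian_galois iota (fun z => if `[< maximal_abelian iota z >] then t z else z).
Proof.
move=> ht; have [tD tM tk] := ht.
have tE z : maximal_abelian iota z ->
    (if `[< maximal_abelian iota z >] then t z else z) = t z.
  by move=> Kz; case: asboolP.
split=> [|z w|z w|c|z nKz]; last by case: asboolP.
- split=> [z Kz|z w|z Kz].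
  + rewrite tE //; have [L [j [x [ab <-]]]] := (maximal_abelianP z).1 Kz.
    by have [s _ ->] := abelian_hom_gal ht ab; exact: abelian_ext_sub.
  + rewrite !inE => Kz Kw; rewrite !tE // => tzw.
    have [|L [j [ab js]]] := @maximal_abelian_finite [:: z; w].
      by move=> u; rewrite !inE => /orP[] /eqP ->.
    have [x Ex] := js z (mem_head _ _).
    have [y Ey] := js w ltac:(by rewrite !inE eqxx orbT).
    have [s _ ts] := abelian_hom_gal ht ab; move: tzw.
    by rewrite -Ex -Ey !ts => /(fmorph_inj j)/(fmorph_inj s) ->.
  + have [L [j [x [ab Ex]]]] := (maximal_abelianP z).1 Kz.
    have [s sG ts] := abelian_hom_gal ht ab.
    exists (j ((s^-1)%g x)); first exact: abelian_ext_sub.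
    rewrite tE; last exact: abelian_ext_sub.
    by rewrite ts -galM ?memvf // mulVg gal_id.
- rewrite !inE => Kz Kw; rewrite !tE //; last exact: maximal_abelianD.
  by rewrite tD ?inE.
- rewrite !inE => Kz Kw; rewrite !tE //; last exact: maximal_abelianM.
  by rewrite tM ?inE.
- by rewrite tE ?tk //; exact: maximal_abelian_iota.
Qed.

Lemma abelian_galois_sub g z : abelian_galois iota g -> maximal_abelian iota z ->
  maximal_abelian iota (g z).
Proof. by case=> [[gK _ _] _ _ _ _] Kz; apply: gK. Qed.

Lemma abelian_galois_ext g h : abelian_galois iota g -> abelian_galois iota h ->
  (forall z, maximal_abelian iota z -> g z = h z) -> g = h.
Proof.
move=> [_ _ _ _ gN] [_ _ _ _ hN] gh; apply: funext => z.
by have [/gh //|nKz] := pselect (maximal_abelian iota z); rewrite gN // hN.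
Qed.

Lemma abelian_galois_id : abelian_galois iota id.
Proof. by split=> //; split=> [z Kz//|z w _ _|z Kz] //; exists z. Qed.

Lemma abelian_galois_comp g h : abelian_galois iota g -> abelian_galois iota h ->
  abelian_galois iota (g \o h).
Proof.
move=> gG hG; have [gb gD gM gk gN] := gG; have [hb hD hM hk hN] := hG.
split=> [|z w|z w|c|z nKz].
- exact: set_bij_comp hb gb.
- rewrite !inE => Kz Kw /=; rewrite hD ?inE // gD ?inE //; exact: abelian_galois_sub.
- rewrite !inE => Kz Kw /=; rewrite hM ?inE // gM ?inE //; exact: abelian_galois_sub.
- by rewrite /= hk gk.
- by rewrite /= hN // gN.
Qed.

Lemma abelian_galois_commute g h : abelian_galois iota g -> abelian_galois iota h ->
  g \o h = h \o g.
Proof.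
move=> gG hG; apply: abelian_galois_ext; try exact: abelian_galois_comp.
move=> _ /maximal_abelianP[L [j [x [ab <-]]]]; have [jA gL aL] := ab.
have [s sG gs] := abelian_hom_gal (abelian_galois_hom gG) ab.
have [t tG ht] := abelian_hom_gal (abelian_galois_hom hG) ab.
rewrite /= ht !gs ht; congr (j _); rewrite -!galM ?memvf //.
by congr ((_ : gal_of _) _); apply: (centsP aL).
Qed.

Lemma abelian_galois_inv g : abelian_galois iota g ->
  exists2 h, abelian_galois iota h & g \o h = id.
Proof.
move=> gG; have gH := abelian_galois_hom gG.
have [[gK gI gS] gD gM gk gN] := gG.
have /choice[h0 h0P] z : exists w, maximal_abelian iota z ->
    maximal_abelian iota w /\ g w = z.
  have [/gS[w Kw gw]|nKz] := pselect (maximal_abelian iota z); first by exists w.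
  by exists z.
have h0K z : maximal_abelian iota z -> maximal_abelian iota (h0 z).
  by move=> /h0P[].
have gh0 z : maximal_abelian iota z -> g (h0 z) = z by move=> /h0P[].
have ginj z w : maximal_abelian iota z -> maximal_abelian iota w -> g z = g w -> z = w.
  by move=> Kz Kw; apply: gI; rewrite inE.
have hh : abelian_hom h0.
  split=> [z w|z w|c]; rewrite ?inE.
  - move=> Kz Kw; apply: ginj; rewrite ?gD ?inE ?gh0 //; try exact: h0K;
      by [exact: maximal_abelianD | apply: h0K; exact: maximal_abelianD
         | apply: maximal_abelianD; exact: h0K].
  - move=> Kz Kw; apply: ginj; rewrite ?gM ?inE ?gh0 //; try exact: h0K;
      by [exact: maximal_abelianM | apply: h0K; exact: maximal_abelianM
         | apply: maximal_abelianM; exact: h0K].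
  - have Kc := maximal_abelian_iota c.
    by apply: ginj => //; [exact: h0K|rewrite gh0 // gk].
have hG := abelian_hom_galois hh.
exists (fun z => if `[< maximal_abelian iota z >] then h0 z else z) => //.
apply: abelian_galois_ext; [exact: abelian_galois_comp|exact: abelian_galois_id|].
by move=> z Kz /=; case: asboolP => // _; exact: gh0.
Qed.

Lemma abelian_galois_orbit z : maximal_abelian iota z ->
  exists s : seq F, forall g, abelian_galois iota g -> g z \in s.
Proof.
move=> Kz; have [p [s [pz ps]]] := maximal_abelian_roots Kz.
exists s => g gG; apply: ps.
have [L [j [x [ab Ex]]]] := (maximal_abelianP z).1 Kz; have [jA _ _] := ab.
have [t tG gt] := abelian_hom_gal (abelian_galois_hom gG) ab.
by rewrite -Ex gt; apply: abelian_ext_root; rewrite ?Ex.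
Qed.

(** * Lifting automorphisms of a finite extension to the maximal abelian extension *)

Section Lift.
Variables (L : splittingFieldType k) (j : {rmorphism L -> F}) (s : gal_of {:L}).
Hypotheses (ab : abelian_ext j) (sG : s \in 'Gal({:L} / 1)%g).

(** A finite approximation of the lift: [t] is a map of all of [F], but is controlled on a finite
    abelian extension containing [S]. *)
Let partial_lift (S : seq F) (t : F -> F) := (forall x, t (j x) = j (s x)) /\
  exists (M : splittingFieldType k) (jM : {rmorphism M -> F}) (u : gal_of {:M}),
    [/\ abelian_ext jM, u \in 'Gal({:M} / 1)%g,
      forall z, z \in S -> exists x, jM x = z & forall x, t (jM x) = jM (u x)].

Let partial_lift_exists (S : seq F) : (forall z, z \in S -> maximal_abelian iota z) ->
  exists t, partial_lift S t.
Proof.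
move=> SK; have [L1 [j1 [ab1 j1S]]] := maximal_abelian_finite SK.
have [M [jM [abM rM r1]]] := abelian_compositum ab ab1.
have [jA _ _] := ab; have [jMA _ _] := abM.
have [i [iA ji]] := embedding_factor jA jMA rM.
have [u uG ui] := gal_lift iA sG.
pose t z := xget z [set w | exists2 y, jM y = z & w = jM (u y)].
have tE y : t (jM y) = jM (u y).
  rewrite /t; case: xgetP => [w _ [y' /fmorph_inj -> //]|/(_ (jM (u y)))].
  by case; exists y.
exists t; split=> [x|]; first by rewrite -ji tE ui ji.
exists M, jM, u; split=> // z /j1S[x1 <-]; exact: r1.
Qed.

(** A compactness argument. Partial lifts indexed by the finite subsets of K^ab take finitely many
    values at each point, so they converge along an ultrafilter containing, for each finite subset,
    the set of all larger ones. Every identity required of the limit involves finitely many points,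
    hence is inherited from some partial lift. *)
Lemma abelian_galois_lift :
  exists2 g, abelian_galois iota g & forall x, g (j x) = j (s x).
Proof.
pose I := {S : seq F | `[< forall z, z \in S -> maximal_abelian iota z >]}.
have /choice[t tP] (S : I) : exists t, partial_lift (val S) t.
  by case: S => S /= /asboolP; exact: partial_lift_exists.
pose D (S0 : I) : set I := [set S : I | {subset (val S0 : seq F) <= (val S : seq F)}].
pose U0 : set_system I := filter_from setT D.
have pI : forall z, z \in [::] -> maximal_abelian iota z by [].
pose S0 : I := Sub [::] (asboolT pI).
have U0F : ProperFilter U0.
  apply: filter_from_proper; last by move=> S _; exists S.
  apply: filter_from_filter; first by exists S0.
  move=> S1 S2 _ _.
  have p12 : forall z, z \in (val S1 : seq F) ++ val S2 -> maximal_abelian iota z.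
    move=> z; rewrite mem_cat => /orP[zS|zS].
      by have /asboolP := valP S1; apply.
    by have /asboolP := valP S2; apply.
  exists (Sub ((val S1 : seq F) ++ val S2) (asboolT p12)) => //= S SS; split=> z zS; apply: SS.
    by rewrite mem_cat zS.
  by rewrite mem_cat zS orbT.
have [U [UU U0U]] := ultraFilterLemma U0F.
have FU : Filter U by exact: filter_filter.
have UD (S : seq F) : (forall z, z \in S -> maximal_abelian iota z) ->
    U [set T : I | {subset S <= (val T : seq F)}].
  by move=> pS; apply: U0U; exists (Sub S (asboolT pS)).
(* A function with finitely many values is constant on a member of the ultrafilter. *)
have fin_ultra (z : F) (r : seq F) : U [set T | t T z \in r] ->
    exists v, U [set T | t T z = v].
  elim: r => [U_|w r IHr Ur].
    by have /filter_ex[T /=] := U_; rewrite in_nil.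
  have [Uw|Uw] := in_ultra_setVsetC [set T | t T z = w] UU; first by exists w.
  apply: IHr; apply: filterS (filterI Ur Uw) => T [/=].
  by rewrite inE => /orP[/eqP|].
pose v z := xget z [set w | U [set T | t T z = w]].
have vP z : maximal_abelian iota z -> U [set T | t T z = v z].
  move=> Kz; suff [r /fin_ultra[w Uw]] : exists r : seq F, U [set T | t T z \in r].
    by rewrite /v; case: xgetP => // /(_ w).
  have [p [r [pz pr]]] := maximal_abelian_roots Kz; exists r.
  have /UD : forall w, w \in [:: z] -> maximal_abelian iota w.
    by move=> w; rewrite inE => /eqP ->.
  apply: filterS => T /= /(_ z (mem_head _ _)) zT; apply: pr.
  have [_ [M [jM [u [[jMA _ _] uG rM tM]]]]] := tP T.
  have [x Ex] := rM z zT.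
  by rewrite -Ex tM; apply: abelian_ext_root; rewrite ?Ex.
have vh : abelian_hom v.
  split=> [z w|z w|c]; rewrite ?inE.
  - move=> Kz Kw; have Kzw := maximal_abelianD Kz Kw.
    have /UD UT : forall x, x \in [:: z; w] -> maximal_abelian iota x.
      by move=> x; rewrite !inE => /orP[] /eqP ->.
    have U2 := @filterI _ U FU _ _ (vP z Kz) (vP w Kw).
    have U4 := @filterI _ U FU _ _ (@filterI _ U FU _ _ U2 (vP _ Kzw)) UT; have [T /= [[[zT wT] zwT] /= sT]] := filter_ex U4.
    have [_ [M [jM [u [_ uG rM tM]]]]] := tP T.
    have [x Ex] := rM z (sT z (mem_head _ _)).
    have [y Ey] := rM w (sT w ltac:(by rewrite !inE eqxx orbT)).
    by rewrite -zT -wT -zwT -Ex -Ey -rmorphD !tM -rmorphD; congr (jM _); exact: rmorphD.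
  - move=> Kz Kw; have Kzw := maximal_abelianM Kz Kw.
    have /UD UT : forall x, x \in [:: z; w] -> maximal_abelian iota x.
      by move=> x; rewrite !inE => /orP[] /eqP ->.
    have U2 := @filterI _ U FU _ _ (vP z Kz) (vP w Kw).
    have U4 := @filterI _ U FU _ _ (@filterI _ U FU _ _ U2 (vP _ Kzw)) UT; have [T /= [[[zT wT] zwT] /= sT]] := filter_ex U4.
    have [_ [M [jM [u [_ uG rM tM]]]]] := tP T.
    have [x Ex] := rM z (sT z (mem_head _ _)).
    have [y Ey] := rM w (sT w ltac:(by rewrite !inE eqxx orbT)).
    by rewrite -zT -wT -zwT -Ex -Ey -rmorphM !tM -rmorphM; congr (jM _); exact: rmorphM.
  - have /filter_ex[T /= <-] := vP _ (maximal_abelian_iota c).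
    have [_ [M [jM [u [[jMA _ _] uG rM tM]]]]] := tP T.
    by rewrite -jMA tM (fixed_gal (sub1v _) uG) // memvZ ?mem1v.
exists (fun z => if `[< maximal_abelian iota z >] then v z else z).
  exact: abelian_hom_galois.
move=> x; have Kx := abelian_ext_sub x ab; case: asboolP => // _.
by have /filter_ex[T /= <-] := vP _ Kx; have [-> _] := tP T.
Qed.

End Lift.

(** [gal_matrix] gives a basis of a finite extension whose matrix of conjugates is invertible. As
    each of its automorphisms lifts to K^ab, a relation over [F] valid for all lifts is a vector
    killed by that matrix. This is the source of the injectivity of the tensor product with C. *)
Lemma maximal_abelian_independent (s : seq F) :
  (forall z, z \in s -> maximal_abelian iota z) ->
  exists d (w : 'I_d -> F), [/\ forall l, maximal_abelian iota (w l),
    forall z, z \in s -> exists c : 'I_d -> k, z = \sum_l iota (c l) * w l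
  & forall c : 'I_d -> F,
      (forall g, abelian_galois iota g -> \sum_l c l * g (w l) = 0) ->
      forall l, c l = 0].
Proof.
move=> sK; have [L [j [ab js]]] := maximal_abelian_finite sK.
have [jA gL aL] := ab.
have [w [_ nzw] [Mu _ genw]] := gal_matrix 'Gal({:L} / 1)%g.
exists #|'Gal({:L} / 1)%g|, (fun l => j (tnth w l)); split.
- by move=> l; exact: abelian_ext_sub.
- move=> z /js[x <-].
  have : x \in (\sum_i fixedField 'Gal({:L} / 1)%g * <[tnth w i]>)%VS.
    by rewrite genw ?groupP ?memvf.
  move=> /memv_sumP[u uP ->].
  have /choice[c cP] i : exists c, u i = c *: tnth w i.
    have := uP i isT; rewrite (galois_fixedField gL) prod1v => /vlineP[c ->].
    by exists c.
  exists c; rewrite rmorph_sum; apply: eq_bigr => i _.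
  by rewrite cP -mulr_algl rmorphM jA.
- move=> c cg l.
  pose M := \matrix_(i, j < #|'Gal({:L} / 1)%g|) enum_val i (tnth w j).
  have McE : map_mx j M *m (\col_l c l) = 0.
    apply/colP => i; rewrite !mxE.
    have [g gG gj] := abelian_galois_lift ab (enum_valP i).
    rewrite -[RHS](cg g gG); apply: eq_bigr => m _.
    by rewrite !mxE gj mulrC.
  have : \col_l c l = 0.
    rewrite -[LHS]mul1mx -(mulVmx (_ : map_mx j M \in unitmx)) ?map_unitmx //.
    by rewrite -mulmxA McE mulmx0.
  by move=> /colP/(_ l); rewrite !mxE.
Qed.

End AbelianExtensions.

Local Open Scope classical_set_scope.
Local Open Scope ring_scope.

(** * Entire functions and the complex exponential *)

Section ComplexNorm.
Variable R : realType.
Local Notation C := R[i].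
Implicit Types (z w : C).

(** The norm of [R[i]] has values in [R[i]]; this is the modulus as an element of the ordered field
    [R], where estimates are carried out. *)
Definition cabs z : R := complex.Re `|z|.

Lemma cabsE z : `|z| = (cabs z)%:C%C.
Proof. by rewrite /cabs; case: z => a b. Qed.

Lemma cabs_ge0 z : 0 <= cabs z.
Proof. by rewrite -(lecR 0 (cabs z)) -cabsE; exact: normr_ge0. Qed.

Lemma cabsM z w : cabs (z * w) = cabs z * cabs w.
Proof. by apply: (fmorph_inj (real_complex R)); rewrite rmorphM /= -!cabsE normrM. Qed.

Lemma cabsD z w : cabs (z + w) <= cabs z + cabs w.
Proof. by rewrite -lecR rmorphD /= -!cabsE ler_normD. Qed.

Lemma cabsN z : cabs (- z) = cabs z.
Proof. by rewrite /cabs normrN. Qed.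

Lemma cabsB z w : cabs (z - w) <= cabs z + cabs w.
Proof. by rewrite (le_trans (cabsD _ _)) ?cabsN. Qed.

Lemma cabsBC z w : cabs (z - w) = cabs (w - z).
Proof. by rewrite -cabsN opprB. Qed.

Lemma cabs0 : cabs 0 = 0. Proof. by rewrite /cabs normr0. Qed.

Lemma cabs1 : cabs 1 = 1. Proof. by rewrite /cabs normr1. Qed.

Lemma cabs_real (x : R) : cabs x%:C%C = `|x|.
Proof.
apply: (fmorph_inj (real_complex R)); rewrite /= -cabsE.
by rewrite normc_def /= expr0n addr0 sqrtr_sqr.
Qed.

Lemma cabs_eq0 z : (cabs z == 0) = (z == 0).
Proof.
by rewrite -(fmorph_eq0 (real_complex R)) /= -cabsE normr_eq0.
Qed.

Lemma cabs_gt0 z : (0 < cabs z) = (z != 0).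
Proof. by rewrite lt_neqAle cabs_ge0 andbT eq_sym cabs_eq0. Qed.

Lemma cabsV z : cabs z^-1 = (cabs z)^-1.
Proof. by apply: (fmorph_inj (real_complex R)); rewrite fmorphV /= -!cabsE normfV. Qed.

Lemma cabs_i : cabs 'i%C = 1.
Proof.
apply: (fmorph_inj (real_complex R)); rewrite /= -cabsE.
by rewrite normc_def /= expr0n expr1n add0r sqrtr1.
Qed.

Lemma cabs_Re z : `|complex.Re z| <= cabs z.
Proof. by rewrite -lecR -cabsE normc_ge_Re. Qed.

Lemma cabs_Im z : `|complex.Im z| <= cabs z.
Proof.
have := cabs_Re ('i%C * z); rewrite cabsM cabs_i mul1r; case: z => a b /=.
by rewrite mul0r mul1r sub0r normrN.
Qed.

Lemma cabs_le z : cabs z <= `|complex.Re z| + `|complex.Im z|.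
Proof.
rewrite {1}[z]complexE (le_trans (cabsD _ _)) // cabsM cabs_i mul1r.
by rewrite !cabs_real.
Qed.

Lemma gt0_complexP (e : C) : 0 < e -> exists2 r : R, 0 < r & e = r%:C%C.
Proof.
by case: e => a b; rewrite ltcE /= => /andP[/eqP -> a0]; exists a.
Qed.

Lemma ge0_complexP (e : C) : 0 <= e -> exists2 r : R, 0 <= r & e = r%:C%C.
Proof.
by case: e => a b; rewrite lecE /= => /andP[/eqP -> a0]; exists a.
Qed.

End ComplexNorm.

(** * Goursat's lemma on squares, for Riemann sums *)

Section Goursat.
Variable R : realType.
Local Notation C := R[i].
Local Notation I := ('i%C : C).
Implicit Types (f g : C -> C) (a d z w : C).

(** A left Riemann sum of f dz along the segment from [a] to [a + d], in 3^n steps. Thirds rather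
    than halves: one of the nine subsquares of a square then has the same centre, which isolates a
    singularity placed there. *)
Fixpoint rsum f n a d : C :=
  if n is m.+1 then
    rsum f m a (d / 3) + rsum f m (a + d / 3) (d / 3) + rsum f m (a + d / 3 + d / 3) (d / 3)
  else d * f a.

(** The positively oriented boundary of a square. Opposite edges are sampled in the same direction,
    so that an edge shared by two subsquares cancels exactly and not up to an error. *)
Definition contour f n a d : C :=
  rsum f n a d - rsum f n (a + I * d) d + rsum f n (a + d) (I * d) - rsum f n a (I * d).

Lemma third_segment a d (t : R) (j : nat) : 0 <= t <= 1 -> (j < 3)%N ->
  exists2 u : R, 0 <= u <= 1 & a + (d / 3) *+ j + t%:C%C * (d / 3) = a + u%:C%C * d.
Proof.
move=> /andP[t0 t1] j3; exists ((j%:R + t) / 3).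
  have : (j%:R : R) <= 2 by rewrite (ler_nat R _ 2).
  have : 0 <= (j%:R : R) by [].
  by move=> *; apply/andP; split; lra.
rewrite rmorphM rmorphD fmorphV /= !rmorph_nat -mulr_natl -addrA; congr (_ + _).
by field.
Qed.

Lemma rsum_seg_ind (P : nat -> C -> C -> Prop) (Q : C -> Prop) :
  (forall a d, (forall t : R, 0 <= t <= 1 -> Q (a + t%:C%C * d)) -> P 0%N a d) ->
  (forall n a d, P n a (d / 3) -> P n (a + d / 3) (d / 3) ->
     P n (a + d / 3 + d / 3) (d / 3) -> P n.+1 a d) ->
  forall n a d, (forall t : R, 0 <= t <= 1 -> Q (a + t%:C%C * d)) -> P n a d.
Proof.
move=> P0 PS; elim=> [|n IHn] a d Qd; first exact: P0.
have sub j : (j < 3)%N -> P n (a + (d / 3) *+ j) (d / 3).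
  move=> j3; apply: IHn => t /third_segment-/(_ a d j j3)[u u01 ->]; exact: Qd.
by apply: PS; [have := sub 0%N isT; rewrite mulr0n addr0
  | exact: (sub 1%N) | have := sub 2%N isT; rewrite mulr2n addrA].
Qed.

Lemma eq_rsum f g n a d : (forall t : R, 0 <= t <= 1 -> f (a + t%:C%C * d) = g (a + t%:C%C * d)) ->
  rsum f n a d = rsum g n a d.
Proof.
move: n a d; apply: (rsum_seg_ind (P := fun n a d => rsum f n a d = rsum g n a d)
  (Q := fun z => f z = g z)).
  move=> a d /(_ 0); rewrite mul0r addr0 => /= -> //; by rewrite lexx ler01.
by move=> n a d /= -> -> ->.
Qed.

Lemma rsumB f g n a d : rsum (fun z => f z - g z) n a d = rsum f n a d - rsum g n a d.
Proof. by elim: n a d => [|n IHn] a d /=; [ring | rewrite !IHn; ring]. Qed.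

Lemma rsumZ c f n a d : rsum (fun z => c * f z) n a d = c * rsum f n a d.
Proof. by elim: n a d => [|n IHn] a d /=; [ring | rewrite !IHn; ring]. Qed.

(** The discretization error for an affine function is homogeneous of degree two in [d] with a
    constant that depends on [n] alone. The errors of opposite edges thus cancel, and contour sums
    of affine functions vanish at every finite stage. *)
Lemma rsum_affine c e n : exists k : C, forall a d,
  rsum (fun z => c + e * z) n a d = d * (c + e * a) + e * d ^+ 2 * k.
Proof.
elim: n => [|n [k kE]]; first by exists 0 => a d /=; ring.
by exists (3^-1 + k / 3) => a d /=; rewrite !kE; field.
Qed.

Lemma contour_affine c e n a d : contour (fun z => c + e * z) n a d = 0.
Proof.
by have [k kE] := rsum_affine c e n; rewrite /contour !kE; ring.
Qed.

Lemma contourB f g n a d :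
  contour (fun z => f z - g z) n a d = contour f n a d - contour g n a d.
Proof. by rewrite /contour !rsumB; ring. Qed.

Lemma contourZ c f n a d : contour (fun z => c * f z) n a d = c * contour f n a d.
Proof. by rewrite /contour !rsumZ; ring. Qed.

Lemma rsum_bound f (B : R) n a d :
  (forall t : R, 0 <= t <= 1 -> cabs (f (a + t%:C%C * d)) <= B) ->
  cabs (rsum f n a d) <= B * cabs d.
Proof.
move: n a d; apply: (rsum_seg_ind (P := fun n a d => cabs (rsum f n a d) <= B * cabs d)
  (Q := fun z => cabs (f z) <= B)).
  move=> a d /(_ 0); rewrite mul0r addr0 => /= fB; rewrite cabsM mulrC.
  by rewrite ler_wpM2r ?cabs_ge0 // fB // lexx ler01.
have c3 : cabs (3^-1 : C) = 3^-1.
  rewrite cabsV; congr (_^-1); have -> : (3 : C) = 3%:C%C by rewrite rmorph_nat.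
  by rewrite cabs_real ger0_norm.
move=> n a d /=; rewrite !cabsM c3 => h1 h2 h3.
apply: le_trans (cabsD _ _) _; apply: le_trans (lerD (cabsD _ _) (lexx _)) _.
have : B * (cabs d / 3) = B * cabs d / 3 by rewrite mulrA.
lra.
Qed.

Lemma rsum_Im_ge f (k : R) n a d :
  (forall t : R, 0 <= t <= 1 -> k <= complex.Im (d * f (a + t%:C%C * d))) ->
  k <= complex.Im (rsum f n a d).
Proof.
elim: n a d k => [|n IHn] a d k kf /=.
  by have := kf 0; rewrite mul0r addr0; apply; rewrite lexx ler01.
have sub j : (j < 3)%N -> k / 3 <= complex.Im (rsum f n (a + (d / 3) *+ j) (d / 3)).
  move=> j3; apply: IHn => t t01.
  have [u u01 ->] := third_segment a d t01 j3.
  have -> : d / 3 * f (a + u%:C%C * d) = (3^-1)%:C%C * (d * f (a + u%:C%C * d)).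
    by rewrite fmorphV rmorph_nat; ring.
  have := kf u u01; case: (d * _) => x y /=; lra.
have := sub 0%N isT; have := sub 1%N isT; have := sub 2%N isT.
rewrite mulr0n mulr1n mulr2n addr0 addrA.
case: (rsum f n a _) => x1 y1; case: (rsum f n (a + _) _) => x2 y2.
case: (rsum f n (a + _ + _) _) => x3 y3 /=; lra.
Qed.

Lemma complex_ext z w : complex.Re z = complex.Re w -> complex.Im z = complex.Im w -> z = w.
Proof. by case: z w => [x y] [x' y'] /= -> ->. Qed.

Lemma complex_grid (x y u : R) i j :
  (x +i* y)%C + u%:C%C *+ i + (I * u%:C%C) *+ j = ((x + u *+ i) +i* (y + u *+ j))%C.
Proof.
have E n : u%:C%C *+ n = (u *+ n)%:C%C :> C by rewrite -rmorphMn.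
by rewrite -mulrnAr !E; apply: complex_ext => /=; ring.
Qed.

Definition square a (s : R) z :=
  (complex.Re a <= complex.Re z <= complex.Re a + s) /\
  (complex.Im a <= complex.Im z <= complex.Im a + s).

Definition subsquare a (s : R) (i j : nat) : C :=
  a + (s / 3)%:C%C *+ i + (I * (s / 3)%:C%C) *+ j.

Lemma contourS f n a (s : R) : contour f n.+1 a s%:C%C =
  \sum_(i < 3) \sum_(j < 3) contour f n (subsquare a s i j) (s / 3)%:C%C.
Proof.
pose e := (s / 3)%:C%C : C.
have -> : s%:C%C = e + e + e by rewrite /e -!rmorphD; congr (_%:C%C); field.
have e3 : (e + e + e) / 3 = e by field.
have ie3 : (I * (e + e + e)) / 3 = I * e by field.
rewrite /contour /= e3 ie3 !big_ord_recr !big_ord0 /= /subsquare -/e.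
pose P i j : C := a + e *+ i + (I * e) *+ j.
have PE i j : a + e *+ i + (I * e) *+ j = P i j by [].
rewrite !PE.
have Pi i j : P i j + e = P i.+1 j by rewrite /P mulrS; ring.
have Pj i j : P i j + I * e = P i j.+1 by rewrite /P mulrS; ring.
have -> : a = P 0%N 0%N by rewrite /P !mulr0n !addr0.
have -> : P 0%N 0%N + I * (e + e + e) = P 0%N 3%N by rewrite -!Pj; ring.
have -> : P 0%N 0%N + (e + e + e) = P 3%N 0%N by rewrite -!Pi; ring.
by rewrite !Pi !Pj; ring.
Qed.

Lemma contour_bound f (B s : R) n a : 0 <= s -> (forall z, square a s z -> cabs (f z) <= B) ->
  cabs (contour f n a s%:C%C) <= 4 * B * s.
Proof.
move=> s0 fB.
have bnd b d : cabs d = s -> (forall t : R, 0 <= t <= 1 -> square a s (b + t%:C%C * d)) ->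
    cabs (rsum f n b d) <= B * s.
  by move=> ds bd; rewrite -ds; apply: rsum_bound => t /bd/fB.
have sE : cabs s%:C%C = s by rewrite cabs_real ger0_norm.
have isE : cabs (I * s%:C%C) = s by rewrite cabsM cabs_i mul1r.
have st (t : R) : 0 <= t <= 1 -> 0 <= t * s <= s.
  by move=> /andP[t0 t1]; rewrite mulr_ge0 //= ler_piMl.
have pts (t u : R) : 0 <= t <= s -> 0 <= u <= s -> square a s (a + t%:C%C + I * u%:C%C).
  by clear; case: a => x y; rewrite /square /= => ? ?; split; lra.
have s0s : 0 <= s <= s by rewrite lexx s0.
have s00 : 0 <= (0 : R) <= s by rewrite lexx s0.
have b1 : cabs (rsum f n a s%:C%C) <= B * s.
  apply: bnd => // t /st ts; have := pts _ _ ts s00.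
  by rewrite !rmorph0 !rmorphM mulr0 addr0.
have b2 : cabs (rsum f n (a + I * s%:C%C) s%:C%C) <= B * s.
  apply: bnd => // t /st ts; have := pts _ _ ts s0s.
  by rewrite !rmorphM addrAC.
have b3 : cabs (rsum f n (a + s%:C%C) (I * s%:C%C)) <= B * s.
  apply: bnd => // t /st ts; have := pts _ _ s0s ts.
  by rewrite !rmorphM mulrCA.
have b4 : cabs (rsum f n a (I * s%:C%C)) <= B * s.
  apply: bnd => // t /st ts; have := pts _ _ s00 ts.
  by rewrite !rmorphM rmorph0 addr0 mulrCA.
rewrite /contour.
apply: le_trans (cabsB _ _) _; apply: le_trans (lerD (cabsD _ _) (lexx _)) _.
apply: le_trans (lerD (lerD (cabsB _ _) (lexx _)) (lexx _)) _.
have : 4 * B * s = B * s + B * s + B * s + B * s by ring.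
lra.
Qed.

Definition cdiff f z := exists d : C, forall e : R, 0 < e ->
  exists2 r : R, 0 < r & forall w, cabs (w - z) <= r ->
    cabs (f w - f z - d * (w - z)) <= e * cabs (w - z).

Lemma square_dist a (s : R) z w : square a s z -> square a s w -> cabs (w - z) <= 2 * s.
Proof.
move=> az aw; apply: le_trans (cabs_le _) _.
have -> : 2 * s = s + s by ring.
move: az aw; rewrite /square; case: z w => [x y] [x' y'] /= [zx zy] [wx wy].
by apply: lerD; rewrite ler_norml; apply/andP; split; lra.
Qed.

(** The first order approximation of [f] at [z] is affine, so subtracting it leaves the contour sum
    unchanged. *)
Lemma goursat_local f z (e : R) : cdiff f z -> 0 < e ->
  exists2 r : R, 0 < r & forall a (s : R) n, 0 <= s -> s <= r -> square a s z ->
    cabs (contour f n a s%:C%C) <= e * s ^+ 2.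
Proof.
(* 8 is the product of the perimeter [4 s] and of the bound [2 s] on the distance of two points,
   divided by [s ^+ 2]. *)
move=> [d fd] e0; have [|r r0 fr] := fd (e / 8); first by rewrite divr_gt0.
exists (r / 2); first by rewrite divr_gt0.
move=> a s n s0 sr az.
have -> : contour f n a s%:C%C =
    contour (fun w => f w - (f z - d * z + d * w)) n a s%:C%C.
  by rewrite contourB contour_affine subr0.
have -> : e * s ^+ 2 = 4 * (e / 4 * s) * s by field.
apply: contour_bound => // w aw.
have wz := square_dist az aw.
have -> : f w - (f z - d * z + d * w) = f w - f z - d * (w - z) by ring.
apply: le_trans (fr _ _) _; first by lra.
have := cabs_ge0 (w - z); nra.
Qed.

(** If the bound failed for arbitrarily fine sums, it would fail on one of the nine subsquares, and
    so on down a nest of squares; at their common point it contradicts [goursat_local]. *)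
Lemma goursat f a (s : R) (e : R) : 0 <= s -> (forall z, square a s z -> cdiff f z) -> 0 < e ->
  exists N, forall n, (N <= n)%N -> cabs (contour f n a s%:C%C) <= e * s ^+ 2.
Proof.
move=> s0 fd e0; apply: contrapT => nogood.
pose good b (t : R) := exists N, forall n, (N <= n)%N ->
  cabs (contour f n b t%:C%C) <= e * t ^+ 2.
have step (b : C) (t : R) : 0 <= t -> ~ good b t -> exists p : 'I_3 * 'I_3,
    ~ good (subsquare b t p.1 p.2) (t / 3).
  move=> t0 nb; apply: contrapT => /forallNP all_good; apply: nb.
  have /choice[N NP] (p : 'I_3 * 'I_3) :
      exists N, forall n, (N <= n)%N -> cabs (contour f n (subsquare b t p.1 p.2)
        (t / 3)%:C%C) <= e * (t / 3) ^+ 2.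
    by have /contrapT := all_good p.
  (* The successor accounts for one level of subdivision: the sum of order n + 1 on a square
     consists of sums of order n on its subsquares. *)
  exists (\max_p N p).+1 => -[//|n]; rewrite ltnS => Nn; rewrite contourS.
  have bnd (i j : 'I_3) : cabs (contour f n (subsquare b t i j) (t / 3)%:C%C) <=
      e * (t / 3) ^+ 2.
    by apply: (NP (i, j)); apply: leq_trans Nn; apply: (leq_bigmax (i, j)).
  have cabs_sum3 (F : 'I_3 -> C) (B : R) : (forall i, cabs (F i) <= B) ->
      cabs (\sum_i F i) <= 3 * B.
    move=> FB; rewrite !big_ord_recr big_ord0 /= add0r.
    apply: le_trans (cabsD _ _) _; apply: le_trans (lerD (cabsD _ _) (lexx _)) _.
    have := FB (widen_ord (leqnSn 2) (widen_ord (leqnSn 1) ord_max)).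
    by have := FB (widen_ord (leqnSn 2) ord_max); have := FB ord_max; lra.
  have -> : e * t ^+ 2 = 3 * (3 * (e * (t / 3) ^+ 2)) by field.
  by apply: (cabs_sum3) => i; apply: (cabs_sum3) => j.
have /choice[nx nxP] (bt : C * R) : exists p : 'I_3 * 'I_3,
    0 <= bt.2 -> ~ good bt.1 bt.2 -> ~ good (subsquare bt.1 bt.2 p.1 p.2) (bt.2 / 3).
  case: (pselect (0 <= bt.2 /\ ~ good bt.1 bt.2)) => [[t0 nb]|nn].
    by have [p pP] := step bt.1 bt.2 t0 nb; exists p.
  by exists (ord0, ord0) => t0 nb; case: nn.
pose sq k := iter k (fun bt => (subsquare bt.1 bt.2 (nx bt).1 (nx bt).2, bt.2 / 3)) (a, s).
have sqS k : sq k.+1 = (subsquare (sq k).1 (sq k).2 (nx (sq k)).1 (nx (sq k)).2, (sq k).2 / 3).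
  by [].
have side k : (sq k).2 = s / 3 ^+ k.
  elim: k => [|k IHk]; first by rewrite expr0 divr1.
  by rewrite sqS /= IHk exprS; field; rewrite expf_neq0.
have side0 k : 0 <= (sq k).2 by rewrite side divr_ge0 // exprn_ge0.
have bad k : ~ good (sq k).1 (sq k).2.
  by elim: k => [//|k IHk]; rewrite sqS /=; apply: nxP.
have nest k m : square (sq k).1 (sq k).2 (sq (k + m)%N).1 /\
    complex.Re (sq (k + m)%N).1 + (sq (k + m)%N).2 <= complex.Re (sq k).1 + (sq k).2 /\
    complex.Im (sq (k + m)%N).1 + (sq (k + m)%N).2 <= complex.Im (sq k).1 + (sq k).2.
  elim: m => [|m [[IH1 IH2] [IH3 IH4]]].
    by rewrite addn0 /square; have := side0 k; split; [split|split]; lra.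
  have := side0 (k + m)%N; rewrite addnS sqS /=.
  move: IH1 IH2 IH3 IH4; case: (sq (k + m)%N) => -[x y] t /=; case: (nx _) => i j /=.
  rewrite /subsquare; set u := t / 3.
  rewrite complex_grid.
  have tu : t = 3 * u by rewrite /u; field.
  have i2 : (i%:R : R) <= 2 by rewrite (ler_nat R _ 2) -ltnS.
  have j2 : (j%:R : R) <= 2 by rewrite (ler_nat R _ 2) -ltnS.
  have i0 : 0 <= (i%:R : R) by [].
  have j0 : 0 <= (j%:R : R) by [].
  rewrite tu -[u *+ i]mulr_natl -[u *+ j]mulr_natl /square /= => h1 h2 h3 h4 u3.
  have u0 : 0 <= u by lra.
  have iu : 0 <= i%:R * u <= 2 * u by rewrite mulr_ge0 //= ler_wpM2r.
  have ju : 0 <= j%:R * u <= 2 * u by rewrite mulr_ge0 //= ler_wpM2r.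
  by split; [split|split]; lra.
(* [p] will be the real or the imaginary part; the supremum over the lower left corners lies within
   every square of the nest. *)
have limit (p : C -> R) : (forall k m, p (sq k).1 <= p (sq (k + m)%N).1 /\
     p (sq (k + m)%N).1 + (sq (k + m)%N).2 <= p (sq k).1 + (sq k).2) ->
    exists x, forall k, p (sq k).1 <= x <= p (sq k).1 + (sq k).2.
  move=> pm; pose X := range (fun k => p (sq k).1).
  have ub k : ubound X (p (sq k).1 + (sq k).2).
    move=> _ [m _ <-]; have [h1 h2] := pm m k; have [h3 h4] := pm k m.
    by have := side0 (k + m)%N; rewrite addnC in h1 h2 *; move: h1 h2 h3 h4; rewrite addnC; lra.
  have hX : has_sup X by split; [exists (p (sq 0%N).1), 0%N | exists (p (sq 0%N).1 + (sq 0%N).2); exact: ub].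
  exists (sup X) => k; apply/andP; split.
    by apply: ub_le_sup; [exact: (proj2 hX)|exists k].
  by apply: ge_sup; [exact: (proj1 hX)|exact: ub].
have [x xP] : exists x, forall k, complex.Re (sq k).1 <= x <= complex.Re (sq k).1 + (sq k).2.
  by apply: limit => k m; have [[/andP[h1 h1'] h2] [h3 h4]] := nest k m.
have [y yP] : exists y, forall k, complex.Im (sq k).1 <= y <= complex.Im (sq k).1 + (sq k).2.
  by apply: limit => k m; have [[h2 /andP[h1 h1']] [h3 h4]] := nest k m.
pose z := (x +i* y)%C : C.
have sqz k : square (sq k).1 (sq k).2 z by split; [exact: xP | exact: yP].
have [r r0 rP] := goursat_local (fd z (sqz 0%N)) e0.
have [k kr] : exists k, (sq k).2 <= r.
  have : (fun k => s / 3 ^+ k) @ \oo --> (0 : R).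
    rewrite -(mulr0 s); apply: cvgM; first exact: cvg_cst.
    rewrite (_ : (fun k => (3 ^+ k)^-1) = (fun k => (3^-1 : R) ^+ k)); last first.
      by apply/funext => k; rewrite exprVn.
    by apply: cvg_expr; rewrite ger0_norm ?invr_ge0 // invf_lt1 // ltr1n.
  move/cvgrPdist_le/(_ r r0) => [k _ /(_ k (leqnn k))] /=.
  by rewrite sub0r normrN -side ger0_norm //; exists k.
by apply: (bad k); exists 0%N => n _; apply: rP.
Qed.

End Goursat.

(** * The identity theorem for entire functions vanishing on the real line *)

Section IdentityTheorem.
Variable R : realType.
Local Notation C := R[i].
Local Notation I := ('i%C : C).
Implicit Types (f g h : C -> C) (a d z w : C).

Lemma derivable_cdiff (f : C^o -> C^o) z : derivable f z 1 -> cdiff f z.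
Proof.
move=> df; exists ('D_1 f z) => e e0.
have /cvgrPdist_le/(_ e%:C%C) := df; rewrite ltcR => /(_ e0).
rewrite near_withinE => /nbhs_ballP[d /= /gt0_complexP[r r0 ->] rP].
exists (r / 2); first by rewrite divr_gt0.
move=> w wr; have [->|wz] := eqVneq w z.
  by rewrite !subrr mulr0 subr0 cabs0 mulr0.
have wz0 : w - z != 0 by rewrite subr_eq0.
have := rP (w - z).
rewrite /ball /= sub0r normrN cabsE ltcR => /(_ _ wz0)-/(_ _)/wrap[].
  by apply: le_lt_trans wr _; lra.
rewrite cabsE lecR /= => wP.
have -> : f w - f z - 'D_1 f z * (w - z) =
   - (w - z) * ('D_1 f z - (w - z)^-1 *: (f ((w - z) *: (1 : C^o) + z) - f z)).
  have -> : (w - z) *: (1 : C^o) + z = w by rewrite /GRing.scale /= mulr1 subrK.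
  by rewrite /GRing.scale /=; field.
by rewrite cabsM cabsN mulrC ler_wpM2r ?cabs_ge0.
Qed.

Lemma cdiff_derivable (f : C^o -> C^o) z : cdiff f z -> derivable f z 1.
Proof.
move=> [d fd]; rewrite /derivable; apply/cvg_ex; exists d; apply/cvgrPdist_le => e' /gt0_complexP[e e0 ->].
have [r r0 rP] := fd e e0.
rewrite near_withinE; apply/nbhs_ballP; exists r%:C%C => [/=|w]; first by rewrite ltcR.
rewrite /ball /= sub0r normrN cabsE ltcR => wr w0.
have := rP (w + z); rewrite addrK => /(_ (ltW wr)) fw.
have -> : w *: (1 : C^o) + z = w + z by rewrite /GRing.scale /= mulr1.
have -> : d - w^-1 *: (f (w + z) - f z) = - w^-1 * (f (w + z) - f z - d * w).
  by rewrite /GRing.scale /=; field.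
rewrite cabsE lecR cabsM cabsN cabsV mulrC ler_pdivrMr ?cabs_gt0 //.
Qed.

Lemma derivable_affine (h : C^o -> C^o) z c w :
  derivable h (z + c * w) 1 -> derivable (fun w : C^o => h (z + c * w)) w 1.
Proof.
move=> /derivable_cdiff[d hd]; apply: cdiff_derivable; exists (d * c) => e e0.
pose k := cabs c + 1; have k0 : 0 < k by rewrite ltr_wpDl ?cabs_ge0.
have [r r0 rP] := hd (e / k) (divr_gt0 e0 k0).
exists (r / k); first exact: divr_gt0.
move=> u ur.
have E : z + c * u - (z + c * w) = c * (u - w) by ring.
have cu : cabs (c * (u - w)) <= k * cabs (u - w).
  by rewrite cabsM ler_wpM2r ?cabs_ge0 // /k lerDl.
have := rP (z + c * u); rewrite E -mulrA => /(_ _)/wrap[]; last first.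
  rewrite [d * (c * _)]mulrA => /le_trans; apply.
  by rewrite ler_pM2l // ler_pdivrMl.
by apply: le_trans cu _; rewrite mulrC -ler_pdivlMr.
Qed.

Lemma derivable_prod (f g : C^o -> C^o) z : derivable f z 1 -> derivable g z 1 ->
  derivable (fun w : C^o => f w * g w : C^o) z 1.
Proof. exact: derivableM. Qed.

(** The lower left corner of the square of side [2 r] centred at 0. *)
Definition center (r : R) : C := (- r -i* r)%C.

Lemma cabs_sum9 (F : nat -> nat -> C) (c e : R) :
  (forall i j, (i < 3)%N -> (j < 3)%N -> (i, j) != (1%N, 1%N) -> cabs (F i j) <= e) ->
  cabs (F 1%N 1%N) <= c ->
  cabs (\sum_(i < 3) \sum_(j < 3) F i j) <= c + 8 * e.
Proof.
move=> Fe F11; rewrite !big_ord_recr !big_ord0 /= !add0r.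
have t2 x y (u v : R) : cabs x <= u -> cabs y <= v -> cabs (x + y) <= u + v.
  by move=> xu yv; apply: le_trans (cabsD _ _) _; apply: lerD.
have -> : c + 8 * e = (e + e + e) + (e + c + e) + (e + e + e) by ring.
by apply: (t2); [apply: (t2)|]; apply: (t2); rewrite ?Fe //; apply: (t2); rewrite ?Fe.
Qed.

(** [f] may be singular at 0. At each of the [m] subdivisions the eight outer subsquares avoid 0 and
    fall under [goursat], so that up to [e] the contour shrinks to the central square. *)
Lemma goursat_center f m : (forall z, square (center 1) 2 z -> z != 0 -> cdiff f z) ->
  forall e : R, 0 < e -> exists N, forall n, (N <= n)%N ->
    cabs (contour f (n + m)%N (center 1) 2%:C%C) <=
    e + cabs (contour f n (center (3^-1 ^+ m)) (2 * 3^-1 ^+ m)%:C%C).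
Proof.
move=> fd; elim: m => [|m IHm] e e0.
  by exists 0%N => n _; rewrite addn0 expr0 mulr1 lerDr ltW.
have [N1 N1P] := IHm _ (divr_gt0 e0 (ltr0n R 2)).
pose r : R := 3^-1 ^+ m; have r0 : 0 < r by rewrite exprn_gt0 // invr_gt0.
have r1 : r <= 1 by rewrite exprn_ile1 ?invr_ge0 // invf_le1 // ler1n.
have centerE : subsquare (center r) (2 * r) 1 1 = center (r / 3).
  by rewrite /subsquare /center; apply: complex_ext => /=; field.
pose good (p : nat * nat) N := (p.1 < 3)%N -> (p.2 < 3)%N -> p != (1%N, 1%N) ->
  forall n, (N <= n)%N -> cabs (contour f n (subsquare (center r) (2 * r) p.1 p.2)
    (2 * r / 3)%:C%C) <= e / 16.
have small p : exists N, good p N.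
  case: p => i j; rewrite /good /=.
  case: (pselect [/\ (i < 3)%N, (j < 3)%N & (i, j) != (1%N, 1%N)]) => [[i3 j3 ij]|nij]; last first.
    by exists 0%N => i3 j3 ij; case: nij.
  have [|||N NP] := @goursat R f (subsquare (center r) (2 * r) i j) (2 * r / 3)
    (e / 16 / (2 * r / 3) ^+ 2); last first.
  - exists N => _ _ _ n /NP; rewrite divfK // expf_neq0 //.
    by rewrite gt_eqF // divr_gt0 // mulr_gt0.
  - by rewrite !divr_gt0 // exprn_gt0 // divr_gt0 // mulr_gt0.
  - move=> z; rewrite /subsquare /center.
    rewrite complex_grid.
    rewrite -(mulr_natl (2 * r / 3) i) -(mulr_natl (2 * r / 3) j) /square /=.
    have u0 : 0 < 2 * r / 3 by rewrite divr_gt0 ?mulr_gt0.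
    have ur : 2 * r = 3 * (2 * r / 3) by field.
    move: (2 * r / 3) u0 ur => u u0 ur [zx zy].
    have i2 : (i%:R : R) <= 2 by rewrite (ler_nat R _ 2) -ltnS.
    have j2 : (j%:R : R) <= 2 by rewrite (ler_nat R _ 2) -ltnS.
    have i0 : 0 <= (i%:R : R) by [].
    have j0 : 0 <= (j%:R : R) by [].
    have u0' := ltW u0.
    have iu : 0 <= i%:R * u <= 2 * u by rewrite mulr_ge0 //= ler_wpM2r.
    have ju : 0 <= j%:R * u <= 2 * u by rewrite mulr_ge0 //= ler_wpM2r.
    apply: fd; first by rewrite /square /=; split; lra.
    apply/eqP => z0; move: zx zy; rewrite {}z0 /= => zx zy.
    case: i j i3 j3 ij {i2 j2 i0 j0 iu ju} zx zy => [|[|[|i]]] [|[|[|j]]] //= _ _ _; lra.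
  - by rewrite divr_ge0 // mulr_ge0 // ltW.
have [N2 N2P] := choice small.
pose N3 := \max_(p : 'I_3 * 'I_3) N2 (p.1 : nat, p.2 : nat).
exists (maxn N1 N3) => n; rewrite geq_max => /andP[nN1 nN3].
rewrite addnS -addSn; apply: le_trans (N1P _ _) _; first exact: leqW.
rewrite contourS.
set c := cabs (contour f n _ _).
suff h : cabs (\sum_(i < 3) \sum_(j < 3) contour f n (subsquare (center r) (2 * r) i j)
    (2 * r / 3)%:C%C) <= c + 8 * (e / 16).
  by apply: le_trans (lerD (lexx _) h) _; lra.
rewrite /c {c}; apply: (cabs_sum9 (F := fun i j => contour f n
   (subsquare (center r) (2 * r) i j) (2 * r / 3)%:C%C)) => [i j i3 j3 ij|].
  apply: (N2P (i, j)) => //; apply: leq_trans nN3.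
  exact: (leq_bigmax (Ordinal i3, Ordinal j3)).
have -> : 2 * 3^-1 ^+ m / 3 = 2 * 3^-1 ^+ m.+1 :> R by rewrite exprSr mulrA.
by rewrite -/r centerE exprSr.
Qed.

(** A substitute for the value 2 pi i that holds at every stage. On each edge the imaginary part of
    d / z has constant sign and modulus 2 / |z|^2, at least 1 since |z|^2 is at most 2; each edge
    therefore contributes at least 1. *)
Lemma contour_inv_Im n : 4 <= complex.Im (contour (fun z : C => z^-1) n (center 1) 2%:C%C).
Proof.
have im (a d : C) (u v x y : R -> R) (s : R) :
    s * s = 1 ->
    (forall t, d = (u t +i* v t)%C /\ a + t%:C%C * d = (x t +i* y t)%C) ->
    (forall t, 0 <= t <= 1 -> x t ^+ 2 + y t ^+ 2 <= 2 /\ x t ^+ 2 + y t ^+ 2 > 0 /\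
       s * (v t * x t - u t * y t) = 2) ->
    1 <= s * complex.Im (rsum (fun z : C => z^-1) n a d).
  move=> ss E bnd.
  have -> : s * complex.Im (rsum (fun z : C => z^-1) n a d) =
     complex.Im (rsum (fun z : C => s%:C%C * z^-1) n a d).
    by rewrite rsumZ; case: (rsum _ _ _ _) => p q /=; rewrite mul0r addr0.
  apply: rsum_Im_ge => t /bnd[b1 [b2 b3]]; have [-> ->] := E t.
  move: b1 b2 b3; move: (u t) (v t) (x t) (y t) => u' v' x' y' b1 b2 b3.
  rewrite /= !mul0r !addr0 subr0.
  have -> : u' * (s * - (y' / (x' ^+ 2 + y' ^+ 2))) + v' * (s * (x' / (x' ^+ 2 + y' ^+ 2))) =
     s * (v' * x' - u' * y') / (x' ^+ 2 + y' ^+ 2) by field; rewrite gt_eqF.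
  by rewrite b3 ler_pdivlMr // mul1r.
have b1 := @im (center 1) 2%:C%C (fun=> 2) (fun=> 0) (fun t => -1 + 2 * t) (fun=> -1) 1 _ _ _.
have b2 := @im (center 1 + I * 2%:C%C) 2%:C%C (fun=> 2) (fun=> 0) (fun t => -1 + 2 * t) (fun=> 1) (-1) _ _ _.
have b3 := @im (center 1 + 2%:C%C) (I * 2%:C%C) (fun=> 0) (fun=> 2) (fun=> 1) (fun t => -1 + 2 * t) 1 _ _ _.
have b4 := @im (center 1) (I * 2%:C%C) (fun=> 0) (fun=> 2) (fun=> -1) (fun t => -1 + 2 * t) (-1) _ _ _.
have {}b1 := b1 ltac:(by rewrite mulr1)
  ltac:(by move=> t; split; apply: complex_ext => /=; ring)
  ltac:(by move=> t /andP[t0 t1]; split; [nra|split; [nra|ring]]).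
have {}b2 := b2 ltac:(by rewrite mulrNN mulr1)
  ltac:(by move=> t; split; apply: complex_ext => /=; ring)
  ltac:(by move=> t /andP[t0 t1]; split; [nra|split; [nra|ring]]).
have {}b3 := b3 ltac:(by rewrite mulr1)
  ltac:(by move=> t; split; apply: complex_ext => /=; ring)
  ltac:(by move=> t /andP[t0 t1]; split; [nra|split; [nra|ring]]).
have {}b4 := b4 ltac:(by rewrite mulrNN mulr1)
  ltac:(by move=> t; split; apply: complex_ext => /=; ring)
  ltac:(by move=> t /andP[t0 t1]; split; [nra|split; [nra|ring]]).
move: b1 b2 b3 b4; rewrite /contour.
case: (rsum _ _ (center 1) 2%:C%C) => x1 y1; case: (rsum _ _ (center 1 + I * _) _) => x2 y2.
case: (rsum _ _ (center 1 + _) _) => x3 y3; case: (rsum _ _ _ _) => x4 y4 /=; lra.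
Qed.

(* Otherwise k w = (H w - H 0) / w is holomorphic off 0 and bounded near 0, so
   its integral around the square vanishes; but there k w = - H 0 / w. *)
Lemma vanishing_boundary (H : C^o -> C^o) : (forall z, derivable H z 1) ->
  (forall x y : R, `|x| = 1 \/ `|y| = 1 -> H (x +i* y)%C = 0) -> H 0 = 0.
Proof.
move=> dH Hbd.
pose k := fun w : C => (H w - H 0) / w.
have kd z : square (center 1) 2 z -> z != 0 -> cdiff k z.
  move=> _ z0; apply: derivable_cdiff.
  apply: derivableM; first by apply: derivableB; [exact: dH|exact: derivable_cst].
  by apply: derivableV => //; exact: derivable_id.
have [d dP] := derivable_cdiff (dH 0); have [r r0 rP] := dP 1 ltr01.
pose B := cabs d + 1.
have kB w : cabs w <= r -> cabs (k w) <= B.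
  move=> wr; have [->|w0] := eqVneq w 0.
    by rewrite /k invr0 mulr0 cabs0 addr_ge0 ?cabs_ge0.
  have := rP w; rewrite !subr0 mul1r => /(_ wr) kw.
  rewrite /k cabsM cabsV ler_pdivrMr ?cabs_gt0 //.
  have -> : H w - H 0 = H w - H 0 - d * w + d * w by rewrite subrK.
  apply: le_trans (cabsD _ _) _; rewrite /B mulrDl mul1r addrC cabsM; lra.
have Iz n : contour k n (center 1) 2%:C%C = - H 0 * contour (fun z : C => z^-1) n (center 1) 2%:C%C.
  rewrite -contourZ /contour.
  have edge a e : (forall t : R, 0 <= t <= 1 -> H (a + t%:C%C * e) = 0) ->
      rsum k n a e = rsum (fun z : C => - H 0 * z^-1) n a e.
    by move=> H0; apply: eq_rsum => t t01; rewrite /k H0 // sub0r.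
  have oneN : `|-1| = 1 :> R by rewrite normrN normr1.
  congr (_ - _ + _ - _); apply: edge => t _; rewrite /center.
  - rewrite (_ : _ + _ = ((-1 + t * 2) +i* -1)%C); first by apply: Hbd; right.
    by apply: complex_ext => /=; ring.
  - rewrite (_ : _ + _ = ((-1 + t * 2) +i* 1)%C); first by apply: Hbd; right; rewrite normr1.
    by apply: complex_ext => /=; ring.
  - rewrite (_ : _ + _ = (1 +i* (-1 + t * 2))%C); first by apply: Hbd; left; rewrite normr1.
    by apply: complex_ext => /=; ring.
  - rewrite (_ : _ + _ = (-1 +i* (-1 + t * 2))%C); first by apply: Hbd; left.
    by apply: complex_ext => /=; ring.
suff small (e : R) : 0 < e -> cabs (H 0) <= e.
  apply/eqP; rewrite -cabs_eq0 eq_le cabs_ge0 andbT; apply/ler_addgt0Pr => e e0.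
  by rewrite add0r small.
move=> e0.
(* With half-side u at most [r / 2] the central square lies where [k] is bounded by [B], and its
   perimeter is 8 u. *)
have [m mP] : exists m, 3^-1 ^+ m <= Num.min (r / 2) (e / (8 * B)).
  have : (fun m => (3^-1 : R) ^+ m) @ \oo --> (0 : R).
    by apply: cvg_expr; rewrite ger0_norm ?invr_ge0 // invf_lt1 // ltr1n.
  have q0 : 0 < Num.min (r / 2) (e / (8 * B)).
    by rewrite lt_min !divr_gt0 // mulr_gt0 // ltr_wpDl ?cabs_ge0.
  move/cvgrPdist_le/(_ _ q0) => [m _ /(_ m (leqnn m))] /=.
  by rewrite sub0r normrN ger0_norm ?exprn_ge0 ?invr_ge0 //; exists m.
have [N /(_ N (leqnn N))] := goursat_center m kd e0.
rewrite Iz cabsM cabsN => bnd.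
set u : R := 3^-1 ^+ m in mP bnd.
have u0 : 0 <= u by rewrite exprn_ge0 // invr_ge0.
have B0 : 0 < B by rewrite ltr_wpDl ?cabs_ge0.
have ur : u <= r / 2 by apply: le_trans mP _; rewrite ge_min lexx.
have ue : u <= e / (8 * B) by apply: le_trans mP _; rewrite ge_min lexx orbT.
have c1 : cabs (contour k N (center u) (2 * u)%:C%C) <= 4 * B * (2 * u).
  apply: contour_bound; first by rewrite mulr_ge0.
  move=> z [zx zy]; apply: kB; apply: le_trans (cabs_le _) _; move: zx zy.
  case: z => x y /= zx zy; have -> : r = r / 2 + r / 2 by field.
  by apply: lerD; rewrite ler_norml; apply/andP; split; lra.
have c2 : 4 * B * (2 * u) <= e.
  by move: ue; rewrite ler_pdivlMr ?mulr_gt0 //; lra.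
have c3 : 4 <= cabs (contour (fun z : C => z^-1) (N + m) (center 1) 2%:C%C).
  apply: le_trans (contour_inv_Im _) _; apply: le_trans (ler_norm _) (cabs_Im _).
have := cabs_ge0 (H 0); nra.
Qed.

(* The product of the four rotates of h about z vanishes on the boundary of a
   square centred at z with one side on the real axis. *)
Lemma entire_real_zero (h : C^o -> C^o) : (forall z, derivable h z 1) ->
  (forall t : R, h t%:C%C = 0) -> forall z, h z = 0.
Proof.
move=> dh h0 z.
pose b := (complex.Im z)%:C%C : C.
pose H := fun w : C^o => (h (z + b * w) * h (z + (b * I) * w) * h (z + (- b) * w)
  * h (z + (- b * I) * w) : C^o).
have dH w : derivable H w 1.
  apply: derivable_prod; [apply: derivable_prod; [apply: derivable_prod|]|];
    by apply: derivable_affine; exact: dh.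
have : H 0 = 0.
  apply: vanishing_boundary => // x y xy; rewrite /H.
  have real c : complex.Im c = 0 -> h c = 0.
    by case: c => c1 c2 /= ->; exact: h0.
  have {xy} : [\/ y = -1, x = -1, y = 1 | x = 1].
    by case: xy => /eqP; rewrite eqr_norml ler01 andbT => /orP[] /eqP;
      [constructor 4|constructor 2|constructor 3|constructor 1].
  rewrite /b; case: z {b H dH} => p q /= [] ->.
  - by rewrite real ?mul0r //=; ring.
  - by rewrite (real (_ + _ * I * _)) ?mulr0 ?mul0r //=; ring.
  - by rewrite (real (_ + - _ * (_ +i* 1)%C)) ?mulr0 ?mul0r //=; ring.
  - by rewrite (real (_ + - _ * I * _)) ?mulr0 //=; ring.
rewrite /H !mulr0 !addr0 => /eqP; rewrite !mulf_eq0 -!orbA !orbb => /eqP //.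
Qed.

End IdentityTheorem.

(** * The complex exponential *)

Section ComplexExponential.
Variable R : realType.
Local Notation C := R[i].

Definition cexp (z : C) : C :=
  ((expR (complex.Re z))%:C * (cos (complex.Im z) +i* sin (complex.Im z)))%C.

Lemma cexpD z w : cexp (z + w) = cexp z * cexp w.
Proof.
case: z w => [x y] [x' y']; rewrite /cexp /= expRD cosD sinD.
by apply: complex_ext => /=; ring.
Qed.

Lemma cexp_real (t : R) : cexp t%:C%C = (expR t)%:C%C.
Proof. by rewrite /cexp /= cos0 sin0 mulr1. Qed.

Lemma cexp0 : cexp 0 = 1.
Proof. by rewrite (cexp_real 0) expR0. Qed.

Lemma cabs_cexp z : cabs (cexp z) = expR (complex.Re z).
Proof.
rewrite /cexp cabsM cabs_real ger0_norm ?expR_ge0 //.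
apply: (fmorph_inj (real_complex R)); rewrite rmorphM /= -cabsE normc_def /=.
by rewrite cos2Dsin2 sqrtr1 mulr1.
Qed.

Lemma conj_cexp z : (cexp z)^*%C = cexp z^*%C.
Proof.
case: z => x y; rewrite /cexp /= cosN sinN.
by apply: complex_ext => /=; ring.
Qed.

Lemma derive_estimate (f : R -> R) (d : R) : is_derive (0 : R) (1 : R) f d ->
  forall e : R, 0 < e -> exists2 r : R, 0 < r & forall x, `|x| <= r ->
    `|f x - f 0 - d * x| <= e * `|x|.
Proof.
move=> df e e0; have /cvgrPdist_le/(_ e e0) := @ex_derive _ _ _ _ _ _ _ df.
rewrite near_withinE => /nbhs_ballP[r /= r0 rP].
exists (r / 2); first by rewrite divr_gt0.
move=> x xr; have [->|x0] := eqVneq x 0; first by rewrite mulr0 !subrr normr0 mulr0.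
have := rP x; rewrite /ball /= sub0r normrN => /(_ _ x0)-/(_ _)/wrap[].
  by apply: le_lt_trans xr _; lra.
have -> : x *: 1 + 0 = x :> R by rewrite addr0 /GRing.scale /= mulr1.
rewrite -[lim _]/('D_1 f 0) (@derive_val _ _ _ _ _ _ _ df) => xP.
have -> : f x - f 0 - d * x = - x * (d - x^-1 *: (f x - f 0)).
  by rewrite /GRing.scale /=; field.
by rewrite normrM normrN mulrC ler_wpM2r.
Qed.

Lemma cexp_estimate (e : R) : 0 < e -> exists2 r : R, 0 < r & forall w, cabs w <= r ->
  cabs (cexp w - 1 - w) <= e * cabs w.
Proof.
move=> e0.
(* The real and imaginary parts of the remainder consist of nine terms in all, each at most
   [e1 * cabs w]; 20 leaves a margin. *)
pose e1 := Num.min 1 (e / 20); have e10 : 0 < e1 by rewrite lt_min ltr01 divr_gt0.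
have [r1 r10 r1P] := derive_estimate (is_derive_expR (0 : R)) e10.
have [r2 r20 r2P] := derive_estimate (is_derive_cos (0 : R)) e10.
have [r3 r30 r3P] := derive_estimate (is_derive_sin (0 : R)) e10.
exists (Num.min (Num.min r1 r2) (Num.min r3 e1)); first by rewrite !lt_min r10 r20 r30 ltr01 divr_gt0.
move=> w; rewrite !le_min => /andP[/andP[w1 w2] /andP[w3 w4]].
have xw := cabs_Re w; have yw := cabs_Im w.
have := r1P _ (le_trans xw w1); have := r2P _ (le_trans yw w2); have := r3P _ (le_trans yw w3).
rewrite sin0 cos0 expR0 oppr0 mul0r subr0 !mul1r.
set a := expR _ - 1 - _; set b := cos _ - 1; set c' := sin _ + 0 - _ => cP bP aP.
have {}w4 : cabs w <= e1 by rewrite le_min.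
set W := cabs w in xw yw w1 w2 w3 w4 *.
have W0 : 0 <= W by exact: cabs_ge0.
have e1l : e1 <= 1 by rewrite ge_min lexx.
have e1e : e1 <= e / 20 by rewrite ge_min lexx orbT.
have {}aP : `|a| <= e1 * W by apply: le_trans aP _; rewrite ler_pM2l.
have {}bP : `|b| <= e1 * W by apply: le_trans bP _; rewrite ler_pM2l.
have {}cP : `|c'| <= e1 * W by apply: le_trans cP _; rewrite ler_pM2l.
have W1 : W <= 1 by apply: le_trans e1l.
have nm (p q P Q : R) : `|p| <= P -> `|q| <= Q -> `|p * q| <= P * Q.
  by move=> pP qQ; rewrite normrM ler_pM.
have na (p q P Q : R) : `|p| <= P -> `|q| <= Q -> `|p + q| <= P + Q.
  by move=> pP qQ; apply: le_trans (ler_normD _ _) _; exact: lerD.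
have e1W : e1 * W <= 1 by rewrite mulr_ile1 // ltW.
have E1 : complex.Re (cexp w - 1 - w) = b + complex.Re w * b + a + a * b.
  by rewrite /a /b /cexp; case: w {W W0 xw yw w1 w2 w3 w4 aP bP cP W1 e1W a b c'} => x y /=; ring.
have E2 : complex.Im (cexp w - 1 - w) =
   c' + complex.Re w * complex.Im w + complex.Re w * c' + a * complex.Im w + a * c'.
  by rewrite /a /c' /cexp; case: w {W W0 xw yw w1 w2 w3 w4 aP bP cP W1 e1W a b c' E1} => x y /=; ring.
apply: le_trans (cabs_le _) _; rewrite E1 E2.
have x1 := le_trans xw W1; have y1 := le_trans yw W1.
have a1 := le_trans aP e1W.
have n1 := nm _ _ _ _ x1 bP; have n2 := nm _ _ _ _ a1 bP.
have n3 := nm _ _ _ _ (le_trans xw w4) yw; have n4 := nm _ _ _ _ x1 cP.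
have n5 := nm _ _ _ _ a1 cP; have n6 := nm _ _ _ _ aP y1.
have := na _ _ _ _ (na _ _ _ _ (na _ _ _ _ bP n1) aP) n2.
have := na _ _ _ _ (na _ _ _ _ (na _ _ _ _ (na _ _ _ _ cP n3) n4) n6) n5.
have : e1 * W <= e * W / 20 by rewrite mulrAC ler_wpM2r.
have : 0 <= e * W by rewrite mulr_ge0 // ltW.
rewrite !mul1r !mulr1; lra.
Qed.

(** The functional equation moves differentiability from 0 to any point. *)
Lemma derivable_cexp (c : C) z : derivable (fun z : C^o => cexp (c * z) : C^o) z 1.
Proof.
have cdiff0 : cdiff cexp 0.
  exists 1 => e /cexp_estimate[r r0 rP]; exists r => // w; rewrite subr0 => /rP.
  by rewrite cexp0 mul1r.
have dz w : derivable (cexp : C^o -> C^o) w 1.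
    apply: cdiff_derivable; have [d dP] := cdiff0; exists (cexp w * d) => e e0.
    have [|r r0 rP] := dP (e / (cabs (cexp w))).
      by rewrite divr_gt0 // cabs_cexp expR_gt0.
    exists r => // u ur; have := rP (u - w); rewrite subr0 => /(_ ur).
    rewrite cexp0 => h.
    have -> : cexp u - cexp w - cexp w * d * (u - w) =
        cexp w * (cexp (u - w) - 1 - d * (u - w)).
      have {1}-> : u = w + (u - w) by ring.
      by rewrite (cexpD w (u - w)); ring.
    have E0 : 0 < cabs (cexp w) by rewrite cabs_cexp expR_gt0.
    rewrite cabsM; apply: le_trans (ler_wpM2l (ltW E0) h) _.
    have -> // : cabs (cexp w) * (e / cabs (cexp w) * cabs (u - w)) = e * cabs (u - w).
    by field; rewrite gt_eqF.
have := @derivable_affine R cexp 0 c z (dz _).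
by under eq_fun do rewrite add0r.
Qed.

End ComplexExponential.

(** * The Hilbert space l2 and the trace of diagonal operators *)

Section ComplexSeries.
Variable R : realType.
Local Notation C := R[i].
Implicit Types (u v : nat -> C) (s t : C).

Lemma small_cabs_eq0 s (k : R) : (forall e : R, 0 < e -> cabs s <= k * e) -> s = 0.
Proof.
move=> se; apply/eqP; rewrite -cabs_eq0 eq_le cabs_ge0 andbT; apply/ler_addgt0Pr => e e0.
rewrite add0r; pose k1 := `|k| + 1; have k10 : 0 < k1 by rewrite ltr_wpDl.
have := se (e / k1) (divr_gt0 e0 k10) => /le_trans; apply.
apply: (@le_trans _ _ (k1 * (e / k1))); last by rewrite mulrC divfK // gt_eqF.
have kk1 : k <= k1 by rewrite /k1 (le_trans (ler_norm k)) // lerDl.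
by rewrite ler_wpM2r // divr_ge0 // ltW.
Qed.

(** The rate in the conclusion is the same for all such sequences. Completeness of l2 relies on it,
    as limits are taken there coordinate by coordinate. *)
Lemma complex_seq_complete u : (forall k m, (k <= m)%N -> cabs (u k - u m) <= k.+1%:R^-1) ->
  exists s, forall k, cabs (u k - s) <= 2 * k.+1%:R^-1.
Proof.
move=> uc; pose e k : R := k.+1%:R^-1.
have e0 k : 0 < e k by rewrite invr_gt0.
have uck k m : cabs (u k - u m) <= e k + e m.
  have := e0 k; have := e0 m.
  case/orP: (leq_total k m) => /uc; rewrite -/(e _); last rewrite cabsBC; lra.
have real (v : nat -> R) : (forall k m, `|v k - v m| <= e k + e m) ->
    exists x, forall k, `|v k - x| <= e k.
  move=> vc; pose X := range (fun k => v k - e k).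
  have ub k : ubound X (v k + e k).
    by move=> _ [m _ <-]; have := vc k m; rewrite ler_norml => /andP[]; lra.
  have hX : has_sup X by split; [exists (v 0%N - e 0%N), 0%N | exists (v 0%N + e 0%N); exact: ub].
  exists (sup X) => k; rewrite ler_norml; apply/andP; split.
    have : sup X <= v k + e k by apply: ge_sup; [exact: (proj1 hX)|exact: ub].
    lra.
  have : v k - e k <= sup X by apply: ub_le_sup; [exact: (proj2 hX)|exists k].
  lra.
have [|x xP] := real (fun k => complex.Re (u k)).
  by move=> k m; apply: le_trans (uck k m); have := cabs_Re (u k - u m); case: (u k) (u m) => ? ? [].
have [|y yP] := real (fun k => complex.Im (u k)).
  by move=> k m; apply: le_trans (uck k m); have := cabs_Im (u k - u m); case: (u k) (u m) => ? ? [].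
exists (x +i* y)%C => k; apply: le_trans (cabs_le _) _.
have := xP k; have := yP k; case: (u k) => p q /=; rewrite -/(e k); lra.
Qed.

Definition has_csum u s := forall e : R, 0 < e -> exists N, forall n, (N <= n)%N ->
  cabs (\sum_(i < n) u i - s) <= e.

Lemma has_csum_unique u s t : has_csum u s -> has_csum u t -> s = t.
Proof.
move=> us ut; apply/eqP; rewrite -subr_eq0; apply/eqP; apply: (@small_cabs_eq0 _ 2) => e e0.
have [N NP] := us e e0; have [M MP] := ut e e0.
have h1 := NP _ (leq_maxl N M); have h2 := MP _ (leq_maxr N M).
have -> : s - t = (\sum_(i < maxn N M) u i - t) - (\sum_(i < maxn N M) u i - s) by ring.
by apply: le_trans (cabsB _ _) _; lra.
Qed.

Lemma eq_has_csum u v s : u =1 v -> has_csum u s -> has_csum v s.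
Proof. by move=> uv; rewrite (_ : v = u) //; apply/funext => n; rewrite uv. Qed.

Lemma has_csumD u v s t : has_csum u s -> has_csum v t -> has_csum (fun n => u n + v n) (s + t).
Proof.
move=> us vt e e0; have [N NP] := us (e / 2) (divr_gt0 e0 (ltr0n R 2)).
have [M MP] := vt (e / 2) (divr_gt0 e0 (ltr0n R 2)).
exists (maxn N M) => n; rewrite geq_max => /andP[/NP h1 /MP h2].
rewrite big_split /= opprD addrACA.
by apply: le_trans (cabsD _ _) _; lra.
Qed.

Lemma has_csumZ c u s : has_csum u s -> has_csum (fun n => c * u n) (c * s).
Proof.
move=> us e e0; pose k := cabs c + 1; have k0 : 0 < k by rewrite ltr_wpDl ?cabs_ge0.
have [N NP] := us (e / k) (divr_gt0 e0 k0); exists N => n /NP h.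
rewrite -mulr_sumr -mulrBr cabsM; apply: (@le_trans _ _ (k * (e / k))).
  by apply: ler_pM; rewrite ?cabs_ge0 // /k lerDl.
by rewrite mulrC divfK // gt_eqF.
Qed.

Lemma has_csum_conj u s : has_csum u s -> has_csum (fun n => (u n)^*%C) s^*%C.
Proof.
move=> us e /us[N NP]; exists N => n /NP.
by rewrite -rmorph_sum -rmorphB /= /cabs normcJ.
Qed.

Lemma has_csum_bound u s (B : R) : has_csum u s -> (forall n, cabs (\sum_(i < n) u i) <= B) ->
  cabs s <= B.
Proof.
move=> us uB; apply/ler_addgt0Pr => e /us[N /(_ N (leqnn N)) h].
have -> : s = \sum_(i < N) u i - (\sum_(i < N) u i - s) by ring.
by apply: le_trans (cabsB _ _) _; have := uB N; lra.
Qed.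

Lemma has_csum_finite u N : (forall n, (N <= n)%N -> u n = 0) -> has_csum u (\sum_(i < N) u i).
Proof.
move=> u0 e e0; exists N => n Nn; rewrite -(subnKC Nn) big_split_ord /=.
rewrite [X in _ + X - _]big1 ?addr0 ?subrr ?cabs0 ?ltW // => i _.
by rewrite u0 // leq_addr.
Qed.

Lemma cabs_sum (I : Type) (r : seq I) (P : pred I) (F : I -> C) :
  cabs (\sum_(i <- r | P i) F i) <= \sum_(i <- r | P i) cabs (F i).
Proof.
elim/big_rec2 : _ => [|i x y _ xy]; first by rewrite cabs0.
by apply: le_trans (cabsD _ _) _; rewrite lerD2l.
Qed.

Lemma ler_sum_ord (w : nat -> R) m n : (forall i, 0 <= w i) -> (m <= n)%N ->
  \sum_(i < m) w i <= \sum_(i < n) w i.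
Proof.
move=> w0 mn; rewrite -(subnKC mn) big_split_ord /= lerDl; exact: sumr_ge0.
Qed.

Lemma bounded_series_tail (w : nat -> R) (B e : R) : (forall i, 0 <= w i) ->
  (forall n, \sum_(i < n) w i <= B) -> 0 < e ->
  exists N, forall m n, (N <= m)%N -> (m <= n)%N ->
    \sum_(i < n) w i - \sum_(i < m) w i <= e.
Proof.
move=> w0 wB e0; pose X := range (fun n => \sum_(i < n) w i).
have hX : has_sup X by split; [exists (\sum_(i < 0) w i), 0%N | exists B => _ [n _ <-]].
have [_ [N _ <-] NP] := sup_adherent e0 hX.
exists N => m n Nm mn.
have h1 : \sum_(i < n) w i <= sup X by apply: ub_le_sup; [exact: (proj2 hX)|exists n].
have h2 := ler_sum_ord w0 Nm; lra.
Qed.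

Lemma has_csum_abs u (B : R) : (forall n, \sum_(i < n) cabs (u i) <= B) -> exists s, has_csum u s.
Proof.
move=> uB; have u0 i : 0 <= cabs (u i) by exact: cabs_ge0.
have [N NP] := choice (fun k => bounded_series_tail u0 uB
  (ltac:(by rewrite invr_gt0) : 0 < (k.+1%:R : R)^-1)).
(* Adding up the chosen ranks makes them monotone in [k]. *)
pose M k := (\sum_(j < k.+1) N j)%N.
have MN k : (N k <= M k)%N by rewrite /M big_ord_recr /= leq_addl.
have Mm k m : (k <= m)%N -> (M k <= M m)%N.
  by move=> km; rewrite /M -(subnKC (km : (k.+1 <= m.+1)%N)) big_split_ord /= leq_addr.
have diff m n : (m <= n)%N -> cabs (\sum_(i < n) u i - \sum_(i < m) u i) <=
    \sum_(i < n) cabs (u i) - \sum_(i < m) cabs (u i).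
  move=> mn; rewrite -(subnKC mn) !big_split_ord /= !(addrC (\sum_(i < m) _)) !addrK.
  exact: cabs_sum.
have [|s sP] := @complex_seq_complete (fun k => \sum_(i < M k) u i).
  move=> k m km; rewrite cabsBC; apply: le_trans (diff _ _ (Mm _ _ km)) _.
  by apply: NP; [exact: MN|exact: Mm].
exists s => e e0.
have [k kP] : exists k, 3 * (k.+1%:R : R)^-1 <= e.
  exists (Num.truncn (3 / e)).
  rewrite ler_pdivrMr // mulrC -ler_pdivrMr //.
  by apply: ltW; apply: truncnS_gt.
exists (M k) => n Mkn.
have -> : \sum_(i < n) u i - s = (\sum_(i < n) u i - \sum_(i < M k) u i) + (\sum_(i < M k) u i - s).
  by ring.
apply: le_trans (cabsD _ _) _.
have := le_trans (diff _ _ Mkn) (NP k _ _ (MN k) Mkn).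
by move: (sP k) kP; set v := _^-1; lra.
Qed.

Lemma eventually_small (e : R) : 0 < e -> exists k, (k.+1%:R : R)^-1 <= e.
Proof.
move=> e0; exists (Num.truncn e^-1).
rewrite -[leRHS]invrK lef_pV2 ?posrE ?invr_gt0 //.
by apply: ltW; apply: truncnS_gt.
Qed.

End ComplexSeries.

Section SeqComplete.
Variables (R : realType) (V : normedModType R[i]).

(** Reduces Cauchy filters to sequences with a prescribed rate: the k-th point is chosen in the
    intersection of the first k + 1 small balls that belong to the filter. *)
Lemma seq_complete_cvg :
  (forall u : nat -> V, (forall k m, (k <= m)%N -> `|u k - u m| <= (k.+1%:R^-1 : R)%:C%C) ->
    exists l, forall e : R, 0 < e -> exists N, forall n, (N <= n)%N -> `|u n - l| <= e%:C%C) ->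
  forall F : set_system V, ProperFilter F -> cauchy F -> cvg F.
Proof.
move=> sc F FF /cauchy_ballP Fc.
pose e k : R := k.+1%:R^-1 / 2.
have e0 k : 0 < (e k)%:C%C by rewrite ltcR divr_gt0 // invr_gt0.
have /choice[c cP] k : exists c, F (ball (c : V) (e k)%:C%C).
  by have /cauchy_ballP /cauchyP /(_ _ (e0 k))[c cF] := Fc; exists c.
pose B k := \bigcap_(j in [set j | (j < k.+1)%N]) ball (c j) (e j)%:C%C.
have FB k : F (B k).
  elim: k => [|k IHk].
    by apply: filterS (cP 0%N) => x xB j /=; rewrite ltnS leqn0 => /eqP ->.
  apply: filterS (filterI IHk (cP k.+1)) => x [xB xk] j /=.
  by rewrite ltnS leq_eqVlt => /orP[/eqP -> //|jk]; exact: xB.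
have [u uP] := choice (fun k => filter_ex (FB k)).
have [|l lP] := sc u.
  move=> k m km; have h1 := uP k k (leqnn _); have h2 := uP m k km.
  rewrite ltW //; have := ball_triangle (ball_sym h1) h2.
  by rewrite -ball_normE /ball_ /= -rmorphD -splitr.
apply/cvg_ex; exists l; apply/cvgrPdist_le => e' /gt0_complexP[d d0 ->].
have [N NP] := lP (d / 2) (divr_gt0 d0 (ltr0n R 2)).
have [k kP] := eventually_small (divr_gt0 d0 (ltr0n R 2)).
pose n := maxn N k.
have : F (ball (c n) (e n)%:C%C) by exact: cP.
apply: filterS => x; rewrite -ball_normE /ball_ /= => cx.
have := uP n n (leqnn _); rewrite -ball_normE /ball_ /= => cu.
have ul := NP n (leq_maxl _ _).
rewrite distrC -(subrKA (u n)).
apply: le_trans (ler_normD _ _) _.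
have -> : d%:C%C = (d / 2)%:C%C + (d / 2)%:C%C by rewrite -rmorphD -splitr.
apply: lerD => //; rewrite -(subrKA (c n)).
apply: le_trans (ler_normD _ _) _; rewrite (distrC x).
apply: (@le_trans _ _ ((e n)%:C%C + (e n)%:C%C)); first by rewrite lerD // ltW.
rewrite -rmorphD -splitr lecR; apply: le_trans kP.
by rewrite lef_pV2 ?posrE // ler_nat ltnS leq_maxr.
Qed.

End SeqComplete.

(** The discriminant argument behind Cauchy-Schwarz, shared by the inner product of l2 and by the
    positive functional [mu]; it is enough to let z run through real multiples of the conjugate of
    [b]. *)
Lemma discriminant_bound (R : realType) (a c : R) (b : R[i]) : 0 <= c ->
  (forall z : R[i], 0 <= a + 2 * complex.Re (z * b) + cabs z ^+ 2 * c) ->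
  cabs b ^+ 2 <= a * c.
Proof.
move=> c0' abc.
have a0 : 0 <= a by have := abc 0; rewrite mul0r cabs0 /= mulr0 expr0n mul0r !addr0.
have bb : complex.Re (b^*%C * b) = cabs b ^+ 2.
  rewrite mulrC -sqr_normc cabsE expr2 -rmorphM /= -expr2 //.
have bt (t : R) : 0 <= a - 2 * t * cabs b ^+ 2 + t ^+ 2 * cabs b ^+ 2 * c.
  have := abc (- t%:C%C * b^*%C); rewrite cabsM cabsN cabs_real /cabs normcJ -/(cabs b).
  rewrite -mulrA exprMn real_normK ?num_real //.
  rewrite (_ : - t%:C%C * b^*%C * b = (- t)%:C%C * (b^*%C * b)); last by rewrite rmorphN mulrA.
  rewrite -bb; case: (b^*%C * b) => p q /=; lra.
have B0 : 0 <= cabs b ^+ 2 by exact: sqr_ge0.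
set B := cabs b ^+ 2 in bt B0 *.
have [c0|c0] := ltP 0 c.
  have := bt c^-1.
  have -> : a - 2 * c^-1 * B + c^-1 ^+ 2 * B * c = a - B / c by field; rewrite gt_eqF.
  by rewrite subr_ge0 ler_pdivrMr.
(* Here c = 0: the expression is affine in t, and a nonzero [b] would make it negative for large
   t. *)
have [->|Bn0] := eqVneq B 0; last first.
  have Bp : 0 < B by rewrite lt_neqAle eq_sym Bn0.
  have := bt ((a + 1) / B).
  have : 0 <= ((a + 1) / B) ^+ 2 * B * - c by rewrite mulr_ge0 ?oppr_ge0 // mulr_ge0 // sqr_ge0.
  have -> : 2 * ((a + 1) / B) * B = 2 * (a + 1) by field.
  lra.
exact: mulr_ge0.
Qed.

(** * The Hilbert space of square-summable sequences *)

Section L2.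
Variable R : realType.
Local Notation C := R[i].

Definition l2_pred (x : nat -> C^o) : bool :=
  `[< exists M : R, forall n, \sum_(i < n) cabs (x i) ^+ 2 <= M >].

Record l2 := MkL2 { l2_fun :> nat -> C^o; l2P : l2_pred l2_fun }.

HB.instance Definition _ := [isSub for l2_fun].
HB.instance Definition _ := [Choice of l2 by <:].

Lemma l2_ext (x y : l2) : (forall n, x n = y n) -> x = y.
Proof. by move=> xy; apply/val_inj/funext. Qed.

Lemma cabs_sqrD (z w : C) : cabs (z + w) ^+ 2 <= 2 * cabs z ^+ 2 + 2 * cabs w ^+ 2.
Proof.
have h := cabsD z w; have h0 := cabs_ge0 (z + w).
apply: (@le_trans _ _ ((cabs z + cabs w) ^+ 2)); first by rewrite lerXn2r ?nnegrE ?addr_ge0 ?cabs_ge0.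
have := sqr_ge0 (cabs z - cabs w); nra.
Qed.

Lemma l2_submod_closed : submod_closed l2_pred.
Proof.
split=> [|c x y /asboolP[M MP] /asboolP[N NP]]; apply/asboolP.
  by exists 0 => n; rewrite big1 // => i _; rewrite /= cabs0 expr0n.
exists (2 * (cabs c ^+ 2 * M) + 2 * N) => n.
apply: (@le_trans _ _ (\sum_(i < n) (2 * (cabs c ^+ 2 * cabs (x i) ^+ 2) + 2 * cabs (y i) ^+ 2))).
  by apply: ler_sum => i _; apply: le_trans (cabs_sqrD _ _) _; rewrite cabsM exprMn.
rewrite big_split /= -!mulr_sumr; apply: lerD; rewrite ler_pM2l //.
  by rewrite ler_wpM2l ?sqr_ge0 ?MP.
exact: NP.
Qed.

HB.instance Definition _ := GRing.isSubmodClosed.Build C (nat -> C^o) l2_pred l2_submod_closed.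
HB.instance Definition _ := [SubChoice_isSubLmodule of l2 by <:].

Lemma l2_sum_sqr (x : l2) : exists M : R, forall n, \sum_(i < n) cabs (x i) ^+ 2 <= M.
Proof. exact/asboolP/(l2P x). Qed.

Lemma l2D (x y : l2) n : (x + y) n = x n + y n. Proof. by []. Qed.
Lemma l2Z c (x : l2) n : (c *: x) n = c * x n. Proof. by []. Qed.
Lemma l2B (x y : l2) n : (x - y) n = x n - y n. Proof. by []. Qed.
Lemma l20 n : (0 : l2) n = 0. Proof. by []. Qed.

Lemma l2_dot_exists (x y : l2) : exists s, has_csum (fun n => x n * (y n)^*%C) s.
Proof.
have [M MP] := l2_sum_sqr x; have [N NP] := l2_sum_sqr y.
apply: (@has_csum_abs _ _ (M + N)) => n.
apply: le_trans (lerD (MP n) (NP n)); rewrite -big_split /=; apply: ler_sum => i _.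
rewrite cabsM {2}/cabs normcJ -/(cabs _).
have := sqr_ge0 (cabs (x i) - cabs (y i)); have := sqr_ge0 (cabs (x i)).
have := sqr_ge0 (cabs (y i)); nra.
Qed.

Definition l2_dot (x y : l2) : C := xget 0 [set s | has_csum (fun n => x n * (y n)^*%C) s].

Lemma l2_dotP (x y : l2) : has_csum (fun n => x n * (y n)^*%C) (l2_dot x y).
Proof. by rewrite /l2_dot; have [s sP] := l2_dot_exists x y; case: xgetP => [//|/(_ s)]. Qed.

Lemma l2_dot_eq (x y : l2) s : has_csum (fun n => x n * (y n)^*%C) s -> l2_dot x y = s.
Proof. exact/has_csum_unique/l2_dotP. Qed.

Lemma l2_dotC x y : l2_dot x y = (l2_dot y x)^*%C.
Proof.
apply: l2_dot_eq; apply: eq_has_csum (has_csum_conj (l2_dotP y x)) => n.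
by rewrite rmorphM /= conjcK mulrC.
Qed.

Lemma l2_dot_linearl c x y z : l2_dot (c *: x + y) z = c * l2_dot x z + l2_dot y z.
Proof.
apply: l2_dot_eq; apply: eq_has_csum (has_csumD (has_csumZ c (l2_dotP x z)) (l2_dotP y z)) => n.
by rewrite l2D l2Z mulrDl mulrA.
Qed.

Lemma conjcE (z : C) : Num.conj z = z^*%C.
Proof. by []. Qed.

Lemma l2_bilinear : bilinear_for *%R (Num.conj \; *%R) l2_dot.
Proof.
split=> [y c x z|x c y z] /=; first exact: l2_dot_linearl.
rewrite l2_dotC l2_dot_linearl rmorphD rmorphM /= -!l2_dotC //.
Qed.

HB.instance Definition _ := bilinear_isBilinear.Build C l2 l2 C *%R (Num.conj \; *%R) l2_dot
  l2_bilinear.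

Lemma l2_hermitian x y : l2_dot x y = (-1) ^+ false * Num.conj (l2_dot y x).
Proof. by rewrite mul1r; exact: l2_dotC. Qed.

HB.instance Definition _ := isHermitianSesquilinear.Build C l2 false Num.conj l2_dot l2_hermitian.

Lemma l2_dot_ge (x : l2) n : exists2 r : R, l2_dot x x = r%:C%C & \sum_(i < n) cabs (x i) ^+ 2 <= r.
Proof.
have xx i : x i * (x i)^*%C = (cabs (x i) ^+ 2)%:C%C.
  by rewrite -sqr_normc cabsE rmorphXn.
have h := eq_has_csum xx (l2_dotP x x).
have im : complex.Im (l2_dot x x) = 0.
  have := l2_dotC x x; case: (l2_dot x x) => p q /= [] /eqP.
  by rewrite -subr_eq0 opprK -mulr2n mulrn_eq0 => /eqP.
exists (complex.Re (l2_dot x x)); first by rewrite [LHS]complexE im rmorph0 mulr0 addr0.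
apply/ler_addgt0Pr => e e0; have [N /(_ (maxn N n) (leq_maxl _ _))] := h e e0.
rewrite -rmorph_sum /= => hN.
have := le_trans (cabs_Re _) hN; rewrite ler_norml raddfB /= => /andP[_].
have := @ler_sum_ord _ (fun i => cabs (x i) ^+ 2) n (maxn N n) (fun i => sqr_ge0 _) (leq_maxr _ _).
case: (l2_dot x x) => p q /=; lra.
Qed.

Lemma l2_dot_gt0 x : x != 0 -> 0 < l2_dot x x.
Proof.
move=> x0; have [n xn] : exists n, x n != 0.
  apply: contrapT => /forallNP nx; move/eqP: x0; apply; apply: l2_ext => n.
  by have /negP := nx n; rewrite negbK => /eqP.
have [r -> rP] := l2_dot_ge x n.+1; rewrite ltcR; apply: lt_le_trans rP.
rewrite big_ord_recr /= ltr_wpDl ?exprn_gt0 ?cabs_gt0 //.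
by apply: sumr_ge0 => i _; exact: sqr_ge0.
Qed.

HB.instance Definition _ := isDotProduct.Build C l2 l2_dot l2_dot_gt0.

Definition l2_norm (x : l2) : R := Num.sqrt (complex.Re (l2_dot x x)).

Lemma l2_norm_ge0 x : 0 <= l2_norm x. Proof. exact: sqrtr_ge0. Qed.

Lemma l2_norm_sqr x : (l2_norm x ^+ 2)%:C%C = l2_dot x x.
Proof.
have [r rE rP] := l2_dot_ge x 0; rewrite /l2_norm rE /= sqr_sqrtr //.
by move: rP; rewrite big_ord0.
Qed.

Lemma l2_norm_sum (x : l2) n : \sum_(i < n) cabs (x i) ^+ 2 <= l2_norm x ^+ 2.
Proof.
have [r rE rP] := l2_dot_ge x n.
by rewrite -lecR l2_norm_sqr rE lecR.
Qed.

Lemma l2_norm_le (x : l2) (B : R) : 0 <= B -> (forall n, \sum_(i < n) cabs (x i) ^+ 2 <= B ^+ 2) ->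
  l2_norm x <= B.
Proof.
move=> B0 xB; rewrite -(@ler_pXn2r _ 2) ?nnegrE ?l2_norm_ge0 //.
have : cabs (l2_dot x x) <= B ^+ 2.
  apply: has_csum_bound (l2_dotP x x) _ => n; apply: le_trans (cabs_sum _ _ _) _.
  apply: le_trans (xB n); apply: ler_sum => i _.
  by rewrite cabsM {2}/cabs normcJ -/(cabs _) expr2.
by rewrite -l2_norm_sqr cabs_real ger0_norm ?sqr_ge0.
Qed.

Lemma l2_dot_normD z x y : l2_norm (z *: x + y) ^+ 2 =
  l2_norm y ^+ 2 + 2 * complex.Re (z * l2_dot x y) + cabs z ^+ 2 * l2_norm x ^+ 2.
Proof.
have E : l2_dot (z *: x + y) (z *: x + y) = z * z^*%C * l2_dot x x + (z * l2_dot x y +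
    (z * l2_dot x y)^*%C) + l2_dot y y.
  rewrite l2_dot_linearl (l2_dotC x) (l2_dotC y) !l2_dot_linearl (l2_dotC y x).
  rewrite !rmorphD !rmorphM /= !conjcK -(l2_dotC x x) -(l2_dotC y y); ring.
have E2 : (cabs z ^+ 2)%:C%C = z * z^*%C :> C by rewrite -sqr_normc cabsE rmorphXn.
have E3 w : (2 * complex.Re w)%:C%C = w + w^*%C :> C by rewrite addcJ rmorphM rmorph_nat.
apply: (fmorph_inj (real_complex R)); rewrite /= l2_norm_sqr E -!l2_norm_sqr -E2 -E3.
by rewrite -rmorphM -!rmorphD /=; congr (_%:C%C); ring.
Qed.

Lemma l2_cauchy_schwarz x y : cabs (l2_dot x y) <= l2_norm x * l2_norm y.
Proof.
rewrite -(@ler_pXn2r _ 2) ?nnegrE ?cabs_ge0 ?mulr_ge0 ?l2_norm_ge0 // exprMn mulrC.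
by apply: discriminant_bound => [|z]; rewrite -?l2_dot_normD sqr_ge0.
Qed.

Lemma l2_normD x y : l2_norm (x + y) <= l2_norm x + l2_norm y.
Proof.
rewrite -(@ler_pXn2r _ 2) ?nnegrE ?addr_ge0 ?l2_norm_ge0 //.
have := l2_dot_normD 1 x y; rewrite scale1r cabs1 expr1n !mul1r => ->.
have := le_trans (ler_norm _) (le_trans (cabs_Re _) (l2_cauchy_schwarz x y)).
rewrite sqrrD; lra.
Qed.

Lemma l2_normZ z x : l2_norm (z *: x) = cabs z * l2_norm x.
Proof.
apply/eqP; rewrite -(@eqrXn2 _ 2) ?l2_norm_ge0 ?mulr_ge0 ?cabs_ge0 ?l2_norm_ge0 //.
have := l2_dot_normD z x 0; rewrite addr0 => ->.
have l00 : l2_norm 0 = 0.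
  by rewrite /l2_norm (_ : l2_dot 0 0 = 0) ?sqrtr0 // linear0l.
have -> : l2_dot x 0 = 0.
  apply/eqP; rewrite -cabs_eq0 eq_le cabs_ge0 andbT.
  by apply: le_trans (l2_cauchy_schwarz _ _) _; rewrite l00 mulr0.
by rewrite l00 mulr0 /= mulr0 expr0n !add0r exprMn.
Qed.

Lemma l2_norm_eq0 x : l2_norm x = 0 -> x = 0.
Proof.
move=> x0; apply: l2_ext => n; have := l2_norm_sum x n.+1.
rewrite x0 expr0n big_ord_recr /= => h.
have h0 : 0 <= \sum_(i < n) cabs (x i) ^+ 2 by apply: sumr_ge0 => i _; exact: sqr_ge0.
apply/eqP; rewrite -cabs_eq0 -sqrf_eq0 eq_le sqr_ge0 andbT; lra.
Qed.

Definition l2_cnorm (x : l2) : C := (l2_norm x)%:C%C.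

Lemma l2_cnormD x y : l2_cnorm (x + y) <= l2_cnorm x + l2_cnorm y.
Proof. by rewrite -rmorphD lecR l2_normD. Qed.
Lemma l2_cnormZ (z : C) x : l2_cnorm (z *: x) = `|z| * l2_cnorm x.
Proof. by rewrite /l2_cnorm l2_normZ rmorphM /= -cabsE. Qed.
Lemma l2_cnorm_eq0 x : l2_cnorm x = 0 -> x = 0.
Proof. by case=> /l2_norm_eq0. Qed.

HB.instance Definition _ := Lmodule_isNormed.Build C l2 l2_cnormD l2_cnormZ l2_cnorm_eq0.

Lemma l2_normE (x : l2) : `|x| = (l2_norm x)%:C%C. Proof. by []. Qed.

Lemma l2_coord (x : l2) n : cabs (x n) <= l2_norm x.
Proof.
rewrite -(@ler_pXn2r _ 2) ?nnegrE ?cabs_ge0 ?l2_norm_ge0 //.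
apply: le_trans (l2_norm_sum x n.+1); rewrite big_ord_recr /= lerDr.
by apply: sumr_ge0 => i _; exact: sqr_ge0.
Qed.

Lemma l2_seq_complete (u : nat -> l2) :
  (forall k m, (k <= m)%N -> `|u k - u m| <= (k.+1%:R^-1 : R)%:C%C) ->
  exists l, forall e : R, 0 < e -> exists N, forall n, (N <= n)%N -> `|u n - l| <= e%:C%C.
Proof.
pose e k : R := k.+1%:R^-1; have e0 k : 0 < e k by rewrite invr_gt0.
move=> uc; have {}uc k m : (k <= m)%N -> l2_norm (u k - u m) <= e k.
  by move=> /uc; rewrite l2_normE lecR.
have /choice[l lP] i : exists s, forall k, cabs (u k i - s) <= 2 * e k.
  apply: complex_seq_complete => k m km; apply: le_trans (uc k m km).
  by have := l2_coord (u k - u m) i; rewrite l2B.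
have fin k n : \sum_(i < n) cabs (u k i - l i) ^+ 2 <= (2 * e k) ^+ 2.
  apply/ler_addgt0Pr => d d0.
  (* Replacing the limit by [u m] costs at most [8 * e m] in each of the [n] terms. *)
  have [m0 m0P] := eventually_small (divr_gt0 d0 (ltr0n R (8 * n).+1)).
  pose m := maxn k m0.
  have em : e m <= d / (8 * n).+1%:R.
    by apply: le_trans m0P; rewrite lef_pV2 ?posrE // ler_nat ltnS leq_maxr.
  have e1 : e m <= 1 by rewrite invf_le1 // ler1n.
  have h1 : \sum_(i < n) cabs (u k i - u m i) ^+ 2 <= e k ^+ 2.
    apply: le_trans (l2_norm_sum (u k - u m) n) _.
    have h := uc k m (leq_maxl _ _).
    by rewrite lerXn2r ?nnegrE ?l2_norm_ge0 //; exact: ltW.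
  apply: (@le_trans _ _ (\sum_(i < n) (2 * cabs (u k i - u m i) ^+ 2 + 8 * e m))).
    apply: ler_sum => i _; have -> : u k i - l i = (u k i - u m i) + (u m i - l i) by ring.
    apply: le_trans (cabs_sqrD _ _) _; rewrite lerD2l.
    have := lP i m; have := cabs_ge0 (u m i - l i); have := e0 m; nra.
  rewrite big_split /= -mulr_sumr sumr_const card_ord -mulr_natl.
  have : n%:R * (8 * e m) <= d.
    have : (8 * n).+1%:R * e m <= d by rewrite mulrC -ler_pdivlMr.
    rewrite -natr1 natrM; have := e0 m; nra.
  have := sqr_ge0 (e k); nra.
have lp : l2_pred l.
  apply/asboolP; have [M MP] := l2_sum_sqr (u 0%N).
  exists (2 * (2 * e 0%N) ^+ 2 + 2 * M) => n.
  apply: (@le_trans _ _ (\sum_(i < n) (2 * cabs (u 0%N i - l i) ^+ 2 + 2 * cabs (u 0%N i) ^+ 2))).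
    apply: ler_sum => i _; rewrite [cabs (_ - _)]cabsBC.
    by have := cabs_sqrD (l i - u 0%N i) (u 0%N i); rewrite subrK.
  by rewrite big_split /= -!mulr_sumr; apply: lerD; rewrite ler_pM2l ?fin ?MP.
exists (MkL2 lp) => d d0; have [k kP] := eventually_small (divr_gt0 d0 (ltr0n R 2)).
exists k => n kn; rewrite l2_normE lecR; apply: (@le_trans _ _ (2 * e n)).
  apply: l2_norm_le => [|m]; first by rewrite mulr_ge0 // ltW.
  exact: fin.
have kP' : e k <= d / 2 := kP.
have : e n <= e k by rewrite lef_pV2 ?posrE // ler_nat.
lra.
Qed.

HB.instance Definition _ := Uniform_isComplete.Build l2 (seq_complete_cvg l2_seq_complete).

Lemma l2_norm_dot (x : l2) : `|x| ^+ 2 = l2_dot x x.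
Proof. by have := l2_norm_sqr x; rewrite rmorphXn /= => <-. Qed.

Definition l2_hilbert : hilbert_space R := @HilbertSpace R l2 l2_dot l2_norm_dot.

End L2.

Lemma lipschitz_continuous (R : realType) (V W : normedModType R[i]) (T : V -> W) (B : R) :
  (forall x y, `|T x - T y| <= B%:C%C * `|x - y|) -> continuous T.
Proof.
move=> TB x; apply/cvgrPdist_le => e' /gt0_complexP[e e0 ->].
have B1 : 0 < `|B| + 1 by rewrite ltr_wpDl.
apply/nbhs_ballP; exists (e / (`|B| + 1))%:C%C => [/=|y]; first by rewrite ltcR divr_gt0.
rewrite -ball_normE /ball_ /= => /ltW xy; apply: le_trans (TB _ _) _.
apply: (@le_trans _ _ ((`|B| + 1)%:C%C * `|x - y|)).
  by rewrite ler_wpM2r // lecR (le_trans (ler_norm _)) // lerDl.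
apply: le_trans (ler_wpM2l _ xy) _; first by rewrite (lecR 0) ltW.
by rewrite -rmorphM lecR /= mulrC divfK // gt_eqF.
Qed.

Lemma linear_subE (K : nzRingType) (U W : lmodType K) (T : U -> W) :
  linear T -> forall x y, T x - T y = T (x - y).
Proof.
by move=> linT x y; have := linT (-1) y x; rewrite !scaleN1r (addrC (- y)) (addrC (- T y)) => ->.
Qed.

(** * Orthonormal bases and diagonal operators *)

Section L2Bases.
Variable R : realType.
Local Notation C := R[i].
Local Notation V := (l2 R).
Local Notation dot := (@l2_dot R).
Local Notation norm := (@l2_norm R).
Implicit Types (x y e : V) (A B : {fset V}).

Lemma l2_dot_suml (I : Type) (s : seq I) (c : I -> C) (f : I -> V) y :
  dot (\sum_(i <- s) c i *: f i) y = \sum_(i <- s) c i * dot (f i) y.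
Proof.
elim: s => [|i s IHs]; first by rewrite !big_nil linear0l.
by rewrite !big_cons l2_dot_linearl IHs.
Qed.

Lemma l2_dotBl x y z : dot (x - y) z = dot x z - dot y z.
Proof. by rewrite -scaleN1r addrC l2_dot_linearl mulN1r addrC. Qed.

Lemma l2_dotBr x y z : dot z (x - y) = dot z x - dot z y.
Proof. by rewrite l2_dotC l2_dotBl rmorphB /= -!l2_dotC. Qed.

Lemma l2_norm0 : norm 0 = 0.
Proof. by rewrite /l2_norm linear0l sqrtr0. Qed.

Lemma l2_normN x : norm (- x) = norm x.
Proof. by rewrite -scaleN1r l2_normZ cabsN cabs1 mul1r. Qed.

Lemma l2_normBC x y : norm (x - y) = norm (y - x).
Proof. by rewrite -l2_normN opprB. Qed.

Lemma l2_pythagoras x y : dot x y = 0 -> norm (x + y) ^+ 2 = norm x ^+ 2 + norm y ^+ 2.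
Proof.
move=> xy; have := l2_dot_normD 1 x y.
by rewrite scale1r cabs1 expr1n !mul1r xy /= mulr0 addr0 => ->; rewrite addrC.
Qed.

Definition projection B x : V := \sum_(e <- B) dot x e *: e.

Section OrthonormalBasis.
Variable E : set V.
Hypothesis onbE : orthonormal_basis (V := l2_hilbert R) E.

Let dotE e f : E e -> E f -> dot e f = (e == f)%:R.
Proof.
case: onbE => E1 E0 _ Ee Ef; have [<-|ef] := eqVneq e f; first exact: E1.
by apply: E0 => // /eqP; apply/negP.
Qed.

Lemma projection_dot B x e : [set` B] `<=` E -> e \in B -> dot (projection B x) e = dot x e.
Proof.
move=> BE eB; rewrite /projection l2_dot_suml (bigD1_seq e) ?fset_uniq //=.
rewrite (dotE (BE _ eB) (BE _ eB)) eqxx mulr1.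
rewrite big_seq_cond big1 ?addr0 // => f /andP[fB fe].
by rewrite (dotE (BE _ fB) (BE _ eB)) (negPf fe) mulr0.
Qed.

Lemma projection_orth A B x : [set` B] `<=` E -> (A `<=` B)%fset ->
  dot (projection A x) (x - projection B x) = 0.
Proof.
move=> BE AB; rewrite /projection l2_dot_suml big_seq big1 // => e eA.
rewrite l2_dotBr (l2_dotC e x) (l2_dotC e (projection _ _)) projection_dot //.
  by rewrite subrr mulr0.
exact: (fsubsetP AB).
Qed.

Lemma projection_diff A B x : [set` B] `<=` E -> (A `<=` B)%fset ->
  norm (x - projection A x) ^+ 2 =
  norm (projection B x - projection A x) ^+ 2 + norm (x - projection B x) ^+ 2.
Proof.
move=> BE AB; rewrite -l2_pythagoras ?l2_dotBl ?projection_orth ?subrr //.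
by congr (norm _ ^+ 2); rewrite [RHS]addrC subrKA.
Qed.

Lemma projection_mono A B x : [set` B] `<=` E -> (A `<=` B)%fset ->
  norm (x - projection B x) <= norm (x - projection A x).
Proof.
move=> BE AB; rewrite -(@ler_pXn2r _ 2) ?nnegrE ?l2_norm_ge0 //.
by rewrite (projection_diff x BE AB) lerDr sqr_ge0.
Qed.

Lemma projection_norm B x : [set` B] `<=` E -> norm (projection B x) <= norm x.
Proof.
move=> BE; rewrite -(@ler_pXn2r _ 2) ?nnegrE ?l2_norm_ge0 //.
have -> : norm x ^+ 2 = norm (projection B x) ^+ 2 + norm (x - projection B x) ^+ 2.
  by rewrite -l2_pythagoras ?projection_orth // addrC subrK.
by rewrite lerDl sqr_ge0.
Qed.

(** Finite subsets of [E] whose distance to [x] approaches the infimum have, by Pythagoras, a Cauchy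
    sequence of projections. The limit differs from [x] by a vector orthogonal to [E], which is 0 by
    maximality of the basis. *)
Lemma projection_approx x (r : R) : 0 < r -> exists A, [set` A] `<=` E /\
  forall B, (A `<=` B)%fset -> [set` B] `<=` E -> norm (projection B x - x) <= r.
Proof.
move=> r0.
pose D := [set d | exists2 A, [set` A] `<=` E & d = norm (x - projection A x) ^+ 2].
have D0 : D (norm (x - projection fset0 x) ^+ 2).
  by exists fset0 => //; move=> e /=; rewrite in_fset0.
have hD : has_inf D by split; [exists (norm (x - projection fset0 x) ^+ 2)
  | exists 0 => _ [A _ ->]; exact: sqr_ge0].
pose s := inf D; have sD A : [set` A] `<=` E -> s <= norm (x - projection A x) ^+ 2.
  by move=> AE; apply: ge_inf; [exact: (proj2 hD)|exists A].
pose e k : R := k.+1%:R^-1 / 2; have e0 k : 0 < e k by rewrite divr_gt0 // invr_gt0.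
have /choice[A AP] k : exists A, [set` A] `<=` E /\ norm (x - projection A x) ^+ 2 <= s + e k ^+ 2.
  have [_ [A AE ->] /ltW h] := inf_adherent (exprn_gt0 2 (e0 k)) hD; by exists A.
have near k B : [set` B] `<=` E -> (A k `<=` B)%fset ->
    norm (projection B x - projection (A k) x) <= e k.
  move=> BE AB; rewrite -(@ler_pXn2r _ 2) ?nnegrE ?l2_norm_ge0 ?(ltW (e0 k)) //.
  rewrite -(lerD2r (norm (x - projection B x) ^+ 2)) -projection_diff //.
  by apply: le_trans (AP k).2 _; rewrite addrC lerD2l; exact: sD.
have cauchy k m : (k <= m)%N -> `|projection (A k) x - projection (A m) x| <= (k.+1%:R^-1 : R)%:C%C.
  move=> km; rewrite l2_normE lecR.
  have UE : [set` (A k `|` A m)%fset] `<=` E.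
    by move=> f /=; rewrite in_fsetU => /orP[/(AP k).1|/(AP m).1].
  have h1 := near k _ UE (fsubsetUl _ _); have h2 := near m _ UE (fsubsetUr _ _).
  rewrite l2_normBC in h1.
  have emk : e m <= e k by rewrite ler_pM2r ?invr_gt0 // lef_pV2 ?posrE // ler_nat.
  rewrite -(subrKA (projection (A k `|` A m)%fset x)).
  apply: le_trans (l2_normD _ _) _.
  have -> : k.+1%:R^-1 = e k + e k by rewrite /e; field.
  lra.
have [y yP] := l2_seq_complete cauchy.
have xy : x = y.
  case: onbE => _ _ maxE; apply/eqP; rewrite -subr_eq0; apply/eqP; apply: maxE => f Ef /=.
  apply: (@small_cabs_eq0 _ _ 2) => d d0; have [N NP] := yP d d0.
  have [k0 k0P] := eventually_small d0; pose k := maxn N k0.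
  have ek : e k <= d.
    apply: le_trans k0P; apply: (@le_trans _ _ (k.+1%:R^-1)).
      by rewrite ler_pdivrMr // ler_peMr ?invr_ge0 // ler1n.
    by rewrite lef_pV2 ?posrE // ler_nat ltnS leq_maxr.
  have UE : [set` (f |` A k)%fset] `<=` E.
    by move=> g /=; rewrite in_fset1U => /orP[/eqP -> //|/(AP k).1].
  have f1 : norm f = 1.
    apply/eqP; rewrite -(@eqrXn2 _ 2) ?l2_norm_ge0 // expr1n.
    by rewrite -(inj_eq (fmorph_inj (real_complex R))) /= l2_norm_sqr dotE // eqxx.
  have -> : dot (x - y) f = dot (projection (f |` A k)%fset x - projection (A k) x) f
      + dot (projection (A k) x - y) f.
    by rewrite !l2_dotBl (projection_dot x UE) ?fset1U1 //; ring.
  have h1 := near k _ UE (fsubsetUr _ _).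
  have := NP k (leq_maxl _ _); rewrite l2_normE lecR => h2.
  apply: le_trans (cabsD _ _) _.
  have := l2_cauchy_schwarz (projection (f |` A k)%fset x - projection (A k) x) f.
  have := l2_cauchy_schwarz (projection (A k) x - y) f.
  rewrite f1 !mulr1; lra.
have [N NP] := yP r r0; have := NP N (leqnn N); rewrite -xy l2_normE lecR => hN.
exists (A N); split; first exact: (AP N).1.
move=> B AB BE; rewrite l2_normBC; apply: le_trans hN.
by rewrite (l2_normBC (projection _ x)); exact: projection_mono.
Qed.

End OrthonormalBasis.

Definition delta_seq (n : nat) : nat -> C^o := fun i => (i == n)%:R.

Lemma delta_seqP n : l2_pred (delta_seq n).
Proof.
apply/asboolP; exists 1 => m.
have [nm|mn] := ltnP n m; last first.
  rewrite big1 // => i _; rewrite /delta_seq (ltn_eqF (leq_trans (ltn_ord i) mn)).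
  by rewrite cabs0 expr0n.
rewrite (bigD1 (Ordinal nm)) //= big1 ?addr0 => [|i ni].
  by rewrite /delta_seq eqxx cabs1 expr1n.
by rewrite /delta_seq -[_ == n]/(i == Ordinal nm) (negPf ni) cabs0 expr0n.
Qed.

Definition l2_delta n : V := MkL2 (delta_seqP n).

Lemma l2_deltaE n i : l2_delta n i = (i == n)%:R. Proof. by []. Qed.

Lemma l2_dot_delta x n : dot x (l2_delta n) = x n.
Proof.
apply: l2_dot_eq; have -> : x n = \sum_(i < n.+1) x i * (l2_delta n i)^*%C.
  rewrite big_ord_recr big1 => [|i _]; first by rewrite /= /delta_seq eqxx conjc1 mulr1 add0r.
  by rewrite /= /delta_seq ltn_eqF // conjc0 mulr0.
by apply: has_csum_finite => i ni; rewrite l2_deltaE gtn_eqF // conjc0 mulr0.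
Qed.

Lemma l2_norm_delta n : norm (l2_delta n) = 1.
Proof.
apply/eqP; rewrite -(@eqrXn2 _ 2) ?l2_norm_ge0 // expr1n.
by rewrite -(inj_eq (fmorph_inj (real_complex R))) /= l2_norm_sqr l2_dot_delta l2_deltaE eqxx.
Qed.

Definition in_diag (d : nat -> C) : set V := [set x | exists y : V, forall n, y n = d n * x n].

Definition diag (d : nat -> C) x : V := xget 0 [set y : V | forall n, y n = d n * x n].

Lemma diagE d x n : in_diag d x -> diag d x n = d n * x n.
Proof. by move=> [y yP]; rewrite /diag; case: xgetP => [z _ /(_ n) //|/(_ y)]. Qed.

Lemma diag_eq d x y : (forall n, y n = d n * x n) -> diag d x = y.
Proof. by move=> xy; apply: l2_ext => n; rewrite diagE ?xy //; exists y. Qed.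

Section BoundedDiag.
Variables (d : nat -> C) (B : R).
Hypothesis dB : forall n, cabs (d n) <= B.

Let B0 : 0 <= B. Proof. exact: le_trans (cabs_ge0 _) (dB 0). Qed.

Lemma diag_bound_sum x n : \sum_(i < n) cabs (d i * x i) ^+ 2 <= (B * norm x) ^+ 2.
Proof.
rewrite exprMn; apply: le_trans (ler_wpM2l (sqr_ge0 _) (l2_norm_sum x n)).
rewrite mulr_sumr; apply: ler_sum => i _; rewrite cabsM exprMn ler_wpM2r ?sqr_ge0 //.
by rewrite lerXn2r ?nnegrE ?cabs_ge0.
Qed.

Lemma in_diag_bounded x : in_diag d x.
Proof.
have p : l2_pred (fun n => d n * x n).
  by apply/asboolP; exists ((B * norm x) ^+ 2) => n; exact: diag_bound_sum.
by exists (MkL2 p).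
Qed.

Lemma diag_boundE x n : diag d x n = d n * x n.
Proof. exact/diagE/in_diag_bounded. Qed.

Lemma diag_norm x : norm (diag d x) <= B * norm x.
Proof.
apply: l2_norm_le => [|n]; first by rewrite mulr_ge0 // l2_norm_ge0.
by under eq_bigr do rewrite diag_boundE; exact: diag_bound_sum.
Qed.

Lemma diag_linear : linear (diag d).
Proof.
move=> c x y; apply: l2_ext => n.
by rewrite diag_boundE !l2D !l2Z !diag_boundE mulrDr mulrCA.
Qed.

End BoundedDiag.

Lemma bounded_operatorP (T : V -> V) (B : R) : linear T ->
  (forall x, norm (T x) <= B * norm x) -> bounded_operator (V := l2_hilbert R) T.
Proof.
move=> linT TB; split=> //.
apply: (@lipschitz_continuous R (l2_hilbert R) (l2_hilbert R) T B) => x y.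
rewrite (linear_subE linT).
by rewrite !l2_normE -rmorphM lecR; exact: TB.
Qed.

Lemma diag_bounded_operator d (B : R) : (forall n, cabs (d n) <= B) ->
  bounded_operator (V := l2_hilbert R) (diag d).
Proof. by move=> dB; apply: (@bounded_operatorP _ B); [exact: diag_linear dB|exact: diag_norm]. Qed.

Definition above (N n : nat) : C := (N <= n)%:R.

Lemma above_le1 N n : cabs (above N n) <= 1.
Proof. by rewrite /above; case: (_ <= _)%N; rewrite ?cabs1 ?cabs0. Qed.

Lemma l2_tail x (r : R) : 0 < r -> exists N, norm (diag (above N) x) <= r.
Proof.
move=> r0.
have [N NP] := bounded_series_tail (fun i => sqr_ge0 (cabs (x i))) (l2_norm_sum x) (exprn_gt0 2 r0).
exists N; apply: l2_norm_le => [|n]; first exact: ltW.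
have E m : \sum_(i < N + m) cabs (diag (above N) x i) ^+ 2 =
    \sum_(i < N + m) cabs (x i) ^+ 2 - \sum_(i < N) cabs (x i) ^+ 2.
  rewrite !big_split_ord /= [X in X + _ = _]big1 => [|i _].
    rewrite add0r addrAC subrr add0r; apply: eq_bigr => i _.
    by rewrite (diag_boundE (above_le1 N)) /above leq_addr mul1r.
  by rewrite (diag_boundE (above_le1 N)) /above leqNgt ltn_ord mul0r cabs0 expr0n.
have [nN|Nn] := leqP n N.
  apply: (@le_trans _ _ (\sum_(i < N + 0) cabs (diag (above N) x i) ^+ 2)).
    by apply: (ler_sum_ord (w := fun i => cabs (diag (above N) x i) ^+ 2)) => [i|]; rewrite ?sqr_ge0 ?addn0.
  by rewrite E; apply: NP; rewrite ?addn0.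
by rewrite -(subnKC (ltnW Nn)) E; apply: NP; rewrite ?leq_addr.
Qed.

(** Dominated convergence for diagonal operators: the uniform bound controls the tail of [x], and
    entrywise convergence its finitely many first coordinates. *)
Lemma diag_family (T : Type) (F : set_system T) (FF : Filter F) (d : T -> nat -> C) (B : R) :
  (\forall t \near F, forall n, cabs (d t n) <= B) ->
  (forall n (e : R), 0 < e -> \forall t \near F, cabs (d t n) <= e) ->
  forall x (e : R), 0 < e -> \forall t \near F, norm (diag (d t) x) <= e.
Proof.
move=> dB d0 x e e0; pose B1 := `|B| + 1; have B10 : 0 < B1 by rewrite ltr_wpDl.
have [N NP] := l2_tail x (divr_gt0 e0 (mulr_gt0 (ltr0n R 2) B10)).
pose k := norm x + 1; have k0 : 0 < k by rewrite ltr_wpDl ?l2_norm_ge0.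
have near0 : \forall t \near F, forall n : 'I_N, cabs (d t n) <= e / (2 * k).
  by apply: filter_forall => n; apply: d0; rewrite divr_gt0 // mulr_gt0.
apply: filterS (filterI dB near0) => t [tB t0].
pose d1 n := if (n < N)%N then d t n else 0.
have d1b n : cabs (d1 n) <= e / (2 * k).
  rewrite /d1; case: ifP => nN; first exact: (t0 (Ordinal nN)).
  by rewrite cabs0 divr_ge0 ?ltW // mulr_gt0.
have tB1 n : cabs (d t n) <= B1.
  by apply: le_trans (tB n) _; apply: le_trans (ler_norm _) _; rewrite /B1 lerDl.
have -> : diag (d t) x = diag d1 x + diag (d t) (diag (above N) x).
  apply: l2_ext => n; rewrite l2D !(diag_boundE tB1) (diag_boundE d1b) (diag_boundE (above_le1 N)).
  by rewrite /d1 /above; case: ltnP => _ /=; rewrite ?mul0r ?mulr0 ?mul1r ?addr0 ?add0r.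
apply: le_trans (l2_normD _ _) _.
have h1 := diag_norm d1b x; have h2 := diag_norm tB1 (diag (above N) x).
have h3 : e / (2 * k) * norm x <= e / 2.
  apply: (@le_trans _ _ (e / (2 * k) * k)).
    by apply: ler_wpM2l; [apply/ltW/divr_gt0 => //; exact: mulr_gt0|rewrite /k lerDl].
  by rewrite le_eqVlt; apply/orP; left; apply/eqP; field; rewrite gt_eqF.
have h4 : B1 * norm (diag (above N) x) <= e / 2.
  apply: le_trans (ler_wpM2l (ltW B10) NP) _.
  by have -> // : B1 * (e / (2 * B1)) = e / 2 by field; rewrite gt_eqF.
by rewrite [e]splitr; apply: lerD; [exact: le_trans h1 h3|exact: le_trans h2 h4].
Qed.

End L2Bases.

(** * The trace in an arbitrary orthonormal basis *)

Section Trace.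
Variable R : realType.
Local Notation C := R[i].
Local Notation V := (l2 R).
Local Notation dot := (@l2_dot R).
Local Notation norm := (@l2_norm R).

(** For a finite part [Bs] of a basis with projection P, exchanging sums turns the partial trace
    into the sum over n of w_n <S P delta_n, delta_n>. For large [Bs] the vector P delta_n is close
    to delta_n for small n, and the remaining n carry little weight; so every basis gives the sum
    computed in the standard one. *)
Lemma l2_trace (w : nat -> R) (W : R) (S : V -> V) (B : R) (z : C) :
  (forall n, 0 <= w n) -> (forall n, \sum_(i < n) w i <= W) ->
  linear S -> (forall x, norm (S x) <= B * norm x) ->
  has_csum (fun n => (w n)%:C%C * dot (S (l2_delta R n)) (l2_delta R n)) z ->
  has_trace (V := l2_hilbert R) (diag (fun n => (w n)%:C%C) \o S) z.
Proof.
move=> w0 wW linS SB zP.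
have wn n : cabs (w n)%:C%C <= W.
  rewrite cabs_real ger0_norm //; apply: le_trans (wW n.+1).
  by rewrite big_ord_recr /= lerDr sumr_ge0.
have W0 : 0 <= W by apply: le_trans (wn 0); exact: cabs_ge0.
pose B1 := `|B| + 1; have B10 : 0 < B1 by rewrite ltr_wpDl.
have {}SB x : norm (S x) <= B1 * norm x.
  apply: le_trans (SB x) _; rewrite ler_wpM2r ?l2_norm_ge0 //.
  by apply: le_trans (ler_norm _) _; rewrite /B1 lerDl.
split.
  apply: (@bounded_operatorP _ _ (W * B1)).
    by move=> c x y /=; rewrite linS (diag_linear wn).
  move=> x /=; apply: le_trans (diag_norm wn _) _.
  by rewrite -mulrA ler_wpM2l.
move=> E onbE r r0.
pose r1 := r / 2; have r10 : 0 < r1 by rewrite divr_gt0.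
(* Projection errors are at most 2 from [N] on, whence the 4, and at most [r2] before; the two
   ranges contribute [r1 / 2] each. *)
have [N NP] := bounded_series_tail w0 wW (divr_gt0 r10 (mulr_gt0 (ltr0n R 4) B10)).
pose r2 := r1 / (2 * (B1 * (W + 1))).
have W1 : 0 < W + 1 by rewrite ltr_wpDl.
have r20 : 0 < r2 by rewrite divr_gt0 // !mulr_gt0.
have /choice[A AP] n := projection_approx onbE (l2_delta R n) r20.
pose A0 := (\bigcup_(n <- iota 0 N) A n)%fset.
exists A0; split.
  move=> e /= /bigfcupP[n _]; exact: (AP n).1.
move=> Bs AB BE.
have close n : (n < N)%N -> norm (projection Bs (l2_delta R n) - l2_delta R n) <= r2.
  move=> nN; apply: (AP n).2 => //; apply: fsubset_trans AB.
  by apply: (bigfcup_sup (fun n => A n)) => //; rewrite mem_iota add0n.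
have far n : norm (projection Bs (l2_delta R n) - l2_delta R n) <= 2.
  apply: le_trans (l2_normD _ _) _; rewrite l2_normN l2_norm_delta.
  have := projection_norm onbE (l2_delta R n) BE; rewrite l2_norm_delta; lra.
have linS_sum (s : seq V) (c : V -> C) : S (\sum_(e <- s) c e *: e) = \sum_(e <- s) c e *: S e.
  elim: s => [|e s IHs]; last by rewrite !big_cons linS IHs.
  rewrite !big_nil; have := linS (-1) 0 0; rewrite scaler0 addr0 scaleN1r addNr //.
have sumB : has_csum (fun n => (w n)%:C%C * dot (S (projection Bs (l2_delta R n))) (l2_delta R n))
    (\sum_(e <- Bs) dot ((diag (fun n => (w n)%:C%C) \o S) e) e).
  have wS n : (w n)%:C%C * dot (S (projection Bs (l2_delta R n))) (l2_delta R n) =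
      \sum_(e <- Bs) (w n)%:C%C * ((S e n) * (e n)^*%C).
    rewrite /projection linS_sum l2_dot_suml mulr_sumr; apply: eq_bigr => e _.
    by rewrite l2_dot_delta (l2_dotC _ e) l2_dot_delta [_^*%C * _]mulrC.
  apply: (@eq_has_csum _ (fun n => \sum_(e <- Bs) (w n)%:C%C * ((S e n) * (e n)^*%C))) => [n|].
    by rewrite wS.
  elim: (Bs : seq V) => [|e s IHs].
    move=> d d0; exists 0%N => n _; rewrite big_nil subr0 big1 ?cabs0 ?ltW // => i _.
    by rewrite big_nil.
  rewrite big_cons; apply: (@eq_has_csum _ (fun n => (w n)%:C%C * (S e n * (e n)^*%C) +
     \sum_(e <- s) (w n)%:C%C * (S e n * (e n)^*%C))) => [n|]; first by rewrite big_cons.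
  apply: has_csumD IHs; apply: eq_has_csum (l2_dotP _ _) => n /=.
  by rewrite (diag_boundE wn) mulrA.
have diff := has_csumD sumB (has_csumZ (-1) zP); rewrite mulN1r in diff.
rewrite cabsE ltcR; apply: (@le_lt_trans _ _ r1); last by rewrite /r1; lra.
apply: (has_csum_bound diff) => n; apply: le_trans (cabs_sum _ _ _) _.
have term i : cabs ((w i)%:C%C * dot (S (projection Bs (l2_delta R i))) (l2_delta R i) +
   -1 * ((w i)%:C%C * dot (S (l2_delta R i)) (l2_delta R i))) <=
   w i * (B1 * norm (projection Bs (l2_delta R i) - l2_delta R i)).
  rewrite mulN1r -mulrBr -l2_dotBl cabsM cabs_real ger0_norm // ler_wpM2l //.
  apply: le_trans (l2_cauchy_schwarz _ _) _; rewrite l2_norm_delta mulr1.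
  by rewrite (linear_subE linS); exact: SB.
apply: (@le_trans _ _ (\sum_(i < n) (w i * (B1 * r2) + (if (N <= i)%N then w i else 0) * (2 * B1)))).
  apply: ler_sum => i _; apply: le_trans (term i) _.
  case: leqP => Ni.
    have := far i; have := w0 i => wi0 fi.
    have : w i * (B1 * norm (projection Bs (l2_delta R i) - l2_delta R i)) <= w i * (B1 * 2).
      by rewrite ler_wpM2l // ler_wpM2l // ltW.
    have : 0 <= w i * (B1 * r2) by rewrite mulr_ge0 // mulr_ge0 // ltW.
    lra.
  by rewrite mul0r addr0 ler_wpM2l // ler_wpM2l ?close // ltW.
rewrite big_split /= -!mulr_suml.
have tail : \sum_(i < n) (if (N <= i)%N then w i else 0) <= r1 / (4 * B1).
  have w'0 i : 0 <= (if (N <= i)%N then w i else 0) by case: ifP.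
  apply: le_trans (ler_sum_ord w'0 (leq_maxr N n)) _.
  apply: le_trans (NP N (maxn N n) (leqnn _) (leq_maxl _ _)).
  rewrite -(subnKC (leq_maxl N n)) !big_split_ord /= [X in X + _]big1 => [|i _].
    rewrite add0r addrAC subrr add0r; apply: ler_sum => i _.
    by rewrite leq_addr.
  by rewrite leqNgt ltn_ord.
have h1 : (\sum_(i < n) w i) * (B1 * r2) <= r1 / 2.
  apply: (@le_trans _ _ ((W + 1) * (B1 * r2))).
    by apply: ler_wpM2r; [apply: mulr_ge0; exact: ltW | have := wW n; lra].
  by rewrite /r2 le_eqVlt; apply/orP; left; apply/eqP; field; rewrite !gt_eqF.
have h2 : (\sum_(i < n) (if (N <= i)%N then w i else 0)) * (2 * B1) <= r1 / 2.
  apply: le_trans (ler_wpM2r _ tail) _; first by rewrite mulr_ge0 // ltW.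
  by rewrite le_eqVlt; apply/orP; left; apply/eqP; field; rewrite gt_eqF.
lra.
Qed.

End Trace.

(** * The Hamiltonian, its unitary group and its heat semigroup *)

Section Hamiltonian.
Variable R : realType.
Local Notation C := R[i].
Local Notation V := (l2 R).
Local Notation dot := (@l2_dot R).
Local Notation norm := (@l2_norm R).

Lemma cvg_dist_realP (W : normedModType C) (T : Type) (F : set_system T) (FF : Filter F)
    (f : T -> W) (y : W) :
  (f t @[t --> F] --> y) <->
  (forall e : R, 0 < e -> \forall t \near F, `|f t - y| <= e%:C%C).
Proof.
split=> [/cvgrPdist_le fy e e0|fy].
  have := fy e%:C%C; rewrite (ltcR 0) => /(_ e0); apply: filterS => t.
  by rewrite distrC.
apply/cvgrPdist_le => _ /gt0_complexP[e e0 ->]; apply: filterS (fy e e0) => t.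
by rewrite distrC.
Qed.

Lemma cabs_cexp_le1 (w : C) : complex.Re w <= 0 -> cabs (cexp w) <= 1.
Proof. by move=> w0; rewrite cabs_cexp -expR0 ler_expR. Qed.

Lemma cexpX (w : C) m : cexp w ^+ m = cexp (m%:R * w).
Proof.
by elim: m => [|m IHm]; rewrite ?expr0 ?mul0r ?cexp0 // exprS IHm -cexpD -natr1 mulrDl mul1r addrC.
Qed.

Lemma cabs_pow_sub1 (w : C) m : cabs w <= 1 -> cabs (w ^+ m - 1) <= m%:R * cabs (w - 1).
Proof.
move=> w1; elim: m => [|m IHm]; first by rewrite expr0 subrr cabs0 mul0r.
have -> : w ^+ m.+1 - 1 = w * (w ^+ m - 1) + (w - 1) by rewrite exprS; ring.
rewrite -natr1 mulrDl mul1r; apply: le_trans (cabsD _ _) _; rewrite cabsM lerD2r.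
by apply: le_trans IHm; rewrite ler_piMl ?cabs_ge0.
Qed.

(** [cexp_estimate] reaches small arguments only, so [w] is cut into equal parts; the m-th power of
    a number of modulus at most 1 moves away from 1 at most m times as far. *)
Lemma cexp_sub1 (w : C) : complex.Re w <= 0 -> cabs (cexp w - 1) <= 2 * cabs w.
Proof.
move=> w0; have [r r0 rP] := @cexp_estimate R 1 ltr01.
have k0 : 0 < r / (cabs w + 1) by rewrite divr_gt0 // ltr_wpDl ?cabs_ge0.
have [m mP] := eventually_small k0; pose M : R := m.+1%:R; have M0 : 0 < M by [].
pose w1 := (M^-1)%:C%C * w.
have w1E : cabs w1 = M^-1 * cabs w by rewrite /w1 cabsM cabs_real ger0_norm // invr_ge0.
have w1r : cabs w1 <= r.
  rewrite w1E; apply: le_trans (ler_wpM2r (cabs_ge0 _) mP) _.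
  by rewrite mulrAC ler_pdivrMr ?ltr_wpDl ?cabs_ge0 // ler_pM2l // lerDl.
have w10 : complex.Re w1 <= 0.
  case: (w) w0 @w1 {w1E w1r} => a b /= a0; rewrite mul0r subr0.
  by rewrite pmulr_rle0 // invr_gt0.
have -> : w = m.+1%:R * w1.
  rewrite /w1 mulrA -(rmorph_nat (real_complex R)) /= -rmorphM /= divff ?gt_eqF //.
  by rewrite mul1r.
rewrite -cexpX cabsM; apply: le_trans (cabs_pow_sub1 _ (cabs_cexp_le1 w10)) _.
have -> : cabs (m.+1%:R : C) = M by rewrite -[m.+1%:R](rmorph_nat (real_complex R)) /= cabs_real ger0_norm.
rewrite mulrCA ler_pM2l //; have := rP _ w1r; rewrite mul1r => h.
have -> : cexp w1 - 1 = (cexp w1 - 1 - w1) + w1 by ring.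
by apply: le_trans (cabsD _ _) _; lra.
Qed.

Lemma has_csum_ge0 (u : nat -> C) s : has_csum u s -> (forall n, 0 <= u n) -> 0 <= s.
Proof.
move=> us u0; have sum n : exists2 r : R, 0 <= r & \sum_(i < n) u i = r%:C%C.
  by apply: ge0_complexP; rewrite sumr_ge0.
rewrite lecE; apply/andP; split.
  have : `|complex.Im s| <= 0.
    apply/ler_addgt0Pr => e e0; have [N /(_ N (leqnn N))] := us e e0.
    have [r r0 ->] := sum N; rewrite add0r; apply: le_trans.
    by apply: le_trans (cabs_Im _); case: (s) => a b /=; rewrite sub0r normrN.
  by rewrite normr_le0 eq_sym.
apply/ler_addgt0Pr => e e0; have [N /(_ N (leqnn N))] := us e e0.
have [r r0 ->] := sum N => h; have := cabs_Re (r%:C%C - s).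
case: (s) h => a b /= h; have := ler_norm (r - a); lra.
Qed.

Variable L : R.
Hypothesis L0 : 0 < L.

Definition level (n : nat) : C := (n%:R * L)%:C%C.

Definition hamiltonian : unbounded_operator (l2_hilbert R) :=
  UnboundedOp (V := l2_hilbert R) (in_diag level) (diag level).

(** The operator e^(c t H). Taking [c] to be the imaginary unit or -1 lets the group and the
    semigroup share their lemmas. *)
Definition evol (c : C) (t : R) : V -> V := diag (fun n => cexp (c * t%:C%C * level n)).

Lemma level_ge0 n : 0 <= level n.
Proof. by rewrite (lecR 0) mulr_ge0 // ltW. Qed.

Lemma Re_mul_level z n : complex.Re z <= 0 -> complex.Re (z * level n) <= 0.
Proof.
case: z => a b /= a0; rewrite mulr0 subr0.
by rewrite mulr_le0_ge0 // mulr_ge0 // ltW.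
Qed.

Lemma evol_le1 c t n : complex.Re (c * t%:C%C) <= 0 -> cabs (cexp (c * t%:C%C * level n)) <= 1.
Proof. by move=> ct; apply/cabs_cexp_le1/Re_mul_level. Qed.

Lemma evol0 c x : evol c 0 x = x.
Proof. by apply: diag_eq => n; rewrite mulr0 mul0r cexp0 mul1r. Qed.

Lemma evolE c t x n : complex.Re (c * t%:C%C) <= 0 ->
  evol c t x n = cexp (c * t%:C%C * level n) * x n.
Proof. by move=> ct; apply: (@diag_boundE _ _ 1) => m; exact: evol_le1. Qed.

Lemma evolD c s t x : complex.Re (c * s%:C%C) <= 0 -> complex.Re (c * t%:C%C) <= 0 ->
  evol c (s + t) x = evol c s (evol c t x).
Proof.
move=> cs ct; apply: diag_eq => n; rewrite !evolE // mulrA -cexpD; congr (cexp _ * _).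
by rewrite rmorphD /=; ring.
Qed.

Lemma evol_bounded c t : complex.Re (c * t%:C%C) <= 0 ->
  bounded_operator (V := l2_hilbert R) (evol c t).
Proof. by move=> ct; apply: (@diag_bounded_operator _ _ 1) => n; exact: evol_le1. Qed.

Lemma evol_linear c t : complex.Re (c * t%:C%C) <= 0 -> linear (evol c t).
Proof. by move=> ct; apply: (@diag_linear _ _ 1) => n; exact: evol_le1. Qed.

Lemma evol_norm c t x : complex.Re (c * t%:C%C) <= 0 -> norm (evol c t x) <= norm x.
Proof.
by move=> ct; rewrite -[leRHS]mul1r; apply: diag_norm => n; exact: evol_le1.
Qed.

Lemma cabs_scaled c (t e : R) n : 0 < e -> `|t| <= e / (cabs (c * level n) + 1) ->
  cabs (c * t%:C%C * level n) <= e.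
Proof.
move=> e0 te; rewrite mulrAC cabsM cabs_real; have k := cabs_ge0 (c * level n).
apply: le_trans (ler_wpM2l k te) _.
rewrite mulrCA ler_piMr //; first exact: ltW.
by rewrite ler_pdivrMr ?mul1r ?lerDl // ltr_wpDl.
Qed.

Section AtZero.
Variables (c : C) (F : set_system R).
Hypothesis FF : ProperFilter F.
Hypothesis FRe : \forall t \near F, complex.Re (c * t%:C%C) <= 0.
Hypothesis F0 : forall e : R, 0 < e -> \forall t \near F, `|t| <= e.

Let Fsmall n (e : R) : 0 < e -> \forall t \near F, cabs (c * t%:C%C * level n) <= e.
Proof.
move=> e0; apply: filterS (F0 (divr_gt0 e0 _)) => [t|]; first exact: cabs_scaled.
by rewrite ltr_wpDl ?cabs_ge0.
Qed.

(** [F] stands for the full or the one-sided neighbourhoods of 0, according to whether the group or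
    the semigroup is meant. *)
Lemma evol_cvg x : evol c t x @[t --> F] --> x.
Proof.
apply/cvg_dist_realP => e e0.
pose d t n := cexp (c * t%:C%C * level n) - 1.
have dB : \forall t \near F, forall n, cabs (d t n) <= 2.
  apply: filterS FRe => t ct n; apply: le_trans (cabsB _ _) _; rewrite cabs1.
  by have := evol_le1 n ct; lra.
have d0 n (e1 : R) : 0 < e1 -> \forall t \near F, cabs (d t n) <= e1.
  move=> e10; apply: filterS (filterI FRe (Fsmall n (divr_gt0 e10 (ltr0n R 2)))) => t [ct te].
  by apply: le_trans (cexp_sub1 (Re_mul_level n ct)) _; lra.
have dx := diag_family FF dB d0 x e0.
apply: filterS (filterI (filterI FRe dB) dx) => t [[ct dt] h].
rewrite l2_normE lecR.
suff -> : evol c t x - x = diag (d t) x by [].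
by apply: l2_ext => n; rewrite l2B evolE // (diag_boundE dt) /d; ring.
Qed.

Hypothesis c0 : c != 0.
Hypothesis Fneq0 : \forall t \near F, t != 0.

(** Entrywise, the difference quotient is [1 + d t n] times the entry of c H x, where [d] is bounded
    by 3 and tends to 0, so [diag_family] gives the limit on the domain. Conversely the limit has
    the entries of c H x, and its mere existence in l2 puts [x] in the domain. *)
Lemma evol_generator x y : (in_diag level x /\ c *: diag level x = y) <->
  (t%:C%C^-1 *: (evol c t x - x) @[t --> F] --> y).
Proof.
(* The eigenvalue 0 is set apart since it would be a denominator. *)
pose d t n := if n == 0%N then 0 else
  (cexp (c * t%:C%C * level n) - 1 - c * t%:C%C * level n) / (c * t%:C%C * level n).
have level0 n : n != 0%N -> level n != 0.
  by move=> n0; rewrite fmorph_eq0 mulf_neq0 ?pnatr_eq0 // gt_eqF.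
have w0 t n : t != 0 -> n != 0%N -> c * t%:C%C * level n != 0.
  by move=> t0 n0; rewrite !mulf_neq0 ?level0 // fmorph_eq0.
have dB : \forall t \near F, forall n, cabs (d t n) <= 3.
  apply: filterS (filterI FRe Fneq0) => t [ct t0] n; rewrite /d.
  case: ifPn => n0; first by rewrite cabs0.
  rewrite cabsM cabsV ler_pdivrMr ?cabs_gt0 ?w0 //; apply: le_trans (cabsB _ _) _.
  by have := cexp_sub1 (Re_mul_level n ct); lra.
have d0 n (e : R) : 0 < e -> \forall t \near F, cabs (d t n) <= e.
  move=> e0; have [r r0 rP] := cexp_estimate e0.
  apply: filterS (filterI Fneq0 (Fsmall n r0)) => t [t0 te].
  rewrite /d; case: ifPn => n0; first by rewrite cabs0 ltW.
  by rewrite cabsM cabsV ler_pdivrMr ?cabs_gt0 ?w0 //; exact: rP.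
have quot t n : t != 0 -> complex.Re (c * t%:C%C) <= 0 ->
    (t%:C%C^-1 *: (evol c t x - x)) n = (1 + d t n) * (c * level n * x n).
  move=> t0 ct; rewrite l2Z l2B evolE // /d; have t0' : t%:C%C != 0 :> C by rewrite fmorph_eq0.
  case: ifPn => [/eqP ->|n0]; first by rewrite /level mul0r !(mulr0, mul0r) cexp0 mul1r subrr mulr0.
  have fieldE (l t1 E z : C) : l != 0 -> t1 != 0 ->
      t1^-1 * (E * z - z) = (1 + (E - 1 - c * t1 * l) / (c * t1 * l)) * (c * l * z).
    by move=> l0 t10; field; rewrite l0 c0 t10.
  by apply: fieldE => //; exact: level0.
split=> [[xD <-]|].
  apply/cvg_dist_realP => e e0.
  have dx := diag_family FF dB d0 (c *: diag level x) e0.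
  apply: filterS (filterI (filterI (filterI FRe Fneq0) dB) dx) => t [[[ct t0] dt] h].
  rewrite l2_normE lecR.
  suff -> : t%:C%C^-1 *: (evol c t x - x) - c *: diag level x = diag (d t) (c *: diag level x) by [].
  apply: l2_ext => n; rewrite l2B quot // (diag_boundE dt) l2Z (diagE _ xD); ring.
move=> /cvg_dist_realP xy.
have yE n : y n = c * level n * x n.
  apply/eqP; rewrite -subr_eq0; apply/eqP.
  apply: (@small_cabs_eq0 _ _ (1 + cabs (c * level n * x n))) => e e0.
  have [t [[[ct t0] te] h]] := filter_ex (filterI (filterI (filterI FRe Fneq0) (d0 n e e0)) (xy e e0)).
  move: h; rewrite l2_normE lecR => /(le_trans (l2_coord _ n)); rewrite l2B quot // => h.
  have -> : y n - c * level n * x n = d t n * (c * level n * x n) -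
    ((1 + d t n) * (c * level n * x n) - y n) by ring.
  apply: le_trans (cabsB _ _) _; rewrite cabsM [leRHS]mulrDl mul1r [leRHS]addrC.
  by apply: lerD => //; rewrite mulrC ler_wpM2l ?cabs_ge0.
have xD : in_diag level x by exists (c^-1 *: y) => n; rewrite l2Z yE; field.
by split=> //; apply: l2_ext => n; rewrite l2Z (diagE _ xD) yE mulrA.
Qed.

End AtZero.

Lemma Re_imaginary (t : R) : complex.Re ('i%C * t%:C%C) <= 0.
Proof. by rewrite /= mul0r mulr0 subrr. Qed.

Lemma evol_unitary_norm t x : norm (evol 'i%C t x) = norm x.
Proof.
apply/eqP; rewrite eq_le evol_norm ?Re_imaginary //=.
have := evolD x (Re_imaginary (- t)) (Re_imaginary t); rewrite addNr evol0 => {1}->.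
by apply: evol_norm; exact: Re_imaginary.
Qed.

Lemma near0_small (e : R) : 0 < e -> \forall t \near (0 : R)^', `|t| <= e.
Proof. by move=> e0; apply: dnbhs0_le. Qed.

Lemma hamiltonian_group : exp_group hamiltonian (evol 'i%C).
Proof.
split=> [t|x|s t x|x t|x y].
- exact/evol_bounded/Re_imaginary.
- exact: evol0.
- by apply: evolD; exact: Re_imaginary.
- apply/cvg_dist_realP => e e0.
  have : evol 'i%C s x @[s --> nbhs (0 : R)] --> x.
    apply: evol_cvg; first by apply: nearW => s; exact: Re_imaginary.
    by move=> e1 e10; exact: (@nbhs0_le R R).
  move=> /cvg_dist_realP /(_ e e0) h.
  have /nbhs_ballP[r r0 rP] := h; apply/nbhs_ballP; exists r => // s ts.
  have := rP (s - t); rewrite /ball /= sub0r opprB => /(_ ts).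
  rewrite !l2_normE !lecR => h1.
  have -> : evol 'i%C s x = evol 'i%C t (evol 'i%C (s - t) x).
    by rewrite -evolD ?Re_imaginary // addrC subrK.
  rewrite (linear_subE (evol_linear (Re_imaginary t))).
  by apply: le_trans h1; apply: evol_norm; exact: Re_imaginary.
- apply: (@evol_generator 'i%C (0 : R)^') => //.
  + by apply: nearW => s; exact: Re_imaginary.
  + exact: near0_small.
  + by rewrite -cabs_gt0 cabs_i.
  + exact: nbhs_dnbhs_neq.
Qed.

Lemma Re_m1 (t : R) : 0 <= t -> complex.Re (-1 * t%:C%C) <= 0.
Proof. by rewrite mulN1r /= oppr_le0. Qed.

Lemma hamiltonian_semigroup : exp_semigroup hamiltonian (evol (-1)).
Proof.
have Fpos : \forall t \near (0 : R)^'+, complex.Re (-1 * t%:C%C) <= 0.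
  by near=> t; apply: Re_m1; apply: ltW.
have Fsmall (e : R) : 0 < e -> \forall t \near (0 : R)^'+, `|t| <= e.
  move=> e0; near=> t; rewrite ger0_norm; last exact: ltW.
  by near: t; exact: nbhs_right_le.
split=> [t t0|x|s t x s0 t0|x|x y].
- exact/evol_bounded/Re_m1.
- exact: evol0.
- by apply: evolD; exact: Re_m1.
- exact: evol_cvg.
- rewrite -evol_generator //; last by near=> t; rewrite gt_eqF.
    by rewrite scaleN1r.
Unshelve. all: by end_near.
Qed.

Lemma in_diag_finite d (x : V) N : (forall n, (N <= n)%N -> x n = 0) -> in_diag d x.
Proof.
move=> x0; pose d1 n := if (n < N)%N then d n else 0.
have d1B n : cabs (d1 n) <= \sum_(i < N) cabs (d i).
  rewrite /d1; case: ifP => nN; last by rewrite cabs0 sumr_ge0 // => i _; exact: cabs_ge0.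
  by rewrite (bigD1 (Ordinal nN)) //= lerDl sumr_ge0 // => i _; exact: cabs_ge0.
exists (diag d1 x) => n; rewrite (diag_boundE d1B) /d1; case: ltnP => // nN.
by rewrite x0 // !mulr0.
Qed.

Lemma dense_realP (W : normedModType C) (S : set W) :
  (forall x (e : R), 0 < e -> exists2 y, S y & `|x - y| <= e%:C%C) -> dense S.
Proof.
move=> SP O [x Ox] oO; have /nbhs_ballP[e' /gt0_complexP[e e0 ->] eP] : nbhs x O by exact: open_nbhs_nbhs.
have [y Sy xy] := SP x (e / 2) (divr_gt0 e0 (ltr0n R 2)).
exists y; split=> //; apply: eP; rewrite -ball_normE /=; apply: le_lt_trans xy _.
by rewrite ltcR; lra.
Qed.

Lemma level_delta n : in_diag level (l2_delta R n).
Proof. by apply: (@in_diag_finite _ _ n.+1) => m nm; rewrite l2_deltaE gtn_eqF. Qed.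

(** Testing the adjoint relation on the vectors delta_n determines [w] entry by entry, and [w] being
    in l2 says that [y] is in the domain. *)
Lemma hamiltonian_self_adjoint : self_adjoint hamiltonian.
Proof.
split=> [||z x y xD yD|y w].
- split=> [|z x y [x1 xP] [y1 yP]].
    by exists 0 => n; rewrite !l20 mulr0.
  by exists (z *: x1 + y1) => n; rewrite !l2D !l2Z xP yP; ring.
- apply: dense_realP => x e e0; have [N NP] := l2_tail x e0.
  exists (x - diag (above R N) x).
    apply: (@in_diag_finite _ _ N) => n nN.
    by rewrite l2B (diag_boundE (above_le1 R N)) /above nN mul1r subrr.
  by rewrite opprB addrC subrK l2_normE lecR.
- apply: diag_eq => n; rewrite -[RHS]/(level n * (z * x n + y n)).
  rewrite -[LHS]/(z * diag level x n + diag level y n) !diagE //; ring.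
split=> [h|[yD <-] x xD].
  have wE n : w n = level n * y n.
    have := h _ (level_delta n); rewrite /= l2_dotC [RHS]l2_dotC.
    have -> : diag level (l2_delta R n) = level n *: l2_delta R n.
      apply: diag_eq => m; rewrite l2Z l2_deltaE; case: eqP => [->//|_]; by rewrite !mulr0.
    move=> /(can_inj (@conjcK R)); rewrite l2_dot_delta => <-.
    rewrite l2_dotC -[level n *: _]addr0 l2_dot_linearl linear0l addr0 l2_dotC l2_dot_delta.
    have conjM (a b : C) : (a * b^*%C)^*%C = a^*%C * b by case: a b => [a1 a2] [b1 b2]; apply: complex_ext => /=; ring.
    by rewrite conjM /level conjc_real.
  split; first by exists w.
  by apply: diag_eq => n; rewrite wE.
apply: l2_dot_eq; apply: eq_has_csum (l2_dotP _ _) => n /=.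
have levelJ (a : R) (z : C) : (a%:C * z)^*%C = a%:C%C * z^*%C.
  by case: z => b1 b2; apply: complex_ext => /=; ring.
rewrite !diagE // /level levelJ; ring.
Qed.

Lemma hamiltonian_positive : positive_operator hamiltonian.
Proof.
move=> x xD; apply: (has_csum_ge0 (l2_dotP _ _)) => n /=.
by rewrite diagE // -mulrA mulr_ge0 ?level_ge0 // -sqr_normc exprn_ge0.
Qed.

Lemma hamiltonian_eigenvalue : smallest_eigenvalue hamiltonian 0.
Proof.
split=> [|m [x [x0 xD xE]]].
  exists (l2_delta R 0); split=> [||/=].
  - by apply/eqP => /(congr1 norm); rewrite l2_norm_delta l2_norm0; lra.
  - exact: level_delta.
  apply: diag_eq => n; rewrite scale0r l20 l2_deltaE; case: eqP => [->|_]; last by rewrite mulr0.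
  by rewrite /level mul0r mul0r.
have [n xn] : exists n, x n != 0.
  apply: contrapT => /forallNP nx; move/eqP: x0; apply; apply: l2_ext => n.
  by apply/eqP; have := nx n; move/negP; rewrite negbK.
suff -> : m = level n by exact: level_ge0.
have := congr1 (fun v : V => v n) xE; rewrite /= diagE // => /esym.
exact: mulIf.
Qed.

End Hamiltonian.

(** * The algebra of families of compact operators and its flow *)

Section LocallyConstant.
Variables (R : realType) (k : fieldType) (iota : {rmorphism k -> R[i]}).
Local Notation C := R[i].

Lemma embedding_char0 : [pchar k] =i pred0.
Proof.
move=> p; apply/negbTE/negP => /andP[p_pr /eqP p0].
have : iota p%:R = 0 by rewrite p0 rmorph0.
by rewrite rmorph_nat => /eqP; rewrite pnatr_eq0; case: (p) p_pr.
Qed.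

Definition galois_pred : pred (C -> C) := fun g => `[< abelian_galois iota g >].

Record galois_type := GaloisElt { galois_fun :> C -> C; galoisP : galois_pred galois_fun }.

HB.instance Definition _ := [isSub for galois_fun].

Local Notation G := galois_type.
Local Notation Kab := (maximal_abelian iota).

Lemma galois_elt (g : G) : abelian_galois iota g. Proof. exact/asboolP/galoisP. Qed.

Lemma galois_ext (g h : G) : (forall z, Kab z -> g z = h z) -> g = h.
Proof. by move=> gh; apply/val_inj/(abelian_galois_ext (galois_elt g) (galois_elt h)). Qed.

Definition galois_mk g (gG : abelian_galois iota g) : G := GaloisElt (introT (asboolP _) gG).

Definition galois_one : G := galois_mk (abelian_galois_id iota).

(* The junk value at a non-Galois g makes translation a total operation.       *)
Definition translate (g : C -> C) (h : G) : G := insubd h (h \o g).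

Lemma translateE g h : abelian_galois iota g -> translate g h = h \o g :> (C -> C).
Proof.
move=> gG; rewrite /translate insubdK //.
by apply/asboolP; apply: abelian_galois_comp => //; exact: galois_elt.
Qed.

Definition hat (z : C) : G -> C := fun g => g z.

Lemma hatD z w : Kab z -> Kab w -> hat (z + w) = hat z \+ hat w.
Proof.
move=> Kz Kw; apply/funext => g; have [_ gD _ _ _] := galois_elt g.
by rewrite /hat (gD _ _ (mem_set Kz) (mem_set Kw)).
Qed.

Lemma hatM z w : Kab z -> Kab w -> hat (z * w) = hat z \* hat w.
Proof.
move=> Kz Kw; apply/funext => g; have [_ _ gM _ _] := galois_elt g.
by rewrite /hat (gM _ _ (mem_set Kz) (mem_set Kw)).
Qed.

Lemma hat_iota c : hat (iota c) = cst (iota c).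
Proof. by apply/funext => g; have [_ _ _ gk _] := galois_elt g; rewrite /hat gk. Qed.

(** Local constancy for the Krull topology, expressed without it: the value depends on the action of
    [g] on finitely many elements of K^ab. *)
Definition locconst (u : G -> C) := exists2 s : seq C, (forall z, z \in s -> Kab z) &
  forall g h : G, (forall z, z \in s -> g z = h z) -> u g = u h.

Lemma locconst_cst c : locconst (cst c). Proof. by exists [::]. Qed.

Lemma locconst_map2 (f : C -> C -> C) u v : locconst u -> locconst v ->
  locconst (fun g => f (u g) (v g)).
Proof.
move=> [s sK us] [t tK vt]; exists (s ++ t) => [z|g h gh].
  by rewrite mem_cat => /orP[/sK|/tK].
by rewrite (us g h) 1?(vt g h) // => z zs; apply: gh; rewrite mem_cat zs ?orbT.
Qed.

Lemma locconst_map (f : C -> C) u : locconst u -> locconst (f \o u).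
Proof. by move=> uL; exact: (locconst_map2 (fun a _ => f a) uL uL). Qed.

Lemma locconst_hat z : Kab z -> locconst (hat z).
Proof.
move=> Kz; exists [:: z] => [w|g h gh]; first by rewrite inE => /eqP ->.
by apply: gh; rewrite inE.
Qed.

Lemma locconst_translate g u : abelian_galois iota g -> locconst u -> locconst (u \o translate g).
Proof.
move=> gG [s sK us]; exists (map g s) => [z /mapP[w /sK Kw ->]|h1 h2 h12 /=].
  exact: abelian_galois_sub.
by apply: us => z zs; rewrite !translateE //=; apply: h12; exact: map_f.
Qed.

Definition spanned (u : G -> C) := exists2 s : seq (C * C), (forall p, p \in s -> Kab p.2) &
  forall g, u g = \sum_(p <- s) p.1 * g p.2.

Lemma spannedZ c z : Kab z -> spanned (fun g => c * g z).
Proof.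
move=> Kz; exists [:: (c, z)] => [p|g]; first by rewrite inE => /eqP ->.
by rewrite big_seq1.
Qed.

Lemma spanned_cst c : spanned (cst c).
Proof.
have := spannedZ c (maximal_abelian_iota iota embedding_char0 1).
rewrite (_ : (fun g => _) = cst c) //; apply/funext => g.
by rewrite -/(hat _ g) hat_iota rmorph1 /= mulr1.
Qed.

Lemma spannedD u v : spanned u -> spanned v -> spanned (u \+ v).
Proof.
move=> [s sK us] [t tK vt]; exists (s ++ t) => [p|g].
  by rewrite mem_cat => /orP[/sK|/tK].
by rewrite big_cat /= us vt.
Qed.

Lemma spannedM u v : spanned u -> spanned v -> spanned (u \* v).
Proof.
move=> [s sK us] [t tK vt]; exists [seq (p.1 * q.1, p.2 * q.2) | p <- s, q <- t] => [p|g].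
  move=> /allpairsP[[p1 q1] /= [ps qt ->]] /=.
  by apply: (maximal_abelianM embedding_char0); [exact: sK|exact: tK].
rewrite big_allpairs_dep /= us vt big_distrlr /=.
rewrite big_seq [RHS]big_seq; apply: eq_bigr => p /sK Kp.
rewrite big_seq [RHS]big_seq; apply: eq_bigr => q /tK Kq.
by have [_ _ gM _ _] := galois_elt g; rewrite (gM _ _ (mem_set Kp) (mem_set Kq)); ring.
Qed.

(** Lagrange interpolation at the finitely many conjugates of [z]. *)
Lemma spanned_indicator z v : Kab z -> spanned (fun g => (g z == v)%:R).
Proof.
move=> Kz; have [s sP] := abelian_galois_orbit Kz.
have pi (r : seq C) : spanned (fun g => \prod_(w <- r | w != v) ((g z - w) / (v - w))).
  elim: r => [|w r IHr].
    by rewrite (_ : (fun g => _) = cst 1); [exact: spanned_cst|apply/funext => g; rewrite big_nil].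
  have [wv|wv] := eqVneq w v.
    rewrite (_ : (fun g => _) = (fun g : G => \prod_(w <- r | w != v) ((g z - w) / (v - w)))) //.
    by apply/funext => g; rewrite big_cons wv eqxx.
  have := spannedM (spannedD (spannedZ (v - w)^-1 Kz) (spanned_cst (- w / (v - w)))) IHr.
  rewrite (_ : _ \* _ = (fun g : G => \prod_(w <- w :: r | w != v) ((g z - w) / (v - w)))) //.
  by apply/funext => g /=; rewrite big_cons wv; congr (_ * _); rewrite mulrBl mulNr mulrC.
have := pi s; rewrite (_ : (fun g => _) = (fun g : G => (g z == v)%:R)) //.
apply/funext => g; case: eqP => [->|/eqP gv].
  by rewrite big1 // => w wv; rewrite divff // subr_eq0 eq_sym.
apply/eqP; rewrite prodf_seq_eq0; apply/hasP; exists (g z); first exact/sP/galois_elt.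
by rewrite gv subrr mul0r /=.
Qed.

(* Induction on the list: u is the sum over the values v of g z of the         *)
(* indicator of g z = v times a function of the remaining coordinates.         *)
Lemma locconst_spanned u : locconst u -> spanned u.
Proof.
move=> [s]; elim: s u => [u _ us|z s IHs u sK us].
  rewrite (_ : u = cst (u galois_one)); first exact: spanned_cst.
  by apply/funext => g; exact: us.
have Kz : Kab z by apply: sK; rewrite inE eqxx.
have [r rP] := abelian_galois_orbit Kz.
pose uv v g := xget 0 [set c | exists h : G, [/\ h z = v, forall w, w \in s -> h w = g w & c = u h]].
have uvs v : spanned (uv v).
  apply: IHs => [w ws|g h gh]; first by apply: sK; rewrite inE ws orbT.
  rewrite /uv; congr xget; apply/seteqP; split=> c [l [lv ls ->]]; exists l; split=> // w ws.
    by rewrite ls ?gh.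
  by rewrite ls ?gh.
have : spanned (fun g => \sum_(v <- undup r) (g z == v)%:R * uv v g).
  elim: (undup r) => [|v l IHl].
    by rewrite (_ : (fun g => _) = cst 0); [exact: spanned_cst|apply/funext => g; rewrite big_nil].
  have := spannedD (spannedM (spanned_indicator v Kz) (uvs v)) IHl.
  by congr spanned; apply/funext => g /=; rewrite big_cons.
congr spanned; apply/funext => g.
have gr : g z \in undup r by rewrite mem_undup; exact/rP/galois_elt.
rewrite (bigD1_seq (g z)) ?undup_uniq //= eqxx mul1r big1 ?addr0 => [|v]; last first.
  by rewrite eq_sym => /negPf ->; rewrite mul0r.
have agree c : (exists h : G, [/\ h z = g z, forall w, w \in s -> h w = g w & c = u h]) -> c = u g.
  move=> [h [hz hs ->]]; apply: us => w; rewrite inE => /orP[/eqP -> //|]; exact: hs.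
rewrite /uv; case: xgetP => [c _ /agree//|/(_ (u g))[]]; by exists g.
Qed.

Lemma locconst_bounded u : locconst u -> exists2 B : R, 0 <= B & forall g, cabs (u g) <= B.
Proof.
move=> /locconst_spanned[s]; elim: s u => [|[c z] s IHs] u sK us.
  by exists 0 => // g; rewrite us big_nil cabs0.
have Kz : Kab z by apply: (sK (c, z)); rewrite inE eqxx.
have [r rP] := abelian_galois_orbit Kz.
have [B B0 BP] := IHs (fun g => \sum_(p <- s) p.1 * g p.2)
  (fun p ps => sK p (ltac:(by rewrite inE ps orbT))) (fun=> erefl).
have r0 : 0 <= \sum_(w <- r) cabs w by apply: sumr_ge0 => w _; exact: cabs_ge0.
exists (cabs c * \sum_(w <- r) cabs w + B) => [|g].
  by rewrite addr_ge0 // mulr_ge0 ?cabs_ge0.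
rewrite us big_cons /=; apply: le_trans (cabsD _ _) _; apply: lerD => //.
rewrite cabsM ler_wpM2l ?cabs_ge0 //.
have gr : g z \in r by exact/rP/galois_elt.
by rewrite (big_rem (g z)) //= lerDl sumr_ge0 // => w _; exact: cabs_ge0.
Qed.

End LocallyConstant.

Lemma l2_norm_le0 (R : realType) (x : l2 R) (K : R) :
  (forall e : R, 0 < e -> l2_norm x <= K * e) -> x = 0.
Proof.
move=> xe; apply: l2_norm_eq0.
have := @small_cabs_eq0 R (l2_norm x)%:C%C K; rewrite cabs_real ger0_norm ?l2_norm_ge0 //.
by move=> /(_ xe) /(congr1 (@complex.Re R)).
Qed.

Lemma l2_dotDl (R : realType) (x y z : l2 R) : l2_dot (x + y) z = l2_dot x z + l2_dot y z.
Proof. by have := l2_dot_linearl 1 x y z; rewrite scale1r mul1r. Qed.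

Lemma l2_dotDr (R : realType) (x y z : l2 R) : l2_dot z (x + y) = l2_dot z x + l2_dot z y.
Proof. by rewrite l2_dotC l2_dotDl rmorphD /= -!l2_dotC. Qed.

Lemma l2_adjoint_bound (R : realType) (T : l2 R -> l2 R) y w (B : R) : 0 <= B ->
  (forall x, l2_norm (T x) <= B * l2_norm x) ->
  (forall x, l2_dot (T x) y = l2_dot x w) -> l2_norm w <= B * l2_norm y.
Proof.
move=> B0 TB /(_ w) Tw; have [w0|w0] := eqVneq (l2_norm w) 0.
  by rewrite w0 mulr_ge0 ?l2_norm_ge0.
have {}w0 : 0 < l2_norm w by rewrite lt_neqAle l2_norm_ge0 andbT eq_sym.
rewrite -(ler_pM2l w0) -expr2.
have -> : l2_norm w ^+ 2 = cabs (l2_dot (T w) y).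
  by rewrite Tw -l2_norm_sqr cabs_real ger0_norm // sqr_ge0.
apply: le_trans (l2_cauchy_schwarz _ _) _.
by rewrite mulrA ler_wpM2r ?l2_norm_ge0 // mulrC; exact: TB.
Qed.

(** * Finite matrices over the Galois group and their norm closure *)

Section Algebra.
Variables (R : realType) (k : fieldType) (iota : {rmorphism k -> R[i]}).
Local Notation C := R[i].
Local Notation G := (galois_type iota).
Local Notation V := (l2 R).
Local Notation dot := (@l2_dot R).
Local Notation norm := (@l2_norm R).
Local Notation family := (G -> V -> V).
Implicit Types (a b : family) (g : G) (u : G -> C).

(** The matrix E_mn(u), acting on l2 at each [g]. *)
Definition unit_family m n u : family := fun g x => (u g * x n) *: l2_delta R m.

(** [U] is the set of admissible entries: all locally constant functions for the dense subalgebra of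
    analytic elements, the functions [hat z] for the arithmetic subalgebra. *)
Inductive finite_family (U : set (G -> C)) : family -> Prop :=
| FiniteZero : finite_family U (fun _ _ => 0)
| FiniteAdd m n u b : U u -> finite_family U b ->
    finite_family U (fun g x => unit_family m n u g x + b g x).

Local Notation fin := (finite_family (@locconst R k iota)).

Lemma unit_family_linear m n u g : linear (unit_family m n u g).
Proof. by move=> c x y; rewrite /unit_family l2D l2Z scalerA -scalerDl; congr (_ *: _); ring. Qed.

Lemma unit_family_norm m n u g x : norm (unit_family m n u g x) <= cabs (u g) * norm x.
Proof.
by rewrite /unit_family l2_normZ l2_norm_delta mulr1 cabsM ler_wpM2l ?cabs_ge0 // l2_coord.
Qed.

Lemma unit_family_adjoint m n u g x y :
  dot (unit_family m n u g x) y = dot x (unit_family n m (fun h => (u h)^*%C) g y).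
Proof.
rewrite /unit_family -[_ *: _ in LHS]addr0 l2_dot_linearl linear0l addr0.
rewrite l2_dotC l2_dot_delta (l2_dotC x) -[_ *: _ in RHS]addr0 l2_dot_linearl linear0l addr0.
rewrite l2_dotC l2_dot_delta; case: (u g) (x n) (y m) => [a1 a2] [b1 b2] [c1 c2].
by apply: complex_ext => /=; ring.
Qed.

Lemma unit_familyM m n u p q v g x : unit_family m n u g (unit_family p q v g x) =
  (n == p)%:R *: unit_family m q (u \* v) g x.
Proof.
rewrite /unit_family l2Z l2_deltaE scalerA; congr (_ *: _) => /=; ring.
Qed.

Section FiniteFamilies.
Variable U : set (G -> C).

Lemma finite_family_linear b g : finite_family U b -> linear (b g).
Proof.
elim=> [|m n u b1 _ _ IHb] c x y; first by rewrite scaler0 addr0.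
by rewrite unit_family_linear IHb scalerDr addrACA.
Qed.

Lemma finite_familyD a b : finite_family U a -> finite_family U b ->
  finite_family U (fun g x => a g x + b g x).
Proof.
move=> + bF; elim=> [|m n u a1 Uu _ IHa].
  by rewrite (_ : (fun _ _ => _) = b) //; apply/funext => g; apply/funext => x; rewrite add0r.
rewrite (_ : (fun _ _ => _) = (fun g x => unit_family m n u g x + (a1 g x + b g x))).
  exact: FiniteAdd.
by apply/funext => g; apply/funext => x; rewrite addrA.
Qed.

(** One induction for scalar multiples, the flow, translations and localizations, all of which act
    on matrix entries. *)
Lemma finite_family_map (f : family -> family) (f1 : nat -> nat -> (G -> C) -> G -> C)
    (r : bool) :
  (f (fun _ _ => 0) = fun _ _ => 0) ->
  (forall m n u b, f (fun g x => unit_family m n u g x + b g x) = fun g x =>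
     (if r then unit_family n m (f1 m n u) else unit_family m n (f1 m n u)) g x + f b g x) ->
  (forall m n u, U u -> U (f1 m n u)) ->
  forall b, finite_family U b -> finite_family U (f b).
Proof.
move=> f0 fD Uf b; elim=> [|m n u b1 Uu _ IHb]; first by rewrite f0; exact: FiniteZero.
by rewrite fD; case: (r); apply: FiniteAdd => //; exact: Uf.
Qed.

Lemma finite_familyM : (forall u v, U u -> U v -> U (u \* v)) ->
  forall a b, finite_family U a -> finite_family U b -> finite_family U (fun g x => a g (b g x)).
Proof.
move=> UM a b + bF; elim=> [|m n u a1 Uu _ IHa]; first exact: FiniteZero.
apply: (finite_familyD _ IHa); elim: bF => [|p q v b1 Uv _ IHb].
  rewrite (_ : (fun _ _ => _) = fun _ _ => 0); first exact: FiniteZero.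
  by apply/funext => g; apply/funext => x; rewrite /unit_family l20 mulr0 scale0r.
rewrite (_ : (fun _ _ => _) = fun g x => unit_family m n u g (unit_family p q v g x) +
    unit_family m n u g (b1 g x)).
  apply: (finite_familyD _ IHb); have [np|np] := eqVneq n p.
    rewrite (_ : (fun _ _ => _) = fun g x => unit_family m q (u \* v) g x + 0).
      by apply: FiniteAdd; [exact: UM|exact: FiniteZero].
    by apply/funext => g; apply/funext => x; rewrite unit_familyM np eqxx scale1r addr0.
  rewrite (_ : (fun _ _ => _) = fun _ _ => 0); first exact: FiniteZero.
  by apply/funext => g; apply/funext => x; rewrite unit_familyM (negPf np) scale0r.
apply/funext => g; apply/funext => x.
by have := unit_family_linear m n u g 1 (unit_family p q v g x) (b1 g x); rewrite !scale1r.
Qed.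

End FiniteFamilies.

Lemma finite_family_sub (U W : set (G -> C)) b : (forall u, U u -> W u) ->
  finite_family U b -> finite_family W b.
Proof. by move=> UW; elim=> [|m n u b1 /UW Wu _ IHb]; [exact: FiniteZero|exact: FiniteAdd]. Qed.

Lemma finZ c b : fin b -> fin (fun g x => c *: b g x).
Proof.
apply: (@finite_family_map _ (fun b g x => c *: b g x) (fun _ _ u g => c * u g) false).
- by apply/funext => g; apply/funext => x; rewrite scaler0.
- move=> m n u b1; apply/funext => g; apply/funext => x.
  by rewrite scalerDr /unit_family scalerA mulrA.
- by move=> m n u; exact: (@locconst_map _ _ _ (fun z => c * z)).
Qed.

Lemma fin_bounded b : fin b -> exists2 B : R, 0 <= B & forall g x, norm (b g x) <= B * norm x.
Proof.
elim=> [|m n u b1 uL _ [B B0 BP]]; first by exists 0 => // g x; rewrite mul0r l2_norm0.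
have [D D0 DP] := locconst_bounded uL; exists (D + B) => [|g x]; first exact: addr_ge0.
apply: le_trans (l2_normD _ _) _; rewrite mulrDl.
apply: lerD; last exact: BP.
by apply: le_trans (unit_family_norm _ _ _ _ _) _; rewrite ler_wpM2r ?l2_norm_ge0.
Qed.

Lemma fin_adjoint b : fin b -> exists2 b', fin b' & forall g x y, dot (b g x) y = dot x (b' g y).
Proof.
elim=> [|m n u b1 uL _ [b' bF bP]].
  by exists (fun _ _ => 0); [exact: FiniteZero|move=> g x y; rewrite linear0l linear0r].
exists (fun g x => unit_family n m (fun h => (u h)^*%C) g x + b' g x).
  by apply: FiniteAdd => //; exact: (locconst_map (@conjc R) uL).
by move=> g x y; rewrite l2_dotDl l2_dotDr -unit_family_adjoint -bP.
Qed.

Definition in_algebra : {pred family} := fun a => `[< forall e : R, 0 < e ->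
  exists2 b, fin b & forall g x, norm (a g x - b g x) <= e * norm x >].

Lemma in_algebraP a : reflect (forall e : R, 0 < e ->
  exists2 b, fin b & forall g x, norm (a g x - b g x) <= e * norm x) (a \in in_algebra).
Proof. exact: asboolP. Qed.

Lemma fin_in_algebra b : fin b -> b \in in_algebra.
Proof.
move=> bF; apply/in_algebraP => e e0; exists b => // g x.
by rewrite subrr l2_norm0 mulr_ge0 ?l2_norm_ge0 ?ltW.
Qed.

Lemma in_algebra_bounded a : a \in in_algebra ->
  exists2 B : R, 0 <= B & forall g x, norm (a g x) <= B * norm x.
Proof.
move=> /in_algebraP /(_ 1 ltr01) [b bF bP]; have [B B0 BP] := fin_bounded bF.
exists (1 + B) => [|g x]; first by rewrite addr_ge0.
rewrite -(subrK (b g x) (a g x)); apply: le_trans (l2_normD _ _) _.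
by rewrite mulrDl lerD.
Qed.

Lemma in_algebra_linear a g : a \in in_algebra -> linear (a g).
Proof.
move=> /in_algebraP aA c x y; apply/eqP; rewrite -subr_eq0; apply/eqP.
apply: (@l2_norm_le0 _ _ (norm (c *: x + y) + cabs c * norm x + norm y)) => e e0.
have [b bF bP] := aA e e0; have linb := finite_family_linear g bF.
have -> : a g (c *: x + y) - (c *: a g x + a g y) =
    (a g (c *: x + y) - b g (c *: x + y)) - (c *: (a g x - b g x) + (a g y - b g y)).
  apply: l2_ext => n; rewrite linb !(l2B, l2D, l2Z); ring.
apply: le_trans (l2_normD _ _) _; rewrite l2_normN.
have h1 := bP g (c *: x + y); have h2 := bP g x; have h3 := bP g y.
have h4 := l2_normD (c *: (a g x - b g x)) (a g y - b g y).
have h5 : norm (c *: (a g x - b g x)) <= cabs c * (e * norm x).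
  by rewrite l2_normZ ler_wpM2l ?cabs_ge0.
lra.
Qed.

Lemma in_algebra_submod : submod_closed in_algebra.
Proof.
split=> [|c a a' /in_algebraP aA /in_algebraP aA']; first exact/fin_in_algebra/FiniteZero.
apply/in_algebraP => e e0; pose d := e / (cabs c + 1).
have c0 : 0 < cabs c + 1 by rewrite ltr_wpDl ?cabs_ge0.
have d0 : 0 < d by rewrite divr_gt0.
have [b bF bP] := aA d d0; have [b' bF' bP'] := aA' d d0.
exists (fun g x => c *: b g x + b' g x); first exact: (finite_familyD (finZ c bF) bF').
move=> g x; rewrite (_ : _ - _ = c *: (a g x - b g x) + (a' g x - b' g x)); last first.
  rewrite -[(c *: a + a') g x]/(c *: a g x + a' g x).
  by apply: l2_ext => n; rewrite !(l2B, l2D, l2Z); ring.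
apply: le_trans (l2_normD _ _) _; rewrite l2_normZ.
have -> : e * norm x = cabs c * (d * norm x) + d * norm x by rewrite /d; field; rewrite gt_eqF.
by apply: lerD => //; rewrite ler_wpM2l ?cabs_ge0.
Qed.

Definition adjoint_family a : family := fun g y =>
  xget 0 [set w | forall x, dot (a g x) y = dot x w].

(** Finite families have explicit adjoints; along finite approximations of [a] their values at [y]
    form a Cauchy sequence, and its limit is the vector sought. The constant [K] normalizes the
    approximations to the rate asked by [l2_seq_complete]. *)
Lemma adjoint_exists a g y : a \in in_algebra -> exists w, forall x, dot (a g x) y = dot x w.
Proof.
move=> /in_algebraP aA; pose K := 2 * (norm y + 1).
have K0 : 0 < K by rewrite mulr_gt0 // ltr_wpDl ?l2_norm_ge0.
pose e j : R := K^-1 * j.+1%:R^-1; have e0 j : 0 < e j by rewrite mulr_gt0 ?invr_gt0.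
have /choice[b bP] j : exists b, [/\ fin b, forall x, norm (a g x - b g x) <= e j * norm x
    & exists w, forall x, dot (b g x) y = dot x w].
  have [b bF bP] := aA (e j) (e0 j); have [b' _ bE] := fin_adjoint bF.
  by exists b; split=> //; exists (b' g y).
have /choice[w wP] j : exists w, forall x, dot (b j g x) y = dot x w by case: (bP j).
have ey j : e j * norm y <= j.+1%:R^-1 / 2.
  rewrite /e mulrAC [leLHS]mulrC ler_wpM2l ?invr_ge0 //.
  by rewrite ler_pdivrMl // /K; have := l2_norm_ge0 y; lra.
have wc i j : (i <= j)%N -> `|w i - w j| <= (i.+1%:R^-1 : R)%:C%C.
  move=> ij; rewrite l2_normE lecR.
  have : norm (w i - w j) <= (e i + e j) * norm y.
    apply: (@l2_adjoint_bound _ (fun x => b i g x - b j g x)) => [|x|x].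
    - by rewrite addr_ge0 ?ltW.
    - rewrite (_ : _ - _ = (a g x - b j g x) - (a g x - b i g x)); last first.
        by apply: l2_ext => n; rewrite !l2B; ring.
      apply: le_trans (l2_normD _ _) _; rewrite l2_normN addrC mulrDl lerD //.
        by case: (bP i).
      by case: (bP j).
    - by rewrite l2_dotBl l2_dotBr !wP.
  have : j.+1%:R^-1 <= i.+1%:R^-1 :> R by rewrite lef_pV2 ?posrE // ler_nat.
  move=> ji h; apply: le_trans h _; rewrite mulrDl.
  apply: le_trans (lerD (ey i) (ey j)) _; move: ji.
  by move: (j.+1%:R^-1 : R) (i.+1%:R^-1 : R) => r1 r2 ji; lra.
have [z zP] := l2_seq_complete wc; exists z => x.
apply/eqP; rewrite -subr_eq0; apply/eqP.
apply: (@small_cabs_eq0 _ _ (norm x * (norm y + 1))) => d d0.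
have [N NP] := zP d d0.
have [j0 j0P] := eventually_small (mulr_gt0 K0 d0); pose j := maxn N j0.
have -> : dot (a g x) y - dot x z = dot (a g x - b j g x) y + dot x (w j - z).
  by rewrite l2_dotBl l2_dotBr wP; ring.
apply: le_trans (cabsD _ _) _.
have h1 := l2_cauchy_schwarz (a g x - b j g x) y; have h2 := l2_cauchy_schwarz x (w j - z).
have h3 : norm (a g x - b j g x) <= d * norm x.
  case: (bP j) => _ /(_ x) h _; apply: le_trans h _; rewrite ler_wpM2r ?l2_norm_ge0 //.
  rewrite ler_pdivrMl //; apply: le_trans j0P.
  by rewrite lef_pV2 ?posrE // ler_nat ltnS leq_maxr.
have := NP j (leq_maxl _ _); rewrite l2_normE lecR => h4.
have h5 := ler_wpM2l (l2_norm_ge0 x) h4; have h6 := ler_wpM2r (l2_norm_ge0 y) h3.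
have -> : norm x * (norm y + 1) * d = d * norm x * norm y + norm x * d by ring.
by apply: lerD; [exact: le_trans h1 h6|exact: le_trans h2 h5].
Qed.

Lemma adjoint_dot a g x y : a \in in_algebra -> dot (a g x) y = dot x (adjoint_family a g y).
Proof.
move=> aA; rewrite /adjoint_family; have [w wP] := adjoint_exists g y aA.
by case: xgetP => [v _ -> //|/(_ w)[]].
Qed.

Lemma l2_dot_ext (y z : V) : (forall x, dot x y = dot x z) -> y = z.
Proof.
move=> yz; apply/eqP; rewrite -subr_eq0; apply/eqP; apply: l2_norm_eq0.
apply/eqP; rewrite -sqrf_eq0 -(inj_eq (fmorph_inj (real_complex R))) /= l2_norm_sqr.
by rewrite l2_dotBr yz subrr.
Qed.

Lemma adjoint_family_eq a b : a \in in_algebra ->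
  (forall g x y, dot (a g x) y = dot x (b g y)) -> adjoint_family a = b.
Proof.
move=> aA ab; apply/funext => g; apply/funext => y; apply: l2_dot_ext => x.
by rewrite -adjoint_dot.
Qed.

Lemma adjoint_in_algebra a : a \in in_algebra -> adjoint_family a \in in_algebra.
Proof.
move=> aA; apply/in_algebraP => e e0; have /in_algebraP /(_ e e0)[b bF bP] := aA.
have [b' bF' bE] := fin_adjoint bF; exists b' => // g y.
apply: (@l2_adjoint_bound _ (fun x => a g x - b g x)) => // [|x]; first exact: ltW.
by rewrite l2_dotBl l2_dotBr adjoint_dot // bE.
Qed.

Definition mul_family a b : family := fun g x => a g (b g x).

Lemma mul_in_algebra a b : a \in in_algebra -> b \in in_algebra -> mul_family a b \in in_algebra.
Proof.
move=> aA bA; have [A A0 AP] := in_algebra_bounded aA; have [B B0 BP] := in_algebra_bounded bA.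
apply/in_algebraP => e e0; pose K := 2 * (A + B + 1); have K0 : 0 < K by rewrite mulr_gt0 // ltr_wpDl ?addr_ge0.
pose d := Num.min 1 (e / K).
have d0 : 0 < d by rewrite lt_min ltr01 divr_gt0.
have d1 : d <= 1 by rewrite ge_min lexx.
have dK : d * K <= e by rewrite -ler_pdivlMr // ge_min lexx orbT.
move: d d0 d1 dK => d d0 d1 dK.
have /in_algebraP /(_ d d0) [a1 aF aP] := aA; have /in_algebraP /(_ d d0) [b1 bF bP] := bA.
exists (fun g x => a1 g (b1 g x)).
  by apply: finite_familyM => // u v; exact: (@locconst_map2 _ _ _ (fun s t => s * t)).
move=> g x; rewrite /mul_family.
have -> : a g (b g x) - a1 g (b1 g x) = a g (b g x - b1 g x) + (a g (b1 g x) - a1 g (b1 g x)).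
  by rewrite -(linear_subE (in_algebra_linear g aA)) addrA subrK.
apply: le_trans (l2_normD _ _) _.
have h1 := le_trans (AP g (b g x - b1 g x)) (ler_wpM2l A0 (bP g x)).
have h2 : norm (b1 g x) <= (B + d) * norm x.
  have -> : b1 g x = b g x - (b g x - b1 g x) by apply: l2_ext => n; rewrite !l2B; ring.
  by apply: le_trans (l2_normD _ _) _; rewrite l2_normN mulrDl lerD.
have h3 := le_trans (aP g (b1 g x)) (ler_wpM2l (ltW d0) h2).
apply: le_trans (lerD h1 h3) _; rewrite !mulrA -mulrDl ler_wpM2r ?l2_norm_ge0 //.
apply: le_trans dK; have hd : d * d <= d by rewrite ler_piMl // ltW.
have hA : 0 <= d * A by rewrite mulr_ge0 // ltW.
have hB : 0 <= d * B by rewrite mulr_ge0 // ltW.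
by rewrite /K; lra.
Qed.

End Algebra.

(** * The operator norm and the structure of a C*-algebra *)

Section OperatorNorm.
Variables (R : realType) (k : fieldType) (iota : {rmorphism k -> R[i]}).
Local Notation C := R[i].
Local Notation G := (galois_type iota).
Local Notation V := (l2 R).
Local Notation dot := (@l2_dot R).
Local Notation norm := (@l2_norm R).
Local Notation family := (G -> V -> V).
Local Notation fin := (finite_family (@locconst R k iota)).

Record kms_alg := KmsAlg { alg_fun :> family; algP : alg_fun \in @in_algebra R k iota }.

HB.instance Definition _ := [isSub for alg_fun].
HB.instance Definition _ := [Choice of kms_alg by <:].
HB.instance Definition _ := GRing.isSubmodClosed.Build C family (@in_algebra R k iota)
  (@in_algebra_submod R k iota).
HB.instance Definition _ := [SubChoice_isSubLmodule of kms_alg by <:].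

Local Notation A := kms_alg.
Implicit Types (a b : A) (g : G) (x y : V).

Lemma alg_ext a b : (forall g x, a g x = b g x) -> a = b.
Proof. by move=> ab; apply/val_inj/funext => g; apply/funext => x; exact: ab. Qed.

Lemma algD a b g x : (a + b) g x = a g x + b g x. Proof. by []. Qed.
Lemma algZ c a g x : (c *: a) g x = c *: a g x. Proof. by []. Qed.
Lemma algB a b g x : (a - b) g x = a g x - b g x. Proof. by []. Qed.
Lemma alg0 g x : (0 : A) g x = 0. Proof. by []. Qed.

Lemma alg_linear a g : linear (a g).
Proof. exact/in_algebra_linear/algP. Qed.

Definition alg_norm a : R := sup [set norm (a g x) | g in setT & x in [set x | norm x <= 1]].

Lemma alg_norm_has_sup a :
  has_sup [set norm (a g x) | g in setT & x in [set x | norm x <= 1]].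
Proof.
split; first by exists (norm (a (galois_one iota) 0)), (galois_one iota) => //; exists 0; rewrite /= ?l2_norm0 ?ler01.
have [B B0 BP] := in_algebra_bounded (algP a).
exists B => _ [g _ [x /= x1 <-]]; apply: le_trans (BP g x) _.
by rewrite ler_piMr.
Qed.

Lemma alg_linear0 a g : a g 0 = 0.
Proof. by have := alg_linear a g (-1) 0 0; rewrite scaler0 addr0 scaleN1r addNr. Qed.

Lemma alg_linearZ a g c x : a g (c *: x) = c *: a g x.
Proof. by have := alg_linear a g c x 0; rewrite !addr0 alg_linear0 addr0. Qed.

Lemma alg_normP a g x : norm (a g x) <= alg_norm a * norm x.
Proof.
have [x0|x0] := eqVneq (norm x) 0.
  by rewrite (l2_norm_eq0 x0) alg_linear0 l2_norm0 mulr0.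
have {}x0 : 0 < norm x by rewrite lt_neqAle l2_norm_ge0 andbT eq_sym.
pose c : C := ((norm x)^-1)%:C%C; have cE : cabs c = (norm x)^-1.
  by rewrite cabs_real ger0_norm // invr_ge0 ltW.
rewrite -ler_pdivrMr // mulrC -cE -l2_normZ -alg_linearZ.
apply: ub_le_sup; first exact: (proj2 (alg_norm_has_sup a)).
by exists g => //; exists (c *: x) => //=; rewrite l2_normZ cE mulVf // gt_eqF.
Qed.

Lemma alg_norm_le a (B : R) : (forall g x, norm (a g x) <= B * norm x) -> alg_norm a <= B.
Proof.
move=> aB; apply: ge_sup; first exact: (proj1 (alg_norm_has_sup a)).
have B0 : 0 <= B.
  have := aB (galois_one iota) (l2_delta R 0); rewrite l2_norm_delta mulr1.
  exact/le_trans/l2_norm_ge0.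
by move=> _ [g _ [x /= x1 <-]]; apply: le_trans (aB g x) _; rewrite ler_piMr.
Qed.

Lemma alg_norm_ge0 a : 0 <= alg_norm a.
Proof.
have := alg_normP a (galois_one iota) (l2_delta R 0); rewrite l2_norm_delta mulr1.
exact/le_trans/l2_norm_ge0.
Qed.

Lemma alg_normD a b : alg_norm (a + b) <= alg_norm a + alg_norm b.
Proof.
apply: alg_norm_le => g x; rewrite algD mulrDl; apply: le_trans (l2_normD _ _) _.
by apply: lerD; exact: alg_normP.
Qed.

Lemma alg_normZ_le c a : alg_norm (c *: a) <= cabs c * alg_norm a.
Proof.
apply: alg_norm_le => g x; rewrite algZ l2_normZ -mulrA ler_wpM2l ?cabs_ge0 //.
exact: alg_normP.
Qed.

Lemma alg_normZ c a : alg_norm (c *: a) = cabs c * alg_norm a.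
Proof.
apply/eqP; rewrite eq_le alg_normZ_le /=; have [->|c0] := eqVneq c 0.
  by rewrite cabs0 mul0r alg_norm_ge0.
have := alg_normZ_le c^-1 (c *: a); rewrite scalerA mulVf // scale1r cabsV.
by rewrite ler_pdivlMl ?cabs_gt0.
Qed.

Lemma alg_norm_eq0 a : alg_norm a = 0 -> a = 0.
Proof.
move=> a0; apply: alg_ext => g x; apply: l2_norm_eq0; apply/eqP.
by rewrite eq_le l2_norm_ge0 andbT; have := alg_normP a g x; rewrite a0 mul0r.
Qed.

Definition alg_cnorm a : C := (alg_norm a)%:C%C.

Lemma alg_cnormD a b : alg_cnorm (a + b) <= alg_cnorm a + alg_cnorm b.
Proof. by rewrite -rmorphD lecR alg_normD. Qed.
Lemma alg_cnormZ c a : alg_cnorm (c *: a) = `|c| * alg_cnorm a.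
Proof. by rewrite /alg_cnorm alg_normZ rmorphM /= -cabsE. Qed.
Lemma alg_cnorm_eq0 a : alg_cnorm a = 0 -> a = 0.
Proof. by case=> /alg_norm_eq0. Qed.

HB.instance Definition _ := Lmodule_isNormed.Build C A alg_cnormD alg_cnormZ alg_cnorm_eq0.

Lemma alg_normE a : `|a| = (alg_norm a)%:C%C. Proof. by []. Qed.

Lemma alg_approx a (e : R) : 0 < e -> exists2 b : A, fin b & alg_norm (a - b) <= e.
Proof.
move=> e0; have /in_algebraP /(_ e e0)[b bF bP] := algP a.
exists (KmsAlg (fin_in_algebra bF)) => //.
by apply: alg_norm_le => g x; exact: bP.
Qed.

Lemma alg_seq_complete (u : nat -> A) :
  (forall i j, (i <= j)%N -> `|u i - u j| <= (i.+1%:R^-1 : R)%:C%C) ->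
  exists l, forall e : R, 0 < e -> exists N, forall n, (N <= n)%N -> `|u n - l| <= e%:C%C.
Proof.
move=> uc.
have near i j g x : (i <= j)%N -> norm (u i g x - u j g x) <= i.+1%:R^-1 * norm x.
  move=> /uc; rewrite alg_normE lecR => h; rewrite -algB.
  by apply: le_trans (alg_normP _ _ _) _; rewrite ler_wpM2r ?l2_norm_ge0.
have lim g x : exists y, forall e : R, 0 < e ->
    exists N, forall n, (N <= n)%N -> norm (u n g x - y) <= e.
  (* Rescaling by [c] absorbs the factor [norm x] of [near], as [l2_seq_complete] wants a rate
     independent of [x]. *)
  pose c : C := ((norm x + 1)^-1)%:C%C; have K0 : 0 < norm x + 1 by rewrite ltr_wpDl ?l2_norm_ge0.
  have cE : cabs c = (norm x + 1)^-1 by rewrite cabs_real ger0_norm // invr_ge0 ltW.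
  have c0 : c != 0 by rewrite -cabs_gt0 cE invr_gt0.
  have [|y yP] := @l2_seq_complete R (fun i => c *: u i g x).
    move=> i j /near => /(_ g x) h; rewrite l2_normE lecR -scalerBr l2_normZ cE ler_pdivrMl //.
    apply: le_trans h _; rewrite mulrC ler_wpM2r ?invr_ge0 //.
    by rewrite lerDl.
  exists (c^-1 *: y) => e e0; have [N NP] := yP (e / (norm x + 1)) (divr_gt0 e0 K0).
  exists N => n /NP; rewrite l2_normE lecR => h.
  rewrite -[u n g x]scale1r -(mulVf c0) -scalerA -scalerBr l2_normZ cabsV cE invrK.
  by rewrite mulrC -ler_pdivlMr.
have /choice[l0 l0P] : forall p : G * V, exists y, forall e : R, 0 < e ->
    exists N, forall n, (N <= n)%N -> norm (u n p.1 p.2 - y) <= e by case.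
pose l : family := fun g x => l0 (g, x).
have lP i g x : norm (u i g x - l g x) <= i.+1%:R^-1 * norm x.
  apply/ler_addgt0Pr => e e0; have [N NP] := l0P (g, x) e e0.
  rewrite -(subrKA (u (maxn i N) g x)); apply: le_trans (l2_normD _ _) _.
  by apply: lerD; [exact/near/leq_maxl|exact/NP/leq_maxr].
have lA : l \in @in_algebra R k iota.
  apply/in_algebraP => e e0; have [i iP] := eventually_small (divr_gt0 e0 (ltr0n R 2)).
  have /in_algebraP /(_ _ (divr_gt0 e0 (ltr0n R 2)))[b bF bP] := algP (u i).
  exists b => // g x; rewrite -(subrKA (u i g x)); apply: le_trans (l2_normD _ _) _.
  rewrite [e]splitr mulrDl lerD //; first rewrite l2_normBC.
  by apply: le_trans (lP i g x) _; rewrite ler_wpM2r ?l2_norm_ge0.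
exists (KmsAlg lA) => e e0; have [N NP] := eventually_small e0.
exists N => n Nn; rewrite alg_normE lecR; apply: alg_norm_le => g x; rewrite algB.
apply: le_trans (lP n g x) _; rewrite ler_wpM2r ?l2_norm_ge0 //.
by apply: le_trans NP; rewrite lef_pV2 ?posrE // ler_nat.
Qed.

HB.instance Definition _ := Uniform_isComplete.Build A (seq_complete_cvg alg_seq_complete).

Definition alg_mul a b : A := KmsAlg (mul_in_algebra (algP a) (algP b)).
Definition alg_star a : A := KmsAlg (adjoint_in_algebra (algP a)).

Lemma alg_mulE a b g x : alg_mul a b g x = a g (b g x). Proof. by []. Qed.

Lemma alg_starP a g x y : dot (a g x) y = dot x (alg_star a g y).
Proof. exact/adjoint_dot/algP. Qed.

Lemma alg_star_dot a g x y : dot (alg_star a g x) y = dot x (a g y).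
Proof. by rewrite l2_dotC -alg_starP -l2_dotC. Qed.

Lemma alg_star_eq a b : (forall g x y, dot (a g x) y = dot x (b g y)) -> alg_star a = b.
Proof.
by move=> ab; apply: alg_ext => g y; apply: l2_dot_ext => x; rewrite -ab alg_starP.
Qed.

Lemma alg_mulA : associative alg_mul.
Proof. by move=> a b c; apply: alg_ext. Qed.

Lemma alg_mul_linearl b : linear (alg_mul^~ b).
Proof. by move=> c a a'; apply: alg_ext. Qed.

Lemma alg_mul_linearr a : linear (alg_mul a).
Proof. by move=> c b b'; apply: alg_ext => g x; rewrite algD algZ !alg_mulE algD algZ alg_linear. Qed.

Lemma l2_dotZr (z : C) x y : dot x (z *: y) = z^*%C * dot x y.
Proof.
rewrite l2_dotC -[z *: y]addr0 l2_dot_linearl linear0l addr0 (l2_dotC x).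
by case: (dot y x) z => [a1 a2] [b1 b2]; apply: complex_ext => /=; ring.
Qed.

Lemma l2_dotZl (z : C) x y : dot (z *: x) y = z * dot x y.
Proof. by rewrite -[z *: x]addr0 l2_dot_linearl linear0l addr0. Qed.

Lemma alg_starD a b : alg_star (a + b) = alg_star a + alg_star b.
Proof.
by apply: alg_star_eq => g x y; rewrite !algD l2_dotDl l2_dotDr !alg_starP.
Qed.

Lemma alg_starZ (z : C) a : alg_star (z *: a) = Num.conj z *: alg_star a.
Proof.
apply: alg_star_eq => g x y; rewrite !algZ l2_dotZl l2_dotZr alg_starP conjcE.
by congr (_ * _); case: (z) => z1 z2; apply: complex_ext => /=; ring.
Qed.

Lemma alg_starM a b : alg_star (alg_mul a b) = alg_mul (alg_star b) (alg_star a).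
Proof. by apply: alg_star_eq => g x y; rewrite !alg_mulE !alg_starP. Qed.

Lemma alg_starK : involutive alg_star.
Proof. by move=> a; apply: alg_star_eq => g x y; rewrite alg_star_dot. Qed.

Lemma alg_normM a b : alg_norm (alg_mul a b) <= alg_norm a * alg_norm b.
Proof.
apply: alg_norm_le => g x; rewrite alg_mulE -mulrA; apply: le_trans (alg_normP _ _ _) _.
by rewrite ler_wpM2l ?alg_norm_ge0 ?alg_normP.
Qed.

Lemma alg_norm_star_le a : alg_norm (alg_star a) <= alg_norm a.
Proof.
apply: alg_norm_le => g y; apply: (l2_adjoint_bound (T := a g)); first exact: alg_norm_ge0.
  exact: alg_normP.
by move=> x; rewrite alg_starP.
Qed.

Lemma alg_norm_star a : alg_norm (alg_star a) = alg_norm a.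
Proof.
by apply/eqP; rewrite eq_le alg_norm_star_le -{1}(alg_starK a) alg_norm_star_le.
Qed.

Lemma alg_normC a : alg_norm (alg_mul (alg_star a) a) = alg_norm a ^+ 2.
Proof.
apply/eqP; rewrite eq_le; apply/andP; split.
  by apply: le_trans (alg_normM _ _) _; rewrite alg_norm_star expr2.
have s0 := alg_norm_ge0 (alg_mul (alg_star a) a).
rewrite -[leRHS]sqr_sqrtr // lerXn2r ?nnegrE ?alg_norm_ge0 ?sqrtr_ge0 //.
apply: alg_norm_le => g x; rewrite -(@ler_pXn2r _ 2) ?nnegrE ?mulr_ge0 ?l2_norm_ge0 ?sqrtr_ge0 //.
rewrite exprMn [Num.sqrt (alg_norm _) ^+ 2]sqr_sqrtr //.
have -> : norm (a g x) ^+ 2 = cabs (dot (alg_mul (alg_star a) a g x) x).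
  by rewrite alg_mulE alg_star_dot -l2_norm_sqr cabs_real ger0_norm // sqr_ge0.
apply: le_trans (l2_cauchy_schwarz _ _) _; rewrite expr2 mulrA ler_wpM2r ?l2_norm_ge0 //.
exact: alg_normP.
Qed.

Lemma alg_cnormM a b : `|alg_mul a b| <= `|a| * `|b|.
Proof. by rewrite !alg_normE -rmorphM lecR alg_normM. Qed.

Lemma alg_cnormC a : `|alg_mul (alg_star a) a| = `|a| ^+ 2.
Proof. by rewrite !alg_normE alg_normC rmorphXn. Qed.

Definition kms_cstar : cstar_algebra R := CStarAlgebra alg_mulA alg_mul_linearl alg_mul_linearr
  alg_starD alg_starZ alg_starM alg_starK alg_cnormM alg_cnormC.

End OperatorNorm.

(* Sealed: otherwise a failed comparison of two generators unfolds them all the *)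
(* way down to the arithmetic of R[i].                                         *)
HB.lock Definition gen (R : realType) (k : fieldType) (iota : {rmorphism k -> R[i]}) (m n : nat)
  (u : galois_type iota -> R[i]) : kms_alg iota := insubd (0 : kms_alg iota) (unit_family m n u).

Section Generators.
Variables (R : realType) (k : fieldType) (iota : {rmorphism k -> R[i]}).
Local Notation C := R[i].
Local Notation G := (galois_type iota).
Local Notation V := (l2 R).
Local Notation A := (kms_alg iota).
Implicit Types (a b : A) (g : G) (x y : V) (u v : G -> C).

Lemma gen_val m n u : locconst u -> val (gen m n u) = unit_family m n u.
Proof.
move=> uL; rewrite gen.unlock insubdK //; apply: fin_in_algebra.
rewrite (_ : unit_family m n u = fun g x => unit_family m n u g x + 0).
  by apply: FiniteAdd => //; exact: FiniteZero.
by apply/funext => g; apply/funext => x; rewrite addr0.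
Qed.

Lemma gen_app m n u g x : locconst u -> gen m n u g x = (u g * x n) *: l2_delta R m.
Proof. by move=> uL; rewrite -[gen m n u g x]/(val (gen m n u) g x) gen_val. Qed.

Lemma locconstM u v : locconst u -> locconst v -> locconst (u \* v).
Proof. exact: (locconst_map2 (fun s t => s * t)). Qed.

Lemma locconstD u v : locconst u -> locconst v -> locconst (u \+ v).
Proof. exact: (locconst_map2 (fun s t => s + t)). Qed.

Lemma locconstZ (c : C) u : locconst u -> locconst (fun g => c * u g).
Proof. exact: (locconst_map (fun t => c * t)). Qed.

Lemma locconstJ u : locconst u -> locconst (fun g => (u g)^*%C).
Proof. exact: (locconst_map (@conjc R)). Qed.

Lemma gen_mul m n u p q v : locconst u -> locconst v ->
  alg_mul (gen m n u) (gen p q v) = (n == p)%:R *: gen m q (u \* v).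
Proof.
move=> uL vL; apply: alg_ext => g x; rewrite alg_mulE algZ (gen_app _ _ _ _ uL) (gen_app _ _ _ _ vL).
rewrite (gen_app _ _ _ _ (locconstM uL vL)).
exact: unit_familyM.
Qed.

Lemma gen_star m n u : locconst u -> alg_star (gen m n u) = gen n m (fun g => (u g)^*%C).
Proof.
move=> uL; apply: alg_star_eq => g x y; rewrite (gen_app _ _ _ _ uL) (gen_app _ _ _ _ (locconstJ uL)).
exact: unit_family_adjoint.
Qed.

Lemma gen_add m n u v : locconst u -> locconst v -> gen m n (u \+ v) = gen m n u + gen m n v.
Proof.
move=> uL vL; apply: alg_ext => g x; rewrite algD (gen_app _ _ _ _ uL) (gen_app _ _ _ _ vL).
rewrite (gen_app _ _ _ _ (locconstD uL vL)).
by rewrite /= -scalerDl mulrDl.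
Qed.

Lemma gen_scale m n c u : locconst u -> gen m n (fun g => c * u g) = c *: gen m n u.
Proof.
move=> uL; apply: alg_ext => g x; rewrite algZ (gen_app _ _ _ _ uL) (gen_app _ _ _ _ (locconstZ c uL)).
by rewrite scalerA mulrA.
Qed.

Lemma gen_norm m n u (B : R) : locconst u -> (forall g, cabs (u g) <= B) ->
  alg_norm (gen m n u) <= B.
Proof.
move=> uL uB; apply: alg_norm_le => g x; rewrite gen_app //.
by apply: le_trans (unit_family_norm _ _ _ _ _) _; rewrite ler_wpM2r ?l2_norm_ge0.
Qed.

(** Transfers the induction from bare families to elements of the algebra; each remainder is again
    an element because its entries are locally constant. *)
Lemma finite_alg_ind (U : set (G -> C)) (P : A -> Prop) : (forall u, U u -> locconst u) ->
  P 0 -> (forall m n u b, U u -> finite_family U (val b) -> P b -> P (gen m n u + b)) ->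
  forall b, finite_family U (val b) -> P b.
Proof.
move=> UL P0 PD b; have [f] : exists f, f = val b by exists (val b).
move=> fb; rewrite -fb => fF; elim: fF b fb => [|m n u f1 Uu fF IHf] b fb.
  by have -> : b = 0 by apply: val_inj; rewrite -fb.
have f1A : f1 \in @in_algebra R k iota.
  by apply: fin_in_algebra; apply: finite_family_sub fF.
have -> : b = gen m n u + KmsAlg f1A.
  apply: val_inj; rewrite -fb; apply/funext => g; apply/funext => x.
  by rewrite -[RHS]/(gen m n u g x + f1 g x) gen_app //; exact: UL.
by apply: PD => //; exact: IHf.
Qed.

Lemma finite_gen (U : set (G -> C)) m n u : U u -> locconst u ->
  finite_family U (val (gen m n u)).
Proof.
move=> Uu uL; rewrite gen_val // (_ : unit_family m n u = fun g x => unit_family m n u g x + 0).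
  by apply: FiniteAdd => //; exact: FiniteZero.
by apply/funext => g; apply/funext => x; rewrite addr0.
Qed.

End Generators.

(** * The flow and the Galois action *)

Section Dynamics.
Variables (R : realType) (k : fieldType) (iota : {rmorphism k -> R[i]}) (L : R).
Hypothesis L0 : 0 < L.
Local Notation C := R[i].
Local Notation G := (galois_type iota).
Local Notation V := (l2 R).
Local Notation dot := (@l2_dot R).
Local Notation norm := (@l2_norm R).
Local Notation A := (kms_alg iota).
Local Notation fin := (finite_family (@locconst R k iota)).
Local Notation U := (evol L 'i%C).
Implicit Types (a b : A) (g h : G) (x y : V) (u v : G -> C).

Lemma evol_iK t x : U t (U (- t) x) = x.
Proof. have := evolD L0 x (Re_imaginary t) (Re_imaginary (- t)).
by rewrite subrr evol0 => <-. Qed.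

Lemma evol_iKV t x : U (- t) (U t x) = x.
Proof. by rewrite -{2}(opprK t) evol_iK. Qed.

Lemma evol_i_linear t : linear (U t).
Proof. by apply: evol_linear => //; exact: Re_imaginary. Qed.

Lemma evol_iE t x n : U t x n = cexp ('i%C * t%:C%C * level L n) * x n.
Proof. by apply: evolE => //; exact: Re_imaginary. Qed.

Lemma evol_adjoint t x y : dot (U t x) y = dot x (U (- t) y).
Proof.
apply: l2_dot_eq; apply: eq_has_csum (l2_dotP _ _) => n; rewrite !evol_iE.
have cJ (z w : C) : (z * w)^*%C = z^*%C * w^*%C.
  by case: z w => [? ?] [? ?]; apply: complex_ext => /=; ring.
rewrite cJ conj_cexp mulrCA mulrA; congr (cexp _ * _ * _).
by rewrite /level; apply: complex_ext => /=; ring.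
Qed.

Definition phase (t : R) m n : C := cexp ('i%C * t%:C%C * (level L m - level L n)).

Lemma phase_evol t m n u g x :
  U t (unit_family m n u g (U (- t) x)) = unit_family m n (fun g => phase t m n * u g) g x.
Proof.
apply: l2_ext => i; rewrite evol_iE /unit_family !l2Z evol_iE l2_deltaE.
case: eqP => [->|_]; last by rewrite !mulr0.
have -> : phase t m n = cexp ('i%C * t%:C%C * level L m) * cexp ('i%C * (- t)%:C%C * level L n).
  rewrite /phase -cexpD; congr cexp.
  by rewrite /level; apply: complex_ext => /=; ring.
ring.
Qed.

Definition flow_family t (a : G -> V -> V) : G -> V -> V := fun g x => U t (a g (U (- t) x)).

Lemma fin_flow t (b : G -> V -> V) : fin b -> fin (flow_family t b).
Proof.
apply: (@finite_family_map _ _ _ _ (flow_family t) (fun m n u g => phase t m n * u g) false).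
- apply/funext => g; apply/funext => x; rewrite /flow_family.
  by have := evol_i_linear t (-1) 0 0; rewrite scaler0 addr0 scaleN1r addNr.
- move=> m n u b1; apply/funext => g; apply/funext => x; rewrite /flow_family.
  have := evol_i_linear t 1 (unit_family m n u g (U (- t) x)) (b1 g (U (- t) x)).
  by rewrite !scale1r => ->; rewrite phase_evol.
- by move=> m n u; exact: locconstZ.
Qed.

Lemma flow_in_algebra t a : flow_family t a \in @in_algebra R k iota.
Proof.
apply/in_algebraP => e e0; have /in_algebraP /(_ e e0)[b bF bP] := algP a.
exists (flow_family t b); first exact: fin_flow.
move=> g x; rewrite /flow_family (linear_subE (evol_i_linear t)) evol_unitary_norm //.
by apply: le_trans (bP _ _) _; rewrite evol_unitary_norm.
Qed.

Definition flow t a : A := KmsAlg (flow_in_algebra t a).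

Lemma flowE t a g x : flow t a g x = U t (a g (U (- t) x)). Proof. by []. Qed.

Lemma flow0 a : flow 0 a = a.
Proof. by apply: alg_ext => g x; rewrite flowE oppr0 !evol0. Qed.

Lemma flowD s t a : flow (s + t) a = flow s (flow t a).
Proof.
apply: alg_ext => g x; rewrite !flowE opprD (addrC (- s)).
by rewrite !(evolD L0) //; exact: Re_imaginary.
Qed.

Lemma flow_linear t : linear (flow t).
Proof.
by move=> c a b; apply: alg_ext => g x; rewrite algD algZ !flowE algD algZ evol_i_linear.
Qed.

Lemma flow_norm t a : alg_norm (flow t a) = alg_norm a.
Proof.
have le s b : alg_norm (flow s b) <= alg_norm b.
  apply: alg_norm_le => g x; rewrite flowE evol_unitary_norm //.
  by apply: le_trans (alg_normP _ _ _) _; rewrite evol_unitary_norm.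
apply/eqP; rewrite eq_le le /=; have := le (- t) (flow t a).
by rewrite -flowD addNr flow0.
Qed.

Lemma flow_gen t m n u : locconst u -> flow t (gen m n u) = phase t m n *: gen m n u.
Proof.
move=> uL; apply: alg_ext => g x; rewrite -gen_scale // gen_app; last exact: locconstZ.
by rewrite flowE gen_app // phase_evol.
Qed.

Lemma flow_star t a : flow t (alg_star a) = alg_star (flow t a).
Proof.
apply/esym/alg_star_eq => g x y; by rewrite !flowE evol_adjoint alg_starP evol_adjoint opprK.
Qed.

Lemma flow_star_automorphism t : star_automorphism (A := kms_cstar iota) (flow t).
Proof.
split; first exact: flow_linear.
- exists (flow (- t)) => a; first by rewrite -flowD addNr flow0.
  by rewrite -flowD subrr flow0.
- by move=> a b; apply: alg_ext => g x; rewrite flowE !alg_mulE !flowE evol_iKV.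
- by move=> a; exact: flow_star.
Qed.


Lemma phase_cvg0 m n (e : R) : 0 < e -> \forall t \near nbhs (0 : R), cabs (phase t m n - 1) <= e.
Proof.
move=> e0; pose c := cabs (level L m - level L n); have c0 : 0 <= c by exact: cabs_ge0.
apply: filterS (@nbhs0_le R R (e / (2 * (c + 1))) _) => [t te|]; last first.
  by rewrite divr_gt0 // mulr_gt0 // ltr_wpDl.
apply: le_trans (cexp_sub1 _) _; first by rewrite /level /= le_eqVlt; apply/orP; left; apply/eqP; ring.
rewrite !cabsM cabs_i mul1r cabs_real -/c.
apply: (@le_trans _ _ (2 * (e / (2 * (c + 1)) * (c + 1)))).
  by rewrite ler_pM2l // ler_pM // lerDl.
by rewrite le_eqVlt; apply/orP; left; apply/eqP; field; rewrite gt_eqF // ltr_wpDl.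
Qed.

(** On a generator the flow is multiplication by a scalar tending to 1; since the flow is isometric,
    strong continuity passes from finite sums to their norm limits. *)
Lemma flow_cvg0 a (e : R) : 0 < e -> \forall t \near nbhs (0 : R), alg_norm (flow t a - a) <= e.
Proof.
have lin t b c : flow t (b + c) - (b + c) = (flow t b - b) + (flow t c - c).
  by have := flow_linear t 1 b c; rewrite !scale1r => ->; rewrite opprD addrACA.
have fin0 b : fin (val b) ->
    forall e : R, 0 < e -> \forall t \near nbhs (0 : R), alg_norm (flow t b - b) <= e.
  move: b; apply: finite_alg_ind => [//|d d0|m n u b uL _ IHb d d0].
    apply: nearW => t; suff -> : flow t 0 - 0 = 0 by apply: alg_norm_le => g x; rewrite alg0 l2_norm0 mulr_ge0 ?l2_norm_ge0 ?ltW.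
    by have := flow_linear t (-1) 0 0; rewrite scaler0 addr0 scaleN1r addNr subr0.
  have [B B0 BP] := locconst_bounded uL.
  have d1 : 0 < d / (2 * (B + 1)) by rewrite divr_gt0 // mulr_gt0 // ltr_wpDl.
  apply: filterS (filterI (phase_cvg0 m n d1) (IHb _ (divr_gt0 d0 (ltr0n R 2)))) => t [pt bt].
  rewrite lin; apply: le_trans (alg_normD _ _) _.
  have -> : flow t (gen m n u) - gen m n u = (phase t m n - 1) *: gen m n u.
    by rewrite flow_gen // scalerBl scale1r.
  rewrite alg_normZ.
  have h : cabs (phase t m n - 1) * alg_norm (gen m n u) <= d / 2.
    apply: (@le_trans _ _ (d / (2 * (B + 1)) * (B + 1))).
      apply: ler_pM => //; rewrite ?cabs_ge0 ?alg_norm_ge0 //.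
      by apply: le_trans (gen_norm _ _ uL BP) _; rewrite lerDl.
    by rewrite le_eqVlt; apply/orP; left; apply/eqP; field; rewrite gt_eqF // ltr_wpDl.
  by rewrite [d]splitr; apply: lerD.
move=> e0; have e3 : 0 < e / 3 by rewrite divr_gt0.
have [b bF ab] := alg_approx a e3; apply: filterS (fin0 b bF _ e3) => t tb.
have -> : a = (a - b) + b by rewrite subrK.
rewrite lin; apply: le_trans (alg_normD _ _) _.
have h1 : alg_norm (flow t (a - b) - (a - b)) <= alg_norm (a - b) + alg_norm (a - b).
  apply: le_trans (alg_normD _ _) _; rewrite flow_norm lerD2l.
  by rewrite -scaleN1r alg_normZ cabsN cabs1 mul1r.
move: h1 ab tb; move: (alg_norm _) (alg_norm _) (alg_norm _) => r1 r2 r3; lra.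
Qed.

Lemma flow_continuous a : continuous (flow^~ a : R -> A).
Proof.
move=> t; apply/cvg_dist_realP => e e0.
have /nbhs_ballP[r r0 rP] := flow_cvg0 a e0; apply/nbhs_ballP; exists r => // s ts.
have := rP (s - t); rewrite /ball /= sub0r opprB => /(_ ts) h.
rewrite alg_normE lecR -{1}(subrKC t s) flowD.
by rewrite (linear_subE (flow_linear t)) flow_norm.
Qed.

Definition kms_system : cstar_system R :=
  @CStarSystem R (kms_cstar iota) flow flow_star_automorphism flow0 flowD flow_continuous.

Definition gal_shift (s : C -> C) a : A := insubd a (fun g x => a (translate s g) x).

Lemma gal_shiftE s a g x : abelian_galois iota s -> gal_shift s a g x = a (translate s g) x.
Proof.
move=> sG; rewrite -[LHS]/(val (gal_shift s a) g x) /gal_shift insubdK //.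
apply/in_algebraP => e e0; have /in_algebraP /(_ e e0)[b bF bP] := algP a.
exists (fun g => b (translate s g)); last by move=> h y; exact: bP.
pose f (b : G -> V -> V) := fun g => b (translate s g); rewrite -[fun g => _]/(f b).
move: b bF {bP}; apply: (@finite_family_map _ _ _ _ f (fun m n u => u \o translate s) false) => // m n u.
exact: locconst_translate.
Qed.

Lemma gal_shiftM s t a : abelian_galois iota s -> abelian_galois iota t ->
  gal_shift (s \o t) a = gal_shift s (gal_shift t a).
Proof.
move=> sG tG; apply: alg_ext => g x; have stG := abelian_galois_comp sG tG.
rewrite !gal_shiftE //; congr (alg_fun a _ x).
by apply: galois_ext => z Kz; rewrite !translateE.
Qed.

Lemma gal_shift1 a : gal_shift id a = a.
Proof.
apply: alg_ext => g x; rewrite gal_shiftE; last exact: abelian_galois_id.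
by congr (alg_fun a _ x); apply: galois_ext => z Kz; rewrite translateE //; exact: abelian_galois_id.
Qed.

Lemma gal_shift_linear s : abelian_galois iota s -> linear (gal_shift s).
Proof. by move=> sG c a b; apply: alg_ext => g x; rewrite algD algZ !gal_shiftE. Qed.

Lemma gal_shift_automorphism s : abelian_galois iota s ->
  star_automorphism (A := kms_cstar iota) (gal_shift s).
Proof.
move=> sG; have [t tG st] := abelian_galois_inv (embedding_char0 iota) sG.
split; first exact: gal_shift_linear.
- exists (gal_shift t) => a; rewrite -gal_shiftM //; last by rewrite st gal_shift1.
  by rewrite (abelian_galois_commute tG sG) st gal_shift1.
- by move=> a b; apply: alg_ext => g x; rewrite gal_shiftE // !alg_mulE !gal_shiftE.
- move=> a; apply/esym/alg_star_eq => g x y; rewrite !gal_shiftE //; exact: alg_starP.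
Qed.

Lemma gal_shift_flow s t a : abelian_galois iota s ->
  gal_shift s (flow t a) = flow t (gal_shift s a).
Proof. by move=> sG; apply: alg_ext => g x; rewrite gal_shiftE // !flowE gal_shiftE. Qed.

Definition kms_galois_system : galois_cstar_system iota :=
  @GaloisCStarSystem R k iota kms_system gal_shift gal_shift_automorphism gal_shift1
    gal_shiftM gal_shift_flow.

End Dynamics.

(** * States determined by a measure on the Galois group *)

Section GeometricSeries.
Variables (R : realType) (lam : R).
Hypotheses (lam0 : 0 <= lam) (lam1 : lam < 1).

Lemma geometric_sum n : (1 - lam) * \sum_(i < n) lam ^+ i = 1 - lam ^+ n.
Proof. by rewrite -(opprB lam 1) -(opprB (lam ^+ n) 1) subrX1 mulNr. Qed.

Lemma geometric_bound n : \sum_(i < n) lam ^+ i <= (1 - lam)^-1.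
Proof.
rewrite -[leRHS]mulr1 ler_pdivlMl ?subr_gt0 // geometric_sum lerBlDr lerDl.
exact: exprn_ge0.
Qed.

Lemma geometric_small (e : R) : 0 < e -> exists n, lam ^+ n <= e.
Proof.
move=> e0; have l1 : `|lam| < 1 by rewrite ger0_norm.
have /cvgrPdist_le /(_ e e0) [n _ nP] := cvg_expr l1.
exists n; have := nP n (leqnn n); rewrite sub0r normrN; exact/le_trans/ler_norm.
Qed.

End GeometricSeries.

(** Multiplication by the indicator of a clopen set, a central projection; composing a state with it
    amounts to conditioning. It is sealed like [gen]. *)
HB.lock Definition localize (R : realType) (k : fieldType) (iota : {rmorphism k -> R[i]})
    (P : galois_type iota -> bool) (a : kms_alg iota) : kms_alg iota :=
  insubd (0 : kms_alg iota) (fun g x => (P g)%:R *: a g x).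

Section Weights.
Variables (R : realType) (k : fieldType) (iota : {rmorphism k -> R[i]}).
Local Notation C := R[i].
Local Notation G := (galois_type iota).
Local Notation V := (l2 R).
Local Notation norm := (@l2_norm R).
Local Notation A := (kms_alg iota).
Local Notation fin := (finite_family (@locconst R k iota)).
Implicit Types (a b : A) (g : G) (u v : G -> C) (phi psi : A -> C) (P : G -> bool).

Definition ind P : G -> C := fun g => (P g)%:R.

Lemma locconst_ind P u : locconst u -> (forall g h, u g = u h -> P g = P h) -> locconst (ind P).
Proof. by move=> [s sK us] Pu; exists s => // g h gh; rewrite /ind (Pu g h (us g h gh)). Qed.

Lemma localizeE P a g x : locconst (ind P) -> localize P a g x = (P g)%:R *: a g x.
Proof.
move=> PL; rewrite -[LHS]/(val (localize P a) g x) localize.unlock insubdK //.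
apply/in_algebraP => e e0; have /in_algebraP /(_ e e0)[b bF bP] := algP a.
pose f (b : G -> V -> V) := fun g x => (P g)%:R *: b g x; exists (f b).
  move: b bF {bP}; apply: (@finite_family_map _ _ _ _ f (fun m n u => ind P \* u) false).
  - by apply/funext => h; apply/funext => y; rewrite /f scaler0.
  - move=> m n u b; apply/funext => h; apply/funext => y.
    by rewrite /f scalerDr /unit_family scalerA mulrA.
  - by move=> m n u; exact: locconstM.
move=> h y; rewrite /f -scalerBr l2_normZ; apply: le_trans (bP h y).
by rewrite ler_piMl ?l2_norm_ge0 //; case: (P h); rewrite ?cabs0 ?cabs1.
Qed.

Lemma localize_gen P m n u : locconst (ind P) -> locconst u ->
  localize P (gen m n u) = gen m n (ind P \* u).
Proof.
move=> PL uL; apply: alg_ext => g x; rewrite localizeE // (gen_app _ _ _ _ uL).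
by rewrite (gen_app _ _ _ _ (locconstM PL uL)) scalerA mulrA.
Qed.

Lemma localize_linear P : locconst (ind P) -> linear (localize P).
Proof.
move=> PL c a b; apply: alg_ext => g x; rewrite algD algZ !localizeE // algD algZ.
by rewrite scalerDr !scalerA mulrC.
Qed.

Lemma localize_norm P a : locconst (ind P) -> alg_norm (localize P a) <= alg_norm a.
Proof.
move=> PL; apply: alg_norm_le => g x; rewrite localizeE // l2_normZ.
apply: le_trans (alg_normP a g x); rewrite ler_piMl ?l2_norm_ge0 //.
by case: (P g); rewrite ?cabs0 ?cabs1.
Qed.

Lemma localizeMr P a b : locconst (ind P) -> localize P (alg_mul a b) = alg_mul a (localize P b).
Proof.
move=> PL; apply: alg_ext => g x.
by rewrite localizeE // !alg_mulE localizeE // alg_linearZ.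
Qed.

Lemma localizeMl P a b : locconst (ind P) -> localize P (alg_mul a b) = alg_mul (localize P a) b.
Proof. by move=> PL; apply: alg_ext => g x; rewrite localizeE // !alg_mulE localizeE. Qed.

Lemma localize_star P a : locconst (ind P) -> alg_star (localize P a) = localize P (alg_star a).
Proof.
move=> PL; apply: alg_star_eq => g x y; rewrite !localizeE // l2_dotZl l2_dotZr alg_starP.
by case: (P g); rewrite ?conjc1 ?conjc0.
Qed.

Lemma localizeK P a : locconst (ind P) -> localize P (localize P a) = localize P a.
Proof.
move=> PL; apply: alg_ext => g x; rewrite !localizeE // scalerA.
by case: (P g); rewrite ?mulr1 ?mulr0.
Qed.

Lemma localizeC P a : locconst (ind P) -> locconst (ind (predC P)) ->
  a = localize P a + localize (predC P) a.
Proof.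
move=> PL PL'; apply: alg_ext => g x; rewrite algD !localizeE //= -scalerDl.
by case: (P g); rewrite ?addr0 ?add0r scale1r.
Qed.

Lemma locconst_indC P : locconst (ind P) -> locconst (ind (predC P)).
Proof.
move=> [s sK Ps]; exists s => // g h gh; have := Ps g h gh; rewrite /ind /=.
by case: (P g) (P h) => [] [] //= /eqP; rewrite ?(eq_sym 0) oner_eq0.
Qed.

Definition coef n a : G -> C := fun g => a g (l2_delta R n) n.

Lemma cabs_coef n a g : cabs (coef n a g) <= alg_norm a.
Proof.
apply: le_trans (l2_coord _ _) _; apply: le_trans (alg_normP _ _ _) _.
by rewrite l2_norm_delta mulr1.
Qed.

Lemma coef_add n a b : coef n (a + b) = coef n a \+ coef n b.
Proof. by apply/funext => g; rewrite /coef algD l2D. Qed.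

Lemma coef_gen m n u i : locconst u ->
  coef i (gen m n u) = fun g => ((i == m) && (i == n))%:R * u g.
Proof.
move=> uL; apply/funext => g; rewrite /coef (gen_app _ _ _ _ uL) l2Z !l2_deltaE -mulnb natrM (eq_sym i n).
by ring.
Qed.

Lemma locconst_coef n a : fin (val a) -> locconst (coef n a).
Proof.
move: a; apply: finite_alg_ind => [//||m p u b uL _ IHb]; last first.
  by rewrite coef_add coef_gen //; apply: locconstD => //; exact: locconstZ.
by have := @locconst_cst R k iota 0; congr locconst; apply/funext => g.
Qed.

(** The notion of state in terms of the real-valued norms, the equivalence being [is_stateP]. *)
Definition is_pstate phi := [/\ linear (phi : A -> C^o),
  forall a, 0 <= phi (alg_mul (alg_star a) a), forall a, cabs (phi a) <= alg_norm a
  & forall c : R, 0 <= c -> (forall a, cabs (phi a) <= c * alg_norm a) -> 1 <= c].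

(** [lam] is the Boltzmann factor. At [lam = 0] the convention 0 ^+ 0 = 1 keeps the corner entry, so
    that ground states are included. *)
Definition weighted (lam : R) phi := is_pstate phi /\ forall m n u, locconst u ->
  phi (gen m n u) = (m == n)%:R * (lam ^+ m)%:C%C * phi (gen 0 0 u).

Lemma linear_D phi : linear (phi : A -> C^o) -> forall a b, phi (a + b) = phi a + phi b.
Proof. by move=> l a b; have := l 1 a b; rewrite !scale1r. Qed.

Lemma linear_0 phi : linear (phi : A -> C^o) -> phi 0 = 0.
Proof. by move=> l; have := l (-1) 0 0; rewrite scaler0 addr0 scaleN1r addNr. Qed.

Lemma linear_Z phi : linear (phi : A -> C^o) -> forall c a, phi (c *: a) = c * phi a.
Proof. by move=> l c a; have := l c a 0; rewrite !addr0 (linear_0 l) addr0. Qed.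

Lemma linear_B phi : linear (phi : A -> C^o) -> forall a b, phi (a - b) = phi a - phi b.
Proof. by move=> l a b; rewrite -scaleN1r linear_D // linear_Z // mulN1r. Qed.

Lemma linear_big phi n (f : 'I_n -> A) : linear (phi : A -> C^o) ->
  phi (\sum_(i < n) f i) = \sum_(i < n) phi (f i).
Proof. by move=> l; elim/big_rec2 : _ => [|i y a _ <-]; [exact: linear_0|exact: linear_D]. Qed.

Lemma locconst1 : locconst (cst 1 : G -> C). Proof. exact: locconst_cst. Qed.

Lemma gen_norm_gt0 : 0 < alg_norm (gen 0 0 (cst 1) : A).
Proof.
rewrite lt_neqAle alg_norm_ge0 andbT eq_sym; apply/eqP => /alg_norm_eq0.
move=> /(congr1 (fun a : A => coef 0 a (galois_one iota))); rewrite coef_gen; last exact: locconst1.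
by rewrite /= mulr1 /coef alg0 l20 => /eqP; rewrite oner_eq0.
Qed.

Lemma bounded_eq phi psi (B : R) : linear (phi : A -> C^o) -> linear (psi : A -> C^o) ->
  (forall a, cabs (phi a) <= B * alg_norm a) -> (forall a, cabs (psi a) <= B * alg_norm a) ->
  (forall m n u, locconst u -> phi (gen m n u) = psi (gen m n u)) -> phi = psi.
Proof.
move=> lphi lpsi phiB psiB E; apply/funext => a; apply/eqP; rewrite -subr_eq0; apply/eqP.
have B0 : 0 <= B.
  have := phiB (gen 0 0 (cst 1)); have := cabs_ge0 (phi (gen 0 0 (cst 1))) => h1 h2.
  by rewrite -(pmulr_lge0 _ gen_norm_gt0); exact: le_trans h2.
apply: (@small_cabs_eq0 _ _ (B + B)) => e e0; have [b bF ab] := alg_approx a e0.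
have bE : phi b = psi b.
  move: b bF {ab}; apply: finite_alg_ind => [//||m n u b uL _ IHb].
    by rewrite !linear_0.
  by rewrite !linear_D // E // IHb.
have -> : phi a - psi a = phi (a - b) - psi (a - b) by rewrite !linear_B // bE; ring.
apply: le_trans (cabsB _ _) _; rewrite mulrDl; apply: lerD.
  by apply: le_trans (phiB _) _; rewrite ler_wpM2l.
by apply: le_trans (psiB _) _; rewrite ler_wpM2l.
Qed.

Section WeightedState.
Variables (lam : R) (phi : A -> C).
Hypotheses (lam0 : 0 <= lam) (lam1 : lam < 1) (phiW : weighted lam phi).

Let phi_lin : linear (phi : A -> C^o). Proof. by case: phiW => -[]. Qed.
Let phi_pos a : 0 <= phi (alg_mul (alg_star a) a). Proof. by case: phiW => -[]. Qed.
Let phi_bd a : cabs (phi a) <= alg_norm a. Proof. by case: phiW => -[]. Qed.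
Let phi_gen m n u : locconst u ->
  phi (gen m n u) = (m == n)%:R * (lam ^+ m)%:C%C * phi (gen 0 0 u).
Proof. by case: phiW => _; apply. Qed.

Definition mu u := phi (gen 0 0 u).

Lemma muD u v : locconst u -> locconst v -> mu (u \+ v) = mu u + mu v.
Proof. by move=> uL vL; rewrite /mu gen_add // linear_D. Qed.

Lemma muZ c u : locconst u -> mu (fun g => c * u g) = c * mu u.
Proof. by move=> uL; rewrite /mu gen_scale // linear_Z. Qed.

Lemma mu_sqr_ge0 u : locconst u -> 0 <= mu (fun g => (u g)^*%C * u g).
Proof.
move=> uL; have := phi_pos (gen 0 0 u); rewrite gen_star // gen_mul //; last exact: locconstJ.
by rewrite eqxx scale1r.
Qed.

Lemma mu_ge0 u : locconst u -> (forall g, 0 <= u g) -> 0 <= mu u.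
Proof.
move=> uL u0; pose w g : C := (Num.sqrt (complex.Re (u g)))%:C%C.
have wL : locconst w by exact: (locconst_map (fun z : C => (Num.sqrt (complex.Re z))%:C%C) uL).
suff -> : u = fun g => (w g)^*%C * w g by exact: mu_sqr_ge0.
apply/funext => g; rewrite /w conjc_real -rmorphM /= -expr2.
by have [r r0 ->] := ge0_complexP (u0 g); rewrite /= sqr_sqrtr.
Qed.

(** Positivity gives real values on nonnegative functions, hence on real ones, written as the
    difference of t + |t| and |t|. *)
Lemma muJ u : locconst u -> mu (fun g => (u g)^*%C) = (mu u)^*%C.
Proof.
have real (f : C -> R) v : locconst v -> (mu (fun g => (f (v g))%:C%C))^*%C = mu (fun g => (f (v g))%:C%C).
  move=> vL; have aL (h : R -> R) : locconst (fun g => (h (f (v g)))%:C%C).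
    exact: (locconst_map (fun z => (h (f z))%:C%C) vL).
  have pos (h : R -> R) : (forall t, 0 <= h t) -> (mu (fun g => (h (f (v g)))%:C%C))^*%C =
      mu (fun g => (h (f (v g)))%:C%C).
    move=> h0; have : 0 <= mu (fun g => (h (f (v g)))%:C%C) by apply: mu_ge0 => // g; rewrite (lecR 0).
    by move=> /ge0_complexP[r _ ->]; rewrite conjc_real.
  have -> : (fun g => (f (v g))%:C%C) = (fun g => (f (v g) + `|f (v g)|)%:C%C) \+
      (fun g => -1 * (`|f (v g)|)%:C%C).
    by apply/funext => g /=; rewrite mulN1r rmorphD addrK.
  have conjB (x y : C) : x^*%C = x -> y^*%C = y -> (x + -1 * y)^*%C = x + -1 * y.
    by case: x y => [x1 x2] [y1 y2] [x20] [y20]; apply: complex_ext => /=; lra.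
  rewrite (muD (aL (fun t => t + `|t|)) (locconstZ (-1) (aL (fun t => `|t|)))).
  rewrite (muZ _ (aL (fun t => `|t|))); apply: conjB; last exact: (pos (fun t => `|t|)).
  apply: (pos (fun t => t + `|t|)) => t.
  by have := ler_norm (- t); rewrite normrN; lra.
move=> uL; have ReL := locconst_map (fun z : C => (complex.Re z)%:C%C) uL.
have ImL := locconst_map (fun z : C => (complex.Im z)%:C%C) uL.
have -> : (fun g => (u g)^*%C) = (fun g => (complex.Re (u g))%:C%C) \+
    (fun g => - 'i%C * (complex.Im (u g))%:C%C).
  by apply/funext => g /=; case: (u g) => [u1 u2]; apply: complex_ext => /=; ring.
have -> : mu u = mu ((fun g => (complex.Re (u g))%:C%C) \+ (fun g => 'i%C * (complex.Im (u g))%:C%C)).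
  congr mu.
  by apply/funext => g /=; case: (u g) => [u1 u2]; apply: complex_ext => /=; ring.
rewrite (muD ReL (locconstZ _ ImL)) (muD ReL (locconstZ _ ImL)) !muZ //.
move: (real (@complex.Re R) u uL) (real (@complex.Im R) u uL).
case: (mu _) => [p1 p2]; case: (mu _) => [q1 q2] /= [p20] [q20].
by apply: complex_ext => /=; lra.
Qed.

(** Cauchy-Schwarz for [mu] on the set [P]: the square of the left side is at most mu(P) times the
    integral of |v|^2 over [P], itself at most mu(P) B^2. *)
Lemma mu_ind_bound P v (B : R) : locconst (ind P) -> locconst v -> 0 <= B ->
  (forall g, cabs (v g) <= B) -> cabs (mu (ind P \* v)) <= complex.Re (mu (ind P)) * B.
Proof.
move=> PL vL B0 vB; have p0 : 0 <= mu (ind P) by apply: mu_ge0 => // g; rewrite ler0n.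
have [p p0' pE] := ge0_complexP p0; rewrite pE /=.
have PvL := locconstM PL vL.
have vvL : locconst (fun g => (v g)^*%C * v g) := locconstM (locconstJ vL) vL.
have PvvL := locconstM PL vvL.
have q0 : 0 <= mu (ind P \* (fun g => (v g)^*%C * v g)).
  by apply: mu_ge0 => // g /=; rewrite mulr_ge0 ?ler0n // mulrC mul_conjC_ge0.
have [q q0' qE] := ge0_complexP q0.
have qB : q <= p * B ^+ 2.
  rewrite -lecR rmorphM /= -pE -qE -subr_ge0.
  have wL : locconst (fun g => ind P g * ((B ^+ 2)%:C%C - (v g)^*%C * v g)).
    apply: locconstM => //.
    exact: (locconst_map (fun z : C => (B ^+ 2)%:C%C - z^*%C * z) vL).
  have : 0 <= mu (fun g => ind P g * ((B ^+ 2)%:C%C - (v g)^*%C * v g)).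
    apply: mu_ge0 => // g; rewrite mulr_ge0 ?ler0n // subr_ge0 mulrC -sqr_normc cabsE.
    by rewrite -rmorphXn lecR lerXn2r ?nnegrE ?cabs_ge0.
  have -> : (fun g => ind P g * ((B ^+ 2)%:C%C - (v g)^*%C * v g)) =
      (fun g => (B ^+ 2)%:C%C * ind P g) \+ (fun g => -1 * (ind P g * ((v g)^*%C * v g))).
    by apply/funext => g /=; ring.
  rewrite muD ?muZ //; [|exact: locconstZ|exact: (locconstZ (-1) PvvL)].
  by rewrite mulN1r mulrC.
suff : cabs (mu (ind P \* v)) ^+ 2 <= p * q.
  move=> h; rewrite -(@ler_pXn2r _ 2) ?nnegrE ?cabs_ge0 ?mulr_ge0 //.
  apply: le_trans h _; rewrite exprMn [p ^+ 2]expr2 -mulrA; exact: ler_wpM2l.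
apply: discriminant_bound => // z.
have zL : locconst (fun g => ind P g * (z * v g + 1)).
  by apply: locconstM => //; exact: (locconst_map (fun t : C => z * t + 1) vL).
have := mu_sqr_ge0 zL.
have -> : (fun g => (ind P g * (z * v g + 1))^*%C * (ind P g * (z * v g + 1))) =
  ((fun g => (z^*%C * z) * (ind P \* (fun g => (v g)^*%C * v g)) g) \+ ind P) \+
  ((fun g => z * (ind P \* v) g) \+ (fun g => z^*%C * (ind P \* (fun g => (v g)^*%C)) g)).
  apply/funext => g /=; rewrite /ind; case: (P g); case: (v g) z {zL} => [v1 v2] [z1 z2].
    by apply: complex_ext => /=; ring.
  by apply: complex_ext => /=; ring.
have PvJ := locconstM PL (locconstJ vL).
rewrite (muD (locconstD (locconstZ _ PvvL) PL) (locconstD (locconstZ _ PvL) (locconstZ _ PvJ))).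
rewrite (muD (locconstZ _ PvvL) PL) (muD (locconstZ _ PvL) (locconstZ _ PvJ)) !muZ //.
have -> : mu (ind P \* (fun g => (v g)^*%C)) = (mu (ind P \* v))^*%C.
  rewrite -muJ //; congr mu; apply/funext => g /=; rewrite /ind.
  by case: (P g); rewrite ?mul1r ?mul0r ?conjc0.
have -> : z^*%C * z = (cabs z ^+ 2)%:C%C by rewrite mulrC -sqr_normc cabsE rmorphXn.
rewrite qE pE; set b := mu _ => h.
rewrite -lecR (le_trans h) // le_eqVlt; apply/orP; left; apply/eqP.
by case: (b) (z) => [b1 b2] [z1 z2]; rewrite rmorphD rmorphD; apply: complex_ext => /=; ring.
Qed.

(** A weighted functional sees the diagonal of a matrix. The formula is stated for all large [n], so
    that the induction may enlarge the matrix. *)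
Lemma weighted_localize P b : locconst (ind P) -> fin (val b) ->
  exists N, forall n, (N <= n)%N ->
    phi (localize P b) = \sum_(i < n) (lam ^+ i)%:C%C * mu (ind P \* coef i b).
Proof.
move=> PL; move: b; apply: finite_alg_ind => [//||m p u b uL bF [N NP]].
  exists 0%N => n _; have -> : localize P 0 = 0.
    by apply: alg_ext => g x; rewrite localizeE // alg0 scaler0.
  rewrite linear_0 // big1 // => i _; rewrite -[X in mu X](_ : (fun=> 0 * 0) = _).
    by rewrite (muZ 0 (locconst_cst iota 0)) mul0r mulr0.
  by apply/funext => g; rewrite mul0r -[RHS]/(ind P g * 0) mulr0.
exists (maxn N m.+1) => n; rewrite geq_max => /andP[/NP E mn].
have PuL := locconstM PL uL; have rl := localize_linear PL 1 (gen m p u) b.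
rewrite !scale1r in rl; rewrite rl linear_D // E localize_gen // phi_gen //.
have cL i : locconst (coef i b) by exact: locconst_coef.
rewrite [RHS](eq_bigr (fun i : 'I_n => (lam ^+ i)%:C%C * (((i == m :> nat) && (i == p :> nat))%:R *
    mu (ind P \* u)) + (lam ^+ i)%:C%C * mu (ind P \* coef i b))) => [|i _].
  rewrite big_split /=; congr (_ + _); rewrite (bigD1 (Ordinal mn)) //= big1 => [|i].
    by rewrite eqxx addr0 /= mulrCA mulrA.
  by rewrite -val_eqE /= => /negPf ->; rewrite mul0r mulr0.
rewrite -mulrDr; congr (_ * _); rewrite -(muZ _ PuL).
have PcL := locconstM PL (cL i); rewrite -(muD (locconstZ _ PuL) PcL); congr mu.
by apply/funext => g; rewrite coef_add coef_gen //=; ring.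
Qed.

Definition mass P : R := complex.Re (mu (ind P)).

Lemma massE P : locconst (ind P) -> mu (ind P) = (mass P)%:C%C.
Proof.
move=> PL; have /ge0_complexP[r _ E] : 0 <= mu (ind P) by apply: mu_ge0 => // g; rewrite ler0n.
by rewrite /mass E.
Qed.

Lemma mass_ge0 P : locconst (ind P) -> 0 <= mass P.
Proof. by move=> PL; rewrite -lecR -massE // mu_ge0 // => g; rewrite ler0n. Qed.

(** Each diagonal entry costs at most [mass P] times the norm, and the weights sum to a geometric
    series; density extends this from finite matrices. The bound sees only [mass P], which is what
    determines the total mass. *)
Lemma localize_bound P a : locconst (ind P) ->
  cabs (phi (localize P a)) <= mass P / (1 - lam) * alg_norm a.
Proof.
move=> PL; have m0 := mass_ge0 PL; have d0 : 0 < 1 - lam by rewrite subr_gt0.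
have K0 : 0 <= mass P / (1 - lam) by rewrite divr_ge0 // ltW.
have bF b : fin (val b) -> cabs (phi (localize P b)) <= mass P / (1 - lam) * alg_norm b.
  move=> bF; have [N /(_ N (leqnn N)) ->] := weighted_localize PL bF.
  apply: le_trans (cabs_sum _ _ _) _.
  apply: (@le_trans _ _ (\sum_(i < N) lam ^+ i * (mass P * alg_norm b))).
    apply: ler_sum => i _; rewrite cabsM cabs_real ger0_norm ?exprn_ge0 //.
    rewrite ler_wpM2l ?exprn_ge0 //; apply: mu_ind_bound => //; first exact: locconst_coef.
      exact: alg_norm_ge0.
    by move=> g; exact: cabs_coef.
  rewrite -mulr_suml [mass P / _]mulrC -mulrA ler_wpM2r ?mulr_ge0 ?alg_norm_ge0 //.
  exact: geometric_bound.
apply/ler_addgt0Pr => e e0; pose K := mass P / (1 - lam); have {}K0 : 0 <= K := K0.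
have d : 0 < e / (K + 1) by rewrite divr_gt0 // ltr_wpDl.
have [b /bF hb ab] := alg_approx a d.
have rl := localize_linear PL 1 b (a - b); rewrite !scale1r subrKC in rl.
rewrite rl linear_D //; apply: le_trans (cabsD _ _) _.
have h1 : cabs (phi (localize P (a - b))) <= e / (K + 1).
  apply: le_trans (phi_bd _) _; exact: le_trans (localize_norm _ PL) ab.
have h2 : alg_norm b <= alg_norm a + e / (K + 1).
  have -> : b = a + (-1) *: (a - b) by rewrite scaleN1r opprB addrC subrK.
  apply: le_trans (alg_normD _ _) _; rewrite lerD2l alg_normZ cabsN cabs1 mul1r //.
apply: le_trans (lerD hb h1) _; rewrite -/K.
have -> : K * alg_norm a + e = K * (alg_norm a + e / (K + 1)) + e / (K + 1).
  by field; rewrite gt_eqF // ltr_wpDl.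
by rewrite lerD2r ler_wpM2l.
Qed.

End WeightedState.

Definition diag_unit n P : A := \sum_(i < n) gen i i (ind P).

Lemma alg_sumE n (f : 'I_n -> A) g x : (\sum_(i < n) f i) g x = \sum_(i < n) f i g x.
Proof. by elim/big_rec2 : _ => [|i y a _ <-]. Qed.

Lemma l2_sumE n (f : 'I_n -> V) i : (\sum_(j < n) f j) i = \sum_(j < n) f j i.
Proof. by elim/big_rec2 : _ => [|j y v _ <-]. Qed.

Lemma diag_unit_norm n P : locconst (ind P) -> alg_norm (diag_unit n P) <= 1.
Proof.
move=> PL; apply: alg_norm_le => g x; rewrite mul1r.
pose d i : C := (i < n)%:R * (P g)%:R.
have dB i : cabs (d i) <= 1.
  by rewrite /d; case: ltnP => _; case: (P g); rewrite ?(mulr0, mul0r, mulr1) ?cabs1 ?cabs0.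
suff -> : diag_unit n P g x = diag d x by rewrite -[leRHS]mul1r; exact: diag_norm.
apply: l2_ext => i; rewrite (diag_boundE dB) /diag_unit alg_sumE l2_sumE /d.
under eq_bigr do rewrite (gen_app _ _ _ _ PL) l2Z l2_deltaE.
have [ni|ni] := ltnP i n; last first.
  rewrite big1 ?mul0r // => j _; rewrite eq_sym ltn_eqF ?mulr0 //.
  exact: leq_trans (ltn_ord j) ni.
rewrite (bigD1 (Ordinal ni)) //= eqxx mulr1 big1 ?addr0 ?mul1r // => j.
by rewrite -val_eqE /= eq_sym => /negPf ->; rewrite mulr0.
Qed.

(** In the absence of a unit, norm one is tested on [diag_unit n P], of norm at most 1, where [phi]
    takes the value 1 - lam^n. *)
Lemma pstate_intro (lam : R) P phi : 0 <= lam -> lam < 1 -> locconst (ind P) ->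
  linear (phi : A -> C^o) -> (forall a, 0 <= phi (alg_mul (alg_star a) a)) ->
  (forall a, cabs (phi a) <= alg_norm a) ->
  (forall n, phi (gen n n (ind P)) = ((1 - lam) * lam ^+ n)%:C%C) -> is_pstate phi.
Proof.
move=> l0 l1 PL lin pos bd E; split=> // c c0 phic.
apply/ler_addgt0Pr => e e0; have [n nP] := geometric_small l0 l1 e0.
have := phic (diag_unit n P); rewrite /diag_unit.
have -> : phi (\sum_(i < n) gen i i (ind P)) = (1 - lam ^+ n)%:C%C.
  rewrite -geometric_sum mulr_sumr rmorph_sum /= linear_big //.
  by apply: eq_bigr => i _; exact: E.
rewrite cabs_real => h.
have := diag_unit_norm n PL; have := ler_norm (1 - lam ^+ n) => h1 h2.
have := ler_wpM2l c0 h2; rewrite mulr1 => h3; move: h; rewrite -/(diag_unit n P).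
by move: h1 h3; move: `|_| (c * _) => r1 r2; lra.
Qed.

Section Normalization.
Variables (lam : R) (phi : A -> C).
Hypotheses (lam0 : 0 <= lam) (lam1 : lam < 1) (phiW : weighted lam phi).

Local Notation mass := (mass phi).

Lemma locconst_indT : locconst (ind predT). Proof. exact: locconst_cst. Qed.

(** One inequality is that a state has norm at least 1, against [localize_bound] for the whole
    group; the other evaluates the state on the approximate unit. *)
Lemma massT : mass predT = 1 - lam.
Proof.
have d0 : 0 < 1 - lam by rewrite subr_gt0.
have [lin pos bd nrm] := phiW.1; have m0 := mass_ge0 phiW locconst_indT.
apply/eqP; rewrite eq_le; apply/andP; split; last first.
  rewrite -(ler_pM2r (_ : 0 < (1 - lam)^-1)) ?invr_gt0 // divff ?gt_eqF //.
  apply: nrm => [|a]; first by rewrite divr_ge0 // ltW.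
  have := localize_bound lam0 lam1 phiW a locconst_indT.
  suff -> : localize predT a = a by [].
  by apply: alg_ext => g x; rewrite localizeE ?scale1r //; exact: locconst_indT.
apply/ler_addgt0Pr => e e0.
have e1 : 0 < e / (mass predT + 1) by rewrite divr_gt0 // ltr_wpDl.
have [n nP] := geometric_small lam0 lam1 e1.
have := le_trans (bd (diag_unit n predT)) (diag_unit_norm n locconst_indT).
have -> : phi (diag_unit n predT) = ((\sum_(i < n) lam ^+ i) * mass predT)%:C%C.
  rewrite mulr_suml rmorph_sum /= /diag_unit.
  rewrite linear_big //; apply: eq_bigr => i _.
  rewrite (phiW.2 i i _ locconst_indT) eqxx mul1r rmorphM /=.
  by rewrite -(massE phiW locconst_indT).
rewrite cabs_real ger0_norm ?mulr_ge0 ?sumr_ge0 // => [h|i _]; last exact: exprn_ge0.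
have := ler_wpM2l (ltW d0) h; rewrite mulrA geometric_sum mulr1 mulrBl mul1r => h1.
have h2 : lam ^+ n * mass predT <= e.
  apply: le_trans (ler_wpM2r m0 nP) _; rewrite mulrAC ler_pdivrMr ?ltr_wpDl //.
  by apply: ler_wpM2l; [exact: ltW|rewrite lerDl].
by lra.
Qed.

(** The total mass being [1 - lam], the factor is the inverse of the probability of [P]. *)
Definition conditional P a : C := ((1 - lam) / mass P)%:C%C * phi (localize P a).

Lemma conditional_weighted P : locconst (ind P) -> 0 < mass P -> weighted lam (conditional P).
Proof.
move=> PL m0; have d0 : 0 < 1 - lam by rewrite subr_gt0.
have [lin pos bd nrm] := phiW.1.
have c0 : 0 <= (1 - lam) / mass P by rewrite divr_ge0 ?ltW.
have cE m n u : locconst u -> conditional P (gen m n u) =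
    (m == n)%:R * (lam ^+ m)%:C%C * conditional P (gen 0 0 u).
  move=> uL; have PuL := locconstM PL uL.
  by rewrite /conditional !localize_gen // phiW.2 //; ring.
split=> //; apply: (pstate_intro lam0 lam1 PL) => [c a b|a|a|n].
- rewrite /conditional (localize_linear PL) linear_D // linear_Z //.
  by rewrite -[_ *: _]/(_ * _); ring.
- rewrite mulr_ge0 ?(lecR 0) // -(localizeK _ PL) localizeMr // localizeMl //.
  by rewrite -localize_star.
- rewrite cabsM cabs_real ger0_norm //.
  apply: le_trans (ler_wpM2l c0 (localize_bound lam0 lam1 phiW a PL)) _.
  by rewrite mulrA -[X in X * _](_ : 1 = _) ?mul1r //; field; rewrite !gt_eqF.
- rewrite cE // eqxx mul1r /conditional localize_gen //.
  have -> : ind P \* ind P = ind P.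
    by apply/funext => g; rewrite /= /ind; case: (P g); rewrite ?mulr1 ?mulr0.
  rewrite -/(mu phi _) (massE phiW PL) -!rmorphM /=; congr (_%:C%C).
  by field; rewrite gt_eqF.
Qed.

End Normalization.
End Weights.

(** * Gibbs states, and ergodic measures as Dirac masses *)

Section Gibbs.
Variables (R : realType) (k : fieldType) (iota : {rmorphism k -> R[i]}) (lam : R).
Hypotheses (lam0 : 0 <= lam) (lam1 : lam < 1).
Local Notation C := R[i].
Local Notation G := (galois_type iota).
Local Notation V := (l2 R).
Local Notation A := (kms_alg iota).
Local Notation Kab := (maximal_abelian iota).
Implicit Types (a b : A) (g h : G) (u v : G -> C) (phi psi : A -> C) (P : G -> bool).

Let d0 : 0 < 1 - lam. Proof. by rewrite subr_gt0. Qed.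

(** The trace of e^(-beta H) a(g) when [lam] is e^(-beta L); the factor [1 - lam] in [gibbs] is then
    the inverse of the partition function. *)
Definition gibbs_sum g a : C := xget 0 [set s | has_csum (fun n => (lam ^+ n)%:C%C * coef n a g) s].

Definition gibbs g a : C := (1 - lam)%:C%C * gibbs_sum g a.

Lemma gibbs_partial g a n :
  \sum_(i < n) cabs ((lam ^+ i)%:C%C * coef i a g) <= (1 - lam)^-1 * alg_norm a.
Proof.
apply: (@le_trans _ _ (\sum_(i < n) lam ^+ i * alg_norm a)).
  apply: ler_sum => i _; rewrite cabsM cabs_real ger0_norm ?exprn_ge0 //.
  by rewrite ler_wpM2l ?exprn_ge0 // cabs_coef.
by rewrite -mulr_suml ler_wpM2r ?alg_norm_ge0 // geometric_bound.
Qed.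

Lemma gibbs_sumP g a : has_csum (fun n => (lam ^+ n)%:C%C * coef n a g) (gibbs_sum g a).
Proof.
rewrite /gibbs_sum; have [s sP] := @has_csum_abs _ (fun n => (lam ^+ n)%:C%C * coef n a g) _ (gibbs_partial g a).
by case: xgetP => [//|/(_ s)].
Qed.

Lemma gibbs_linear g : linear (gibbs g : A -> C^o).
Proof.
move=> c a b; suff E : gibbs_sum g (c *: a + b) = c * gibbs_sum g a + gibbs_sum g b.
  by rewrite /gibbs E -[_ *: _]/(_ * _); ring.
apply: has_csum_unique (gibbs_sumP _ _) _.
apply: eq_has_csum (has_csumD (has_csumZ c (gibbs_sumP g a)) (gibbs_sumP g b)) => n.
by rewrite coef_add /=; rewrite -[coef n (c *: a) g]/(c * coef n a g); ring.
Qed.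

Lemma gibbs_bound g a : cabs (gibbs g a) <= alg_norm a.
Proof.
rewrite /gibbs cabsM cabs_real gtr0_norm // -ler_pdivlMl //.
apply: (has_csum_bound (gibbs_sumP g a)) => n.
exact: le_trans (cabs_sum _ _ _) (gibbs_partial g a n).
Qed.

Lemma gibbs_pos g a : 0 <= gibbs g (alg_mul (alg_star a) a).
Proof.
rewrite mulr_ge0 ?(lecR 0) ?(ltW d0) //; apply: has_csum_ge0 (gibbs_sumP _ _) _ => n.
rewrite mulr_ge0 ?(lecR 0) ?exprn_ge0 // /coef -l2_dot_delta alg_mulE alg_star_dot.
by rewrite -l2_norm_sqr (lecR 0) sqr_ge0.
Qed.

Lemma gibbs_gen g m n u : locconst u ->
  gibbs g (gen m n u) = (m == n)%:R * ((1 - lam) * lam ^+ m)%:C%C * u g.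
Proof.
move=> uL; rewrite /gibbs.
have -> : gibbs_sum g (gen m n u) = (m == n)%:R * (lam ^+ m)%:C%C * u g.
  apply: has_csum_unique (gibbs_sumP _ _) _.
  have -> : (m == n)%:R * (lam ^+ m)%:C%C * u g =
      \sum_(i < m.+1) (lam ^+ i)%:C%C * coef i (gen m n u) g.
    rewrite big_ord_recr big1 /= => [|i _]; last first.
      by rewrite coef_gen // (ltn_eqF (ltn_ord i)) mul0r mulr0.
    by rewrite add0r coef_gen // eqxx /=; ring.
  by apply: has_csum_finite => i mi; rewrite coef_gen // (gtn_eqF mi) mul0r mulr0.
by rewrite rmorphM /=; ring.
Qed.

Lemma gibbs_weighted g : weighted lam (gibbs g).
Proof.
have L1 := locconst_indT iota.
split=> [|m n u uL]; last first.
  by rewrite !gibbs_gen // eqxx expr0 mulr1 !rmorphM /=; ring.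
apply: (pstate_intro lam0 lam1 L1); [exact: gibbs_linear|exact: gibbs_pos|exact: gibbs_bound|].
by move=> n; rewrite gibbs_gen // eqxx /ind /= mulr1 mul1r.
Qed.

(** Beyond its first term the series has a factor [lam]. The estimate gives convergence to the
    ground state at low temperature, and at [lam = 0] identifies [gibbs] with it. *)
Lemma gibbs_ground g a : cabs (gibbs g a - coef 0 a g) <= 2 * lam * alg_norm a.
Proof.
have s0 : has_csum (fun n => if n == 0%N then coef 0 a g else 0) (coef 0 a g).
  have := @has_csum_finite _ (fun n => if n == 0%N then coef 0 a g else 0) 1.
  by rewrite big_ord1; apply=> -[].
have ds := has_csumD (gibbs_sumP g a) (has_csumZ (-1) s0).
have h : cabs (gibbs_sum g a + -1 * coef 0 a g) <= lam * ((1 - lam)^-1 * alg_norm a).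
  apply: (has_csum_bound ds) => -[|n].
    by rewrite big_ord0 cabs0 !mulr_ge0 ?alg_norm_ge0 ?invr_ge0 // ltW.
  rewrite big_ord_recl /= expr0 mul1r mulN1r subrr add0r.
  apply: le_trans (cabs_sum _ _ _) _.
  apply: (@le_trans _ _ (\sum_(i < n) lam * (lam ^+ i * alg_norm a))).
    apply: ler_sum => i _; rewrite mulr0 addr0 cabsM cabs_real ger0_norm ?exprn_ge0 //.
    by rewrite mulrA -exprS ler_wpM2l ?exprn_ge0 // cabs_coef.
  rewrite -mulr_sumr ler_wpM2l // -mulr_suml ler_wpM2r ?alg_norm_ge0 //.
  exact: geometric_bound.
have -> : gibbs g a - coef 0 a g =
    (1 - lam)%:C%C * (gibbs_sum g a + -1 * coef 0 a g) - lam%:C%C * coef 0 a g.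
  by rewrite /gibbs rmorphB /= rmorph1; ring.
apply: le_trans (cabsB _ _) _; rewrite !cabsM !cabs_real gtr0_norm // ger0_norm //.
have h1 := ler_wpM2l (ltW d0) h; have h2 := ler_wpM2l lam0 (cabs_coef 0 a g).
apply: le_trans (lerD h1 h2) _; rewrite le_eqVlt; apply/orP; left; apply/eqP.
by field; rewrite gt_eqF.
Qed.

Lemma gibbs_eq g phi : weighted lam phi ->
  (forall u, locconst u -> mu phi u = (1 - lam)%:C%C * u g) -> phi = gibbs g.
Proof.
move=> [[lin pos bd nrm] W] E; apply: (@bounded_eq _ _ _ _ _ 1) => //.
- exact: gibbs_linear.
- by move=> a; rewrite mul1r.
- by move=> a; rewrite mul1r; exact: gibbs_bound.
move=> m n u uL; rewrite W // gibbs_gen // -/(mu phi u) E // rmorphM /=; ring.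
Qed.

Section Measure.
Variable phi : A -> C.
Hypothesis phiW : weighted lam phi.

Lemma null_mu P w : locconst (ind P) -> locconst w -> mass phi P = 0 -> mu phi (ind P \* w) = 0.
Proof.
move=> PL wL P0; have [B B0 BP] := locconst_bounded wL.
have := mu_ind_bound phiW PL wL B0 BP; rewrite -/(mass phi P) P0 mul0r => h.
by apply/eqP; rewrite -cabs_eq0 eq_le h cabs_ge0.
Qed.

Lemma mu_cst c : mu phi (cst c) = (1 - lam)%:C%C * c.
Proof.
have -> : cst c = (fun g => c * ind predT g) by apply/funext => g; rewrite /= mulr1.
have L1 := locconst_indT iota.
by rewrite (muZ phiW c L1) (massE phiW L1) (massT lam0 lam1 phiW) mulrC.
Qed.

Lemma massC P : locconst (ind P) -> mass phi P + mass phi (predC P) = 1 - lam.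
Proof.
move=> PL; rewrite -(massT lam0 lam1 phiW); have PL' := locconst_indC PL.
rewrite /mass -raddfD -(muD phiW PL PL'); congr (complex.Re (mu _ _)).
by apply/funext => g; rewrite /ind /=; case: (P g); rewrite ?addr0 ?add0r.
Qed.

Lemma mu_almost_cst u w c : locconst u -> locconst w ->
  mass phi (fun g => u g != c) = 0 -> mu phi (u \* w) = c * mu phi w.
Proof.
move=> uL wL u0; pose P g := u g != c.
have PL : locconst (ind P) by apply: (locconst_ind uL) => g h; rewrite /P => ->.
have vL := locconstM (locconst_map (fun z => z - c) uL) wL.
rewrite -(muZ phiW c wL); have -> : u \* w = (fun g => c * w g) \+ (ind P \* ((fun g => u g - c) \* w)).
  by apply/funext => g; rewrite /= /ind /P; case: eqP => [->|_]; rewrite /= ?(mul0r, mul1r); ring.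
by rewrite (muD phiW (locconstZ c wL) (locconstM PL vL)) (null_mu PL vL u0) addr0.
Qed.

(** Whatever the Gibbs state at [g] does not charge, neither component charges; applied to the set
    where [u] differs from [u g], this makes [u] almost constant. *)
Lemma gibbs_extreme g psi (t : R) : weighted lam psi -> 0 < t < 1 ->
  (forall a, gibbs g a = t%:C%C * phi a + (1 - t)%:C%C * psi a) -> phi = gibbs g.
Proof.
move=> psiW /andP[t0 t1] E; apply: gibbs_eq => // u uL; pose P h := u h != u g.
have PL : locconst (ind P) by apply: (locconst_ind uL) => h1 h2; rewrite /P => ->.
have P0 : mass phi P = 0.
  have Pg : ind P g = 0 by rewrite /ind /P eqxx.
  have := E (gen 0 0 (ind P)); rewrite (gibbs_gen g 0 0 PL) Pg mulr0.
  rewrite -/(mu phi (ind P)) -/(mu psi (ind P)) (massE phiW PL) (massE psiW PL).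
  move=> /(congr1 (@complex.Re R)) /=; rewrite !mul0r !subr0.
  have := mass_ge0 phiW PL; have := mass_ge0 psiW PL => h1 h2 h3.
  have h4 : 0 <= (1 - t) * mass psi P by rewrite mulr_ge0 // subr_ge0 ltW.
  have h5 : 0 <= t * mass phi P by rewrite mulr_ge0 // ltW.
  have /eqP : t * mass phi P = 0 by lra.
  by rewrite mulf_eq0 gt_eqF //= => /eqP.
have L1 := locconst_cst iota 1; have := mu_almost_cst uL L1 P0.
rewrite mu_cst mulr1 mulrC => <-; congr mu; apply/funext => h; by rewrite /= mulr1.
Qed.

Hypothesis ergodic : forall P, locconst (ind P) -> 0 < mass phi P -> 0 < mass phi (predC P) ->
  conditional lam phi P = phi.

(** If both masses were positive, conditioning on [P] would preserve [phi] and yet kill the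
    complement. *)
Lemma mass_dichotomy P : locconst (ind P) -> mass phi P = 0 \/ mass phi (predC P) = 0.
Proof.
move=> PL; have PL' := locconst_indC PL.
have m1 := mass_ge0 phiW PL; have m2 := mass_ge0 phiW PL'.
have [->|n1] := eqVneq (mass phi P) 0; first by left.
have [->|n2] := eqVneq (mass phi (predC P)) 0; first by right.
have p1 : 0 < mass phi P by rewrite lt_neqAle eq_sym n1.
have p2 : 0 < mass phi (predC P) by rewrite lt_neqAle eq_sym n2.
have := congr1 (fun f : A -> C => f (gen 0 0 (ind (predC P)))) (ergodic PL p1 p2).
rewrite /conditional /= localize_gen // -/(mu phi _) -/(mu phi _).
have -> : ind P \* ind (predC P) = cst 0.
  by apply/funext => g; rewrite /= /ind /=; case: (P g); rewrite ?mulr0 ?mul0r.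
rewrite mu_cst !mulr0 (massE phiW PL') => /(congr1 (@complex.Re R)) /= /esym p20.
by right.
Qed.

(** Otherwise each of the finitely many values of [hat z] would have mass 0, and so would the whole
    group. *)
Lemma hat_almost_cst z : Kab z -> exists c, mass phi (fun g => hat z g != c) = 0.
Proof.
move=> Kz; have zL := locconst_hat Kz; have [s sP] := abelian_galois_orbit Kz.
have PL (Q : C -> bool) : locconst (ind (fun g : G => Q (hat z g))).
  by apply: (locconst_ind zL) => g h ->.
apply: contrapT => /forallNP nc.
have nul c : mass phi (fun g => hat z g == c) = 0.
  case: (mass_dichotomy (PL (pred1 c))) => // h; case: (nc c); exact: h.
have : mass phi (fun g => hat z g \in s) = 0.
  elim: s {sP} => [|c s IHs].
    have -> : (fun g : G => hat z g \in [::]) = (fun=> false) by [].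
    rewrite /mass (_ : ind _ = cst 0); first by rewrite mu_cst mulr0.
    by apply/funext.
  rewrite /mass (_ : ind _ = (ind (fun g : G => hat z g == c) \* cst 1) \+
      (ind (fun g : G => hat z g \in s) \* ind (fun g : G => hat z g != c))).
    have L1 := locconst_cst iota 1.
    have h1 := null_mu (PL (pred1 c)) L1 (nul c).
    have h2 := null_mu (PL (mem s)) (PL (fun w => w != c)) IHs.
    rewrite (muD phiW (locconstM (PL (pred1 c)) L1) (locconstM (PL (mem s)) (PL (fun w => w != c)))).
    by rewrite h1 h2 addr0.
  apply/funext => g; rewrite /ind /= inE; case: eqP => _ /=; rewrite ?mulr1 ?mulr0 ?addr0 ?mul0r ?add0r //.
have -> : (fun g : G => hat z g \in s) = predT by apply/funext => g; exact/sP/galois_elt.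
by rewrite (massT lam0 lam1 phiW) => /eqP; rewrite gt_eqF.
Qed.

(** The mean of [hat z], which is also its almost sure value; hence the multiplicativity in
    [mu_hatM]. *)
Definition tau z : C := ((1 - lam)%:C%C)^-1 * mu phi (hat z).

Let dC : (1 - lam)%:C%C != 0 :> C.
Proof. by rewrite fmorph_eq0 gt_eqF. Qed.

Lemma tauE z : (1 - lam)%:C%C * tau z = mu phi (hat z).
Proof. by rewrite /tau mulrA divff // mul1r. Qed.

Lemma mu_hatM z w : Kab z -> locconst w -> mu phi (hat z \* w) = tau z * mu phi w.
Proof.
move=> Kz wL; have zL := locconst_hat Kz; have [c cP] := hat_almost_cst Kz.
rewrite (mu_almost_cst zL wL cP); congr (_ * _).
have L1 := locconst_cst iota 1; have := mu_almost_cst zL L1 cP.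
rewrite mu_cst mulr1 /tau; have -> : (hat z \* cst 1 : G -> C) = hat z by apply/funext => g; rewrite /= mulr1.
by move=> ->; rewrite mulrCA mulVf ?mulr1.
Qed.

Lemma tau_hom : abelian_hom iota tau.
Proof.
split=> [z w|z w|c].
- move=> /set_mem Kz /set_mem Kw; rewrite /tau hatD //.
  by rewrite (muD phiW (locconst_hat Kz) (locconst_hat Kw)) mulrDr.
- move=> /set_mem Kz /set_mem Kw; rewrite {1}/tau hatM // mu_hatM //; last exact: locconst_hat.
  by rewrite mulrCA.
- by rewrite /tau hat_iota mu_cst mulrA mulVf // mul1r.
Qed.

Lemma ergodic_gibbs : exists g, phi = gibbs g.
Proof.
pose g := galois_mk (abelian_hom_galois (embedding_char0 iota) tau_hom); exists g.
have gE z : Kab z -> g z = tau z by move=> Kz; rewrite /g /=; case: asboolP.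
apply: gibbs_eq => // u /locconst_spanned[s sK us].
have {us}-> : u = fun h : G => \sum_(p <- s) p.1 * h p.2 by apply/funext.
suff [_ ->] : locconst (fun h : G => \sum_(p <- s) p.1 * h p.2) /\
    mu phi (fun h : G => \sum_(p <- s) p.1 * h p.2) = (1 - lam)%:C%C * \sum_(p <- s) p.1 * g p.2 by [].
elim: s sK => [|[c z] s IHs] sK.
  rewrite big_nil mulr0 (_ : (fun=> _) = cst 0); first by rewrite mu_cst mulr0; split=> //; exact: locconst_cst.
  by apply/funext => h; rewrite big_nil.
have [sL sE] := IHs (fun p ps => sK p (ltac:(by rewrite inE ps orbT))).
have Kz : Kab z by apply: (sK (c, z)); rewrite inE eqxx.
have czL := locconstZ c (locconst_hat Kz).
rewrite (_ : (fun h : G => _) = (fun h => c * hat z h) \+ (fun h : G => \sum_(p <- s) p.1 * h p.2)).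
  split; first exact: locconstD.
  rewrite (muD phiW czL sL) sE (muZ phiW c (locconst_hat Kz)) big_cons mulrDr; congr (_ + _).
  by rewrite -[RHS]/((1 - lam)%:C%C * (c * g z)) (gE z Kz) -tauE; ring.
by apply/funext => h; rewrite big_cons.
Qed.

End Measure.
End Gibbs.

Lemma derivable_linear (R : realType) (V W : normedModType R[i]) (T : V -> W) (B : R)
    (f : (R[i])^o -> V) (z : (R[i])^o) : linear T ->
  (forall x, `|T x| <= B%:C%C * `|x|) -> derivable f z 1 -> derivable (T \o f) z 1.
Proof.
move=> linT TB /cvg_ex[l fl]; apply/cvg_ex; exists (T l).
have Tc : continuous T by apply: (@lipschitz_continuous _ _ _ T B) => x y; rewrite linear_subE.
have TZ c x : T (c *: x) = c *: T x.
  have T0 : T 0 = 0 by have := linT (-1) 0 0; rewrite scaler0 addr0 scaleN1r addNr.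
  by have := linT c x 0; rewrite !addr0 T0 addr0.
pose q (h : R[i]) := h^-1 *: ((f \o shift z) (h *: 1) - f z).
rewrite (_ : (fun h : R[i] => _) = T \o q); first exact: (continuous_cvg _ (Tc l) fl).
by apply/funext => h; rewrite /q /= TZ (linear_subE linT).
Qed.

Lemma dense_approx (R : realType) (W : normedModType R[i]) (D : set W) : dense D ->
  forall x (e : R), 0 < e -> exists2 y, D y & `|x - y| <= e%:C%C.
Proof.
move=> Dd x e e0; have e0C : 0 < e%:C%C :> R[i] by rewrite ltcR.
have [|y [xy Dy]] := Dd (ball x e%:C%C) _ (ball_open x e%:C%C).
  by exists x; exact: ballxx.
by exists y => //; move: xy; rewrite -ball_normE /= => /ltW.
Qed.

(** * KMS states *)

Section FiniteTemperature.
Variables (R : realType) (k : fieldType) (iota : {rmorphism k -> R[i]}) (L : R) (L0 : 0 < L).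
Local Notation C := R[i].
Local Notation G := (galois_type iota).
Local Notation A := (kms_alg iota).
Local Notation S := (kms_system iota L0).
Local Notation fin := (finite_family (@locconst R k iota)).
Implicit Types (a b : A) (g h : G) (u v : G -> C) (P : G -> bool).

Lemma is_stateP (phi : S -> C^o) : is_state phi <-> is_pstate (phi : A -> C).
Proof.
split=> -[lin pos bd nrm]; split=> //; [move=> a|move=> c c0 phic|move=> a|move=> c phic].
- by have := bd a; rewrite cabsE alg_normE lecR.
- have := nrm c%:C%C; rewrite (lecR 1); apply=> a.
  by rewrite cabsE alg_normE -rmorphM lecR; exact: phic.
- by rewrite cabsE alg_normE lecR.
have c0 : 0 <= c.
  have := phic (gen 0 0 (cst 1) : A); rewrite cabsE alg_normE => h.
  have n0 : 0 < (alg_norm (gen 0 0 (cst 1) : A))%:C%C :> C by rewrite ltcR gen_norm_gt0.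
  by rewrite -(pmulr_lge0 _ n0); apply: le_trans h; rewrite (lecR 0) cabs_ge0.
have [r r0 cE] := ge0_complexP c0; rewrite cE (lecR 1); apply: nrm => // a.
by have := phic a; rewrite cabsE alg_normE cE -rmorphM lecR.
Qed.

(** The exponent of the flow on E_mn(u), from which its entire extension is read off. *)
Definition twist m n : C := 'i%C * (level L m - level L n).

Lemma phase_twist t m n : phase L t m n = cexp (twist m n * t%:C%C).
Proof. by rewrite /phase /twist; congr cexp; ring. Qed.

Lemma twistC m n : - twist n m = twist m n.
Proof. by rewrite /twist -mulrN opprB. Qed.

Section KMSRelation.
Variables (beta : R) (phi : A -> C).
Hypotheses (beta0 : 0 < beta) (phiK : KMS_finite (A := S) beta (phi : S -> C^o)).

Let lam := expR (- beta * L).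

Let phiS : is_pstate phi. Proof. by apply/is_stateP; case: phiK. Qed.
Let lin : linear (phi : A -> C^o). Proof. by case: phiS. Qed.
Let bd a : cabs (phi a) <= alg_norm a. Proof. by case: phiS. Qed.

Lemma alg_mulBl a b c : alg_mul (a - b) c = alg_mul a c - alg_mul b c.
Proof. exact: alg_ext. Qed.

Lemma alg_mulBr a b c : alg_mul c (a - b) = alg_mul c a - alg_mul c b.
Proof. by apply: alg_ext => g x; rewrite algB !alg_mulE algB linear_subE //; exact: alg_linear. Qed.

(** For fixed [a] and [f] both sides are continuous in [b], so density frees [b] from [D]. *)
Lemma KMS_dense : exists D : set A, [/\ star_subalgebra (A := S) D, dense (D : set S),
    forall a, D a -> exists f, analytic_extension (A := S) a f
  & forall a b f, D a -> analytic_extension (A := S) a f ->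
      phi (alg_mul a b) = phi (alg_mul b (f (0 +i* beta)%C))].
Proof.
case: phiK => _ _ [D [subD denseD extD KMSD]]; exists D; split=> // a b f Da fa.
apply/eqP; rewrite -subr_eq0; apply/eqP; set c : A := f _.
apply: (@small_cabs_eq0 _ _ (alg_norm a + alg_norm c)) => e e0.
have [d Dd bd'] := dense_approx denseD b e0; rewrite alg_normE lecR in bd'.
have -> : phi (alg_mul a b) - phi (alg_mul b c) =
    phi (alg_mul a (b - d)) - phi (alg_mul (b - d) c).
  have KMSd : phi (alg_mul a d) = phi (alg_mul d c) := KMSD a d f Da Dd fa.
  by rewrite alg_mulBr alg_mulBl !linear_B // KMSd; ring.
apply: le_trans (cabsB _ _) _; rewrite mulrDl; apply: lerD; apply: le_trans (bd _) _.
  by apply: le_trans (alg_normM _ _) _; rewrite ler_wpM2l ?alg_norm_ge0.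
by apply: le_trans (alg_normM _ _) _; rewrite mulrC ler_wpM2l ?alg_norm_ge0.
Qed.

(** Both sides are entire in z. At a real t the invariance of [phi] under the flow at time -t moves
    the flow from [a] to the generator, where it is a scalar. *)
Lemma KMS_gen_ext a f m n u : locconst u -> analytic_extension (A := S) a f ->
  forall z, phi (alg_mul (gen m n u) (f z)) = cexp (- twist m n * z) * phi (alg_mul (gen m n u) a).
Proof.
move=> uL [fR fd] z; set E := gen m n u.
pose h1 (z : C^o) : C^o := phi (alg_mul E (f z)).
pose h2 (z : C^o) : C^o := cexp (- twist m n * z) * phi (alg_mul E a).
suff : (h1 - h2) z = 0 by move=> /eqP; rewrite subr_eq0 => /eqP.
apply: entire_real_zero => [w|t].
  apply: derivableB.
    apply: (@derivable_linear _ A (C^o) (fun b => phi (alg_mul E b)) (alg_norm E) f) => //.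
      by move=> c x y; rewrite alg_mul_linearr lin.
    move=> x; rewrite alg_normE cabsE -rmorphM lecR; apply: le_trans (bd _) _.
    exact: alg_normM.
  by apply: derivable_prod; [exact: derivable_cexp|exact: derivable_cst].
apply/eqP; rewrite subr_eq0; apply/eqP; rewrite /h1 /h2 fR /=.
have inv b : phi (flow L0 (- t) b) = phi b by case: phiK => _ + _; apply.
have [_ _ flM _] := flow_star_automorphism iota L0 (- t).
have flowM : flow L0 (- t) (alg_mul E (flow L0 t a)) = alg_mul (flow L0 (- t) E) (flow L0 (- t) (flow L0 t a)).
  exact: flM.
rewrite -inv flowM -flowD addNr flow0 flow_gen // phase_twist.
have -> : alg_mul (cexp (twist m n * (- t)%:C%C) *: E) a = cexp (twist m n * (- t)%:C%C) *: alg_mul E a.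
  exact: alg_ext.
by rewrite linear_Z //; congr (cexp _ * _); rewrite rmorphN /=; ring.
Qed.

Lemma cexp_twist m n : cexp (- twist m n * (0 +i* beta)%C) * (lam ^+ m)%:C%C = (lam ^+ n)%:C%C.
Proof.
rewrite /lam -!expRM_natl -!cexp_real -cexpD; congr cexp.
by rewrite /twist /level; apply: complex_ext => /=; ring.
Qed.

(** The KMS condition is applied to members of [D], with the generator as second factor; their
    density then gives every [a]. *)
Lemma KMS_gen a m n u : locconst u ->
  (lam ^+ m)%:C%C * phi (alg_mul a (gen m n u)) = (lam ^+ n)%:C%C * phi (alg_mul (gen m n u) a).
Proof.
move=> uL; have [D [subD denseD extD KMSD]] := KMS_dense.
set E := gen m n u; apply/eqP; rewrite -subr_eq0; apply/eqP.
have l1 i : `|lam ^+ i| <= 1.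
  rewrite ger0_norm ?exprn_ge0 ?expR_ge0 // exprn_ile1 ?expR_ge0 //.
  by rewrite -expR0 ler_expR mulNr oppr_le0 mulr_ge0 // ltW.
have inD d : D d -> (lam ^+ m)%:C%C * phi (alg_mul d E) = (lam ^+ n)%:C%C * phi (alg_mul E d).
  move=> Dd; have [f fd] := extD d Dd; rewrite (KMSD d E f Dd fd) (KMS_gen_ext m n uL fd).
  by rewrite mulrA [_ * cexp _]mulrC cexp_twist.
apply: (@small_cabs_eq0 _ _ (alg_norm E + alg_norm E)) => e e0.
have [d Dd bd'] := dense_approx denseD a e0; rewrite alg_normE lecR in bd'.
have -> : (lam ^+ m)%:C%C * phi (alg_mul a E) - (lam ^+ n)%:C%C * phi (alg_mul E a) =
    (lam ^+ m)%:C%C * phi (alg_mul (a - d) E) - (lam ^+ n)%:C%C * phi (alg_mul E (a - d)).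
  by rewrite alg_mulBr alg_mulBl !linear_B // !mulrBr (inD d Dd); ring.
apply: le_trans (cabsB _ _) _; rewrite mulrDl; apply: lerD; rewrite cabsM cabs_real.
  apply: le_trans (ler_piMl (cabs_ge0 _) (l1 m)) _; apply: le_trans (bd _) _.
  by apply: le_trans (alg_normM _ _) _; rewrite mulrC ler_wpM2l ?alg_norm_ge0.
apply: le_trans (ler_piMl (cabs_ge0 _) (l1 n)) _; apply: le_trans (bd _) _.
by apply: le_trans (alg_normM _ _) _; rewrite ler_wpM2l ?alg_norm_ge0.
Qed.

Lemma KMS_weighted : weighted lam phi.
Proof.
(* E_mn(u) is E_m0(u) E_0n(1), while the product in the other order is E_00(u) or 0 according to
   whether m = n. *)
split=> // m n u uL; have := KMS_gen (gen 0 n (cst 1)) m 0 uL.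
rewrite !(gen_mul _ _ _ _ (locconst1 iota) uL) !(gen_mul _ _ _ _ uL (locconst1 iota)) eqxx !linear_Z //.
have -> : (cst 1 : G -> C) \* u = u by apply/funext => g; rewrite /= mul1r.
have -> : u \* (cst 1 : G -> C) = u by apply/funext => g; rewrite /= mulr1.
by rewrite expr0 !mul1r => <-; rewrite (eq_sym n m); ring.
Qed.

(** Localization commutes with the flow and with products, so the subalgebra that serves [phi]
    serves its conditionals. *)
Lemma KMS_conditional P : locconst (ind P) -> 0 < mass phi P ->
  KMS_finite (A := S) beta (conditional lam phi P : S -> C^o).
Proof.
move=> PL m0; have [D [subD denseD extD KMSD]] := KMS_dense.
have l0 : 0 <= lam by exact: expR_ge0.
have l1 : lam < 1 by rewrite /lam -expR0 ltr_expR mulNr oppr_lt0 mulr_gt0.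
split; first by apply/is_stateP; case: (conditional_weighted l0 l1 KMS_weighted PL m0).
- move=> t a; rewrite /conditional; congr (_ * _).
  have <- : flow L0 t (localize P a) = localize P (flow L0 t a).
    apply: alg_ext => g x; rewrite localizeE // !flowE localizeE //.
    have := evol_i_linear L0 t ((P g)%:R) (a g (evol L 'i%C (- t) x)) 0; rewrite !addr0 => ->.
    have := evol_i_linear L0 t (-1) 0 0; rewrite scaler0 addr0 scaleN1r addNr => ->.
    by rewrite addr0.
  by case: phiK => _ + _; apply.
- exists D; split=> // a b f Da _ fa; rewrite /conditional; congr (_ * _).
  by rewrite -[cs_mul _ _]/(alg_mul a b) -[cs_mul _ _]/(alg_mul b _) localizeMr // localizeMl //; exact: KMSD.
Qed.

End KMSRelation.
End FiniteTemperature.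

(** * Gibbs states satisfy the KMS condition *)

Section GibbsStates.
Variables (R : realType) (k : fieldType) (iota : {rmorphism k -> R[i]}) (L : R) (L0 : 0 < L).
Local Notation C := R[i].
Local Notation G := (galois_type iota).
Local Notation A := (kms_alg iota).
Local Notation S := (kms_system iota L0).
Local Notation fin := (finite_family (@locconst R k iota)).
Implicit Types (a b : A) (g h : G) (u v : G -> C) (P : G -> bool).
Variable beta : R.
Hypothesis beta0 : 0 < beta.

Let lam := expR (- beta * L).

Lemma boltzmann_ge0 : 0 <= lam. Proof. exact: expR_ge0. Qed.

Lemma boltzmann_lt1 : lam < 1.
Proof. by rewrite /lam -expR0 ltr_expR mulNr oppr_lt0 mulr_gt0. Qed.

Let l0 := boltzmann_ge0.
Let l1 := boltzmann_lt1.

Lemma gibbs_flow g t a : gibbs lam g (flow L0 t a) = gibbs lam g a.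
Proof.
have lin := gibbs_linear l0 l1 g.
have E : (fun a => gibbs lam g (flow L0 t a)) = gibbs lam g.
  apply: (@bounded_eq _ _ _ _ _ 1) => //.
  - by move=> c x y; rewrite flow_linear lin.
  - by move=> x; rewrite mul1r -(flow_norm L0 t x); exact: gibbs_bound.
  - by move=> x; rewrite mul1r; exact: gibbs_bound.
  move=> m n u uL; rewrite flow_gen // (linear_Z lin) !gibbs_gen //.
  have [->|_] := eqVneq m n; last by rewrite !mul0r mulr0.
  by rewrite phase_twist /twist subrr mulr0 mul0r cexp0 mul1r.
exact: (congr1 (fun f => f a) E).
Qed.

(** As functionals of [b] both sides are bounded and linear, so a comparison on generators is
    enough. *)
Lemma gibbs_KMS_gen g m n u b : locconst u ->
  gibbs lam g (alg_mul (gen m n u) b) =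
  cexp (twist L m n * (0 +i* beta)%C) * gibbs lam g (alg_mul b (gen m n u)).
Proof.
move=> uL; set E := gen m n u; set c := cexp _; have lin := gibbs_linear l0 l1 g.
have EE : (fun b => gibbs lam g (alg_mul E b)) = (fun b => c * gibbs lam g (alg_mul b E)).
  have K0 : 0 <= 1 + cabs c by rewrite addr_ge0 ?cabs_ge0.
  apply: (@bounded_eq _ _ _ _ _ ((1 + cabs c) * alg_norm E)).
  - by move=> z x y; rewrite alg_mul_linearr lin.
  - by move=> z x y; rewrite alg_mul_linearl lin -![_ *: (_ : C^o)]/(_ * _); ring.
  - move=> x; apply: le_trans (gibbs_bound l0 l1 _ _) _; apply: le_trans (alg_normM _ _) _.
    by rewrite -mulrA ler_peMl ?mulr_ge0 ?alg_norm_ge0 // lerDl cabs_ge0.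
  - move=> x; rewrite cabsM -mulrA; apply: ler_pM; rewrite ?cabs_ge0 //; first by rewrite lerDr.
    apply: le_trans (gibbs_bound l0 l1 _ _) _; apply: le_trans (alg_normM _ _) _.
    by rewrite mulrC.
  move=> p q v vL; rewrite /E (gen_mul _ _ _ _ uL vL) (gen_mul _ _ _ _ vL uL) !(linear_Z lin).
  rewrite (gibbs_gen l0 l1 g _ _ (locconstM uL vL)) (gibbs_gen l0 l1 g _ _ (locconstM vL uL)) /=.
  have cE : c * (lam ^+ n)%:C%C = (lam ^+ m)%:C%C.
    by have := cexp_twist L beta n m; rewrite twistC.
  rewrite !rmorphM /= -cE (eq_sym p n) (eq_sym q m); have [<-|_] := eqVneq n p; last by rewrite !(mul0r, mulr0).
  have id (d e s x v1 u1 c1 : C) : d * (e * (s * (c1 * x)) * (u1 * v1)) = c1 * (e * (d * (s * x) * (v1 * u1))).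
    by ring.
  exact: id.
exact: (congr1 (fun f => f b) EE).
Qed.

Lemma fin_gibbs_extension a : fin (val a) -> exists f, analytic_extension (A := S) a f /\
  forall g b, gibbs lam g (alg_mul a b) = gibbs lam g (alg_mul b (f (0 +i* beta)%C)).
Proof.
move: a; apply: finite_alg_ind => [//||m n u a uL _ [f [[fR fd] fK]]].
  exists (fun=> 0); split; [split=> [t|z]|move=> g b].
  - by have := flow_linear L0 t (-1) (0 : A) (0 : A); rewrite scaler0 addr0 scaleN1r addNr => /esym.
  - exact: derivable_cst.
  - have -> : alg_mul 0 b = 0 by exact: alg_ext.
    have -> // : alg_mul b 0 = 0 by apply: alg_ext => h x; rewrite alg_mulE alg0 alg_linear0.
exists ((fun z : C^o => cexp (twist L m n * z) *: gen m n u) + f : C^o -> A).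
split; [split=> [t|z]|move=> g b].
- rewrite /= -[LHS]/(cexp (twist L m n * t%:C%C) *: gen m n u + f t%:C%C) fR /=.
  rewrite -phase_twist -(flow_gen L0) //.
  by have := flow_linear L0 t 1 (gen m n u) a; rewrite !scale1r => ->.
- apply: derivableD; last exact: fd.
  apply: (@derivable_linear _ (C^o) A (fun c : C^o => c *: gen m n u) (alg_norm (gen m n u))
    (fun z : C^o => cexp (twist L m n * z))) => [c x y|x|].
  + by rewrite scalerDl scalerA.
  + by rewrite normrZ alg_normE mulrC.
  + exact: derivable_cexp.
have lin := linear_D (gibbs_linear l0 l1 g).
have -> : alg_mul (gen m n u + a) b = alg_mul (gen m n u) b + alg_mul a b by exact: alg_ext.
rewrite lin fK gibbs_KMS_gen // -(linear_Z (gibbs_linear l0 l1 g)) -lin; congr gibbs.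
apply: alg_ext => h x; rewrite algD algZ !alg_mulE.
rewrite -[((_ + f : C^o -> A) _ : A) h x]/(cexp (twist L m n * (0 +i* beta)%C) *: gen m n u h x + f (0 +i* beta)%C h x).
by have -> := alg_linear b h.
Qed.

Lemma fin_subalgebra : star_subalgebra (A := S) [set a : A | fin (val a)].
Proof.
split=> [|a b aF bF|c a aF|a b aF bF|a aF] /=.
- exact: FiniteZero.
- exact: finite_familyD.
- exact: finZ.
- by apply: finite_familyM => // u v; exact: locconstM.
- have [b bF ab] := fin_adjoint aF.
  by rewrite (adjoint_family_eq (algP a) ab).
Qed.

Lemma fin_dense : dense ([set a : A | fin (val a)] : set S).
Proof.
apply: (@dense_realP _ A) => a e e0; have [b bF ab] := alg_approx a e0.
by exists b => //; rewrite alg_normE lecR.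
Qed.

(* The extension is unique: the difference of two is an entire function        *)
(* vanishing on R.                                                             *)
Lemma gibbs_KMS g : KMS_finite (A := S) beta (gibbs lam g : S -> C^o).
Proof.
have lin := gibbs_linear l0 l1 g.
split; first by apply/is_stateP; case: (gibbs_weighted l0 l1 g).
- by move=> t a; exact: gibbs_flow.
exists [set a : A | fin (val a)]; split.
- exact: fin_subalgebra.
- exact: fin_dense.
- by move=> a /fin_gibbs_extension[f [fa _]]; exists f.
move=> a b f1 aF _ [f1R f1d]; have [f [[fR fd] fK]] := fin_gibbs_extension aF.
rewrite -[cs_mul a b]/(alg_mul a b) fK.
pose h (f : C^o -> A) (z : C^o) : C^o := gibbs lam g (alg_mul b (f z)).
suff /eqP : (h f - h f1) (0 +i* beta)%C = 0 by rewrite subr_eq0 => /eqP.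
have hd (f2 : C^o -> A) z : derivable f2 z 1 -> derivable (h f2) z 1.
  apply: (@derivable_linear _ A (C^o) (fun c => gibbs lam g (alg_mul b c)) (alg_norm b) f2) => [c x y|x].
    by rewrite alg_mul_linearr lin.
  rewrite alg_normE cabsE -rmorphM lecR; apply: le_trans (gibbs_bound l0 l1 _ _) _.
  exact: alg_normM.
apply: entire_real_zero => [z|t]; first by apply: derivableB; exact: hd.
by apply/eqP; rewrite subr_eq0 /h fR f1R.
Qed.

End GibbsStates.

(** * Extremal KMS states form one free orbit *)

Section ExtremePoints.
Variables (R : realType) (k : fieldType) (iota : {rmorphism k -> R[i]}) (L : R) (L0 : 0 < L).
Local Notation C := R[i].
Local Notation G := (galois_type iota).
Local Notation A := (kms_alg iota).
Local Notation S := (kms_system iota L0).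
Implicit Types (a b : A) (g h : G) (u v : G -> C) (P : G -> bool).

Lemma gibbs_translate (lam : R) g s a : abelian_galois iota s ->
  gibbs lam g (gal_shift s a) = gibbs lam (translate s g) a.
Proof.
move=> sG; rewrite /gibbs /gibbs_sum.
suff -> : (fun n => (lam ^+ n)%:C%C * coef n (gal_shift s a) g) =
  (fun n => (lam ^+ n)%:C%C * coef n a (translate s g)) by [].
by apply/funext => n; rewrite /coef gal_shiftE.
Qed.

Section Generic.
Variable lam : R.
Hypotheses (lam0 : 0 <= lam) (lam1 : lam < 1).

Lemma gibbs_inj g h : gibbs lam g = gibbs lam h :> (A -> C) -> g = h.
Proof.
move=> gh; apply: galois_ext => z Kz; have zL := locconst_hat Kz.
have := congr1 (fun f : A -> C => f (gen 0 0 (hat z))) gh.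
rewrite /= (gibbs_gen lam0 lam1 g 0 0 zL) (gibbs_gen lam0 lam1 h 0 0 zL) expr0 mulr1 mul1r.
by apply: mulfI; rewrite fmorph_eq0 gt_eqF // subr_gt0.
Qed.

Variable K : set (S -> C^o).
Hypothesis KW : forall phi, K phi -> weighted lam (phi : A -> C).
Hypothesis Kgibbs : forall g, K (gibbs lam g : S -> C^o).
Hypothesis Kcond : forall phi P, K phi -> locconst (ind P) -> 0 < mass (phi : A -> C) P ->
  K (conditional lam phi P : S -> C^o).

(** [K] is the set of KMS states at a fixed temperature, zero included. A state is the convex
    combination of its conditionals on [P] and on the complement, with coefficient
    [mass P / (1 - lam)]; extremality makes them equal to it, which is the hypothesis of
    [ergodic_gibbs]. *)
Lemma extreme_gibbs (phi : S -> C^o) :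
  extreme_points K phi <-> exists g, phi = (gibbs lam g : A -> C).
Proof.
split=> [[Kphi ext]|[g ->]].
  apply: (ergodic_gibbs lam0 lam1 (KW Kphi)) => P PL m1 m2.
  have PL' := locconst_indC PL; have mC := massC lam0 lam1 (KW Kphi) PL.
  pose t := mass (phi : A -> C) P / (1 - lam).
  have d0 : 0 < 1 - lam by rewrite subr_gt0.
  have t0 : 0 < t by rewrite divr_gt0.
  have tC : 1 - t = mass (phi : A -> C) (predC P) / (1 - lam).
    have -> : mass (phi : A -> C) (predC P) = (1 - lam) - mass (phi : A -> C) P by rewrite -mC addrAC subrr add0r.
    by rewrite /t; field; rewrite gt_eqF.
  have t1 : t < 1 by rewrite -subr_gt0 tC divr_gt0.
  case: (ext _ _ t (Kcond Kphi PL m1) (Kcond Kphi PL' m2)); rewrite ?t0 ?t1 // => a.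
  have cancel (m : R) (x : C) : 0 < m -> (m / (1 - lam))%:C%C * (((1 - lam) / m)%:C%C * x) = x.
    move=> m0; rewrite mulrA -rmorphM /= -[RHS]mul1r; congr (_%:C%C * _).
    by field; rewrite !gt_eqF.
  rewrite /conditional tC !cancel //; have [[lin _ _ _] _] := KW Kphi.
  by rewrite -(linear_D lin) -localizeC.
split=> // psi1 psi2 t K1 K2 t01 E; split; first exact: (gibbs_extreme lam0 lam1 (KW K1) (KW K2) t01).
apply: (gibbs_extreme lam0 lam1 (KW K2) (KW K1) (t := 1 - t)).
  by case/andP: t01 => t0 t1; rewrite subr_gt0 t1 gtrBl.
by move=> a; rewrite E addrC; congr (_ + _%:C%C * _); ring.
Qed.

Lemma extreme_free_transitive :
  free_transitive_on (A := kms_galois_system iota L0) (extreme_points K).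
Proof.
have shift s (g : G) : abelian_galois iota s ->
    (gibbs lam g : A -> C) \o gal_shift s = gibbs lam (translate s g).
  by move=> sG; apply/funext => a /=; exact: gibbs_translate.
split.
- by exists (gibbs lam (galois_one iota)); apply/extreme_gibbs; exists (galois_one iota).
- move=> s phi sG /extreme_gibbs[g ->]; apply/extreme_gibbs; exists (translate s g).
  exact: shift.
- move=> s phi sG /extreme_gibbs[g ->] E.
  have {E} : gibbs lam (translate s g) = gibbs lam g :> (A -> C) by rewrite -shift.
  move=> /gibbs_inj gs; apply: (abelian_galois_ext sG (abelian_galois_id iota)) => z Kz.
  have [t tG tg] := abelian_galois_inv (embedding_char0 iota) (galois_elt g).
  have {}tg : t \o g = id by rewrite (abelian_galois_commute tG (galois_elt g)).
  have := congr1 (fun h : G => t (h z)) gs; rewrite /= translateE //=.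
  have tgE w : t (g w) = w by exact: (congr1 (fun f => f w) tg).
  by rewrite !tgE.
- move=> phi psi /extreme_gibbs[g ->] /extreme_gibbs[h ->].
  have [t tG gt] := abelian_galois_inv (embedding_char0 iota) (galois_elt g).
  have sG := abelian_galois_comp tG (galois_elt h); exists (t \o h) => //.
  rewrite -[RHS]/((gibbs lam g : A -> C) \o gal_shift (t \o h)) shift //; congr gibbs.
  apply: galois_ext => z Kz; rewrite translateE //=.
  exact/esym/(congr1 (fun f => f (h z)) gt).
Qed.

End Generic.

Lemma extremal_finite (beta : R) : 0 < beta -> forall phi : S -> C^o,
  extremal_KMS S beta%:E phi <-> exists g, phi = (gibbs (expR (- beta * L)) g : A -> C).
Proof.
move=> b0; apply: extreme_gibbs.
- exact: boltzmann_ge0.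
- exact: boltzmann_lt1.
- by move=> phi; exact: KMS_weighted.
- by move=> g; exact: gibbs_KMS.
- by move=> phi P phiK; exact: KMS_conditional.
Qed.

Lemma boltzmann_small (e : R) : 0 < e -> exists b0 : R, forall b : R, b0 <= b -> expR (- b * L) <= e.
Proof.
move=> e0; exists ((e * L)^-1) => b bb; rewrite mulNr expRN -[leRHS]invrK lef_pV2 ?posrE ?invr_gt0 ?expR_gt0 //.
apply: le_trans (le_trans _ (expR_ge1Dx (b * L))) => //.
have : e^-1 <= b * L.
  have -> : e^-1 = (e * L)^-1 * L by field; rewrite !gt_eqF.
  by rewrite ler_wpM2r // ltW.
by move: (e^-1) => r; lra.
Qed.

(** The relation of [weighted] is tested on one generator at a time, so it passes to weak limits
    while the Boltzmann factor tends to 0. *)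
Lemma KMS_infinite_weighted (phi : S -> C^o) : KMS_infinite phi -> weighted 0 (phi : A -> C).
Proof.
move=> [phiS [I [F [beta [psi [FF betaF psiK psiF]]]]]].
split; first exact/is_stateP.
have psiW i := KMS_weighted (proj1 (psiK i)) (proj2 (psiK i)).
have psi_near a (e : R) : 0 < e -> \forall i \near F, cabs (psi i a - phi a) <= e.
  move=> e0; have /cvg_dist_realP /(_ e e0) := psiF a.
  by apply: filterS => i; rewrite cabsE lecR.
have lam_near (e : R) : 0 < e -> \forall i \near F, expR (- beta i * L) <= e.
  move=> e0; have [b0 bP] := boltzmann_small e0.
  by have /cvgryPge /(_ b0) := betaF; apply: filterS => i; exact: bP.
move=> m n u uL; have [<-|mn] := eqVneq m n; last first.
  rewrite !mul0r; apply: (@small_cabs_eq0 _ _ 1) => e e0.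
  have [i iP] := filter_ex (psi_near (gen m n u) e e0).
  by move: iP; rewrite (psiW i).2 // (negPf mn) !mul0r sub0r cabsN mul1r.
case: m {n} => [|m]; first by rewrite expr0 !mul1r.
rewrite expr0n /= mulr0 mul0r; set B := alg_norm (gen 0 0 u).
have B0 : 0 <= B by exact: alg_norm_ge0.
apply: (@small_cabs_eq0 _ _ (1 + B)) => e e0.
have [i [iP iL]] := filter_ex (filterI (psi_near (gen m.+1 m.+1 u) e e0) (lam_near e e0)).
have -> : phi (gen m.+1 m.+1 u) = psi i (gen m.+1 m.+1 u) - (psi i (gen m.+1 m.+1 u) - phi (gen m.+1 m.+1 u)).
  ring.
apply: le_trans (cabsB _ _) _; rewrite mulrDl mul1r [leRHS]addrC; apply: lerD => //.
rewrite (psiW i).2 // eqxx mul1r cabsM cabs_real [leRHS]mulrC; apply: ler_pM; rewrite ?cabs_ge0 //.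
  rewrite ger0_norm ?exprn_ge0 ?expR_ge0 //; apply: le_trans iL.
  rewrite exprS ler_piMr ?expR_ge0 // exprn_ile1 ?expR_ge0 //.
  exact/ltW/boltzmann_lt1/(proj1 (psiK i)).
by case: (psiW i) => -[_ _ bd _] _; exact: bd.
Qed.

Lemma gibbs_ground0 g a : gibbs 0 g a = coef 0 a g.
Proof.
apply/eqP; rewrite -subr_eq0 -cabs_eq0 eq_le cabs_ge0 andbT.
by have := gibbs_ground (lexx 0) ltr01 g a; rewrite mulr0 mul0r.
Qed.

Lemma gibbs_KMS_infinite g : KMS_infinite (A := S) (gibbs 0 g : S -> C^o).
Proof.
split; first by apply/is_stateP; case: (gibbs_weighted (lexx 0) ltr01 g).
exists nat, \oo, (fun i => i.+1%:R), (fun i => (gibbs (expR (- (i.+1%:R : R) * L)) g : S -> C^o)).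
split=> [||i|a].
- exact: eventually_filter.
- apply/cvgryPge => x; exists (Num.truncn x).+1 => // i /= xi; apply: ltW.
  apply: lt_le_trans (truncnS_gt x) _; by rewrite ler_nat (leq_trans xi).
- by split=> //; exact: gibbs_KMS.
apply/cvg_dist_realP => e e0.
have K0 : 0 < 2 * (alg_norm a + 1) by rewrite mulr_gt0 // ltr_wpDl ?alg_norm_ge0.
have [b0 bP] := boltzmann_small (divr_gt0 e0 K0).
exists (Num.truncn b0).+1 => // i /= xi.
have h : expR (- (i.+1%:R : R) * L) <= e / (2 * (alg_norm a + 1)).
  by apply: bP; apply: ltW; apply: lt_le_trans (truncnS_gt b0) _; rewrite ler_nat (leq_trans xi).
rewrite cabsE lecR gibbs_ground0.
have l0 := boltzmann_ge0 L (i.+1%:R : R); have l1 := boltzmann_lt1 L0 (ltr0Sn R i).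
apply: le_trans (gibbs_ground l0 l1 g a) _.
have h2 := ler_wpM2r (alg_norm_ge0 a) h.
apply: (@le_trans _ _ (2 * (e / (2 * (alg_norm a + 1)) * alg_norm a))).
  by rewrite -mulrA ler_pM2l.
have -> : 2 * (e / (2 * (alg_norm a + 1)) * alg_norm a) = e * (alg_norm a / (alg_norm a + 1)).
  by field; rewrite gt_eqF // ltr_wpDl ?alg_norm_ge0.
by rewrite ler_piMr ?(ltW e0) // ler_pdivrMr ?mul1r ?lerDl // ltr_wpDl ?alg_norm_ge0.
Qed.

(** The masses of [P] converge to a positive number, so the conditionals of the approximating KMS
    states converge to the conditional of the limit. *)
Lemma KMS_infinite_conditional (phi : S -> C^o) P : KMS_infinite phi -> locconst (ind P) ->
  0 < mass (phi : A -> C) P -> KMS_infinite (A := S) (conditional 0 phi P : S -> C^o).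
Proof.
move=> phiK PL m0; have phiW := KMS_infinite_weighted phiK.
split; first by apply/is_stateP; case: (conditional_weighted (lexx 0) ltr01 phiW PL m0).
move: phiK => [phiS [I [F [beta [psi [FF betaF psiK psiF]]]]]].
have psiW i := KMS_weighted (proj1 (psiK i)) (proj2 (psiK i)).
(* The case distinction keeps every member of the family a KMS state; the mass is positive
   eventually along [F]. *)
exists I, F, beta, (fun i => if 0 < mass (psi i : A -> C) P
  then (conditional (expR (- beta i * L)) (psi i) P : S -> C^o) else psi i).
split; [exact: FF|exact: betaF|move=> i|move=> a].
  split; first exact: (proj1 (psiK i)).
  case: ifP => mi; last exact: (proj2 (psiK i)).
  exact: (KMS_conditional (proj1 (psiK i)) (proj2 (psiK i)) PL mi).
have lam_cvg : (1 - expR (- beta i * L))%:C%C @[i --> F] --> (1 : C^o).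
  apply/(@cvg_dist_realP _ (C^o)) => e e0; have [b0 bP] := boltzmann_small e0.
  have /cvgryPge /(_ b0) := betaF; apply: filterS => i /bP h.
  rewrite rmorphB rmorph1 /= addrAC subrr sub0r normrN cabsE lecR cabs_real.
  by rewrite ger0_norm ?expR_ge0.
have mass_cvg : (mass (psi i : A -> C) P)%:C%C @[i --> F] --> ((mass (phi : A -> C) P)%:C%C : C^o).
  rewrite -(massE phiW PL); have := psiF (gen 0 0 (ind P)).
  by under eq_fun do rewrite -/(mu (psi _ : A -> C) (ind P)) (massE (psiW _) PL).
have m1 : (mass (phi : A -> C) P)%:C%C != 0 :> C by rewrite fmorph_eq0 gt_eqF.
have := cvgM (cvgM lam_cvg (cvgV m1 mass_cvg)) (psiF (localize P a)).
rewrite /conditional subr0; have -> : (1 / mass (phi : A -> C) P)%:C%C = 1 / (mass (phi : A -> C) P)%:C%C :> C.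
  by rewrite rmorphM rmorph1 /= fmorphV.
have FF' : Filter F by exact: filter_filter.
move=> /(_ FF' FF' FF') h; apply: cvg_trans h; apply: near_eq_cvg.
have : \forall i \near F, cabs ((mass (psi i : A -> C) P)%:C%C - (mass (phi : A -> C) P)%:C%C) <= mass (phi : A -> C) P / 2.
  have /(@cvg_dist_realP _ (C^o)) := mass_cvg; move=> /(_ _ (divr_gt0 m0 (ltr0n R 2))).
  by apply: filterS => i; rewrite cabsE lecR.
apply: filterS => i; rewrite -rmorphB cabs_real ler_norml => /andP[h _].
have mi : 0 < mass (psi i : A -> C) P.
  by move: h m0; move: (mass _ _) (mass _ _) => x y; lra.
by rewrite mi /conditional rmorphM /= fmorphV.
Qed.

Lemma extremal_infinite (phi : S -> C^o) :
  extremal_KMS S +oo%E phi <-> exists g, phi = (gibbs 0 g : A -> C).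
Proof.
apply: extreme_gibbs; [exact: lexx|exact: ltr01|exact: KMS_infinite_weighted|exact: gibbs_KMS_infinite|].
by move=> psi P; exact: KMS_infinite_conditional.
Qed.

Lemma kms_free_transitive (beta : \bar R) : (0 < beta)%E ->
  free_transitive_on (A := kms_galois_system iota L0) (extremal_KMS S beta).
Proof.
case: beta => [b| |] //; rewrite ?lte_fin => b0.
  apply: (@extreme_free_transitive (expR (- b * L))).
  - exact: boltzmann_ge0.
  - exact: boltzmann_lt1.
  - by move=> phi; exact: KMS_weighted.
  - by move=> g; exact: gibbs_KMS.
  - by move=> phi P phiK; exact: KMS_conditional.
apply: (@extreme_free_transitive 0); [exact: lexx|exact: ltr01|exact: KMS_infinite_weighted|exact: gibbs_KMS_infinite|].
by move=> psi P; exact: KMS_infinite_conditional.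
Qed.

End ExtremePoints.

(** * Partition function *)

Section PartitionFunction.
Variables (R : realType) (k : fieldType) (iota : {rmorphism k -> R[i]}) (L : R) (L0 : 0 < L).
Local Notation C := R[i].
Local Notation G := (galois_type iota).
Local Notation A := (kms_alg iota).
Local Notation S := (kms_system iota L0).
Local Notation V := (l2 R).
Local Notation norm := (@l2_norm R).
Implicit Types (a b : A) (g h : G).

Lemma closed_realP (W : set V) : closed W -> forall y,
  (forall e : R, 0 < e -> exists2 x, W x & norm (y - x) <= e) -> W y.
Proof.
move=> cW y yW; apply: cW => B /nbhs_ballP[e' /gt0_complexP[e e0 ->] eB].
have [x Wx yx] := yW (e / 2) (divr_gt0 e0 (ltr0n R 2)).
exists x; split=> //; apply: eB; rewrite -ball_normE /= l2_normE ltcR.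
by apply: le_lt_trans yx _; lra.
Qed.

(** The matrix units carry a vector with a nonzero n-th coordinate to multiples of all delta_m,
    which span a dense subspace. *)
Lemma fiber_irreducible g :
  irreducible_representation (V := l2_hilbert R) (A := kms_cstar iota) (fun a => (a : A) g).
Proof.
split=> [a|c a b x|a b x|a x y|].
- by apply: (bounded_operatorP (alg_linear (a : A) g)) => x; exact: alg_normP.
- by [].
- by [].
- exact: alg_starP.
have L1 := locconst1 iota; split.
  exists (gen 0 0 (cst 1) : A), (l2_delta R 0); rewrite (gen_app _ _ _ _ L1) mul1r l2_deltaE eqxx scale1r.
  by apply/eqP => /(congr1 norm); rewrite l2_norm_delta l2_norm0; lra.
move=> W [W0 Wlin] cW Winv; have [[x [Wx x0]]|nx] := pselect (exists x, W x /\ x != 0); last first.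
  left; apply/seteqP; split=> x /= => [Wx|->//].
  by apply/eqP; apply: contrapT => /negP x0; apply: nx; exists x.
right; apply/seteqP; split=> // y _.
have [n xn] : exists n, x n != 0.
  apply: contrapT => /forallNP nx; move/eqP: x0; apply; apply: l2_ext => n.
  by apply/eqP; have := nx n; move/negP; rewrite negbK.
have Wdelta m : W (l2_delta R m).
  have := Wlin (x n)^-1 _ _ (Winv (gen m n (cst 1) : A) x Wx) W0.
  by rewrite (gen_app _ _ _ _ L1) mul1r scalerA mulVf // scale1r addr0.
have Wsum (m : nat) (c : nat -> C) : W (\sum_(i < m) c i *: l2_delta R i).
  elim: m => [|m IHm]; first by rewrite big_ord0.
  have -> : \sum_(i < m.+1) c i *: l2_delta R i = c m *: l2_delta R m + \sum_(i < m) c i *: l2_delta R i.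
    by rewrite big_ord_recr /= [LHS]addrC.
  exact: Wlin.
apply: closed_realP => // e e0; have [N NP] := l2_tail y e0.
exists (\sum_(i < N) y i *: l2_delta R i) => //.
suff -> : y - \sum_(i < N) y i *: l2_delta R i = diag (above R N) y by [].
apply: l2_ext => i; rewrite l2B l2_sumE (diag_boundE (above_le1 R N)) /above.
under eq_bigr do rewrite l2Z l2_deltaE.
have [Ni|iN] := leqP N i.
  rewrite big1 ?subr0 ?mul1r // => j _; rewrite gtn_eqF ?mulr0 //.
  exact: leq_trans (ltn_ord j) Ni.
rewrite (bigD1 (Ordinal iN)) //= eqxx mulr1 big1 ?addr0 ?subrr ?mul0r // => j.
by rewrite -val_eqE /= eq_sym => /negPf ->; rewrite mulr0.
Qed.

Lemma has_csum_geometric (lam : R) : 0 <= lam -> lam < 1 ->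
  has_csum (fun n => (lam ^+ n)%:C%C) ((1 - lam)^-1)%:C%C.
Proof.
move=> l0 l1 e e0; have d0 : 0 < 1 - lam by rewrite subr_gt0.
have [N NP] := geometric_small l0 l1 (mulr_gt0 e0 d0); exists N => n Nn.
have -> : \sum_(i < n) (lam ^+ i)%:C%C - ((1 - lam)^-1)%:C%C = (- (lam ^+ n / (1 - lam)))%:C%C.
  rewrite -rmorph_sum -rmorphB /=; congr (_%:C%C).
  apply: (mulfI (lt0r_neq0 d0)); rewrite mulrBr geometric_sum divff ?gt_eqF //.
  by field; rewrite gt_eqF.
rewrite cabs_real normrN ger0_norm; last by rewrite divr_ge0 ?exprn_ge0 // ltW.
rewrite ler_pdivrMr //; apply: le_trans NP.
by rewrite -(subnKC Nn) exprD ler_piMr ?exprn_ge0 // exprn_ile1 // ltW.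
Qed.

Lemma kms_partition : partition_function_is S (fun beta => (1 - expR (- beta * L))^-1).
Proof.
move=> beta b0 phi /(extremal_finite b0)[g ->].
set lam := expR (- beta * L); have l0 : 0 <= lam := boltzmann_ge0 L beta.
have l1 : lam < 1 := boltzmann_lt1 L0 b0; have d0 : 0 < 1 - lam by rewrite subr_gt0.
exists (l2_hilbert R), (fun a => (a : A) g), (hamiltonian L), (evol L 'i%C), (evol L (-1)).
have TE : evol L (-1) beta = diag (fun n => (lam ^+ n)%:C%C).
  congr diag; apply/funext => n; rewrite /lam -expRM_natl -cexp_real; congr cexp.
  by rewrite /level; apply: complex_ext => /=; ring.
have wn n : 0 <= lam ^+ n by exact: exprn_ge0.
split.
- exact: fiber_irreducible.
- split; [exact: hamiltonian_self_adjoint|exact: hamiltonian_positive|exact: hamiltonian_eigenvalue].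
- split; [exact: hamiltonian_group|exact: hamiltonian_semigroup].
- by [].
rewrite TE; split.
  apply: (l2_trace (S := id) (B := 1) wn (geometric_bound l0 l1)) => [//|x|].
    by rewrite mul1r.
  apply: eq_has_csum (has_csum_geometric l0 l1) => n.
  by rewrite l2_dot_delta l2_deltaE eqxx mulr1.
move=> a; exists (gibbs_sum lam g a).
  apply: (l2_trace (S := (a : A) g) (B := alg_norm (a : A)) wn (geometric_bound l0 l1)).
  - exact: alg_linear.
  - by move=> x; exact: alg_normP.
  by apply: eq_has_csum (gibbs_sumP l0 l1 g a) => n; rewrite l2_dot_delta.
by rewrite /gibbs fmorphV invrK mulrC.
Qed.

End PartitionFunction.

(** * Arithmetic subalgebra *)

Section Arithmetic.
Variables (R : realType) (k : fieldType) (iota : {rmorphism k -> R[i]}) (L : R) (L0 : 0 < L).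
Local Notation C := R[i].
Local Notation G := (galois_type iota).
Local Notation A := (kms_alg iota).
Local Notation S := (kms_galois_system iota L0).
Local Notation V := (l2 R).
Local Notation Kab := (maximal_abelian iota).
Local Notation char0 := (embedding_char0 iota).
Implicit Types (a b : A) (g h : G) (u v : G -> C).

Definition hats : set (G -> C) := [set u | exists2 z, Kab z & u = hat z].

Definition rational : set A := [set a | finite_family hats (val a)].

Lemma hats_locconst u : hats u -> locconst u.
Proof. by move=> [z Kz ->]; exact: locconst_hat. Qed.

Lemma rational_gen m n z : Kab z -> rational (gen m n (hat z)).
Proof. by move=> Kz; apply: finite_gen; [exists z|exact: locconst_hat]. Qed.

Lemma rationalD a b : rational a -> rational b -> rational (a + b).
Proof. exact: finite_familyD. Qed.

Lemma rationalZ c a : rational a -> rational (iota c *: a).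
Proof.
pose f (b : G -> V -> V) : G -> V -> V := fun g x => iota c *: b g x.
move=> aF; suff : finite_family hats (f (val a)) by [].
move: aF; apply: (@finite_family_map _ _ _ _ f (fun _ _ u g => iota c * u g) false).
- by apply/funext => g; apply/funext => x; rewrite /f scaler0.
- move=> m n u b; apply/funext => g; apply/funext => x.
  by rewrite /f scalerDr /unit_family scalerA mulrA.
move=> m n _ [z Kz ->]; exists (iota c * z).
  by apply: (maximal_abelianM char0) => //; exact: (maximal_abelian_iota iota char0).
by rewrite hatM ?hat_iota //; exact: (maximal_abelian_iota iota char0).
Qed.

Lemma rationalM a b : rational a -> rational b -> rational (alg_mul a b).
Proof.
apply: finite_familyM => _ _ [z Kz ->] [w Kw ->]; exists (z * w); last by rewrite hatM.
exact: (maximal_abelianM char0).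
Qed.

Lemma galoisD g z w : Kab z -> Kab w -> g (z + w) = g z + g w.
Proof. by move=> Kz Kw; exact: (congr1 (fun u : G -> C => u g) (hatD Kz Kw)). Qed.

Lemma galoisM g z w : Kab z -> Kab w -> g (z * w) = g z * g w.
Proof. by move=> Kz Kw; exact: (congr1 (fun u : G -> C => u g) (hatM Kz Kw)). Qed.

(** All diagonal entries of a left unit are 1, while those of a finite matrix vanish far out. Hence
    containing the unit is no constraint on the arithmetic subalgebra. *)
Lemma kms_nonunital e : left_id e (@alg_mul R k iota) -> False.
Proof.
move=> e1; have [b bF eb] := alg_approx e (divr_gt0 ltr01 (ltr0n R 2)).
have [N NP] : exists N, forall n, (N <= n)%N -> coef n b =1 cst 0.
  move: b bF {eb}; apply: finite_alg_ind => [//||m n u b uL _ [N NP]].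
    by exists 0%N.
  exists (maxn N m.+1) => i; rewrite geq_max => /andP[Ni mi] g.
  by rewrite coef_add coef_gen //= (NP i Ni) (gtn_eqF mi) mul0r addr0.
have L1 := locconst1 iota; pose g := galois_one iota.
have E : coef N e g = 1.
  have := congr1 (fun a : A => coef N a g) (e1 (gen N N (cst 1))).
  by rewrite coef_gen // !eqxx mulr1 /coef alg_mulE (gen_app _ _ _ _ L1) l2_deltaE eqxx mulr1 scale1r.
have := le_trans (cabs_coef N (e - b) g) eb.
have -> : coef N (e - b) g = coef N e g - coef N b g by [].
by rewrite E NP // subr0 cabs1; lra.
Qed.

Lemma hat0 : hat 0 = cst 0 :> (G -> C).
Proof. by rewrite -(rmorph0 iota) hat_iota. Qed.

Lemma Kab0 : Kab 0.
Proof. by rewrite -(rmorph0 iota); exact: (maximal_abelian_iota iota char0). Qed.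

(** Holding for every size [M] beyond [N], the expansion lets finitely many elements be written with
    a common size. *)
Lemma rational_expand a : rational a -> exists N (zeta : nat -> nat -> C),
  (forall m n, Kab (zeta m n)) /\ forall M, (N <= M)%N ->
    a = \sum_(p : 'I_M * 'I_M) gen p.1 p.2 (hat (zeta p.1 p.2)).
Proof.
move: a; apply: finite_alg_ind => [u|| m n u b [z Kz ->] _ [N [zeta [zK zP]]]].
- exact: hats_locconst.
- exists 0%N, (fun _ _ => 0); split=> [m n|M _]; first exact: Kab0.
  rewrite big1 // => p _; apply: alg_ext => g x.
  by rewrite (gen_app _ _ _ _ (locconst_hat Kab0)) hat0 /= mul0r scale0r.
exists (maxn N (maxn m.+1 n.+1)).
exists (fun m' n' => if (m' == m) && (n' == n) then zeta m n + z else zeta m' n').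
split=> [m' n'|M]; first by case: ifP => // _; exact: (maximal_abelianD char0).
rewrite !geq_max => /and3P[/zP -> mM nM].
rewrite (bigD1 (Ordinal mM, Ordinal nM)) //= [RHS](bigD1 (Ordinal mM, Ordinal nM)) //= !eqxx /=.
rewrite addrA; congr (_ + _).
  by rewrite hatD // (gen_add _ _ (locconst_hat (zK m n)) (locconst_hat Kz)) addrC.
apply: eq_bigr => -[i j]; rewrite xpair_eqE -!val_eqE /= => /negPf ->; by [].
Qed.

Lemma gen_sum m n d (c w : 'I_d -> C) : (forall l, Kab (w l)) ->
  locconst (fun g : G => \sum_l c l * g (w l)) ->
  gen m n (fun g : G => \sum_l c l * g (w l)) = \sum_l c l *: gen m n (hat (w l)).
Proof.
move=> wK cL; apply: alg_ext => g x; rewrite (gen_app _ _ _ _ cL) alg_sumE mulr_suml scaler_suml.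
apply: eq_bigr => l _; rewrite algZ (gen_app _ _ _ _ (locconst_hat (wK l))) scalerA.
by rewrite mulrA.
Qed.

Lemma galois_sum d (c : 'I_d -> k) (w : 'I_d -> C) g : (forall l, Kab (w l)) ->
  g (\sum_l iota (c l) * w l) = \sum_l iota (c l) * g (w l) /\ Kab (\sum_l iota (c l) * w l).
Proof.
move=> wK; elim/big_ind2 : _ => [|x1 x2 y1 y2 [E1 K1] [E2 K2]|l _].
- by rewrite -/(hat 0 g) hat0; split=> //; exact: Kab0.
- by rewrite galoisD // E1 E2; split=> //; exact: (maximal_abelianD char0).
have Kc := maximal_abelian_iota iota char0 (c l).
rewrite galoisM // -/(hat (iota _) g) hat_iota; split=> //.
exact: (maximal_abelianM char0).
Qed.

(* The entries of finitely many elements lie in a finite extension, of which   *)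
(* any basis stays independent over C on the Galois conjugates.                *)
Lemma rational_basis n (a : 'I_n -> A) : (forall i, rational (a i)) ->
  exists (J : finType) (b : J -> A) (c : 'I_n -> J -> k), [/\ forall j, rational (b j),
    forall i, a i = \sum_j iota (c i j) *: b j
  & forall x : J -> C, \sum_j x j *: b j = 0 -> forall j, x j = 0].
Proof.
move=> aR; have /choice[N0 /choice[zeta0 zP]] := fun i => rational_expand (aR i).
pose M := \max_(i < n) N0 i.
pose zeta i (p : 'I_M * 'I_M) := zeta0 i p.1 p.2.
have aE i : a i = \sum_(p : 'I_M * 'I_M) gen p.1 p.2 (hat (zeta i p)).
  by have [_] := zP i; apply; exact: leq_bigmax.
pose s := [seq zeta q.1 q.2 | q <- enum {: 'I_n * ('I_M * 'I_M)}].
have sK z : z \in s -> Kab z by move=> /mapP[q _ ->]; exact: (proj1 (zP q.1)).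
have [d [w [wK span indep]]] := maximal_abelian_independent char0 sK.
have /choice[c0 cP] : forall q : 'I_n * ('I_M * 'I_M), exists c : 'I_d -> k,
    zeta q.1 q.2 = \sum_l iota (c l) * w l.
  by move=> q; apply: span; apply/mapP; exists q => //; rewrite mem_enum.
exists ('I_M * 'I_M * 'I_d)%type, (fun j : 'I_M * 'I_M * 'I_d => gen j.1.1 j.1.2 (hat (w j.2))).
exists (fun i j => c0 (i, j.1) j.2); split=> [j|i|x x0 [[m p] l]].
- exact: rational_gen.
- rewrite aE -(pair_bigA _ (fun q l => iota (c0 (i, q) l) *: gen q.1 q.2 (hat (w l)))) /=.
  apply: eq_bigr => q _.
  have hE : hat (zeta i q) = fun g : G => \sum_l iota (c0 (i, q) l) * g (w l).
    by apply/funext => g; rewrite /hat (cP (i, q)); case: (galois_sum (c0 (i, q)) g wK).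
  have zL : locconst (hat (zeta i q) : G -> C) by apply: locconst_hat; exact: (proj1 (zP i)).
  by rewrite hE in zL *; exact: gen_sum.
move: l; apply: (indep (fun l => x (m, p, l))) => g gG.
have : (\sum_(q : 'I_M * 'I_M) \sum_l x (q, l) *: gen q.1 q.2 (hat (w l)) : A)
    (galois_mk gG) (l2_delta R p) m = 0.
  rewrite pair_bigA /= (eq_bigr (fun j => x j *: gen j.1.1 j.1.2 (hat (w j.2)))) => [|[]//].
  by rewrite x0.
have big_app (T : finType) (f : T -> A) h y : (\sum_t f t) h y = \sum_t f t h y.
  by elim/big_rec2 : _ => [|t u v _ <-].
have big_l2 (T : finType) (f : T -> V) i : (\sum_t f t) i = \sum_t f t i.
  by elim/big_rec2 : _ => [|t u v _ <-].
rewrite big_app big_l2 (bigD1 (m, p)) //= [X in _ + X]big1 ?addr0 => [|[m' p'] ne].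
  rewrite big_app big_l2; apply: etrans; apply: eq_bigr => l _.
  rewrite algZ l2Z (gen_app _ _ _ _ (locconst_hat (wK l))) l2Z !l2_deltaE !eqxx !mulr1.
  by [].
rewrite big_app big_l2 big1 // => l _.
rewrite algZ l2Z (gen_app _ _ _ _ (locconst_hat (wK l))) l2Z !l2_deltaE /=.
move: ne; rewrite xpair_eqE negb_and -!val_eqE /= (eq_sym (m : nat)) => /orP[] /negPf ->.
  by rewrite !mulr0.
by rewrite mulr0 mul0r mulr0.
Qed.

(** Expanded in the basis of [rational_basis], the relation forces each coefficient, a k-linear
    combination of the [z i], to vanish; bilinearity turns the tensor into a sum of terms [b j] (x)
    0. *)
Lemma rational_independent n (a : 'I_n -> A) (z : 'I_n -> C) : (forall i, rational (a i)) ->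
  \sum_(i < n) z i *: a i = 0 -> tensor_eq0 (A := S) rational a z.
Proof.
move=> aR az W B Bl Br; have [J [b [c [bR aE ind]]]] := rational_basis aR.
have B0l w : B (0 : A) w = 0.
  have R0 : rational 0 by exact: FiniteZero.
  by have := Bl (-1) (0 : A) (0 : A) w R0 R0; rewrite scaler0 addr0 scaleN1r addNr.
have B0r x : rational x -> B x 0 = 0.
  move=> xR; by have := Br (-1) x 0 0 xR; rewrite mulr0 addr0 scaleN1r addNr.
have BsumL (r : seq J) (x : J -> k) w :
    B (\sum_(j <- r) iota (x j) *: b j) w = \sum_(j <- r) x j *: B (b j) w /\
    rational (\sum_(j <- r) iota (x j) *: b j).
  elim: r => [|j r [IH1 IH2]]; first by rewrite !big_nil; split=> //; exact: FiniteZero.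
  rewrite !big_cons; split; last by apply: rationalD => //; exact: rationalZ.
  by rewrite -IH1; apply: Bl => //.
have BsumR (r : seq 'I_n) (x : 'I_n -> k) j :
    B (b j) (\sum_(i <- r) iota (x i) * z i) = \sum_(i <- r) x i *: B (b j) (z i).
  elim: r => [|i r IHr]; first by rewrite !big_nil; exact: B0r.
  by rewrite !big_cons Br ?IHr.
have c0 j : \sum_i iota (c i j) * z i = 0.
  apply: (ind (fun j => \sum_i iota (c i j) * z i)); rewrite -[RHS]az.
  under eq_bigr do rewrite scaler_suml.
  rewrite exchange_big /=; apply: eq_bigr => i _; rewrite [in RHS]aE scaler_sumr.
  by apply: eq_bigr => j' _; rewrite scalerA mulrC.
under eq_bigr do rewrite aE (proj1 (BsumL _ _ _)).
by rewrite exchange_big /= big1 // => j _; rewrite -BsumR c0 B0r.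
Qed.

Definition rational_span : set A := [set b | exists n (a : 'I_n -> A) (z : 'I_n -> C),
  (forall i, rational (a i)) /\ b = \sum_(i < n) z i *: a i].

Lemma rational_span_cons c a b : rational a -> rational_span b -> rational_span (c *: a + b).
Proof.
move=> aR [n [a1 [z1 [a1R ->]]]].
exists n.+1, (fun i => if unlift ord0 i is Some j then a1 j else a).
exists (fun i => if unlift ord0 i is Some j then z1 j else c); split=> [i|].
  by case: (unlift _ _).
by rewrite big_ord_recl unlift_none; congr (_ + _); apply: eq_bigr => i _; rewrite liftK.
Qed.

Lemma rational_dense : dense (rational_span : set S).
Proof.
apply: (@dense_realP _ A) => a e e0; have [b bF ab] := alg_approx a e0.
exists b; last by rewrite alg_normE lecR.
move: b bF {ab}; apply: finite_alg_ind => [//||m n u b uL _ bS].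
  by exists 0%N, (fun _ => 0), (fun _ => 0); split=> [[]//|]; rewrite big_ord0.
have [s sK us] := locconst_spanned uL.
suff gs : rational_span (\sum_(p <- s) p.1 *: gen m n (hat p.2) + b).
  rewrite (_ : gen m n u = \sum_(p <- s) p.1 *: gen m n (hat p.2)) //.
  apply: alg_ext => g x; rewrite (gen_app _ _ _ _ uL) us.
  elim: s sK {us gs} => [|p s IHs] sK; first by rewrite !big_nil mul0r scale0r.
  rewrite !big_cons algD mulrDl scalerDl IHs => [|q qs]; last by apply: sK; rewrite inE qs orbT.
  rewrite algZ (gen_app _ _ _ _ (locconst_hat (sK p _))) ?inE ?eqxx // scalerA mulrA //.
elim: s sK {us} => [|p s IHs] sK; first by rewrite big_nil add0r.
rewrite big_cons -addrA; apply: rational_span_cons.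
  by apply: rational_gen; apply: sK; rewrite inE eqxx.
by apply: IHs => q qs; apply: sK; rewrite inE qs orbT.
Qed.

(** Translation by [s] evaluates entries at g \o s, which is s \o g because the Galois group is
    commutative. *)
Lemma coef_rational g a : rational a -> Kab (coef 0 a g) /\
  forall s, abelian_galois iota s -> coef 0 a (translate s g) = s (coef 0 a g).
Proof.
move: a; apply: finite_alg_ind => [u|| m n _ b [z Kz ->] _ [bK bs]].
- exact: hats_locconst.
- have c0 h : coef 0 (0 : A) h = 0 by [].
  split=> [|s sG]; rewrite !c0; first exact: Kab0.
  by rewrite -[s 0]/(hat 0 (galois_mk sG)) hat0.
have zL := locconst_hat Kz; rewrite coef_add coef_gen //=.
have gz : Kab (g z) by exact: abelian_galois_sub (galois_elt g) Kz.
case: andP => _; rewrite ?mul1r ?mul0r ?add0r //=; last first.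
  by split=> // s sG; rewrite mul0r add0r; exact: bs.
split=> [|s sG]; first exact: (maximal_abelianD char0).
rewrite mul1r bs // -[s (_ + _)]/(galois_mk sG (hat z g + coef 0 b g)) galoisD //; congr (_ + _).
rewrite /hat translateE //=.
exact: (congr1 (fun f => f z) (abelian_galois_commute (galois_elt g) sG)).
Qed.

Lemma rational_arithmetic : arithmetic_subalgebra (A := S) rational.
Proof.
split.
- split.
  + exact: FiniteZero.
  + exact: rationalD.
  + exact: rationalZ.
  + exact: rationalM.
  + by move=> e e1 _; case: (@kms_nonunital e).
- by move=> n a z; exact: rational_independent.
- exact: rational_dense.
- move=> phi /extremal_infinite[g ->]; apply/seteqP; split=> [_ [a aR <-]|z Kz].
    by rewrite gibbs_ground0; case: (coef_rational g aR).
  (* The ground state at [g] evaluates entries at [g], so z is attained at the corner entry g^-1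
     z. *)
  have [t tG gt] := abelian_galois_inv char0 (galois_elt g).
  have Kt : Kab (t z) by exact: abelian_galois_sub tG Kz.
  exists (gen 0 0 (hat (t z)) : A); first exact: rational_gen.
  rewrite gibbs_ground0 coef_gen ?mul1r; last exact: locconst_hat.
  exact: (congr1 (fun f => f z) gt).
move=> phi s a /extremal_infinite[g ->] sG aR.
rewrite -[gal_act _ _]/(gal_shift s a) gibbs_translate // !gibbs_ground0.
by case: (coef_rational g aR) => _; exact.
Qed.

End Arithmetic.

Lemma fraction_denom (D : idomainType) (q : {fraction D}) :
  exists d n : D, d != 0 /\ tofrac d * q = tofrac n.
Proof.
elim/generic_quotient.quotW: q => r; exists (frac r).2, (frac r).1; split; first exact: denom_ratioP.
unlock FracField.tofrac; rewrite -[LHS]FracField.pi_mul.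
apply/generic_quotient.eqmodP; rewrite /= FracField.equivfE /FracField.mulf /=.
by rewrite !numden_Ratio ?(oner_neq0, mulf_neq0, denom_ratioP) ?mul1r ?mulr1 // mulrC.
Qed.

(** * Finiteness of the residue field *)

Section PadicUnits.
Variables (p : nat) (p_pr : prime p).
Local Notation Zp := (padic_int p_pr).
Implicit Types (x y z w : Zp).

Lemma padic_addE x y n : (x + y) n = ((x n + y n) %% p ^ n)%N. Proof. by []. Qed.
Lemma padic_mulE x y n : (x * y) n = ((x n * y n) %% p ^ n)%N. Proof. by []. Qed.

Lemma padic_natE m n : (m%:R : Zp) n = (m %% p ^ n)%N.
Proof.
elim: m => [|m IHm] //.
have E1 : (1 : Zp) n = (1 %% p ^ n)%N by [].
by rewrite -natr1 padic_addE IHm E1 modnDm addn1.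
Qed.

Lemma padic_int0 x : x 0%N = 0%N.
Proof. by rewrite -(padic_int_mod x 0) modn1. Qed.

(** Division by p loses one digit, so coordinate n of the quotient is read from coordinate n + 1. *)
Lemma padic_div_p x : x 1%N = 0%N -> exists w, x = p%:R * w.
Proof.
move=> x1; have p0 : (0 < p)%N := prime_gt0 p_pr.
have px n : (p %| x n.+1)%N.
  by apply/eqP; rewrite -{2}(expn1 p) -add1n -(padic_int_modD x 1 n).
have fE n : ((x n.+2 %/ p)%N = (x n.+1 %/ p)%N %[mod p ^ n])%N.
  rewrite {1}(divn_eq (x n.+2) (p ^ n.+1)) -padic_intS expnS.
  by rewrite divnDr // mulnCA mulKn // modnMDl.
exists (padic_of p_pr fE); apply: padic_int_ext => n.
rewrite padic_mulE padic_natE /= modnMmr modnMml [(p * _)%N]mulnC divnK //.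
exact: padic_intS.
Qed.

(** Euler's theorem provides an inverse modulo each p^n as a power of [x n], and uniqueness of
    inverses makes these coherent. *)
Lemma padic_unit1 x : x 1%N != 0%N -> exists y, y * x = 1.
Proof.
move=> x1; have p0 : (0 < p)%N := prime_gt0 p_pr.
have cop n : coprime (x n) (p ^ n).
  case: n => [|n]; first by rewrite expn0 coprimen1.
  apply: coprimeXr; rewrite coprime_sym prime_coprime //; apply: contra x1 => px.
  by rewrite (padic_int_modD x 1 n) add1n expn1.
pose f n := (x n ^ (totient (p ^ n)).-1)%N.
have fP n : (f n * x n = 1 %[mod p ^ n])%N.
  rewrite /f -expnSr prednK ?totient_gt0 ?expn_gt0 ?p0 //.
  exact: Euler_exp_totient.
have fE n : (f n.+1 = f n %[mod p ^ n])%N.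
  have h : (f n.+1 * x n = 1 %[mod p ^ n])%N.
    rewrite -modnMmr -(padic_intE x n) modnMmr.
    have := fP n.+1 => /(congr1 (fun m => m %% p ^ n)%N).
    by rewrite !modn_dvdm // dvdn_exp2l.
  rewrite -[f n.+1]muln1 -modnMmr -(fP n) modnMmr mulnA mulnAC -modnMml h modnMml.
  by rewrite mul1n.
exists (padic_of p_pr fE); apply: padic_int_ext => n.
by rewrite padic_mulE /= modnMml fP.
Qed.

Lemma padic_reduce x : exists w, x = (x 1%N)%:R + p%:R * w.
Proof.
have [w wE] : exists w, x - (x 1%N)%:R = p%:R * w.
  apply: padic_div_p; rewrite padic_addE -[(- _ : Zp) 1%N]/(((p ^ 1).-1 * ((x 1%N)%:R : Zp) 1%N) %% p ^ 1)%N.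
  rewrite padic_natE padic_int_mod modnDmr -mulSn prednK ?expn_gt0 ?prime_gt0 //.
  by rewrite modnMr.
by exists w; rewrite -wE addrC subrK.
Qed.

Lemma padic_mulp_seq w n : (p%:R * w) n.+1 = (p * w n)%N.
Proof.
rewrite padic_mulE padic_natE modnMml expnS -muln_modr (padic_intS w n).
by [].
Qed.

(** The largest common power of p is taken out, by induction on the rank of a nonzero coordinate,
    which division by p lowers. *)
Lemma padic_family_scale d (c : 'I_d -> Zp) : (exists i, c i != 0) ->
  exists m (c' : 'I_d -> Zp), (forall i, c i = p%:R ^+ m * c' i) /\ exists i, c' i 1%N != 0%N.
Proof.
move=> [i ci]; have [n] : exists n, c i n != 0%N.
  apply: contrapT => /forallNP cn; move/eqP: ci; apply; apply: padic_int_ext => n.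
  by have /negP := cn n; rewrite negbK => /eqP ->; rewrite -[RHS]/(0 %% p ^ n)%N mod0n.
elim: n c {ci} => [|n IHn] c cn; first by rewrite padic_int0 in cn.
have [[j cj]|c1] := pselect (exists j, c j 1%N != 0%N).
  by exists 0%N, c; split=> [l|]; [rewrite expr0 mul1r|exists j].
have /choice[c0 c0P] l : exists w, c l = p%:R * w.
  by apply: padic_div_p; apply/eqP; apply: contrapT => /negP cl; apply: c1; exists l.
have [|m [c' [c'P c'1]]] := IHn c0.
  by apply: contra cn => /eqP E; rewrite c0P padic_mulp_seq E muln0.
exists m.+1, c'; split=> // l; by rewrite c0P c'P exprS mulrA.
Qed.

Lemma padic_char0 : p%:R != 0 :> Zp.
Proof.
apply/eqP => /(congr1 (fun x : Zp => x 2%N)); rewrite padic_natE -[RHS]/(0 %% p ^ 2)%N mod0n.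
rewrite modn_small => [p0|]; first by have := prime_gt0 p_pr; rewrite p0.
by rewrite -{1}(expn1 p) ltn_exp2l // prime_gt1.
Qed.

End PadicUnits.

(** * The ring of integers modulo p *)

Section ResidueField.
Variables (p : nat) (p_pr : prime p) (K : fieldExtType (padic_num p_pr)).
Local Notation Zp := (padic_int p_pr).
Local Notation O := (@integer_ring p p_pr K).

Definition zp_emb (z : Zp) : K := (tofrac z)%:A.
HB.instance Definition _ := GRing.RMorphism.copy zp_emb (in_alg K \o @tofrac Zp).
Arguments zp_emb : simpl never.

Lemma zp_emb_eq0 x : (zp_emb x == 0) = (x == 0).
Proof. by rewrite -[zp_emb x]/(in_alg K (tofrac x)) fmorph_eq0 tofrac_eq0. Qed.

Lemma zp_embM x y : zp_emb (x * y) = zp_emb x * zp_emb y. Proof. exact: rmorphM. Qed.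
Lemma zp_embX x n : zp_emb (x ^+ n) = zp_emb x ^+ n. Proof. exact: rmorphXn. Qed.
Lemma zp_emb1 : zp_emb 1 = 1. Proof. exact: rmorph1. Qed.

Lemma zp_embp : zp_emb p%:R = p%:R. Proof. exact: rmorph_nat. Qed.

Lemma p_neq0 : p%:R != 0 :> K.
Proof. by rewrite -zp_embp zp_emb_eq0; exact: padic_char0. Qed.

Lemma O_emb x : O (zp_emb x). Proof. exact: (integral_id zp_emb). Qed.
Lemma O_nat n : O n%:R. Proof. exact: (integral_nat zp_emb). Qed.
Lemma O_add x y : O x -> O y -> O (x + y). Proof. exact: (@integral_add _ _ zp_emb). Qed.
Lemma O_opp x : O x -> O (- x). Proof. exact: (@integral_opp _ _ zp_emb). Qed.
Lemma O_mul x y : O x -> O y -> O (x * y). Proof. exact: (@integral_mul _ _ zp_emb). Qed.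

Lemma O_horner (f : {poly Zp}) x : O x -> O (map_poly zp_emb f).[x].
Proof.
move=> Ox; apply: (@integral_horner _ _ zp_emb) => //; apply/integral_poly => i.
by rewrite coef_map; exact: O_emb.
Qed.

(* If g(w) = 0 with g monic of degree n, then F(X) = p^n g(X / p) kills p w    *)
(* and F(1) is 1 modulo p, hence a unit, while F(p w) - F(1) is a multiple of  *)
(* p w - 1.                                                                    *)
Lemma one_sub_p_unit w : O w -> exists2 y, O y & (1 - p%:R * w) * y = 1.
Proof.
move=> [g gm /rootP gw]; pose n := (size g).-1.
have sg : size g = n.+1 by rewrite prednK // size_poly_gt0 monic_neq0.
pose F : {poly Zp} := \poly_(i < n.+1) (g`_i * p%:R ^+ (n - i)).
have Ow : O w by exists g => //; apply/rootP.
have Opw : O (p%:R * w) by apply: O_mul => //; exact: O_nat.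
have Fpw : (map_poly zp_emb F).[p%:R * w] = 0.
  rewrite (@horner_coef_wide _ n.+1); last exact: leq_trans (size_poly _ _) (size_poly _ _).
  transitivity (p%:R ^+ n * (map_poly zp_emb g).[w]); last first.
    by rewrite -[map_poly _ _]/(map_poly _ g) in gw *; rewrite [X in _ * X]gw mulr0.
  rewrite (@horner_coef_wide _ n.+1 (map_poly zp_emb g)); last first.
    by apply: leq_trans (size_poly _ _) _; rewrite sg.
  rewrite mulr_sumr; apply: eq_bigr => i _.
  rewrite !coef_map /= coef_poly ltn_ord zp_embM zp_embX zp_embp exprMn.
  have -> : p%:R ^+ n = p%:R ^+ (n - i) * p%:R ^+ i :> K by rewrite -exprD subnK // -ltnS.
  by ring.
have [y yF] : exists y, y * F.[1] = 1.
  apply: padic_unit1; have [z ->] : exists z, F.[1] = 1 + p%:R * z.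
    exists (\sum_(i < n) g`_i * p%:R ^+ (n - i).-1).
    rewrite (@horner_coef_wide _ n.+1) ?size_poly // big_ord_recr /= coef_poly ltnSn.
    rewrite subnn expr0 expr1n !mulr1 -[g`_n]/(lead_coef g) (monicP gm) addrC; congr (_ + _).
    rewrite mulr_sumr; apply: eq_bigr => i _.
    rewrite coef_poly ltnS (ltnW (ltn_ord i)) expr1n mulr1 mulrCA -exprS prednK //.
    by rewrite subn_gt0.
  by rewrite padic_addE padic_mulp_seq padic_int0 muln0 addn0 expn1 modn_mod modn_small ?prime_gt1.
have [Q QE] : exists Q, F - (F.[1])%:P = Q * ('X - 1%:P).
  by apply/factor_theorem/rootP; rewrite hornerD hornerN hornerC subrr.
have key : zp_emb F.[1] = (1 - p%:R * w) * (map_poly zp_emb Q).[p%:R * w].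
  have := congr1 (fun f => (map_poly zp_emb f).[p%:R * w]) QE.
  rewrite /= rmorphB rmorphM rmorphB /= map_polyX !map_polyC /= !hornerE Fpw.
  by rewrite rmorph1 => E; apply: oppr_inj; rewrite -[LHS]add0r E; ring.
exists ((map_poly zp_emb Q).[p%:R * w] * zp_emb y).
  by apply: O_mul; [exact: O_horner|exact: O_emb].
by rewrite mulrA -key mulrC -zp_embM yF zp_emb1.
Qed.

(** Finiteness is proved for O / pO, of which the residue field is a quotient. *)
Definition pO x := exists2 w, O w & x = p%:R * w.

Lemma pO_add x y : pO x -> pO y -> pO (x + y).
Proof. by move=> [w Ow ->] [v Ov ->]; exists (w + v); [exact: O_add|rewrite mulrDr]. Qed.

Lemma pO_mul x y : O x -> pO y -> pO (x * y).
Proof. by move=> Ox [w Ow ->]; exists (x * w); [exact: O_mul|rewrite mulrCA]. Qed.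

Lemma pO_opp x : pO x -> pO (- x).
Proof. by move=> [w Ow ->]; exists (- w); [exact: O_opp|rewrite mulrN]. Qed.

Lemma pO_sum d (f : 'I_d -> K) : (forall i, pO (f i)) -> pO (\sum_i f i).
Proof.
move=> fp; elim/big_ind : _ => //; last exact: pO_add.
by exists 0; [exact: (O_nat 0)|rewrite mulr0].
Qed.

(** Linear independence over F_p in O / pO, with coefficients lifted to Z_p; coordinate 1 is the
    reduction modulo p. *)
Definition independent_mod_p d (X : 'I_d -> K) := (forall i, O (X i)) /\
  forall c : 'I_d -> Zp, pO (\sum_i zp_emb (c i) * X i) -> forall i, c i 1%N = 0%N.

(** A relation over Q_p, cleared of denominators and of its common power of p, would be a nontrivial
    relation modulo p. *)
Lemma independent_mod_p_dim d (X : 'I_d -> K) : independent_mod_p X -> (d <= \dim {:K})%N.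
Proof.
move=> [OX indX]; pose T := [tuple X i | i < d].
suff /eqP freeT : free T by rewrite -(size_tuple T) -freeT dimvS ?subvf.
apply/freeP => q q0 i; apply/eqP; apply: contrapT => /negP qi.
have /choice[D /choice[N DN]] := fun j => fraction_denom (q j).
pose c j := N j * \prod_(l | l != j) D l.
have cE j : tofrac (c j) = tofrac (\prod_l D l) * q j.
  rewrite [in RHS](bigD1 j) //= /c rmorphM rmorphM /= -(proj2 (DN j)); ring.
have c0 : exists j, c j != 0.
  exists i; rewrite mulf_neq0 //; last by apply/prodf_neq0 => l _; case: (DN l).
  apply/eqP => Ni; have /eqP := proj2 (DN i).
  by rewrite Ni rmorph0 mulf_eq0 tofrac_eq0 (negPf (proj1 (DN i))) (negPf qi).
have [m [c' [c'P [j c'j]]]] := padic_family_scale c0.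
suff c'0 : \sum_l zp_emb (c' l) * X l = 0.
  move: c'j; rewrite indX //; rewrite c'0; exists 0; rewrite ?mulr0 //.
  exact: (O_nat 0).
apply: (mulfI (expf_neq0 m p_neq0)); rewrite mulr0 mulr_sumr.
rewrite -[RHS](scaler0 _ (tofrac (\prod_l D l))) -[in RHS]q0 scaler_sumr; apply: eq_bigr => l _.
rewrite -zp_embp -zp_embX mulrA -zp_embM -c'P /zp_emb cE (nth_mktuple X 0) mulr_algl scalerA.
by [].
Qed.

(** A family independent modulo p of maximal length spans O / pO over F_p, and coefficients may be
    taken among the digits below p. *)
Lemma residues_finite : exists d (X : 'I_d -> K), (forall i, O (X i)) /\
  forall x, O x -> exists f : {ffun 'I_d -> 'I_p}, pO (x - \sum_i (f i : nat)%:R * X i).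
Proof.
pose P d := `[< exists X : 'I_d -> K, independent_mod_p X >].
have P0 : exists d, P d.
  exists 0%N; apply/asboolP; exists (fun=> 0); split=> [[]//|c _ []//].
have Pdim d : P d -> (d <= \dim {:K})%N by move=> /asboolP[X]; exact: independent_mod_p_dim.
case: (ex_maxnP P0 Pdim) => d /asboolP[X [OX indX]] maxd; exists d, X; split=> // x Ox.
pose Y (i : 'I_d.+1) := if unlift ord0 i is Some j then X j else x.
have nY : ~ independent_mod_p Y.
  move=> iY; have := maxd d.+1; rewrite ltnn => /(_ _)/negP; apply => //.
  by apply/asboolP; exists Y.
have [c [pc [i ci]]] : exists c : 'I_d.+1 -> Zp,
    pO (\sum_i zp_emb (c i) * Y i) /\ exists i, c i 1%N <> 0%N.
  apply: contrapT => nc; apply: nY; split=> [i|c pc i]; first by rewrite /Y; case: (unlift _ _).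
  by apply: contrapT => ci; apply: nc; exists c; split=> //; exists i.
have {}pc : pO (zp_emb (c ord0) * x + \sum_j zp_emb (c (lift ord0 j)) * X j).
  move: pc; rewrite big_ord_recl /Y unlift_none.
  by under eq_bigr do rewrite liftK.
(* Were the coefficient of [x] divisible by p, a relation among the [X] alone would remain. *)
have c01 : c ord0 1%N != 0%N.
  apply/eqP => c0; have [w wE] := padic_div_p c0.
  have pX : pO (\sum_j zp_emb (c (lift ord0 j)) * X j).
    have p0 : pO (zp_emb (c ord0) * x).
      by rewrite wE zp_embM zp_embp -mulrA; exists (zp_emb w * x) => //; apply: O_mul => //; exact: O_emb.
    by have := pO_add (pO_opp p0) pc; rewrite addKr.
  apply: ci; case: (unliftP ord0 i) => [j ->|-> //].
  exact: (indX (fun j => c (lift ord0 j)) pX).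
have [y yc] := padic_unit1 c01.
pose e j : Zp := - (y * c (lift ord0 j)).
have ep j : (e j 1%N < p)%N.
  by rewrite -(padic_int_mod (e j) 1) expn1 ltn_mod prime_gt0.
exists [ffun j => Ordinal (ep j)].
have -> : x - \sum_j ([ffun j => Ordinal (ep j)] j : nat)%:R * X j =
    zp_emb y * (zp_emb (c ord0) * x + \sum_j zp_emb (c (lift ord0 j)) * X j) +
    \sum_j (zp_emb (e j) - (e j 1%N)%:R) * X j.
  rewrite mulrDr mulrA -zp_embM yc zp_emb1 mul1r -addrA; congr (_ + _).
  rewrite mulr_sumr -big_split /= -sumrN; apply: eq_bigr => j _.
  have ee : zp_emb (e j) = - (zp_emb y * zp_emb (c (lift ord0 j))) by rewrite rmorphN /= zp_embM.
  rewrite ffunE -[nat_of_ord _]/(e j 1%N) ee; move: (zp_emb _) (zp_emb _) ((e j 1%N)%:R) => r1 r2 r3.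
  by ring.
apply: pO_add; first by apply: pO_mul => //; exact: O_emb.
apply: pO_sum => j; have [w wE] := padic_reduce (e j).
rewrite {1}wE rmorphD rmorph_nat /= zp_embM addrAC subrr add0r mulrC; apply: pO_mul => //.
by exists (zp_emb w); [exact: O_emb|rewrite zp_embp].
Qed.

(** An inverse z of x + p w would make x z = 1 - p w z, a unit by [one_sub_p_unit]. This small part
    of the additivity of the maximal ideal is enough to compare residue classes. *)
Lemma maximal_ideal_pO x y : maximal_ideal x -> pO y -> maximal_ideal (x + y).
Proof.
move=> [Ox nx] [w Ow ->]; split; first by apply: O_add => //; apply: O_mul => //; exact: O_nat.
move=> [z Oz xz]; have [v Ov vE] := one_sub_p_unit (O_mul Ow Oz).
apply: nx; exists (z * v); first exact: O_mul.
rewrite (_ : x * (z * v) = ((x + p%:R * w) * z - p%:R * (w * z)) * v); last by ring.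
by rewrite xz vE.
Qed.

Definition residue_class x : set K := [set y | O y /\ maximal_ideal (x - y)].

Lemma residue_class_pO x x' : pO (x - x') -> residue_class x = residue_class x'.
Proof.
move=> xx'; apply/seteqP; split=> y [Oy my]; split=> //.
  have := maximal_ideal_pO my (pO_opp xx').
  by rewrite (_ : x - y - (x - x') = x' - y) //; ring.
have := maximal_ideal_pO my xx'.
by rewrite (_ : x' - y + (x - x') = x - y) //; ring.
Qed.

Lemma residue_field_finite : finite_set (@residue_field p p_pr K).
Proof.
have [d [X [OX XP]]] := residues_finite.
pose F (f : {ffun 'I_d -> 'I_p}) := residue_class (\sum_i (f i : nat)%:R * X i).
apply: (@sub_finite_set _ _ (F @` setT)); last exact/finite_image/finite_finset.
by move=> _ [x Ox <-]; have [f xf] := XP x Ox; exists f => //; rewrite /F -(residue_class_pO xf).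
Qed.

(** The classes of 0 and 1 differ; finiteness ensures that [fset_set] really contains them. *)
Lemma module_gt1 : (1 < module_of K)%N.
Proof.
have O0 : O 0 := O_nat 0; have O1 : O 1 := O_nat 1.
rewrite /module_of; apply: (@leq_trans #|` [fset residue_class 0; residue_class 1]%fset|).
  rewrite cardfs2 ltnS lt0b; apply/eqP => E.
  have : residue_class 0 0.
    split=> //; rewrite subrr; split=> // -[y _]; rewrite mul0r => /esym/eqP.
    by rewrite oner_eq0.
  rewrite E => -[_ [_]]; rewrite subr0; apply; exists 1 => //; by rewrite mulr1.
apply/fsubset_leq_card/fsubsetP => C; rewrite in_fset2 in_fset_set; last exact: residue_field_finite.
by move=> /orP[] /eqP ->; apply/mem_set; [exists 0|exists 1].
Qed.

End ResidueField.

Theorem theorem1p3 (R : realType) (p : nat) (p_pr : prime p)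
    (K : fieldExtType (padic_num p_pr)) (iota : {rmorphism K -> R[i]}) :
  exists A : galois_cstar_system iota, bost_connes_type A.
Proof.
have q1 : 1 < (module_of K)%:R :> R by rewrite ltr1n module_gt1.
(* With level spacing ln q the Boltzmann factor e^(-beta L) is q^(-beta). *)
have L0 : 0 < ln ((module_of K)%:R : R) by rewrite ln_gt0.
exists (kms_galois_system iota L0); split.
- by move=> beta; exact: kms_free_transitive.
- have -> : (fun beta => (1 - (module_of K)%:R `^ (- beta))^-1) =
      (fun beta : R => (1 - expR (- beta * ln (module_of K)%:R))^-1).
    apply/funext => beta; rewrite /powR gt_eqF //; exact: lt_trans ltr01 q1.
  exact: kms_partition.
- by exists (@rational R K iota); exact: rational_arithmetic.
Qed.
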